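(* Consider the last-passage model in a random environment described in the context, and assume that the sequence $\{F_j\}$ is i.i.d. under $\mathbb{P}$ and satisfies $$\int_0^{\infty}\{1-\mathbb{E}(F_0(x))\}^{1/2}dx<\infty,\quad \int_0^{\infty}\operatorname{ess\,sup}_{\mathbb{P}}(1-F_0(x))\,dx<\infty,$$ $$\int_{-\infty}^0(\mathbb{E}[F_0(x)])^{1/2}dx<\infty,\quad \int_{-\infty}^0\operatorname{ess\,sup}_{\mathbb{P}}F_0(x)\,dx<\infty.$$ Let $\mu_0=\int x\,dF_0(x)$, $\sigma_0^2=\int(x-\mu_0)^2dF_0(x)$, $\mu=\mathbb{E}(\mu_0)$ and $\sigma^2=\mathbb{E}(\sigma_0^2)$, $\sigma\ge0$. Then as $\alpha\downarrow0$, $$\Psi(\alpha,1)=\mu+2\sigma\sqrt{\alpha}+o(\sqrt\alpha),$$ i.e. $\lim_{\alpha\downarrow0}\alpha^{-1/2}|\Psi(\alpha,1)-\mu-2\sigma\sqrt\alpha|=0$.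
   Context: $\mathbb{P}$ is a probability measure on sequences $\{F_j\}_{j\in\mathbb{Z}_+}$ of Borel probability distributions on $\mathbb{R}$ ($\mathbb{E}$ its expectation). Given $\{F_j\}$, the weights $X(i,j)$, $(i,j)\in\mathbb{Z}_+^2$, are independent with $X(i,j)\sim F_j$. For $z=(k,\ell)$, $T(z)=\max_\pi\sum_{w\in\pi}X(w)$ over nearest-neighbor paths from $(0,0)$ to $(k,\ell)$ whose steps are $(1,0)$ or $(0,1)$. $\Psi(x,y)=\lim_{n\to\infty}n^{-1}T(\lfloor nx\rfloor,\lfloor ny\rfloor)$ (almost sure limit, which exists under the stated assumptions). $\operatorname{ess\,sup}_{\mathbb{P}}f=\inf\{s:\mathbb{P}(f>s)=0\}$. *)

(* Defs.v *)
From HB Require Import structures.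
From mathcomp Require Import all_boot all_order all_algebra.
From mathcomp Require Import all_classical all_reals all_analysis.
From mathcomp Require Import measurable_realfun ess_sup_inf.
Set Implicit Arguments. Unset Strict Implicit. Unset Printing Implicit Defensive.
Import Order.TTheory GRing.Theory Num.Theory.
Import numFieldNormedType.Exports.
Local Open Scope classical_set_scope.
Local Open Scope ring_scope.

Section LPP.
Variable R : realType.

Definition distr := probability R R.

Definition distr_cdf (m : distr) (x : R) : R := fine (m [set` `]-oo, x]]).

Definition eval_gen : set (set distr) :=
  [set S | exists (C : set R) (c : R), measurable C /\
           S = [set m : distr | fine (m C) <= c]].
Definition distr_measurable (S : set distr) : Prop := <<s eval_gen >> S.

(* Up-right paths from (0,0) to (k,l): a word of k+l steps, 'true' = (1,0),
   'false' = (0,1), containing exactly k 'true' steps. *)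
Definition is_path (k l : nat) (p : (k + l).-tuple bool) : bool :=
  count id p == k.

Definition site (k l : nat) (p : (k + l).-tuple bool) (m : nat) : nat * nat :=
  (count id (take m p), m - count id (take m p))%N.

Definition path_weight (X : nat -> nat -> R) (k l : nat)
  (p : (k + l).-tuple bool) : R :=
  \sum_(m < (k + l).+1) X (site p m).1 (site p m).2.

(* Last-passage time T(k,l). The set of paths is nonempty and finite. *)
Definition lpp (X : nat -> nat -> R) (k l : nat) : R :=
  fine (\big[Order.max/-oo%E]_(p : (k + l).-tuple bool | is_path p)
          (path_weight X p)%:E).

End LPP.

Section Model.
Context (R : realType) (d : measure_display) (T : measurableType d).
Variables (P : probability T R) (F : T -> nat -> distr R)
          (X : T -> nat -> nat -> R).

Definition env_measurable : Prop :=
  forall (j : nat) (C : set R), measurable C ->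
    measurable_fun [set: T] ((fun w => F w j C) : T -> \bar R).

Definition env_iid : Prop :=
  (forall (j : nat) (S : set (distr R)), distr_measurable S ->
     P [set w | S (F w j)] = P [set w | S (F w 0%N)]) /\
  (forall (js : seq nat) (S : nat -> set (distr R)), uniq js ->
     (forall j, j \in js -> distr_measurable (S j)) ->
     P [set w | forall j, j \in js -> S j (F w j)] =
       (\prod_(j <- js) P [set w | S j (F w j)])%E).

Definition env_event (A : set T) : Prop :=
  <<s [set B | exists (j : nat) (S : set (distr R)),
          eval_gen S /\ B = [set w | S (F w j)]] >> A.

Definition weights_measurable : Prop :=
  forall i j : nat, measurable_fun setT (fun w => X w i j).

(* Given the environment {F_j}, the weights X(i,j) are independent with
   X(i,j) ~ F_j: for every finite set of distinct sites and every
   environment event A,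
   P(A /\ X(z) <= t(z) for all z in s) = E[ 1_A * prod_{z in s} F_{z.2}(t z) ]. *)
Definition quenched_law : Prop :=
  forall (s : seq (nat * nat)) (t : nat * nat -> R) (A : set T),
    uniq s -> env_event A ->
    P (A `&` [set w | forall z, z \in s -> X w z.1 z.2 <= t z]) =
      (\int[P]_(w in A) (\prod_(z <- s) distr_cdf (F w z.2) (t z))%:E)%E.

End Model.

(* Main.v *)
Require Import Defs.
From HB Require Import structures.
From mathcomp Require Import all_boot all_order all_algebra.
From mathcomp Require Import all_classical all_reals all_analysis.
From mathcomp Require Import measurable_realfun ess_sup_inf.
From mathcomp Require Import zify ring lra.
Set Implicit Arguments. Unset Strict Implicit. Unset Printing Implicit Defensive.
Import Order.TTheory GRing.Theory Num.Theory.
Import numFieldNormedType.Exports.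
Local Open Scope classical_set_scope.
Local Open Scope ring_scope.

(** Write T for the passage time to (n a, n).  A monotone path visits most rows at a single
    site, so up to O(n a) bounded weights T is the maximum S of sums with one site per row.
    Replacing the rows one at a time in a log-sum-exp smoothing of S (Lindeberg's method) shows
    that only the annealed mean and covariances within a row matter: the common covariance
    shifts every path alike, and what remains is the mean plus the standard deviation sigma
    times S for fair +-1 weights.

    For Bernoulli weights S is the departure process of a tandem of queues with geometric and
    Bernoulli stationary laws (Burke's theorem).  Starting the queues from equilibrium bounds
    E S from above for arbitrary row parameters p_j; for fair bits the stationary process is
    dominated by its exit points from the boundary, and concentration gives the matching
    lower bound, hence E S = n (1/2 + sqrt a + o(sqrt a)).

    Weights are rounded to multiples of 1/h.  The part beyond a large level K is a sum of
    indicators of half-lines, each of which is an inhomogeneous Bernoulli model; the bounds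
    above make its contribution o(sqrt a) times the four integrals over the tails.  The
    estimate is uniform in n and in the outer truncation levels, so Fatou's lemma transfers it
    to the almost sure limit Psi. *)

(** * Last-passage recursions *)

Section LastPassage.
Variable R : realType.
Implicit Types (X Y : nat -> nat -> R) (g s t v : nat -> R).

(** The accuracy o(sqrt a) governs every choice. Restricting to one site per row costs O(n a). At
    inverse temperature b, exchanging all rows costs O(n b^2), and the smoothing costs the entropy
    of the paths over b, about n a log(1/a) / b. Both are o(n sqrt a) when b lies well between sqrt
    a and a^(1/4); b = a^(5/16) is used. The constants of the exchange contain the sup norm of the
    weights, so K has to be fixed before a. Beyond K each half-line is handled twice: the problem
    with one site per row only sees the averaged row parameter p and yields integrals of sqrt p,
    while the problem with one site per column needs a stationary parameter above every row
    parameter, whence the essential suprema, at a cost O(n a). To stay within finite sums, geometric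
    laws are cut at a level N and left unnormalised. Invariance then becomes an inequality that
    raises N by one at each use, and N is sent to infinity at the end. The limit variance is
    E(sigma_0^2), not the total variance: weights of one row share their law, and this common
    randomness moves all paths together. *)

Fixpoint lrow g v i : R :=
  if i is i'.+1 then Num.max (lrow g v i') (g i) + v i else g 0%N + v 0%N.

Fixpoint lastp X (j i : nat) : R :=
  if j is j'.+1 then lrow (lastp X j') (X^~ j) i else \sum_(c < i.+1) X c 0%N.

Lemma lastpS0 X j : lastp X j.+1 0 = lastp X j 0 + X 0%N j.+1.
Proof. by []. Qed.

Lemma lastpSS X j i :
  lastp X j.+1 i.+1 = Num.max (lastp X j.+1 i) (lastp X j i.+1) + X i.+1 j.+1.
Proof. by []. Qed.

Lemma lastp0S X i : lastp X 0 i.+1 = lastp X 0 i + X i.+1 0%N.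
Proof. by rewrite /= big_ord_recr. Qed.

Lemma lastp00 X : lastp X 0 0 = X 0%N 0%N.
Proof. by rewrite /= big_ord1. Qed.

Lemma lastp_right X j i : lastp X j i + X i.+1 j <= lastp X j i.+1.
Proof.
case: j => [|j]; first by rewrite lastp0S.
by rewrite lastpSS lerD2r le_max lexx.
Qed.

Lemma lastp_up X j i : lastp X j i + X i j.+1 <= lastp X j.+1 i.
Proof.
case: i => [|i]; first by rewrite lastpS0.
by rewrite lastpSS lerD2r le_max lexx orbT.
Qed.

Definition word_site (s : seq bool) (m : nat) : nat * nat :=
  (count id (take m s), m - count id (take m s))%N.

Definition word_weight X (s : seq bool) : R :=
  \sum_(m < (size s).+1) X (word_site s m).1 (word_site s m).2.

Lemma word_weight_rcons X (s : seq bool) b :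
  word_weight X (rcons s b) =
  word_weight X s + X (count id (rcons s b)) (size (rcons s b) - count id (rcons s b))%N.
Proof.
rewrite /word_weight size_rcons big_ord_recr /= [take _.+1 _]take_oversize ?size_rcons//.
congr (_ + _); apply: eq_bigr => m _.
by rewrite /word_site -cats1 takel_cat // -ltnS.
Qed.

Lemma word_weight_le X (s : seq bool) :
  word_weight X s <= lastp X (size s - count id s) (count id s).
Proof.
elim/last_ind: s => [|s b IH].
  by rewrite /word_weight big_ord1 /word_site /= big_ord1.
rewrite word_weight_rcons.
have cs : (count id s <= size s)%N by exact: count_size.
have -> : count id (rcons s b) = (count id s + b)%N by rewrite -cats1 count_cat /= addn0.
rewrite size_rcons; case: b => /=.
  rewrite addn1 subSS; apply: le_trans (lastp_right _ _ _).
  by rewrite lerD2r.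
rewrite addn0 subSn //; apply: le_trans (lastp_up _ _ _).
by rewrite lerD2r.
Qed.

(** Backtracking along the recursion: the neighbour that attains the maximum dictates the last
    letter. *)
Lemma word_weight_ex X l k : exists s : seq bool,
  [/\ size s = (k + l)%N, count id s = k & word_weight X s = lastp X l k].
Proof.
elim: l k => [|l IHl] k.
  elim: k => [|k [s [ss cs ws]]].
    by exists [::]; rewrite /word_weight big_ord1 lastp00.
  exists (rcons s true).
  have cr : count id (rcons s true) = k.+1 by rewrite -cats1 count_cat cs /= addn1.
  split; rewrite ?size_rcons ?ss ?addn0//.
  by rewrite word_weight_rcons cr size_rcons ss ws lastp0S addn0 subnn.
elim: k => [|k [s [ss cs ws]]].
  have [s [ss cs ws]] := IHl 0%N; exists (rcons s false).
  have cr : count id (rcons s false) = 0%N by rewrite -cats1 count_cat cs.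
  by rewrite word_weight_rcons cr size_rcons ss ws lastpS0.
rewrite lastpSS; case: (leP (lastp X l.+1 k) (lastp X l k.+1)) => _.
  have [{cs ws ss}s [ss cs ws]] := IHl k.+1; exists (rcons s false).
  have cr : count id (rcons s false) = k.+1 by rewrite -cats1 count_cat cs /= !addn0.
  rewrite word_weight_rcons cr size_rcons ss ws addnS; split => //.
  by congr (_ + X _ _); lia.
exists (rcons s true).
have cr : count id (rcons s true) = k.+1 by rewrite -cats1 count_cat cs /= addn1.
rewrite word_weight_rcons cr size_rcons ss ws addSn; split => //.
by congr (_ + X _ _); lia.
Qed.

Lemma lppE X k l : lpp X k l = lastp X l k.
Proof.
have pw (p : (k + l).-tuple bool) : path_weight X p = word_weight X p.
  by rewrite /path_weight /word_weight size_tuple.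
rewrite /lpp; suff -> : \big[Order.max/-oo%E]_(p : (k + l).-tuple bool | is_path p)
   (path_weight X p)%:E = (lastp X l k)%:E by [].
apply/eqP; rewrite eq_le; apply/andP; split.
  apply: bigmax_le => [|p /eqP cp]; first by rewrite leNye.
  rewrite lee_fin pw; apply: le_trans (word_weight_le _ _) _.
  by rewrite cp size_tuple addKn.
have [s [ss cs <-]] := word_weight_ex X l k.
have ss' : size s == (k + l)%N by rewrite ss.
apply: (le_trans _ (le_bigmax_cond _ _ (j := Tuple ss') _)).
  by rewrite pw.
by rewrite /is_path /= cs.
Qed.

Lemma le_lastp X Y l k : (forall i j, (i <= k)%N -> (j <= l)%N -> X i j <= Y i j) ->
  lastp X l k <= lastp Y l k.
Proof.
elim: l k => [|l IHl] k XY; first by apply: ler_sum => c _; apply: XY; rewrite // -ltnS.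
elim: k XY => [|k IHk] XY.
  by rewrite !lastpS0 lerD ?XY// IHl// => i j ik jl; rewrite XY// ltnW.
rewrite !lastpSS lerD ?XY// ge_max !le_max IHk ?IHl ?orbT//.
- by move=> i j ik jl; rewrite XY// ltnW.
- by move=> i j ik jl; rewrite XY// ltnW.
Qed.

Lemma lastpD X Y l k :
  lastp (fun i j => X i j + Y i j) l k <= lastp X l k + lastp Y l k.
Proof.
elim: l k => [|l IHl] k; first by rewrite /= big_split.
elim: k => [|k IHk]; first by rewrite !lastpS0 addrACA lerD2r.
rewrite !lastpSS addrACA lerD2r ge_max.
apply/andP; split; [apply: le_trans IHk _|apply: le_trans (IHl _) _];
  by rewrite lerD// le_max lexx ?orbT.
Qed.

Lemma lastp_cst (c : R) l k : lastp (fun _ _ => c) l k = c * (k + l).+1%:R.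
Proof.
elim: l k => [|l IHl] k.
  by rewrite /= sumr_const card_ord addn0 mulr_natr.
elim: k => [|k IHk]; first by rewrite lastpS0 IHl !add0n -[in RHS]natr1 mulrDr mulr1.
have -> : (k.+1 + l.+1).+1 = (k + l.+1).+2 by lia.
have e : (k.+1 + l).+1 = (k + l.+1).+1 by lia.
by rewrite lastpSS IHk IHl e maxxx -[in RHS]natr1 mulrDr mulr1.
Qed.

(* One site per row: [rmax (foldl sstep (fun=> 0) rows) k] maximises over nondecreasing
   choices of columns in [0, k]. *)
Fixpoint rmax g i : R := if i is i'.+1 then Num.max (rmax g i') (g i) else g 0%N.

Definition sstep s v : nat -> R := fun i => rmax s i + v i.

Definition slast (rows : seq (nat -> R)) (k : nat) : R :=
  rmax (foldl sstep (fun=> 0) rows) k.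

(* One site per column: the transposed problem. *)
Fixpoint tstep t v i : R :=
  if i is i'.+1 then Num.max (tstep t v i' + v i) (t i) else Num.max (t 0%N) (v 0%N).

Definition tlast (rows : seq (nat -> R)) (k : nat) : R := foldl tstep (fun=> 0) rows k.

Definition rows_of X n : seq (nat -> R) := mkseq (fun j i => X i j) n.

Lemma rows_ofS X n : rows_of X n.+1 = rcons (rows_of X n) (X^~ n).
Proof. by rewrite /rows_of mkseqS. Qed.

Lemma rmax_ge g i c : (c <= i)%N -> g c <= rmax g i.
Proof.
elim: i => [|i IH]; first by rewrite leqn0 => /eqP ->.
rewrite leq_eqVlt => /predU1P[->|/IH h] /=; first by rewrite le_max lexx orbT.
by rewrite le_max h.
Qed.

Lemma rmax_le g i (b : R) : (forall c, (c <= i)%N -> g c <= b) -> rmax g i <= b.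
Proof.
elim: i => [|i IH] h /=; first exact: h.
by rewrite ge_max IH ?h// => c ci; apply: h; rewrite ltnW.
Qed.

Lemma rmax_ex g i : exists2 c, (c <= i)%N & rmax g i = g c.
Proof.
elim: i => [|i [c ci e]] /=; first by exists 0%N.
case: leP => _; first by exists i.+1.
by exists c => //; rewrite ltnW.
Qed.

Lemma rmax_mono g i i' : (i <= i')%N -> rmax g i <= rmax g i'.
Proof. by move=> ii'; apply: rmax_le => c ci; apply: rmax_ge; apply: leq_trans ii'. Qed.

Lemma le_rmax g g' i : (forall c, (c <= i)%N -> g c <= g' c) -> rmax g i <= rmax g' i.
Proof. by move=> h; apply: rmax_le => c ci; apply: le_trans (h c ci) (rmax_ge _ ci). Qed.

Lemma slast_rcons rows v k :
  slast (rcons rows v) k = rmax (fun i => slast rows i + v i) k.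
Proof. by rewrite /slast foldl_rcons. Qed.

Lemma tstep_ge t v i : t i <= tstep t v i.
Proof. by case: i => [|i] /=; rewrite le_max lexx ?orbT. Qed.

(** A step up enters a new row and a step to the right a new column, so every site of a path is the
    first one of its row or of its column. The former sites compete in [slast], the latter in
    [tlast]; the origin is counted in both, which nonnegativity permits. *)
Lemma lastp_le_slast_tlast X l k : (forall i j, 0 <= X i j) ->
  lastp X l k <= slast (rows_of X l.+1) k + tlast (rows_of X l.+1) k.
Proof.
move=> X0; elim: l k => [|l IHl] k.
  rewrite /slast /tlast /rows_of /mkseq /=.
  elim: k => [|k IHk].
    by rewrite big_ord1 /sstep /= add0r lerDl le_max lexx.
  rewrite big_ord_recr /=.
  have : tstep (fun=> 0) (X^~ 0%N) k + X k.+1 0%N <= tstep (fun=> 0) (X^~ 0%N) k.+1.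
    by rewrite /= le_max lexx.
  have := rmax_mono (sstep (fun=> 0) (X^~ 0%N)) (leqnSn k).
  move: IHk => /=; lra.
rewrite rows_ofS slast_rcons /tlast foldl_rcons.
elim: k => [|k IHk].
  rewrite lastpS0 /=; have := IHl 0%N; rewrite /tlast.
  have : foldl tstep (fun=> 0) (rows_of X l.+1) 0%N <=
    Num.max (foldl tstep (fun=> 0) (rows_of X l.+1) 0) (X 0%N l.+1) by rewrite le_max lexx.
  lra.
rewrite lastpSS -lerBrDr ge_max.
have h1 := rmax_ge (fun i => slast (rows_of X l.+1) i + X i l.+1) (leqnn k.+1).
have h2 := rmax_mono (fun i => slast (rows_of X l.+1) i + X i l.+1) (leqnSn k).
have h3 := tstep_ge (foldl tstep (fun=> 0) (rows_of X l.+1)) (X^~ l.+1) k.+1.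
have h4 : tstep (foldl tstep (fun=> 0) (rows_of X l.+1)) (X^~ l.+1) k + X k.+1 l.+1
   <= tstep (foldl tstep (fun=> 0) (rows_of X l.+1)) (X^~ l.+1) k.+1.
  by rewrite /= le_max lexx.
have := IHl k.+1; rewrite /tlast; move: h1 h2 h3 h4 IHk; cbv beta => h1 h2 h3 h4 h5 h6.
by apply/andP; split; lra.
Qed.

(** The sites entered by a step to the right number [k], and each is worth at most [K]. *)
Lemma lastp_le_slast X (K : R) l k : (forall i j, `|X i j| <= K) ->
  lastp X l k <= slast (rows_of X l.+1) k + K * k%:R.
Proof.
move=> XK; have XK1 i j : X i j <= K by apply: le_trans (ler_norm _) (XK _ _).
elim: l k => [|l IHl] k.
  rewrite /slast /=; elim: k => [|k IHk].
    by rewrite big_ord1 /sstep /= mulr0 addr0 add0r.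
  rewrite big_ord_recr /= -natr1 mulrDr mulr1.
  have := rmax_mono (sstep (fun=> 0) (X^~ 0%N)) (leqnSn k).
  by move: IHk (XK1 k.+1 0%N) => /=; lra.
rewrite rows_ofS slast_rcons.
elim: k => [|k IHk]; first by rewrite lastpS0 /= mulr0 addr0 lerD2r; have := IHl 0%N; lra.
have h1 := rmax_ge (fun i => slast (rows_of X l.+1) i + X i l.+1) (leqnn k.+1).
have h2 := rmax_mono (fun i => slast (rows_of X l.+1) i + X i l.+1) (leqnSn k).
rewrite lastpSS -lerBrDr ge_max.
have e : k.+1%:R = k%:R + 1 :> R by rewrite natr1.
have := IHl k.+1; move: h1 h2 IHk (XK1 k.+1 l.+1); cbv beta; rewrite e mulrDr mulr1 => h1 h2 h3 h4 h5.
by apply/andP; split; lra.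
Qed.

(** A nondecreasing choice of columns extends to a path by moving right inside the rows; each added
    site is charged [- K]. *)
Lemma slast_le_lastp X (K : R) l k : (forall i j, `|X i j| <= K) ->
  slast (rows_of X l.+1) k <= lastp X l k + K * k.+1%:R.
Proof.
move=> XK; have XK1 i j : - K <= X i j.
  by have := XK i j; rewrite ler_norml => /andP[].
have K0 : 0 <= K by apply: le_trans (XK 0%N 0%N).
have right l' k' c : (c <= k')%N -> lastp X l' c - K * (k' - c)%:R <= lastp X l' k'.
  move=> ck; rewrite -{2}(subnKC ck); elim: (k' - c)%N => [|m IH]; first by rewrite mulr0 subr0 addn0.
  rewrite addnS; apply: le_trans (lastp_right _ _ _).
  by have := XK1 (c + m).+1 l'; move: IH; rewrite -natr1; lra.
elim: l k => [|l IHl] k.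
  rewrite /slast /=; apply: rmax_le => c ck; rewrite /sstep.
  have -> : rmax (fun=> 0 : R) c = 0.
    by elim: c {ck} => //= c ->; rewrite maxxx.
  have : X c 0%N <= lastp X 0 c + K * c%:R.
    case: c {ck} => [|c]; first by rewrite lastp00 mulr0 addr0.
    rewrite lastp0S -natr1.
    have : - (K * c.+1%:R) <= lastp X 0 c.
      rewrite -mulNr mulr_natr -[X in _ *+ X](card_ord c.+1) -sumr_const.
      by apply: ler_sum => i _.
    by rewrite -natr1; lra.
  have := right 0%N k c ck; rewrite natrB//.
  have -> : \sum_(c0 < k.+1) X c0 0%N = lastp X 0 k by [].
  by rewrite -[k.+1%:R]natr1; lra.
rewrite rows_ofS slast_rcons; apply: rmax_le => c ck.
have := IHl c; have := lastp_up X l c; have := right l.+1 k c ck.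
rewrite natrB// -!natr1; lra.
Qed.

End LastPassage.

(** * Finite laws *)

Section FiniteLaws.
Variable R : realType.

(** Neither positivity nor total mass 1 is built in: truncated geometric laws have mass below 1, and
    the two properties are carried as separate hypotheses [lpos] and [mass]. *)
Definition law (A : Type) := seq (A * R).

Definition Ex (A : Type) (l : law A) (h : A -> R) : R := \sum_(x <- l) x.2 * h x.1.

Definition mass (A : Type) (l : law A) : R := Ex l (fun=> 1).

Definition lpos (A : Type) (l : law A) : bool := all (fun x => 0 <= x.2) l.

Section OneLaw.
Variables (A : Type) (l : law A).
Implicit Types h : A -> R.

Lemma eq_Ex h h' : h =1 h' -> Ex l h = Ex l h'.
Proof. by move=> hh'; apply: eq_bigr => x _; rewrite hh'. Qed.

Lemma ExD h h' : Ex l (fun a => h a + h' a) = Ex l h + Ex l h'.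
Proof. by rewrite /Ex -big_split; apply: eq_bigr => x _; rewrite mulrDr. Qed.

Lemma ExZ c h : Ex l (fun a => c * h a) = c * Ex l h.
Proof. by rewrite /Ex mulr_sumr; apply: eq_bigr => x _; rewrite mulrCA. Qed.

Lemma ExB h h' : Ex l (fun a => h a - h' a) = Ex l h - Ex l h'.
Proof. by rewrite /Ex -sumrB; apply: eq_bigr => x _; rewrite mulrBr. Qed.

Lemma Ex_cst c : Ex l (fun=> c) = mass l * c.
Proof. by rewrite mulrC -ExZ; apply: eq_Ex => a; rewrite mulr1. Qed.

Lemma Ex_sum (I : Type) (r : seq I) (H : I -> A -> R) :
  Ex l (fun a => \sum_(i <- r) H i a) = \sum_(i <- r) Ex l (H i).
Proof.
rewrite /Ex exchange_big; apply: eq_bigr => x _.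
by rewrite mulr_sumr.
Qed.

Lemma le_Ex h h' : lpos l -> (forall a, h a <= h' a) -> Ex l h <= Ex l h'.
Proof.
rewrite /Ex /lpos => + hh'; elim: l => [|x l' IH] /=; first by rewrite !big_nil.
by case/andP => x0 /IH; rewrite !big_cons; apply: lerD; rewrite ler_wpM2l.
Qed.

Lemma Ex_ge0 h : lpos l -> (forall a, 0 <= h a) -> 0 <= Ex l h.
Proof.
move=> l0 h0; rewrite -[0](mulr0 (mass l)) -Ex_cst; exact: le_Ex.
Qed.

Lemma Ex_norm h : lpos l -> `|Ex l h| <= Ex l (fun a => `|h a|).
Proof.
move=> l0; rewrite ler_norml -[- _]mulN1r -ExZ; apply/andP; split; apply: le_Ex => // a.
  by rewrite mulN1r lerNl -normrN ler_norm.
exact: ler_norm.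
Qed.

End OneLaw.

Lemma Ex_comm (A B : Type) (l : law A) (l' : law B) (h : A -> B -> R) :
  Ex l (fun a => Ex l' (h a)) = Ex l' (fun b => Ex l (h^~ b)).
Proof.
rewrite /Ex; under eq_bigr do rewrite mulr_sumr.
rewrite exchange_big; apply: eq_bigr => x _; rewrite mulr_sumr.
by apply: eq_bigr => y _; rewrite mulrCA.
Qed.

(** Expectation under a product law, kept as nested finite sums so that coordinates can be peeled
    off one by one. *)
Fixpoint El (A : Type) (ls : seq (law A)) (h : seq A -> R) : R :=
  if ls is l :: ls' then Ex l (fun a => El ls' (fun s => h (a :: s))) else h [::].

Section ManyLaws.
Variable A : Type.
Implicit Types (ls : seq (law A)) (h : seq A -> R).

Lemma eq_El_size ls h h' : (forall s, size s = size ls -> h s = h' s) ->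
  El ls h = El ls h'.
Proof.
elim: ls h h' => [|l ls IH] h h' hh' /=; first exact: hh'.
by apply: eq_Ex => a; apply: IH => s ss; apply: hh'; rewrite /= ss.
Qed.

Lemma eq_El ls h h' : h =1 h' -> El ls h = El ls h'.
Proof. by move=> hh'; apply: eq_El_size => s _. Qed.

Lemma ElD ls h h' : El ls (fun s => h s + h' s) = El ls h + El ls h'.
Proof.
elim: ls h h' => [|l ls IH] h h' //=.
by rewrite -ExD; apply: eq_Ex => a; rewrite IH.
Qed.

Lemma ElZ ls c h : El ls (fun s => c * h s) = c * El ls h.
Proof.
elim: ls h => [|l ls IH] h //=.
by rewrite -ExZ; apply: eq_Ex => a; rewrite IH.
Qed.

Lemma ElB ls h h' : El ls (fun s => h s - h' s) = El ls h - El ls h'.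
Proof. by rewrite -[RHS]addrC -[- _]mulN1r -ElZ -ElD; apply: eq_El => s; rewrite mulN1r addrC. Qed.

Lemma El_cst ls c : El ls (fun=> c) = (\prod_(l <- ls) mass l) * c.
Proof.
elim: ls => [|l ls IH] /=; first by rewrite big_nil mul1r.
by rewrite IH Ex_cst big_cons mulrA.
Qed.

Lemma El_sum (I : Type) (r : seq I) ls (H : I -> seq A -> R) :
  El ls (fun s => \sum_(i <- r) H i s) = \sum_(i <- r) El ls (H i).
Proof.
elim: ls H => [|l ls IH] H //=.
rewrite -Ex_sum; apply: eq_Ex => a; exact: IH.
Qed.

Lemma le_El_size ls h h' : all (@lpos A) ls ->
  (forall s, size s = size ls -> h s <= h' s) -> El ls h <= El ls h'.
Proof.
elim: ls h h' => [|l ls IH] h h' /= + hh'; first by move=> _; exact: hh'.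
by case/andP => l0 ls0; apply: le_Ex => // a; apply: IH => // s ss; apply: hh'; rewrite /= ss.
Qed.

Lemma le_El ls h h' : all (@lpos A) ls -> (forall s, h s <= h' s) -> El ls h <= El ls h'.
Proof. by move=> ls0 hh'; apply: le_El_size => // s _. Qed.

Lemma El_ge0 ls h : all (@lpos A) ls -> (forall s, 0 <= h s) -> 0 <= El ls h.
Proof.
by move=> ls0 h0; rewrite -[0](mulr0 (\prod_(l <- ls) mass l)) -El_cst; apply: le_El.
Qed.

Lemma El_norm ls h : all (@lpos A) ls -> `|El ls h| <= El ls (fun s => `|h s|).
Proof.
move=> l0; rewrite ler_norml -[- _]mulN1r -ElZ; apply/andP; split; apply: le_El => // a.
  by rewrite mulN1r lerNl -normrN ler_norm.
exact: ler_norm.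
Qed.

Lemma Ex_El (B : Type) (l : law B) ls (h : B -> seq A -> R) :
  Ex l (fun b => El ls (h b)) = El ls (fun s => Ex l (h^~ s)).
Proof.
elim: ls h => [|l' ls IH] h //=; rewrite Ex_comm; apply: eq_Ex => a.
by rewrite IH.
Qed.

Lemma lpos_nseq n (l : law A) : lpos l -> all (@lpos A) (nseq n l).
Proof. by move=> l0; rewrite all_nseq l0 orbT. Qed.

Lemma prod_mass_nseq n (l : law A) : \prod_(l' <- nseq n l) mass l' = mass l ^+ n.
Proof. by elim: n => [|n IH] /=; rewrite ?big_nil // big_cons IH exprS. Qed.

Lemma El_drop n a l h : mass l = 1 -> (a <= n)%N ->
  El (nseq n l) (fun s => h (drop a s)) = El (nseq (n - a) l) h.
Proof.
move=> l1; elim: a n => [|a IH] [|n] //= an.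
by rewrite Ex_cst l1 mul1r IH.
Qed.

Lemma El_take n a l h : mass l = 1 -> (a <= n)%N ->
  El (nseq n l) (fun s => h (take a s)) = El (nseq a l) h.
Proof.
move=> l1; elim: a n h => [|a IH] n h.
  move=> _; rewrite (@eq_El _ _ (fun=> h [::])); last by move=> s; rewrite take0.
  by rewrite El_cst prod_mass_nseq l1 expr1n mul1r.
case: n => //= n an; apply: eq_Ex => x.
by rewrite (IH n (fun s => h (x :: s))).
Qed.

End ManyLaws.

Definition ber (p : R) : law bool := [:: (true, p); (false, 1 - p)].
Definition nber (p : R) : law nat := [:: (1%N, p); (0%N, 1 - p)].

(* Geometric law truncated at level N and left unnormalised, so that only finite sums occur. *)
Definition tgeo (r : R) (N : nat) : law nat :=
  [seq (m, (1 - r) * r ^+ m) | m <- iota 0 N.+1].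

Lemma Ex_ber p h : Ex (ber p) h = p * h true + (1 - p) * h false.
Proof. by rewrite /Ex !big_cons big_nil addr0. Qed.

Lemma Ex_nber p h : Ex (nber p) h = p * h 1%N + (1 - p) * h 0%N.
Proof. by rewrite /Ex !big_cons big_nil addr0. Qed.

Lemma mass_ber p : mass (ber p) = 1.
Proof. by rewrite /mass Ex_ber; ring. Qed.

Lemma mass_nber p : mass (nber p) = 1.
Proof. by rewrite /mass Ex_nber; ring. Qed.

Lemma lpos_ber p : 0 <= p <= 1 -> lpos (ber p).
Proof. by move=> /andP[p0 p1]; rewrite /lpos /= p0 subr_ge0 p1. Qed.

Lemma lpos_nber p : 0 <= p <= 1 -> lpos (nber p).
Proof. by move=> /andP[p0 p1]; rewrite /lpos /= p0 subr_ge0 p1. Qed.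

Lemma Ex_tgeo0 r h : Ex (tgeo r 0) h = (1 - r) * h 0%N.
Proof. by rewrite /Ex big_cons big_nil /= expr0 mulr1 addr0. Qed.

Lemma Ex_tgeoS r N h :
  Ex (tgeo r N.+1) h = Ex (tgeo r N) h + (1 - r) * r ^+ N.+1 * h N.+1.
Proof.
by rewrite /Ex /tgeo -(addn1 N.+1) iotaD add0n map_cat big_cat big_seq1.
Qed.

Lemma lpos_tgeo r N : 0 <= r <= 1 -> lpos (tgeo r N).
Proof.
move=> /andP[r0 r1]; rewrite /lpos all_map; apply/allP => m _ /=.
by rewrite mulr_ge0 ?subr_ge0 ?exprn_ge0.
Qed.

Lemma mass_tgeo r N : mass (tgeo r N) = 1 - r ^+ N.+1.
Proof.
elim: N => [|N IH]; first by rewrite /mass Ex_tgeo0 expr1; ring.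
by rewrite /mass Ex_tgeoS -/(mass _) IH !exprS; ring.
Qed.

Lemma mean_tgeo r N : r < 1 ->
  Ex (tgeo r N) (fun m => m%:R) = r / (1 - r) - r ^+ N.+1 * (r / (1 - r) + N.+1%:R).
Proof.
move=> r1; have r1' : 1 - r != 0 by rewrite subr_eq0 eq_sym lt_eqF.
elim: N => [|N IH]; first by rewrite Ex_tgeo0; field.
by rewrite Ex_tgeoS IH -[N.+2%:R]natr1 [r ^+ N.+2]exprS; field.
Qed.

Lemma mean_tgeo_le r N : 0 <= r < 1 -> Ex (tgeo r N) (fun m => m%:R) <= r / (1 - r).
Proof.
move=> /andP[r0 r1]; rewrite mean_tgeo// gerBl mulr_ge0 ?exprn_ge0//.
by rewrite addr_ge0// divr_ge0// subr_ge0 ltW.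
Qed.

Lemma le_mass_tgeo r N : 0 <= r <= 1 -> mass (tgeo r N) <= 1.
Proof. by move=> /andP[r0 _]; rewrite mass_tgeo gerBl exprn_ge0. Qed.

End FiniteLaws.

(** * The Bernoulli queue and its reversibility *)

Section Burke.
Variable R : realType.
Implicit Types (p r : R) (h : nat -> nat -> R).

(** Increments of a stationary passage time around one site carrying the bit [e]: [u] is the
    horizontal increment below, [v] the vertical increment on the left, and the outputs are those
    above and on the right. The first output is Lindley's recursion for a queue of length [u] with
    arrival [e] and service [v], the truncated subtraction being the reflection at 0. *)
Definition queueS (u v : nat) (e : bool) : nat * nat := (u + e - v, maxn (v - u) e)%N.
(** The same site with the axes exchanged: [queueT u v e] is [queueS v u e] with its components
    swapped. It drives the problem with one site per column. *)
Definition queueT (u v : nat) (e : bool) : nat * nat := (maxn (u - v) e, v + e - u)%N.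

(** The balance equation makes the product of a geometric law of ratio [r] and a Bernoulli law of
    parameter [u] invariant under the site map. Cutting at [N] leaves two boundary terms: the state
    [(N, 0)] has lost its preimage at level [N.+1], and the state [(N.+1, 1)] is reached from level
    [N]. *)
Lemma burke_local_eq p r (u : R) N h : r * u * (1 - p) = p * (1 - u) ->
  Ex (tgeo r N) (fun m => Ex (nber u) (fun v => Ex (ber p) (fun e =>
     h (queueS m v e).1 (queueS m v e).2))) =
  Ex (tgeo r N) (fun m => Ex (nber u) (h m))
  - (1 - r) * r ^+ N * p * (1 - u) * h N 0%N
  + (1 - r) * r ^+ N.+1 * u * (1 - p) * h N.+1 1%N.
Proof.
move=> E.
have E' : u * r = p - p * u + p * u * r by move: E; rewrite mulrBr; lra.
elim: N => [|N IH].
  rewrite !Ex_tgeo0 !Ex_nber !Ex_ber /= !exprS !expr0.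
  have -> : (1 - r) * (r * 1) * u * (1 - p) * h 1%N 1%N =
     (1 - r) * (r * u * (1 - p)) * h 1%N 1%N by ring.
  rewrite E; ring.
rewrite !Ex_tgeoS IH !Ex_nber !Ex_ber /=.
have -> : (N.+1 + 1 - 1 = N.+1)%N by lia.
have -> : maxn (1 - N.+1) 1 = 1%N by lia.
have -> : (N.+1 + 0 - 1 = N)%N by lia.
have -> : maxn (1 - N.+1) 0 = 0%N by lia.
have -> : (N.+1 + 1 - 0 = N.+2)%N by lia.
have -> : (N.+1 + 0 - 0 = N.+1)%N by lia.
have -> : (1 - r) * r ^+ N.+2 * u * (1 - p) * h N.+2 1%N =
     (1 - r) * r ^+ N.+1 * (r * u * (1 - p)) * h N.+2 1%N by rewrite !exprS; ring.
have -> : (1 - r) * r ^+ N * p * (1 - u) * h N 0%N =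
     (1 - r) * r ^+ N.+1 * u * (1 - p) * h N 0%N.
  by rewrite -[_ * p * (1 - u)]mulrA -E exprS; ring.
by rewrite E; ring.
Qed.

(** Since [h] is nonnegative, one more level on the right pays for the boundary term. The same
    device gives the reverse inequality below. *)
Lemma burke_local_le p r (u : R) N h : r * u * (1 - p) = p * (1 - u) ->
  0 <= p <= 1 -> 0 <= r <= 1 -> 0 <= u <= 1 -> (forall m v, 0 <= h m v) ->
  Ex (tgeo r N) (fun m => Ex (nber u) (fun v => Ex (ber p) (fun e =>
     h (queueS m v e).1 (queueS m v e).2))) <=
  Ex (tgeo r N.+1) (fun m => Ex (nber u) (h m)).
Proof.
move=> E /andP[p0 p1] /andP[r0 r1] /andP[u0 u1] h0.
rewrite burke_local_eq// Ex_tgeoS -!addrA lerD2l Ex_nber.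
rewrite addrC; apply: (@le_trans _ _ ((1 - r) * r ^+ N.+1 * u * (1 - p) * h N.+1 1%N)).
  rewrite gerBl !mulr_ge0 ?subr_ge0 ?exprn_ge0//.
rewrite -!mulrA !ler_wpM2l ?subr_ge0 ?exprn_ge0//.
rewrite [u * ((1 - p) * _)]mulrCA; apply: (@le_trans _ _ (u * h N.+1 1%N)).
  by rewrite ler_piMl ?mulr_ge0// gerBl.
by rewrite lerDl mulr_ge0// subr_ge0.
Qed.

Lemma burke_local_ge p r (u : R) N h : r * u * (1 - p) = p * (1 - u) ->
  0 <= p <= 1 -> 0 <= r <= 1 -> 0 <= u <= 1 -> (forall m v, 0 <= h m v) ->
  Ex (tgeo r N) (fun m => Ex (nber u) (h m)) <=
  Ex (tgeo r N.+1) (fun m => Ex (nber u) (fun v => Ex (ber p) (fun e =>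
     h (queueS m v e).1 (queueS m v e).2))).
Proof.
move=> E /andP[p0 p1] /andP[r0 r1] /andP[u0 u1] h0.
rewrite burke_local_eq// Ex_tgeoS -!addrA lerDl Ex_nber.
have a0 : 0 <= (1 - r) * r ^+ N.+1 by rewrite mulr_ge0 ?subr_ge0 ?exprn_ge0.
have -> : (1 - r) * r ^+ N.+1 * (u * h N.+1 1%N + (1 - u) * h N.+1 0%N) +
  (- ((1 - r) * r ^+ N.+1 * p * (1 - u) * h N.+1 0%N) +
   (1 - r) * r ^+ N.+2 * u * (1 - p) * h N.+2 1%N) =
  (1 - r) * r ^+ N.+1 * (u * h N.+1 1%N + (1 - p) * ((1 - u) * h N.+1 0%N)) +
   (1 - r) * r ^+ N.+2 * (u * ((1 - p) * h N.+2 1%N)) by ring.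
have a1 : 0 <= (1 - r) * r ^+ N.+2 by rewrite mulr_ge0 ?subr_ge0 ?exprn_ge0.
have p1' : 0 <= 1 - p by rewrite subr_ge0.
have u1' : 0 <= 1 - u by rewrite subr_ge0.
apply: addr_ge0; apply: mulr_ge0 => //; last by rewrite mulr_ge0// mulr_ge0.
by rewrite addr_ge0// mulr_ge0// mulr_ge0.
Qed.

(** Carries the vertical increment [v] through one row of sites: the output is the list of new
    horizontal increments together with the vertical increment that leaves on the right. *)
Fixpoint sweep (f : nat -> nat -> bool -> nat * nat) (v : nat) (us : seq nat) (es : seq bool) :
    seq nat * nat :=
  match us, es with
  | u :: us', e :: es' =>
      let x := f u v e in let y := sweep f x.2 us' es' in (x.1 :: y.1, y.2)
  | _, _ => ([::], v)
  end.

Definition brow (e : seq bool) : nat -> R := fun i => (nth false e i)%:R.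

(** Independent rows of [M] independent bits, with a parameter for each row: the law of threshold
    indicators once the environment is given. *)
Fixpoint EB (M : nat) (ps : seq R) (h : seq (seq bool) -> R) : R :=
  if ps is p :: ps' then El (nseq M (ber p)) (fun e => EB M ps' (fun s => h (e :: s)))
  else h [::].

Section Queues.
Variable f : nat -> nat -> bool -> nat * nat.
Hypothesis f_flow : forall u v e, (u + (f u v e).2 = (f u v e).1 + v)%N.

Lemma size_sweep v us es : size es = size us -> size (sweep f v us es).1 = size us.
Proof.
elim: us v es => [|u us IH] v [|e es] //= [ss].
by rewrite IH.
Qed.

Lemma sweep_flow v us es : size es = size us ->
  (sumn us + (sweep f v us es).2 = v + sumn (sweep f v us es).1)%N.
Proof.
elim: us v es => [|u us IH] v [|e es] //=; first by rewrite add0n addn0.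
move=> [ss]; have := IH (f u v e).2 es ss; have := f_flow u v e; lia.
Qed.

Lemma sweep_take v us es i : size es = size us ->
  (sumn (take i us) <= v + sumn (take i (sweep f v us es).1))%N.
Proof.
elim: us v es i => [|u us IH] v [|e es] [|i] //= [ss].
have := IH (f u v e).2 es i ss; have := f_flow u v e; lia.
Qed.

Lemma sweep_takeS v us es i : (forall u v (e : bool), e <= (f u v e).2)%N ->
  size es = size us -> (i < size us)%N ->
  (sumn (take i.+1 us) + nth false es i <= v + sumn (take i.+1 (sweep f v us es).1))%N.
Proof.
move=> fe; elim: us v es i => [|u us IH] v [|e es] [|i] //= [ss] iu.
  by rewrite !take0 /= !addn0; have := f_flow u v e; have := fe u v e; lia.
by have := IH (f u v e).2 es i ss iu; have := f_flow u v e; lia.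
Qed.

Lemma sweep_takeT v us es i : (forall u v (e : bool), e <= (f u v e).1)%N ->
  size es = size us -> (i < size us)%N ->
  (sumn (take i (sweep f v us es).1) + nth false es i <=
   sumn (take i.+1 (sweep f v us es).1))%N.
Proof.
move=> fe; elim: us v es i => [|u us IH] v [|e es] [|i] //= [ss] iu.
  by rewrite !take0 /= !addn0 add0n fe.
by have := IH (f u v e).2 es i ss iu; rewrite /= -addnA leq_add2l.
Qed.

Variables (ql : nat -> law R nat) (cl : nat -> R -> law R nat) (ok : R -> Prop).
Hypothesis ok01 : forall p, ok p -> 0 <= p <= 1.
Hypothesis ql_pos : forall N, lpos (ql N).
Hypothesis cl_pos : forall N p, ok p -> lpos (cl N p).

Section UpperSweep.
Hypothesis local_le : forall p N N' h, ok p -> (forall u v, 0 <= h u v) ->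
  Ex (ql N) (fun u => Ex (cl N' p) (fun v => Ex (ber p) (fun e =>
    h (f u v e).1 (f u v e).2))) <=
  Ex (ql N.+1) (fun u => Ex (cl N'.+1 p) (h u)).

(** The sites of a row are treated from left to right. After each of them the carried increment is
    again independent of the increments still to be met, so the local inequality applies anew; each
    use lifts the carried law by one level, whence [N' + M]. *)
Lemma sweep_le p M N N' (h : seq nat -> nat -> R) : ok p -> (forall us v, 0 <= h us v) ->
  El (nseq M (ql N)) (fun us => Ex (cl N' p) (fun v => El (nseq M (ber p)) (fun es =>
    h (sweep f v us es).1 (sweep f v us es).2))) <=
  El (nseq M (ql N.+1)) (fun us => Ex (cl (N' + M) p) (h us)).
Proof.
move=> okp; elim: M N N' h => [|M IH] N N' h h0 /=; first by rewrite addn0.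
pose k u v := El (nseq M (ql N)) (fun us => El (nseq M (ber p)) (fun es =>
  h (u :: (sweep f v us es).1) (sweep f v us es).2)).
have -> : Ex (ql N) (fun a => El (nseq M (ql N)) (fun s =>
     Ex (cl N' p) (fun v => Ex (ber p) (fun a0 => El (nseq M (ber p)) (fun s0 =>
     h ((f a v a0).1 :: (sweep f (f a v a0).2 s s0).1) (sweep f (f a v a0).2 s s0).2)))))
  = Ex (ql N) (fun u => Ex (cl N' p) (fun v => Ex (ber p) (fun e =>
     k (f u v e).1 (f u v e).2))).
  apply: eq_Ex => u; rewrite -Ex_El; apply: eq_Ex => v.
  by rewrite -Ex_El.
apply: (le_trans (local_le _ _ _ _)) => //.
  move=> u v; apply: El_ge0; first exact: lpos_nseq.
  move=> us; apply: El_ge0; first by apply/lpos_nseq/lpos_ber/ok01.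
  by [].
apply: le_Ex => // u.
apply: (le_trans _ (le_trans (IH N N'.+1 (fun us v => h (u :: us) v) _) _)) => //.
  by rewrite Ex_El.
by rewrite addSnnS.
Qed.
End UpperSweep.

Section LowerSweep.
Hypothesis local_ge : forall p N N' h, ok p -> (forall u v, 0 <= h u v) ->
  Ex (ql N) (fun u => Ex (cl N' p) (h u)) <=
  Ex (ql N.+1) (fun u => Ex (cl N'.+1 p) (fun v => Ex (ber p) (fun e =>
    h (f u v e).1 (f u v e).2))).

Lemma sweep_ge p M N N' (h : seq nat -> nat -> R) : ok p -> (forall us v, 0 <= h us v) ->
  El (nseq M (ql N)) (fun us => Ex (cl N' p) (h us)) <=
  El (nseq M (ql N.+1)) (fun us => Ex (cl (N' + M) p) (fun v => El (nseq M (ber p)) (fun es =>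
    h (sweep f v us es).1 (sweep f v us es).2))).
Proof.
move=> okp; elim: M N N' h => [|M IH] N N' h h0 /=; first by rewrite addn0.
pose k u v := El (nseq M (ql N.+1)) (fun us => El (nseq M (ber p)) (fun es =>
  h (u :: (sweep f v us es).1) (sweep f v us es).2)).
have -> : Ex (ql N.+1) (fun a => El (nseq M (ql N.+1)) (fun s =>
     Ex (cl (N' + M.+1) p) (fun v => Ex (ber p) (fun a0 => El (nseq M (ber p)) (fun s0 =>
     h ((f a v a0).1 :: (sweep f (f a v a0).2 s s0).1) (sweep f (f a v a0).2 s s0).2)))))
  = Ex (ql N.+1) (fun u => Ex (cl (N' + M.+1) p) (fun v => Ex (ber p) (fun e =>
     k (f u v e).1 (f u v e).2))).
  apply: eq_Ex => u; rewrite -Ex_El; apply: eq_Ex => v.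
  by rewrite -Ex_El.
rewrite addnS; apply: (le_trans _ (local_ge _ _ _ _)) => //; last first.
  move=> u v; apply: El_ge0; first exact: lpos_nseq.
  move=> us; apply: El_ge0; first by apply/lpos_nseq/lpos_ber/ok01.
  by [].
apply: le_Ex => // u.
apply: (le_trans (IH N N' (fun us v => h (u :: us) v) _)) => //.
by rewrite Ex_El.
Qed.
End LowerSweep.

(* Expected total flow out of the last queue, one batch of services per element of [ps]. *)
Fixpoint outflow (N : nat) (M : nat) (ps : seq R) (us : seq nat) : R :=
  if ps is p :: ps' then
    Ex (cl N p) (fun v => El (nseq M (ber p)) (fun es =>
      (sweep f v us es).2%:R + outflow N M ps' (sweep f v us es).1))
  else 0.

Definition all_ok (ps : seq R) := foldr (fun p P => ok p /\ P) True ps.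

Lemma outflow_ge0 N M ps us : all_ok ps -> 0 <= outflow N M ps us.
Proof.
elim: ps us => [|p ps IH] us //= [okp oks].
apply: Ex_ge0; first exact: cl_pos.
move=> v; apply: El_ge0; first by apply/lpos_nseq/lpos_ber/ok01.
by move=> es; rewrite addr_ge0// IH.
Qed.

Hypothesis cl_mass : forall N p, ok p -> mass (cl N p) <= 1.
Hypothesis ql_mass : forall N, mass (ql N) <= 1.

Lemma ql_massM N M : 0 <= mass (ql N) ^+ M <= 1.
Proof.
by rewrite exprn_ge0 ?exprn_ile1 ?Ex_ge0.
Qed.

Section Upper.
Hypothesis local_le : forall p N N' h, ok p -> (forall u v, 0 <= h u v) ->
  Ex (ql N) (fun u => Ex (cl N' p) (fun v => Ex (ber p) (fun e =>
    h (f u v e).1 (f u v e).2))) <=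
  Ex (ql N.+1) (fun u => Ex (cl N'.+1 p) (h u)).
Variables (mq : R) (mc : R -> R).
Hypothesis mq_ge : forall N, Ex (ql N) (fun u => u%:R) <= mq.
Hypothesis mc_ge : forall N p, ok p -> Ex (cl N p) (fun v => v%:R) <= mc p.

(** Stationarity in mean: after a sweep the new horizontal increments and the outgoing vertical one
    are controlled by the product law of the input, so every row adds at most the mean [mc p] of its
    vertical increment. *)
Lemma El_outflow_le N N' M ps : all_ok ps ->
  El (nseq M (ql N)) (outflow N' M ps) <= \sum_(p <- ps) mc p.
Proof.
elim: ps N => [|p ps IH] N /=; first by rewrite El_cst mulr0 big_nil.
move=> [okp oks]; rewrite big_cons.
apply: (le_trans (sweep_le local_le _ _ _ (h := fun us v => v%:R + outflow N' M ps us) _ _)) => //.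
  by move=> us v; rewrite addr_ge0 ?outflow_ge0.
apply: (@le_trans _ _ (El (nseq M (ql N.+1)) (fun us => mc p + outflow N' M ps us))).
  apply: le_El => [|us]; first exact: lpos_nseq.
  rewrite ExD lerD ?mc_ge// Ex_cst ler_piMl ?outflow_ge0 ?cl_mass//.
rewrite ElD lerD ?IH// El_cst prod_mass_nseq ler_piMl//; last by case/andP: (ql_massM N.+1 M).
by apply: le_trans (mc_ge 0 okp); rewrite Ex_ge0 ?cl_pos.
Qed.

Lemma El_sumn_le N M : El (nseq M (ql N)) (fun us => (sumn us)%:R) <= M%:R * mq.
Proof.
have mq0 : 0 <= mq by apply: le_trans (mq_ge 0); rewrite Ex_ge0.
elim: M => [|M IH] /=; first by rewrite mul0r.
under eq_Ex do under eq_El do rewrite natrD.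
under eq_Ex do rewrite ElD El_cst prod_mass_nseq.
rewrite ExD ExZ Ex_cst -natr1 mulrDl mul1r addrC lerD//.
  apply: le_trans IH; rewrite ler_piMl ?ql_mass ?El_ge0 ?lpos_nseq//.
apply: le_trans (mq_ge N).
by rewrite ler_piMl ?Ex_ge0//; case/andP: (ql_massM N M).
Qed.

Variables (step : (nat -> R) -> (nat -> R) -> nat -> R) (fin : (nat -> R) -> nat -> R).

(** The profile [g] lies below the stationary profile whose height on the left boundary is [b] and
    whose horizontal increments are [us]. *)
Definition dominated k (g : nat -> R) (b : R) (us : seq nat) :=
  forall i, (i <= k)%N -> g i <= b + (sumn (take i.+1 us))%:R.

Hypothesis step_dom : forall k g b us v es, size us = k.+1 -> size es = k.+1 -> 0 <= b ->
  dominated k g b us -> dominated k (step g (brow es)) (b + v%:R) (sweep f v us es).1.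
Hypothesis fin_dom : forall k g b us, size us = k.+1 -> dominated k g b us ->
  fin g k <= b + (sumn us)%:R.

(** The increments [v] do not occur in the passage time; integrating them out produces the product
    of masses. They keep a stationary profile, driven by the same bits, above the profile of the
    passage time. *)
Lemma EB_le_outflow k N ps g b us : all_ok ps -> size us = k.+1 -> 0 <= b ->
  dominated k g b us ->
  (\prod_(p <- ps) mass (cl N p)) *
    EB k.+1 ps (fun s => fin (foldl step g (map brow s)) k) <=
  b + (sumn us)%:R + outflow N k.+1 ps us.
Proof.
elim: ps g b us => [|p ps IH] g b us /=.
  by move=> _ su b0 d; rewrite big_nil mul1r addr0; apply: fin_dom.
move=> [okp oks] su b0 d; rewrite big_cons.
set Z := \prod_(j <- ps) _.
have -> : mass (cl N p) * Z * El (nseq k.+1 (ber p)) (fun e =>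
    EB k.+1 ps (fun s => fin (foldl step (step g (brow e)) [seq brow i | i <- s]) k)) =
  Ex (cl N p) (fun v => El (nseq k.+1 (ber p)) (fun e =>
    Z * EB k.+1 ps (fun s => fin (foldl step (step g (brow e)) [seq brow i | i <- s]) k))).
  by rewrite ElZ Ex_cst mulrA.
apply: (@le_trans _ _ (Ex (cl N p) (fun v => El (nseq k.+1 (ber p)) (fun e =>
   (b + (sumn us)%:R) + ((sweep f v us e).2%:R + outflow N k.+1 ps (sweep f v us e).1))))).
  apply: le_Ex => [|v]; first exact: cl_pos.
  apply: le_El_size => [|e]; first by apply/lpos_nseq/lpos_ber/ok01.
  rewrite size_nseq => se.
  have ss : size e = size us by rewrite se su.
  apply: (le_trans (IH _ (b + v%:R) (sweep f v us e).1 _ _ _ _)) => //.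
  - by rewrite size_sweep.
  - by rewrite addr_ge0.
  - exact: step_dom.
  - by have := sweep_flow v ss => /(congr1 (fun n => n%:R : R)); rewrite !natrD; lra.
under eq_Ex do rewrite ElD El_cst prod_mass_nseq mass_ber expr1n mul1r.
by rewrite ExD lerD2r Ex_cst ler_piMl ?cl_mass// addr_ge0.
Qed.

Lemma EB_burke_le k N N' ps : all_ok ps ->
  mass (ql N) ^+ k.+1 * ((\prod_(p <- ps) mass (cl N' p)) *
    EB k.+1 ps (fun s => fin (foldl step (fun=> 0) (map brow s)) k)) <=
  k.+1%:R * mq + \sum_(p <- ps) mc p.
Proof.
move=> oks; set Z := _ * EB _ _ _.
apply: (@le_trans _ _ (El (nseq k.+1 (ql N)) (fun us => (sumn us)%:R + outflow N' k.+1 ps us))).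
  rewrite -prod_mass_nseq -El_cst; apply: le_El_size => [|us]; first exact: lpos_nseq.
  rewrite size_nseq => su; have := @EB_le_outflow k N' ps (fun=> 0) 0 us oks su (lexx _).
  rewrite add0r; apply=> i ik; by rewrite add0r.
by rewrite ElD lerD ?El_sumn_le ?El_outflow_le.
Qed.

End Upper.
End Queues.
End Burke.

(** * Upper bounds for Bernoulli weights from stationary queues *)

Section BurkeBounds.
Variable R : realType.
Implicit Types (p r : R) (ps : seq R).

Lemma all_okP (ok : R -> Prop) ps : {in ps, forall p, ok p} -> all_ok ok ps.
Proof.
elim: ps => [|p ps IH] h //=; split; first by apply: h; rewrite mem_head.
by apply: IH => q qps; apply: h; rewrite inE qps orbT.
Qed.

Lemma queueS_flow u v e : (u + (queueS u v e).2 = (queueS u v e).1 + v)%N.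
Proof. by rewrite /queueS /=; case: e; lia. Qed.

Lemma queueT_flow u v e : (u + (queueT u v e).2 = (queueT u v e).1 + v)%N.
Proof. by rewrite /queueT /=; case: e; lia. Qed.

(** The stationary profile is nondecreasing in the column, hence stays above [rmax g], and the
    vertical increment leaving a site is at least its bit. *)
Lemma sstep_dominated k (g : nat -> R) b us v es : size us = k.+1 -> size es = k.+1 ->
  0 <= b -> dominated k g b us ->
  dominated k (sstep g (brow R es)) (b + v%:R) (sweep queueS v us es).1.
Proof.
move=> su se b0 d i ik; rewrite /sstep.
have gi : rmax g i <= b + (sumn (take i.+1 us))%:R.
  apply: rmax_le => c ci; apply: le_trans (d c (leq_trans ci ik)) _.
  rewrite lerD2l ler_nat -(cat_take_drop c.+1 (take i.+1 us)) take_takel// sumn_cat.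
  exact: leq_addr.
have ss : size es = size us by rewrite su se.
have q2 u w (e : bool) : (e <= (queueS u w e).2)%N by rewrite leq_maxr.
have iu : (i < size us)%N by rewrite su ltnS.
have := sweep_takeS queueS_flow v q2 ss iu.
rewrite -(ler_nat R) !natrD /brow; lra.
Qed.

Lemma tstep_dominated k (g : nat -> R) b us v es : size us = k.+1 -> size es = k.+1 ->
  0 <= b -> dominated k g b us ->
  dominated k (tstep g (brow R es)) (b + v%:R) (sweep queueT v us es).1.
Proof.
move=> su se b0 d.
have ss : size es = size us by rewrite su se.
have q1 u w (e : bool) : (e <= (queueT u w e).1)%N by rewrite leq_maxr.
have dd i : (i <= k)%N -> g i <= b + v%:R + (sumn (take i.+1 (sweep queueT v us es).1))%:R.
  move=> ik; apply: le_trans (d i ik) _.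
  have := sweep_take queueT_flow v i.+1 ss.
  rewrite -(ler_nat R) !natrD; lra.
elim=> [|i IH] ik.
  rewrite /= ge_max dd//=.
  have i0 : (0 < size us)%N by rewrite su.
  have := sweep_takeT v q1 ss i0.
  rewrite take0 /= add0n -(ler_nat R) /brow.
  have : (0 : R) <= v%:R by []. lra.
rewrite [tstep _ _ _]/= ge_max dd// andbT.
have iu : (i.+1 < size us)%N by rewrite su ltnS.
have := sweep_takeT v q1 ss iu.
rewrite -(ler_nat R) !natrD; have := IH (ltnW ik); rewrite /brow; lra.
Qed.

(** Removes the masses of the truncated laws, which tend to 1 with the truncation level. *)
Lemma le_of_cvg1 (m : nat -> R) (E B : R) : m @ \oo --> (1 : R) ->
  (forall N, m N * E <= B) -> E <= B.
Proof.
move=> m1 mE; rewrite -[E]mul1r.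
have c : (fun N => m N * E) @ \oo --> 1 * E by apply: cvgMl.
rewrite -(cvg_lim _ c)//; apply: limr_le; first by apply/cvg_ex; exists (1 * E).
by apply: nearW => N; exact: mE.
Qed.

Lemma cvg_mass_tgeo r : 0 <= r < 1 -> (fun N => mass (tgeo r N)) @ \oo --> (1 : R).
Proof.
move=> /andP[r0 r1]; have -> : (fun N => mass (tgeo r N)) = (fun N => 1 - r ^+ N.+1).
  by apply/funext => N; rewrite mass_tgeo.
rewrite -[X in _ --> X]subr0; apply: cvgB; first exact: cvg_cst.
have := @cvg_expr _ r; rewrite ger0_norm// => /(_ r1).
by rewrite -(cvg_shiftS (fun n => r ^+ n)).
Qed.

Lemma EB_slast_le k ps r : 0 < r < 1 -> {in ps, forall p, 0 <= p <= 1} ->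
  EB k.+1 ps (fun s => slast (map (brow R) s) k) <=
  k.+1%:R * (r / (1 - r)) + \sum_(p <- ps) p / (p + r * (1 - p)).
Proof.
move=> /andP[r0 r1] ps01.
pose ok p := 0 <= p <= 1.
(* The balance equation solved for [u]: the horizontal increments keep one geometric law in all
   rows, and only the vertical law follows the row parameter. *)
pose uu p := p / (p + r * (1 - p)).
have den p : ok p -> 0 < p + r * (1 - p) by rewrite /ok => /andP[]; nra.
have uu01 p : ok p -> 0 <= uu p <= 1.
  move=> okp; have d := den p okp; have /andP[p0 p1] := okp.
  rewrite divr_ge0//= ?(ltW d)// ler_pdivrMr// mul1r lerDl.
  by rewrite mulr_ge0 ?subr_ge0// ltW.
have rel p : ok p -> r * uu p * (1 - p) = p * (1 - uu p).
  by move=> okp; have d := den p okp; rewrite /uu; field; rewrite gt_eqF.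
have r01 : 0 <= r <= 1 by rewrite !ltW.
apply: (@le_of_cvg1 (fun N => mass (tgeo r N) ^+ k.+1)).
  have c := cvg_mass_tgeo (r := r); rewrite ltW//= r1 in c.
  rewrite -[X in _ --> X](expr1n R k.+1).
  elim: k.+1 => [|m IH]; first by rewrite expr0; exact: cvg_cst.
  rewrite exprS (_ : (fun N => _) = fun N => mass (tgeo r N) * mass (tgeo r N) ^+ m).
    by apply: cvgM; [exact: c|exact: IH].
  by apply/funext => N; rewrite exprS.
move=> N; have := @EB_burke_le R queueS queueS_flow (tgeo r) (fun _ p => nber (uu p)) ok
  _ _ _ _ _ _ (r / (1 - r)) uu _ _ (@sstep R) (@rmax R) _ _ k N 0%N ps _.
rewrite big1 ?mul1r; last by move=> p _; rewrite mass_nber.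
apply => //.
- by move=> N'; apply: lpos_tgeo.
- by move=> _ p okp; apply: lpos_nber; apply: uu01.
- by move=> _ p _; rewrite mass_nber.
- by move=> N'; apply: le_mass_tgeo.
- move=> p N1 _ h okp h0; apply: burke_local_le => //; [exact: rel|exact: uu01].
- by move=> N'; apply: mean_tgeo_le; rewrite ltW.
- by move=> _ p _; rewrite Ex_nber mulr1 mulr0 addr0.
- by move=> k' g b us v es; exact: sstep_dominated.
- move=> k' g b us su d; apply: rmax_le => c ck; apply: le_trans (d c ck) _.
  by rewrite lerD2l ler_nat -{2}(cat_take_drop c.+1 us) sumn_cat leq_addr.
- exact: all_okP.
Qed.

(** Now the horizontal increments are Bernoulli with one parameter [u] and the vertical ones
    geometric. Their ratio is below 1 only when the row parameter is below [u]; this is where the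
    essential suprema of the assumptions come from. *)
Lemma EB_tlast_le k ps (u : R) : 0 < u <= 1 -> {in ps, forall p, 0 <= p < u} ->
  EB k.+1 ps (fun s => tlast (map (brow R) s) k) <=
  k.+1%:R * u + \sum_(p <- ps) p * (1 - u) / (u - p).
Proof.
move=> /andP[u0 u1] ps0u.
pose ok p := 0 <= p < u.
(* The balance equation solved for the geometric ratio. *)
pose rr p := p * (1 - u) / (u * (1 - p)).
have den p : ok p -> 0 < u * (1 - p).
  by move=> /andP[p0' pu]; rewrite mulr_gt0// subr_gt0; apply: lt_le_trans u1.
have rr01 p : ok p -> 0 <= rr p < 1.
  move=> okp; have d := den p okp; have /andP[p0' pu] := okp.
  rewrite divr_ge0//= ?(ltW d) ?mulr_ge0 ?subr_ge0// ltr_pdivrMr// mul1r.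
  by rewrite mulrBr mulrBr mulr1 mulr1 [u * p]mulrC ltrD2r.
have rel p : ok p -> rr p * u * (1 - p) = p * (1 - u).
  move=> okp; have := den p okp; rewrite pmulr_rgt0// => d; rewrite /rr.
  by field; rewrite !gt_eqF.
have mean p : ok p -> rr p / (1 - rr p) = p * (1 - u) / (u - p).
  move=> okp; have := den p okp; rewrite pmulr_rgt0// => d; have /andP[p0' pu] := okp.
  have up : u - p != 0 by rewrite subr_eq0 gt_eqF.
  by rewrite /rr; field; rewrite up (gt_eqF u0) (gt_eqF d).
apply: (@le_of_cvg1 (fun N => \prod_(p <- ps) mass (tgeo (rr p) N))).
  have : {in ps, forall p, ok p} by [].
  elim: ps {ps0u} => [|p qs IH] oks.
    by rewrite (_ : (fun _ => _) = fun=> 1); [exact: cvg_cst|apply/funext => N; rewrite big_nil].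
  rewrite (_ : (fun N => _) = (fun N => mass (tgeo (rr p) N) *
      \prod_(q <- qs) mass (tgeo (rr q) N))); last first.
    by apply/funext => N; rewrite big_cons.
  rewrite -[X in _ --> X]mulr1; apply: cvgM.
    by apply: cvg_mass_tgeo; apply: rr01; apply: oks; rewrite mem_head.
  by apply: IH => q qqs; apply: oks; rewrite inE qqs orbT.
have u01 : 0 <= u <= 1 by rewrite ltW.
move=> N; have := @EB_burke_le R queueT queueT_flow (fun=> nber u) (fun N p => tgeo (rr p) N) ok
  _ _ _ _ _ _ u (fun p => p * (1 - u) / (u - p)) _ _ (@tstep R) (fun g k => g k) _ _ k 0%N N ps _.
rewrite mass_nber expr1n mul1r; apply => //.
- by move=> p /andP[-> /ltW pu]; rewrite (le_trans pu).
- by move=> _; apply: lpos_nber.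
- by move=> N' p /rr01/andP[? /ltW ?]; apply: lpos_tgeo; apply/andP.
- by move=> N' p /rr01/andP[? /ltW ?]; apply: le_mass_tgeo; apply/andP.
- move=> p N1 N2 h okp h0; rewrite Ex_comm [X in _ <= X]Ex_comm.
  have /andP[rr0 rr1] := rr01 _ okp; have /andP[p0' pu] := okp.
  apply: (le_trans _ (@burke_local_le _ p (rr p) u N2 (fun m v => h v m) _ _ _ _ _)) => //.
  + exact: rel.
  + by rewrite p0'/= (le_trans (ltW pu)).
  + by rewrite rr0 ltW.
- by move=> _; rewrite Ex_nber mulr1 mulr0 addr0.
- by move=> N' p okp; rewrite -mean//; apply: mean_tgeo_le; exact: rr01.
- by move=> k' g b us v es; exact: tstep_dominated.
- move=> k' g b us su d; apply: le_trans (d k' (leqnn _)) _.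
  by rewrite -su take_size.
- exact: all_okP.
Qed.

End BurkeBounds.

(** * Lower bound for the homogeneous Bernoulli model *)

Section ProductLaws.
Variable R : realType.

Fixpoint Lseq (A : Type) (ls : seq (law R A)) : law R (seq A) :=
  if ls is l :: ls' then [seq (x.1 :: y.1, x.2 * y.2) | x <- l, y <- Lseq ls']
  else [:: ([::], 1)].

Definition Lprod (A B : Type) (l : law R A) (l' : law R B) : law R (A * B) :=
  [seq ((x.1, y.1), x.2 * y.2) | x <- l, y <- l'].

Lemma Ex_Lseq (A : Type) (ls : seq (law R A)) h : Ex (Lseq ls) h = El ls h.
Proof.
elim: ls h => [|l ls IH] h /=; first by rewrite /Ex big_seq1 mul1r.
rewrite /Ex big_allpairs_dep; apply: eq_bigr => x _.
by rewrite -IH mulr_sumr; apply: eq_bigr => y _ /=; rewrite mulrA.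
Qed.

Lemma Ex_Lprod (A B : Type) (l : law R A) (l' : law R B) h :
  Ex (Lprod l l') h = Ex l (fun a => Ex l' (fun b => h (a, b))).
Proof.
rewrite /Ex big_allpairs_dep; apply: eq_bigr => x _.
by rewrite mulr_sumr; apply: eq_bigr => y _ /=; rewrite mulrA.
Qed.

Definition lsupp (A : Type) (P : pred A) (l : law R A) := all (fun x => P x.1) l.

Lemma lpos_Lseq (A : Type) (ls : seq (law R A)) : all (@lpos R A) ls -> lpos (Lseq ls).
Proof.
elim: ls => [|l ls IH] /=; first by rewrite /lpos /= ler01.
case/andP => + /IH; rewrite /lpos; elim: l => [|x l IHl] //= /andP[x0 l0] s0.
rewrite all_cat IHl// andbT all_map; apply: sub_all s0 => y /= y0.
exact: mulr_ge0.
Qed.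

Lemma lpos_Lprod (A B : Type) (l : law R A) (l' : law R B) :
  lpos l -> lpos l' -> lpos (Lprod l l').
Proof.
rewrite /lpos; elim: l => [|x l IHl] //= /andP[x0 l0] s0.
rewrite all_cat IHl// andbT all_map; apply: sub_all s0 => y /= y0.
exact: mulr_ge0.
Qed.

Lemma mass_Lseq (A : Type) (ls : seq (law R A)) : mass (Lseq ls) = \prod_(l <- ls) mass l.
Proof. by rewrite /mass Ex_Lseq El_cst mulr1. Qed.

Lemma mass_Lprod (A B : Type) (l : law R A) (l' : law R B) :
  mass (Lprod l l') = mass l * mass l'.
Proof. by rewrite /mass Ex_Lprod Ex_cst. Qed.

Lemma lsupp_Lseq (A : Type) n (l : law R A) : lsupp (fun s => size s == n) (Lseq (nseq n l)).
Proof.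
rewrite /lsupp; elim: n => [|n IH] //=.
move: (Lseq _) IH => L' IH; elim: l => [|x l IHl] //=; rewrite all_cat IHl andbT all_map.
by apply: sub_all IH => y.
Qed.

Lemma lsupp_Lprod (A B : Type) (l : law R A) (l' : law R B) (P : pred B) :
  lsupp P l' -> lsupp (fun x => P x.2) (Lprod l l').
Proof.
rewrite /lsupp; elim: l => [|x l IHl] //= s0.
rewrite all_cat IHl// andbT all_map; exact: sub_all s0.
Qed.

Lemma le_Ex_supp (A : Type) (P : pred A) (l : law R A) h h' : lpos l -> lsupp P l ->
  (forall a, P a -> h a <= h' a) -> Ex l h <= Ex l h'.
Proof.
rewrite /Ex /lpos /lsupp => + + hh'; elim: l => [|x l' IH] /=; first by rewrite !big_nil.
case/andP => x0 l0 /andP[Px Pl]; rewrite !big_cons; apply: lerD; last exact: IH.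
by rewrite ler_wpM2l// hh'.
Qed.

Lemma le_El_supp (A : Type) (P : pred A) n (l : law R A) h h' : lpos l -> lsupp P l ->
  (forall s, size s = n -> all P s -> h s <= h' s) -> El (nseq n l) h <= El (nseq n l) h'.
Proof.
move=> l0 lP; elim: n h h' => [|n IH] h h' hh' /=; first exact: hh'.
apply: (le_Ex_supp l0 lP) => a Pa; apply: IH => s ss Ps; apply: hh'; rewrite /= ?ss ?Pa//.
Qed.

Lemma EB_El M ps h :
  EB M ps h = El [seq Lseq (nseq M (ber p)) | p : R <- ps] h.
Proof.
elim: ps h => [|p ps IH] h //=; rewrite Ex_Lseq; apply: eq_El => e; exact: IH.
Qed.

Lemma El_take_le (A : Type) n a (l : law R A) h : lpos l -> mass l <= 1 ->
  (forall s, 0 <= h s) -> (a <= n)%N ->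
  El (nseq n l) (fun s => h (take a s)) <= El (nseq a l) h.
Proof.
move=> l0 l1; elim: a n h => [|a IH] n h h0.
  move=> _; rewrite (@eq_El _ _ _ _ (fun=> h [::])); last by move=> s; rewrite take0.
  rewrite El_cst prod_mass_nseq ler_piMl//= exprn_ile1//.
  by rewrite Ex_ge0.
case: n => //= n an; apply: le_Ex => // x.
exact: (IH n (fun s => h (x :: s))).
Qed.

Lemma El_map (A B : Type) n (l : law R A) (l' : law R B) (f : A -> B) h :
  (forall k, Ex l (fun a => k (f a)) = Ex l' k) ->
  El (nseq n l) (fun s => h (map f s)) = El (nseq n l') h.
Proof.
move=> ll'; elim: n h => [|n IH] h //=.
rewrite -(ll' (fun a => El (nseq n l') (fun s => h (a :: s)))); apply: eq_Ex => a.
exact: (IH (fun s => h (f a :: s))).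
Qed.

(* Peeling off one coordinate costs at most the square of its influence. *)
Lemma El_var (A : Type) n (l : law R A) h : lpos l -> mass l = 1 ->
  (forall s1 a a' s2, `|h (s1 ++ a :: s2) - h (s1 ++ a' :: s2)| <= 1) ->
  El (nseq n l) (fun s => (h s - El (nseq n l) h) ^+ 2) <= n%:R.
Proof.
move=> l0 l1; have El1 m c : El (nseq m l) (fun=> c) = c.
  by rewrite El_cst prod_mass_nseq l1 expr1n mul1r.
elim: n h => [|n IH] h hd; first by rewrite /= subrr expr0n.
set E := El _ h.
pose m a := El (nseq n l) (fun s => h (a :: s)).
have mm a a' : `|m a - m a'| <= 1.
  rewrite -ElB; apply: le_trans (El_norm _ (lpos_nseq _ l0)) _.
  by rewrite -[leRHS](El1 n); apply: le_El => [|s]; [exact: lpos_nseq|exact: (hd [::])].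
have EE : E = Ex l m by [].
have mE a : `|m a - E| <= 1.
  rewrite EE -[m a]mul1r -l1 -Ex_cst -ExB; apply: le_trans (Ex_norm _ l0) _.
  exact: le_Ex.
rewrite /= -[n.+1%:R]mul1r -[X in X * _]l1 -Ex_cst; apply: le_Ex => // a.
have -> : El (nseq n l) (fun s => (h (a :: s) - E) ^+ 2) =
    El (nseq n l) (fun s => (h (a :: s) - m a) ^+ 2) + (m a - E) ^+ 2.
  transitivity (El (nseq n l) (fun s => (h (a :: s) - m a) ^+ 2 +
     ((2 * (m a - E)) * (h (a :: s) - m a) + (m a - E) ^+ 2))).
    by apply: eq_El => s; ring.
  by rewrite ElD; congr (_ + _); rewrite ElD ElZ ElB !El1 subrr mulr0 add0r.
rewrite -natr1 lerD//.
  by apply: IH => s1 b b' s2; exact: (hd (a :: s1)).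
by rewrite -real_normK ?num_real// expr_le1.
Qed.

Lemma El_sumn (l : law R nat) n :
  El (nseq n.+1 l) (fun s => (sumn s)%:R) = n.+1%:R * Ex l (fun m => m%:R) * mass l ^+ n.
Proof.
elim: n => [|n IH].
  by rewrite /= expr0 mulr1 mul1r; apply: eq_Ex => a; rewrite addn0.
change (Ex l (fun a => El (nseq n.+1 l) (fun s => (a + sumn s)%:R)) =
  n.+2%:R * Ex l (fun m => m%:R) * mass l ^+ n.+1).
transitivity (Ex l (fun a => mass l ^+ n.+1 * a%:R +
    El (nseq n.+1 l) (fun s => (sumn s)%:R))).
  apply: eq_Ex => a.
  transitivity (El (nseq n.+1 l) (fun s => a%:R + (sumn s)%:R)).
    by apply: eq_El => s; rewrite natrD.
  by rewrite ElD El_cst prod_mass_nseq.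
rewrite ExD ExZ Ex_cst IH -[n.+2%:R]natr1 !exprS; ring.
Qed.

(** The law may have mass below 1, so centring by [rho] leaves a bias [b] per coordinate. For
    truncated geometric laws it vanishes with the truncation. *)
Lemma El_sumn_mean (l : law R nat) n (rho b : R) : lpos l -> mass l <= 1 ->
  `|Ex l (fun m => m%:R - rho)| <= b ->
  `|El (nseq n l) (fun s => (sumn s)%:R - n%:R * rho)| <= n%:R * b.
Proof.
move=> l0 l1 hb; have m0 : 0 <= mass l by rewrite Ex_ge0.
elim: n => [|n IH] /=; first by rewrite !mul0r subrr normr0.
have -> : Ex l (fun a => El (nseq n l) (fun s => (a + sumn s)%:R - n.+1%:R * rho)) =
  mass l ^+ n * Ex l (fun m => m%:R - rho) +
  mass l * El (nseq n l) (fun s => (sumn s)%:R - n%:R * rho).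
  rewrite -ExZ -Ex_cst -ExD; apply: eq_Ex => a.
  rewrite -prod_mass_nseq -El_cst -ElD; apply: eq_El => s.
  by rewrite natrD -natr1; ring.
rewrite -natr1 mulrDl mul1r addrC; apply: le_trans (ler_normD _ _) _.
apply: lerD; rewrite normrM ger0_norm ?exprn_ge0//.
  by apply: le_trans IH; rewrite ler_piMl.
by apply: le_trans hb; rewrite ler_piMl// exprn_ile1.
Qed.

Lemma El_sumn_var (l : law R nat) n (rho b v0 : R) : lpos l -> mass l <= 1 ->
  `|Ex l (fun m => m%:R - rho)| <= b -> Ex l (fun m => (m%:R - rho) ^+ 2) <= v0 ->
  El (nseq n l) (fun s => ((sumn s)%:R - n%:R * rho) ^+ 2) <= n%:R * v0 + n%:R ^+ 2 * b ^+ 2.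
Proof.
move=> l0 l1 hb hv; have m0 : 0 <= mass l by rewrite Ex_ge0.
have v00 : 0 <= v0 by apply: le_trans hv; rewrite Ex_ge0// => a; rewrite sqr_ge0.
have b0 : 0 <= b by apply: le_trans hb.
elim: n => [|n IH] /=; first by rewrite !mul0r subrr expr0n /= mul0r addr0.
have -> : Ex l (fun a => El (nseq n l) (fun s => ((a + sumn s)%:R - n.+1%:R * rho) ^+ 2)) =
  mass l ^+ n * Ex l (fun m => (m%:R - rho) ^+ 2) +
  (2 * Ex l (fun m => m%:R - rho) * El (nseq n l) (fun s => (sumn s)%:R - n%:R * rho) +
  mass l * El (nseq n l) (fun s => ((sumn s)%:R - n%:R * rho) ^+ 2)).
  rewrite -ExZ -Ex_cst [2 * _ * _]mulrAC -ExZ -!ExD; apply: eq_Ex => a.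
  rewrite -prod_mass_nseq -El_cst [2 * _ * _]mulrAC -ElZ -!ElD; apply: eq_El => s.
  by rewrite natrD -natr1; ring.
have h1 : mass l ^+ n * Ex l (fun m => (m%:R - rho) ^+ 2) <= v0.
  apply: le_trans hv; rewrite ler_piMl ?exprn_ile1// Ex_ge0// => a.
  by rewrite sqr_ge0.
have h2 : Ex l (fun m => m%:R - rho) * El (nseq n l) (fun s => (sumn s)%:R - n%:R * rho)
    <= b * (n%:R * b).
  apply: le_trans (ler_norm _) _; rewrite normrM ler_pM//.
  exact: El_sumn_mean.
have h3 : mass l * El (nseq n l) (fun s => ((sumn s)%:R - n%:R * rho) ^+ 2) <=
    n%:R * v0 + n%:R ^+ 2 * b ^+ 2.
  apply: le_trans IH; rewrite ler_piMl// El_ge0 ?lpos_nseq// => s.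
  by rewrite sqr_ge0.
rewrite -[n.+1%:R]natr1; move: h1 h2 h3; rewrite -mulrA.
have : 0 <= b ^+ 2 by rewrite sqr_ge0.
move: (mass l * _) (_ ^+ n * _) (_ * El _ _) => x1 x2 x3; nra.
Qed.

Lemma norm_le_sqr (y t : R) : 0 < t -> `|y| <= (y ^+ 2 / t + t) / 2.
Proof.
move=> t0; have : 0 <= (`|y| - t) ^+ 2 by rewrite sqr_ge0.
rewrite sqrrB real_normK ?num_real// => h.
rewrite ler_pdivlMr// -(ler_pM2r t0) mulrDl divfK ?gt_eqF//.
by move: h; rewrite expr2 -mulr_natr; lra.
Qed.

(** Cauchy-Schwarz in linearised form, without square roots of expectations. The parameter [t] is
    later the square root of the number of rows. *)
Lemma El_norm_le_var (A : Type) (ls : seq (law R A)) h (V t : R) : all (@lpos R A) ls ->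
  \prod_(l <- ls) mass l <= 1 -> 0 < t -> El ls (fun s => h s ^+ 2) <= V ->
  El ls (fun s => `|h s|) <= (V / t + t) / 2.
Proof.
move=> ls0 ls1 t0 hV.
apply: (@le_trans _ _ (El ls (fun s => (t^-1 / 2) * h s ^+ 2 + t / 2))).
  apply: le_El => // s; apply: le_trans (norm_le_sqr _ t0) _.
  by rewrite mulrDl lerD2r [_ / t]mulrC mulrAC.
rewrite ElD El_cst [leRHS]mulrDl; apply: lerD.
  rewrite ElZ [V / t]mulrC [leRHS]mulrAC; apply: ler_wpM2l => //.
  by rewrite divr_ge0// ltW// invr_gt0.
by rewrite ler_piMl// divr_ge0// ltW.
Qed.

Lemma sqr_mean_tgeo (r : R) N : r < 1 ->
  Ex (tgeo r N) (fun m => m%:R ^+ 2) =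
  r * (1 + r) / (1 - r) ^+ 2 -
  r ^+ N.+1 * (r * (1 + r) / (1 - r) ^+ 2 + 2 * N.+1%:R * (r / (1 - r)) + N.+1%:R ^+ 2).
Proof.
move=> r1; have r1' : 1 - r != 0 by rewrite subr_eq0 eq_sym lt_eqF.
elim: N => [|N IH]; first by rewrite Ex_tgeo0; field.
by rewrite Ex_tgeoS IH -[N.+2%:R]natr1 [r ^+ N.+2]exprS; field.
Qed.

Lemma var_tgeo_le (r : R) N : 0 <= r < 1 ->
  Ex (tgeo r N) (fun m => (m%:R - r / (1 - r)) ^+ 2) <=
  r * (1 + r) / (1 - r) ^+ 2 + (r / (1 - r)) ^+ 2.
Proof.
move=> /andP[r0 r1]; have rho0 : 0 <= r / (1 - r) by rewrite divr_ge0// subr_ge0 ltW.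
have c0 : 0 <= r * (1 + r) / (1 - r) ^+ 2.
  by rewrite divr_ge0 ?sqr_ge0// mulr_ge0// addr_ge0.
apply: (@le_trans _ _ (Ex (tgeo r N) (fun m => m%:R ^+ 2 + (r / (1 - r)) ^+ 2))).
  apply: le_Ex => [|m]; first by apply: lpos_tgeo; rewrite r0 ltW.
  have : 0 <= m%:R * (r / (1 - r)) by rewrite mulr_ge0.
  by rewrite sqrrB -mulr_natr; lra.
rewrite ExD; apply: lerD.
  rewrite sqr_mean_tgeo// gerBl mulr_ge0 ?exprn_ge0// !addr_ge0// ?sqr_ge0//.
  by rewrite mulr_ge0.
by rewrite Ex_cst ler_piMl ?sqr_ge0// le_mass_tgeo// r0 ltW.
Qed.

Lemma bias_tgeo (r : R) N : r < 1 ->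
  Ex (tgeo r N) (fun m => m%:R - r / (1 - r)) = - (r ^+ N.+1 * N.+1%:R).
Proof. by move=> r1; rewrite ExB Ex_cst mean_tgeo// mass_tgeo; ring. Qed.

Lemma cvg_bias_tgeo (r : R) : 0 <= r < 1 -> (fun N => r ^+ N.+1 * N.+1%:R) @ \oo --> (0 : R).
Proof.
(* Half of the decay is spent on the factor [N.+1%:R]: nonnegativity of the truncated mean at ratio
   [s] bounds [s ^+ N.+1 * N.+1%:R] by [s / (1 - s)]. *)
move=> /andP[r0 r1]; pose s := Num.sqrt r.
have s0 : 0 <= s by rewrite sqrtr_ge0.
have s1 : s < 1 by rewrite -(sqrtr1 R) ltr_sqrt.
have ss : r = s * s by rewrite -expr2 sqr_sqrtr.
have c : (fun N => s ^+ N.+1 * (s / (1 - s))) @ \oo --> (0 : R).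
  rewrite -[X in _ --> X](mul0r (s / (1 - s))); apply: cvgMl.
  have := @cvg_expr _ s; rewrite ger0_norm// => /(_ s1).
  by rewrite -(cvg_shiftS (fun n => s ^+ n)).
apply: (squeeze_cvgr _ (cvg_cst 0) c).
apply: nearW => N; rewrite mulr_ge0 ?exprn_ge0//= ss exprMn -mulrA ler_wpM2l ?exprn_ge0//.
have h : 0 <= Ex (tgeo s N) (fun m => m%:R).
  by rewrite Ex_ge0// lpos_tgeo// s0 ltW.
move: h; rewrite mean_tgeo// mulrDr.
have : 0 <= s ^+ N.+1 * (s / (1 - s)).
  by rewrite mulr_ge0 ?exprn_ge0// divr_ge0// subr_ge0 ltW.
lra.
Qed.

End ProductLaws.

(** * Exit points of the stationary process from its boundary *)

Section ExitPoints.
Variable R : realType.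
Implicit Types (rows : seq (nat * seq bool)) (us : seq nat).

(** The tool for discarding columns: the system on the right sees weights at least as large [d]
    columns further. *)
Lemma foldl_sstep_le (g g' : nat -> R) vs vs' K d :
  (forall i, (i <= K)%N -> g i <= rmax g' (i + d)%N) -> size vs = size vs' ->
  (forall j i, (j < size vs)%N -> (i <= K)%N ->
     nth (fun=> 0) vs j i <= nth (fun=> 0) vs' j (i + d)%N) ->
  rmax (foldl (@sstep R) g vs) K <= rmax (foldl (@sstep R) g' vs') (K + d)%N.
Proof.
elim: vs vs' g g' => [|v vs IH] [|v' vs'] g g' //= hg.
  move=> _ _; apply: rmax_le => c cK; apply: le_trans (hg c cK) _.
  by apply: rmax_mono; rewrite leq_add2r.
move=> [ss] hv; apply: IH => // [i iK|j i js iK]; last exact: (hv j.+1).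
apply: le_trans (rmax_ge _ (leqnn _)); rewrite /sstep lerD ?(hv 0%N)//.
apply: rmax_le => c ci; apply: le_trans (hg c (leq_trans ci iK)) _.
by apply: rmax_mono; rewrite leq_add2r.
Qed.

Lemma rmax_shift (g : nat -> R) c k : rmax (fun i => g i + c) k = rmax g k + c.
Proof. by elim: k => //= k ->; rewrite addr_maxl. Qed.

Lemma foldl_sstep_shift (g : nat -> R) vs c i :
  foldl (@sstep R) (fun i => g i + c) vs i = foldl (@sstep R) g vs i + c.
Proof.
elim: vs g => [|v vs IH] g //=; rewrite -IH; congr (foldl _ _ _ _).
by apply/funext => m; rewrite /sstep addrAC rmax_shift.
Qed.

Lemma slast_shift vs c k :
  rmax (foldl (@sstep R) (fun=> c) vs) k = slast vs k + c.
Proof.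
have -> : foldl (@sstep R) (fun=> c) vs = fun i => foldl (@sstep R) (fun=> 0) vs i + c.
  apply/funext => i; rewrite -foldl_sstep_shift; congr (foldl _ _ _ _).
  by apply/funext => m; rewrite add0r.
by rewrite rmax_shift.
Qed.

Definition bslast (es : seq (seq bool)) (k : nat) : R := slast (map (brow R) es) k.

Lemma brow_ge0 e i : 0 <= brow R e i. Proof. by rewrite /brow ler0n. Qed.
Lemma brow_le1 e i : brow R e i <= 1. Proof. by rewrite /brow lern1 leq_b1. Qed.
Hint Resolve brow_ge0 brow_le1 : core.

Lemma bslast_cons_ge es e k : bslast es k <= bslast (e :: es) k.
Proof.
have H : bslast es k <= rmax (foldl (@sstep R) (sstep (fun=> 0) (brow R e))
    (map (brow R) es)) (k + 0)%N.
  apply: foldl_sstep_le => // [i ik|j i _ _]; rewrite ?addn0//.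
  apply: le_trans (rmax_ge _ (leqnn i)); rewrite /sstep addr_ge0//.
  exact: le_trans (rmax_ge _ (leqnn i)).
by move: H; rewrite addn0.
Qed.

Lemma bslast_drop_ge es b k : bslast (drop b es) k <= bslast es k.
Proof.
elim: b es => [|b IH] [|e es] //=.
exact: le_trans (IH _) (bslast_cons_ge _ _ _).
Qed.

Lemma nth_map_brow_drop a (es : seq (seq bool)) j i :
  (j < size es)%N -> nth (fun=> 0) (map (brow R) (map (drop a) es)) j i =
  brow R (nth [::] es j) (i + a)%N.
Proof.
move=> js; rewrite -map_comp (nth_map [::])//= /brow nth_drop addnC //.
Qed.

Lemma bslast_col_drop es k a a' : (a' <= a)%N -> (a <= k)%N ->
  bslast (map (drop a) es) (k - a) <= bslast (map (drop a') es) (k - a').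
Proof.
move=> aa ak; have -> : (k - a' = (k - a) + (a - a'))%N by lia.
apply: foldl_sstep_le.
- by move=> i _; apply: le_trans (rmax_ge _ (leqnn _)).
- by rewrite !size_map.
- move=> j i; rewrite !size_map => js _; rewrite !nth_map_brow_drop//.
  by have -> : (i + (a - a') + a' = i + a)%N by lia.
Qed.

(** A path may collect the bit at column [a'] of the first row and then continue from column [a]. *)
Lemma bslast_cons_col es e k a a' : (a' <= a)%N -> (a <= k)%N ->
  bslast (map (drop a) es) (k - a) + brow R e a' <=
  bslast (map (drop a') (e :: es)) (k - a').
Proof.
move=> aa ak; rewrite -slast_shift.
have -> : (k - a' = (k - a) + (a - a'))%N by lia.
change (rmax (foldl (@sstep R) (fun=> brow R e a') (map (brow R) (map (drop a) es))) (k - a) <=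
  rmax (foldl (@sstep R) (sstep (fun=> 0) (brow R (drop a' e)))
    (map (brow R) (map (drop a') es))) (k - a + (a - a'))%N).
apply: foldl_sstep_le.
- move=> i _; apply: le_trans (rmax_ge _ (leq0n _)).
  by rewrite /sstep /= add0r /brow nth_drop addn0.
- by rewrite !size_map.
- move=> j i; rewrite !size_map => js _; rewrite !nth_map_brow_drop//.
  by have -> : (i + (a - a') + a' = i + a)%N by lia.
Qed.

(** Each row brings its increment on the left boundary and its bits, so [sumn us + flow us rows] is
    the stationary passage time at the far corner. *)
Fixpoint flow us rows : nat :=
  if rows is (v, es) :: rows' then
    ((sweep queueS v us es).2 + flow (sweep queueS v us es).1 rows')%N
  else 0.

(** The height of the new profile at column [a] is either still that of the left boundary, or it was
    reached at some earlier column [a'] by collecting the bit there. *)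
Lemma sweep_exit v us es a : size es = size us -> (a < size us)%N ->
  (v + sumn (take a.+1 (sweep queueS v us es).1) <= v)%N \/
  exists2 a', (a' <= a)%N &
   (v + sumn (take a.+1 (sweep queueS v us es).1) <= sumn (take a'.+1 us) + nth false es a')%N.
Proof.
elim: us v es a => [|u us IH] v [|e es] // a [ss] au.
have key : (v + (queueS u v e).1 <= v)%N \/ (v + (queueS u v e).1 <= u + e)%N.
  by rewrite /queueS /=; case: e; lia.
have fl := queueS_flow u v e.
case: a au => [|a] au.
  rewrite /= !take0 /= addn0; case: key => h; [by left|right].
  by exists 0%N => //=; rewrite take0 /= addn0.
have E : sumn (take a.+2 (sweep queueS v (u :: us) (e :: es)).1) =
  ((queueS u v e).1 + sumn (take a.+1 (sweep queueS (queueS u v e).2 us es).1))%N by [].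
rewrite E; have [h|[a' aa h]] := IH (queueS u v e).2 es a ss au.
  case: key => k; [left; lia|right].
  have E1 : sumn (take 1 (u :: us)) = u by rewrite /= take0 /= addn0.
  by exists 0%N => //; rewrite E1 [nth _ _ _]/=; lia.
right; exists a'.+1 => //; rewrite [nth _ _ _]/=.
have -> : sumn (take a'.+2 (u :: us)) = (u + sumn (take a'.+1 us))%N by [].
lia.
Qed.

(* Every optimal path for the stationary process leaves the boundary either along the bottom
   (first alternative) or along the left side (second one). *)
Lemma flow_exit us rows k : size us = k.+1 -> all (fun x => size x.2 == k.+1) rows ->
  (exists2 a, (a <= k)%N & (sumn us + flow us rows)%:R <=
     (sumn (take a.+1 us))%:R + bslast (map (drop a) (map snd rows)) (k - a)) \/
  (exists2 b, (b <= size rows)%N & (sumn us + flow us rows)%:R <=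
     (sumn (take b (map fst rows)))%:R + bslast (drop b (map snd rows)) k).
Proof.
elim: rows us => [|[v es] rows IH] us su /=.
  move=> _; left; exists k => //; rewrite addn0 -su take_size /bslast /slast /=.
  by rewrite lerDl; apply: le_trans (rmax_ge _ (leqnn _)).
case/andP => /eqP se srows.
have ss : size es = size us by rewrite su se.
have su' : size (sweep queueS v us es).1 = k.+1 by rewrite size_sweep.
have fl := sweep_flow queueS_flow v ss.
have -> : (sumn us + ((sweep queueS v us es).2 + flow (sweep queueS v us es).1 rows) =
   v + (sumn (sweep queueS v us es).1 + flow (sweep queueS v us es).1 rows))%N by lia.
rewrite natrD.
have [[a ak h]|[b bs h]] := IH _ su' srows; last first.
  right; exists b.+1 => //=; rewrite natrD; lra.
have au : (a < size us)%N by rewrite su ltnS.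
have [h'|[a' aa h']] := @sweep_exit v us es a ss au.
  right; exists 1%N => //=; rewrite take0 drop0 /= addn0.
  have := @bslast_col_drop (map snd rows) k a 0 (leq0n _) ak.
  rewrite subn0 (@eq_map _ _ (drop 0) id) ?map_id; last by move=> x; rewrite drop0.
  move: h'; rewrite -(ler_nat R) natrD; lra.
left; exists a'; first exact: leq_trans ak.
have := @bslast_cons_col (map snd rows) es k a a' aa ak.
move: h'; rewrite -(ler_nat R) !natrD /brow /=; lra.
Qed.

(** The bounded difference property, through which [El_var] bounds the variance by the number of
    rows. *)
Lemma bslast_influence k s1 (e e' : seq bool) s2 :
  `|bslast (s1 ++ e :: s2) k - bslast (s1 ++ e' :: s2) k| <= 1.
Proof.
have H x y : bslast (s1 ++ x :: s2) k <= bslast (s1 ++ y :: s2) k + 1.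
  rewrite /bslast !map_cat /slast !foldl_cat /=.
  set g := foldl _ _ (map _ s1).
  have -> : rmax (foldl (@sstep R) (sstep g (brow R y)) (map (brow R) s2)) k + 1 =
      rmax (foldl (@sstep R) (fun i => sstep g (brow R y) i + 1) (map (brow R) s2)) k.
    rewrite (_ : foldl _ (fun i => _ + 1) _ =
      fun i => foldl (@sstep R) (sstep g (brow R y)) (map (brow R) s2) i + 1); last first.
      by apply/funext => i; rewrite foldl_sstep_shift.
    by rewrite rmax_shift.
  rewrite -[k in X in _ <= X]addn0; apply: foldl_sstep_le => // [i ik|j i _ _]; rewrite addn0//.
  apply: le_trans (rmax_ge _ (leqnn i)).
  rewrite /sstep -addrA lerD2l; apply: le_trans (brow_le1 x i) _.
  by rewrite lerDr.
rewrite ler_norml; apply/andP; split; have := H e e'; have := H e' e; lra.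
Qed.

Definition fairp : R := 2^-1.

Lemma fairp01 : 0 <= fairp <= 1.
Proof. by rewrite /fairp; apply/andP; split; lra. Qed.

Definition rowlaw (M : nat) : law R (seq bool) := Lseq (nseq M (ber fairp)).

Lemma lpos_rowlaw M : lpos (rowlaw M).
Proof. by apply/lpos_Lseq/lpos_nseq/lpos_ber/fairp01. Qed.

Lemma mass_rowlaw M : mass (rowlaw M) = 1.
Proof. by rewrite mass_Lseq prod_mass_nseq mass_ber expr1n. Qed.

Lemma Ex_rowlaw_drop M a h : (a <= M)%N ->
  Ex (rowlaw M) (fun e => h (drop a e)) = Ex (rowlaw (M - a)) h.
Proof. by move=> aM; rewrite !Ex_Lseq El_drop// mass_ber. Qed.

(* Expected one-site-per-row passage time over [k.+1] columns and [n] rows of fair bits. *)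
Definition fair_slast (k n : nat) : R := El (nseq n (rowlaw k.+1)) (bslast^~ k).

Lemma fair_slast_le k n (s : R) : 0 < s < 1 ->
  fair_slast k n <= k.+1%:R * ((1 - s) / (2 * s)) + n%:R * ((1 + s) / 2).
Proof.
move=> /andP[s0 s1].
have s1' : 0 < 1 + s by rewrite addr_gt0.
(* With this ratio the horizontal mean is [(1 - s) / (2 * s)] and the vertical mean [(1 + s) / 2].
   For [a * n] columns the resulting bound is smallest at [s = sqrt a]. *)
pose r := (1 - s) / (1 + s).
have r01 : 0 < r < 1.
  by rewrite divr_gt0 ?subr_gt0//= ltr_pdivrMr// mul1r; lra.
have h : {in nseq n fairp, forall p, 0 <= p <= 1}.
  by move=> p /nseqP[-> _]; exact: fairp01.
have sum_nseq m (f : R -> R) : \sum_(p <- nseq m fairp) f p = m%:R * f fairp.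
  elim: m => [|m IH] /=; first by rewrite big_nil mul0r.
  by rewrite big_cons IH -natr1; ring.
have := EB_slast_le k r01 h; rewrite EB_El map_nseq sum_nseq.
rewrite -/(rowlaw k.+1) -/(fair_slast k n) => /le_trans; apply.
rewrite le_eqVlt; apply/orP; left; apply/eqP; congr (_ + _).
  congr (_ * _); rewrite /r; field; rewrite (gt_eqF s1') (gt_eqF s0) /=.
  by rewrite gt_eqF//; lra.
congr (_ * _).
rewrite /r /fairp; field; rewrite (gt_eqF s1')/=.
by rewrite gt_eqF//; lra.
Qed.

Lemma El_flow (u : R) N M n us :
  El (nseq n (Lprod (nber u) (rowlaw M))) (fun rows => (flow us rows)%:R) =
  outflow queueS (fun _ _ => nber u) N M (nseq n fairp) us.
Proof.
elim: n us => [|n IH] us //=.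
rewrite Ex_Lprod; apply: eq_Ex => v; rewrite Ex_Lseq; apply: eq_El => e.
under eq_El do rewrite natrD.
rewrite ElD El_cst prod_mass_nseq mass_Lprod mass_nber mass_rowlaw mulr1 expr1n mul1r.
by rewrite IH.
Qed.

(** Counterpart of [El_outflow_le] for fair bits, where balance reads [u = (1 + r)^-1]. Each row
    consumes one truncation level, so the increments start at level [N + n] and the lost mass is
    measured at level [N]. *)
Lemma El_outflow_ge (r u : R) N M n : 0 < r < 1 -> u = (1 + r)^-1 ->
  n%:R * u * mass (tgeo r N) ^+ M <=
  El (nseq M (tgeo r (N + n))) (outflow queueS (fun _ _ => nber u) 0 M (nseq n fairp)).
Proof.
move=> /andP[r0 r1] uE.
have r1' : 0 < 1 + r by rewrite addr_gt0.
have u01 : 0 <= u <= 1.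
  by rewrite uE invr_ge0 (ltW r1')/= invf_le1// lerDl ltW.
have r01 : 0 <= r <= 1 by rewrite !ltW.
have rel : r * u * (1 - fairp) = fairp * (1 - u).
  by rewrite uE /fairp; field; rewrite gt_eqF.
have oks m : all_ok (fun p => p = fairp) (nseq m fairp) by elim: m.
elim: n => [|n IH] /=; first by rewrite !mul0r El_cst mulr0.
rewrite addnS; apply: (le_trans _ (@sweep_ge R queueS (tgeo r) (fun _ _ => nber u)
   (fun p => p = fairp) _ _ _ fairp M (N + n) 0
   (fun us v => v%:R + outflow queueS (fun _ _ => nber u) 0 M (nseq n fairp) us) _ _)) => //.
- rewrite (@eq_El _ _ _ _ (fun us => u + outflow queueS (fun _ _ => nber u) 0 M (nseq n fairp) us)).
    rewrite ElD El_cst prod_mass_nseq -natr1 2!mulrDl mul1r addrC lerD// mulrC.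
    rewrite ler_wpM2r//; first by case/andP: u01.
    have m0 N' : 0 <= mass (tgeo r N') by rewrite Ex_ge0// lpos_tgeo.
    apply: lerXn2r; rewrite ?nnegrE// !mass_tgeo lerD2l lerN2.
    by apply: ler_wiXn2l; rewrite ?ltnS ?leq_addr// ltW.
  by move=> us; rewrite ExD Ex_cst mass_nber mul1r Ex_nber mulr1 mulr0 addr0.
- by move=> p ->; exact: fairp01.
- by move=> N'; exact: lpos_tgeo.
- by move=> p N1 _ h -> h0; apply: burke_local_ge => //; exact: fairp01.
- move=> us v; rewrite addr_ge0//.
  apply: (@outflow_ge0 R queueS (fun _ _ => nber u) (fun p => p = fairp)) => //.
  + by move=> p ->; exact: fairp01.
  + by move=> _ p _; exact: lpos_nber.
Qed.

End ExitPoints.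

Section StationaryExit.
Variable R : realType.

Let tgeo01 (r : R) : 0 < r < 1 -> 0 <= r <= 1.
Proof. by case/andP => *; rewrite !ltW. Qed.

Lemma sumn_take_le (us : seq nat) a c : (a <= c)%N -> (sumn (take a us) <= sumn (take c us))%N.
Proof.
by move=> ac; rewrite -(cat_take_drop a (take c us)) take_takel// sumn_cat leq_addr.
Qed.

Lemma term_le_sum n (f : nat -> R) m : (m < n)%N -> (forall i, 0 <= f i) ->
  f m <= \sum_(i < n) f i.
Proof.
move=> mn f0; rewrite (bigD1 (Ordinal mn))//= lerDl sumr_ge0//.
Qed.

Variables (r : R) (k n D D' : nat).
Hypotheses (r01 : 0 < r < 1) (D0 : (0 < D)%N) (D'0 : (0 < D')%N).
Let rho : R := r / (1 - r).
Let u : R := (1 + r)^-1.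
Let v0 : R := r * (1 + r) / (1 - r) ^+ 2 + rho ^+ 2.
Let RL := Lprod (nber u) (rowlaw R k.+1).

Let rho0 : 0 <= rho.
Proof. by case/andP: r01 => r0 r1; apply: divr_ge0; rewrite ?subr_ge0; exact: ltW. Qed.

Let u01 : 0 <= u <= 1.
Proof.
case/andP: r01 => r0 r1; rewrite /u invr_ge0 invf_le1 ?addr_gt0//.
by rewrite lerDl addr_ge0 ltW.
Qed.

Let u0 : 0 <= u. Proof. by case/andP: u01. Qed.

Let dev_bottom m (us : seq nat) : R :=
  `|(sumn (take (minn (m.+1 * D) k.+1) us))%:R - (minn (m.+1 * D) k.+1)%:R * rho|.
Let dev_cols m (rows : seq (nat * seq bool)) : R :=
  `|bslast R (map (drop (m * D)) (map snd rows)) (k - m * D) - fair_slast R (k - m * D) n|.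
Let dev_left m (rows : seq (nat * seq bool)) : R :=
  `|(sumn (take (minn (m.+1 * D') n) (map fst rows)))%:R - (minn (m.+1 * D') n)%:R * u|.
Let dev_rows m (rows : seq (nat * seq bool)) : R :=
  `|bslast R (drop (m * D') (map snd rows)) k - fair_slast R k (n - m * D')|.

(** The exit point is located only up to a block of length [D] or [D']: the boundary part is charged
    up to the end of the block, the bulk part from its beginning. The maximum over blocks is
    replaced by the sum of all deviations, which stays of order sqrt n because the number of blocks
    will be bounded. *)
Lemma exit_pointwise (A : R) us rows :
  (forall m, (m * D <= k)%N -> (m.+1 * D)%:R * rho + fair_slast R (k - m * D) n <= A) ->
  (forall m, (m * D' <= n)%N -> (m.+1 * D')%:R * u + fair_slast R k (n - m * D') <= A) ->
  size us = k.+1 -> size rows = n -> all (fun x => size x.2 == k.+1) rows ->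
  (sumn us + flow us rows)%:R <= A +
    (\sum_(m < (k %/ D).+1) (dev_bottom m us + dev_cols m rows) +
     \sum_(m < (n %/ D').+1) (dev_left m rows + dev_rows m rows)).
Proof.
move=> hA hA' su sr srows.
have sb : 0 <= \sum_(m < (k %/ D).+1) (dev_bottom m us + dev_cols m rows).
  by apply: sumr_ge0 => m _; rewrite addr_ge0 ?normr_ge0.
have sl : 0 <= \sum_(m < (n %/ D').+1) (dev_left m rows + dev_rows m rows).
  by apply: sumr_ge0 => m _; rewrite addr_ge0 ?normr_ge0.
have [[a ak h]|[b bs h]] := flow_exit R su srows.
- pose m := (a %/ D)%N.
  have mk : (m < (k %/ D).+1)%N by rewrite ltnS leq_div2r.
  have mDa : (m * D <= a)%N by rewrite leq_trunc_div.
  have aD : (a < m.+1 * D)%N by rewrite ltn_ceil.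
  have := @term_le_sum _ (fun m => dev_bottom m us + dev_cols m rows) m mk.
  have pos i : 0 <= dev_bottom i us + dev_cols i rows by rewrite addr_ge0 ?normr_ge0.
  move=> /(_ pos) hm.
  have h1 : (sumn (take a.+1 us))%:R <= (sumn (take (minn (m.+1 * D) k.+1) us))%:R :> R.
    by rewrite ler_nat sumn_take_le// leq_min aD ltnS.
  have h2 := @bslast_col_drop R (map snd rows) k a (m * D) mDa ak.
  have h3 := hA m (leq_trans mDa ak).
  have h4 : (minn (m.+1 * D) k.+1)%:R * rho <= (m.+1 * D)%:R * rho.
    by rewrite ler_wpM2r// ler_nat geq_minl.
  have h5 := ler_norm ((sumn (take (minn (m.+1 * D) k.+1) us))%:R - (minn (m.+1 * D) k.+1)%:R * rho).
  have h6 := ler_norm (bslast R (map (drop (m * D)) (map snd rows)) (k - m * D) -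
     fair_slast R (k - m * D) n).
  move: hm h5 h6; rewrite -/(dev_bottom m us) -/(dev_cols m rows); lra.
- rewrite sr in bs.
  pose m := (b %/ D')%N.
  have mk : (m < (n %/ D').+1)%N by rewrite ltnS leq_div2r.
  have mDa : (m * D' <= b)%N by rewrite leq_trunc_div.
  have aD : (b < m.+1 * D')%N by rewrite ltn_ceil.
  have := @term_le_sum _ (fun m => dev_left m rows + dev_rows m rows) m mk.
  have pos i : 0 <= dev_left i rows + dev_rows i rows by rewrite addr_ge0 ?normr_ge0.
  move=> /(_ pos) hm.
  have h1 : (sumn (take b (map fst rows)))%:R <=
     (sumn (take (minn (m.+1 * D') n) (map fst rows)))%:R :> R.
    by rewrite ler_nat sumn_take_le// leq_min (ltnW aD).
  have h2 : bslast R (drop b (map snd rows)) k <= bslast R (drop (m * D') (map snd rows)) k.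
    by rewrite -(subnK mDa) -drop_drop bslast_drop_ge.
  have h3 := hA' m (leq_trans mDa bs).
  have h4 : (minn (m.+1 * D') n)%:R * u <= (m.+1 * D')%:R * u.
    by rewrite ler_wpM2r// ler_nat geq_minl.
  have h5 := ler_norm ((sumn (take (minn (m.+1 * D') n) (map fst rows)))%:R -
     (minn (m.+1 * D') n)%:R * u).
  have h6 := ler_norm (bslast R (drop (m * D') (map snd rows)) k - fair_slast R k (n - m * D')).
  move: hm h5 h6; rewrite -/(dev_left m rows) -/(dev_rows m rows); lra.
Qed.

Let RLpos : lpos RL.
Proof. by apply: lpos_Lprod; [apply: lpos_nber|apply: lpos_rowlaw]. Qed.

Let RLmass : mass RL = 1.
Proof. by rewrite mass_Lprod mass_nber mass_rowlaw mulr1. Qed.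

Let Ex_RL_snd h : Ex RL (fun x => h x.2) = Ex (rowlaw R k.+1) h.
Proof. by rewrite Ex_Lprod /= Ex_cst mass_nber mul1r. Qed.

Let Ex_RL_fst h : Ex RL (fun x => h x.1) = Ex (nber u) h.
Proof. by rewrite Ex_Lprod; apply: eq_Ex => a /=; rewrite Ex_cst mass_rowlaw mul1r. Qed.

Lemma half_amgm_mono (V V' t : R) : 0 < t -> V <= V' -> (V / t + t) / 2 <= (V' / t + t) / 2.
Proof. by move=> t0 VV; rewrite ler_wpM2r// lerD2r ler_wpM2r// invr_ge0 ltW. Qed.

Lemma El_dev_cols (t : R) m : 0 < t -> (m * D <= k)%N ->
  El (nseq n RL) (dev_cols m) <= (n%:R / t + t) / 2.
Proof.
move=> t0 mk.
rewrite /dev_cols (@El_map _ _ _ n RL (rowlaw R k.+1) snd (fun s =>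
  `|bslast R (map (drop (m * D)) s) (k - m * D) - fair_slast R (k - m * D) n|))//.
rewrite (@El_map _ _ _ n (rowlaw R k.+1) (rowlaw R (k - m * D).+1) (drop (m * D)) (fun s =>
  `|bslast R s (k - m * D) - fair_slast R (k - m * D) n|)); last first.
  by move=> h; rewrite Ex_rowlaw_drop ?subSn// leqW.
apply: El_norm_le_var => //.
- exact/lpos_nseq/lpos_rowlaw.
- by rewrite prod_mass_nseq mass_rowlaw expr1n.
- by apply: El_var; [exact: lpos_rowlaw|exact: mass_rowlaw|exact: bslast_influence].
Qed.

Lemma El_dev_rows (t : R) m : 0 < t -> (m * D' <= n)%N ->
  El (nseq n RL) (dev_rows m) <= (n%:R / t + t) / 2.
Proof.
move=> t0 mk.
rewrite /dev_rows (@El_map _ _ _ n RL (rowlaw R k.+1) snd (fun s =>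
  `|bslast R (drop (m * D') s) k - fair_slast R k (n - m * D')|))//.
rewrite (@El_drop _ _ n _ _ (fun s => `|bslast R s k - fair_slast R k (n - m * D')|))//; last first.
  exact: mass_rowlaw.
apply: le_trans (half_amgm_mono t0 (_ : (n - m * D')%:R <= _)); last first.
  by rewrite ler_nat leq_subr.
apply: El_norm_le_var => //.
- exact/lpos_nseq/lpos_rowlaw.
- by rewrite prod_mass_nseq mass_rowlaw expr1n.
- by apply: El_var; [exact: lpos_rowlaw|exact: mass_rowlaw|exact: bslast_influence].
Qed.

Lemma El_dev_left (t : R) m : 0 < t ->
  El (nseq n RL) (dev_left m) <= (n%:R / t + t) / 2.
Proof.
move=> t0; set c := minn (m.+1 * D') n.
have cn : (c <= n)%N by rewrite geq_minr.
rewrite /dev_left (@El_map _ _ _ n RL (nber u) fst (fun s =>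
  `|(sumn (take c s))%:R - c%:R * u|))//.
rewrite (@El_take _ _ n _ _ (fun s => `|(sumn s)%:R - c%:R * u|)) ?mass_nber//.
apply: le_trans (half_amgm_mono t0 (_ : c%:R <= _)); last first.
  by rewrite ler_nat.
apply: El_norm_le_var => //.
- exact/lpos_nseq/lpos_nber.
- by rewrite prod_mass_nseq mass_nber expr1n.
- have := @El_sumn_var R (nber u) c u 0 1; rewrite expr0n /= mulr0 addr0 mulr1; apply.
  + exact: lpos_nber.
  + by rewrite mass_nber.
  + have -> : Ex (nber u) (fun m => m%:R - u) = 0 by rewrite Ex_nber; ring.
    by rewrite normr0.
  + rewrite Ex_nber mulr0n mulr1n; case/andP: u01 => ? ?; nra.
Qed.

Lemma El_dev_bottom (t b : R) N m : 0 < t -> r ^+ N.+1 * N.+1%:R <= b ->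
  El (nseq k.+1 (tgeo r N)) (dev_bottom m) <=
  ((k.+1%:R * v0 + k.+1%:R ^+ 2 * b ^+ 2) / t + t) / 2.
Proof.
move=> t0 hb; set c := minn (m.+1 * D) k.+1.
have cn : (c <= k.+1)%N by rewrite geq_minr.
have [r0 r1] := andP r01; have r01' := tgeo01 r01.
have b0 : 0 <= b by apply: le_trans hb; rewrite mulr_ge0// exprn_ge0 ?ltW.
have v00 : 0 <= v0.
  rewrite /v0 addr_ge0 ?sqr_ge0// divr_ge0 ?sqr_ge0// mulr_ge0 ?addr_ge0 ?ltW//.
apply: (le_trans (@El_take_le R _ k.+1 c _ (fun s => `|(sumn s)%:R - c%:R * rho|) _ _ _ cn)) => //.
- exact: lpos_tgeo.
- exact: le_mass_tgeo.
apply: le_trans (half_amgm_mono t0 (_ : c%:R * v0 + c%:R ^+ 2 * b ^+ 2 <= _)); last first.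
  have cn' : c%:R <= k.+1%:R :> R by rewrite ler_nat.
  rewrite lerD// ler_wpM2r ?sqr_ge0// lerXn2r ?nnegrE//.
apply: El_norm_le_var => //.
- exact/lpos_nseq/lpos_tgeo.
- by rewrite prod_mass_nseq exprn_ile1 ?le_mass_tgeo ?Ex_ge0 ?lpos_tgeo.
- apply: El_sumn_var.
  + exact: lpos_tgeo.
  + exact: le_mass_tgeo.
  + by rewrite bias_tgeo// normrN ger0_norm// mulr_ge0// exprn_ge0 ?ltW.
  + by apply: var_tgeo_le; rewrite ltW.
Qed.

(** The left side is a lower bound for the stationary mean computed at truncation level [N]; the
    right side integrates [exit_pointwise], every deviation being bounded through its second
    moment. *)
Lemma exit_bound_level (A t : R) N : 0 < t -> 0 <= A ->
  (forall m, (m * D <= k)%N -> (m.+1 * D)%:R * rho + fair_slast R (k - m * D) n <= A) ->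
  (forall m, (m * D' <= n)%N -> (m.+1 * D')%:R * u + fair_slast R k (n - m * D') <= A) ->
  k.+1%:R * Ex (tgeo r (N + n)) (fun m => m%:R) * mass (tgeo r (N + n)) ^+ k +
  n%:R * u * mass (tgeo r N) ^+ k.+1 <=
  A + ((k %/ D).+1%:R *
       (((k.+1%:R * v0 + k.+1%:R ^+ 2 * (r ^+ (N + n).+1 * (N + n).+1%:R) ^+ 2) / t + t) / 2
        + (n%:R / t + t) / 2)
     + (n %/ D').+1%:R * ((n%:R / t + t) / 2 + (n%:R / t + t) / 2)).
Proof.
move=> t0 A0 hA hA'.
have gpos : all (@lpos R nat) (nseq k.+1 (tgeo r (N + n))).
  exact/lpos_nseq/lpos_tgeo/tgeo01.
have gmass : \prod_(l <- nseq k.+1 (tgeo r (N + n))) mass l <= 1.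
  rewrite prod_mass_nseq exprn_ile1 ?le_mass_tgeo ?Ex_ge0 ?lpos_tgeo ?tgeo01//.
have RLc c : El (nseq n RL) (fun=> c) = c.
  by rewrite El_cst prod_mass_nseq RLmass expr1n mul1r.
apply: (@le_trans _ _ (El (nseq k.+1 (tgeo r (N + n))) (fun us =>
   El (nseq n RL) (fun rows => (sumn us + flow us rows)%:R)))).
  rewrite (@eq_El _ _ _ _ (fun us => (sumn us)%:R +
     outflow queueS (fun _ _ => nber u) 0 k.+1 (nseq n (fairp R)) us)); last first.
    move=> us; rewrite -El_flow -[X in X + _]RLc -ElD; apply: eq_El => rows.
    by rewrite natrD.
  by rewrite ElD El_sumn lerD2l; apply: El_outflow_ge.
pose bd us rows : R := A + (\sum_(m < (k %/ D).+1) (dev_bottom m us + dev_cols m rows) +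
     \sum_(m < (n %/ D').+1) (dev_left m rows + dev_rows m rows)).
apply: (@le_trans _ _ (El (nseq k.+1 (tgeo r (N + n))) (fun us =>
   El (nseq n RL) (bd us)))).
  apply: le_El_size => // us; rewrite size_nseq => su.
  apply: (@le_El_supp _ _ (fun x => size x.2 == k.+1)) => //.
    exact: (@lsupp_Lprod R _ _ (nber u) (rowlaw R k.+1) (fun s => size s == k.+1)
      (lsupp_Lseq _ _)).
  by move=> rows sr srows; apply: exit_pointwise.
rewrite /bd (@eq_El _ _ _ _ (fun us => (A + (\sum_(m < (k %/ D).+1) dev_bottom m us)) +
   ((\sum_(m < (k %/ D).+1) El (nseq n RL) (dev_cols m)) +
    \sum_(m < (n %/ D').+1) (El (nseq n RL) (dev_left m) + El (nseq n RL) (dev_rows m)))));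
  last first.
  move=> us; rewrite ElD RLc -addrA; congr (_ + _); rewrite ElD !El_sum addrA; congr (_ + _).
    by rewrite -big_split; apply: eq_bigr => m _; rewrite ElD RLc.
  by apply: eq_bigr => m _; rewrite ElD.
have md a b m : (m < (a %/ b).+1)%N -> (m * b <= a)%N.
  by rewrite ltnS => h; apply: leq_trans (leq_trunc_div a b); rewrite leq_mul2r h orbT.
rewrite ElD El_cst.
set S1 := \sum_(m < (k %/ D).+1) El (nseq n RL) _.
set S2 := \sum_(m < (n %/ D').+1) (El (nseq n RL) _ + _).
have S10 : 0 <= S1 + S2.
  have dv d : (forall x, 0 <= d x) -> 0 <= El (nseq n RL) d by move=> ?; apply: El_ge0 => //; exact: lpos_nseq.
  apply: addr_ge0; apply: sumr_ge0 => m _; first by apply: dv => x; exact: normr_ge0.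
  by apply: addr_ge0; apply: dv => x; exact: normr_ge0.
apply: (@le_trans _ _ (El (nseq k.+1 (tgeo r (N + n)))
   (fun us => A + \sum_(m < (k %/ D).+1) dev_bottom m us) + (S1 + S2))).
  by rewrite lerD2l ler_piMl.
rewrite ElD El_cst El_sum.
apply: (@le_trans _ _ (A + \sum_(m < (k %/ D).+1) El (nseq k.+1 (tgeo r (N + n))) (dev_bottom m) +
   (S1 + S2))).
  by rewrite lerD2r lerD2r ler_piMl.
rewrite -addrA lerD2l addrA lerD//.
  rewrite -big_split /= -[(k %/ D).+1 in leRHS]card_ord mulr_natl -sumr_const ler_sum// => m _.
  rewrite lerD ?El_dev_bottom// El_dev_cols// md//.
rewrite -[(n %/ D').+1 in leRHS]card_ord mulr_natl -sumr_const ler_sum// => m _.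
by rewrite lerD ?El_dev_left// El_dev_rows// md.
Qed.

Lemma exit_bound (A t : R) : 0 < t -> 0 <= A ->
  (forall m, (m * D <= k)%N -> (m.+1 * D)%:R * rho + fair_slast R (k - m * D) n <= A) ->
  (forall m, (m * D' <= n)%N -> (m.+1 * D')%:R * u + fair_slast R k (n - m * D') <= A) ->
  k.+1%:R * rho + n%:R * u <=
  A + ((k %/ D).+1%:R * ((k.+1%:R * v0 / t + t) / 2 + (n%:R / t + t) / 2)
     + (n %/ D').+1%:R * ((n%:R / t + t) / 2 + (n%:R / t + t) / 2)).
Proof.
move=> t0 A0 hA hA'.
have rr : 0 <= r < 1 by case/andP: r01 => ? ?; rewrite ltW.
have cm : (fun N => mass (tgeo r N)) @ \oo --> (1 : R) by apply: cvg_mass_tgeo.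
have cX m : (fun N => mass (tgeo r N) ^+ m) @ \oo --> (1 : R).
  elim: m => [|m IH].
    rewrite (_ : (fun N => _) = fun=> 1); [exact: cvg_cst|by apply/funext => N; rewrite expr0].
  rewrite (_ : (fun N => _) = fun N => mass (tgeo r N) * mass (tgeo r N) ^+ m).
    by rewrite -[X in _ --> X]mul1r; apply: cvgM.
  by apply/funext => N; rewrite exprS.
have cb := cvg_bias_tgeo rr.
have cmean : (fun N => Ex (tgeo r N) (fun m => m%:R)) @ \oo --> rho.
  rewrite (_ : (fun N => _) = fun N => mass (tgeo r N) * rho - r ^+ N.+1 * N.+1%:R).
    rewrite -[X in _ --> X]subr0; apply: cvgB; last exact: cb.
    by rewrite -[X in _ --> X]mul1r; apply: cvgMl.
  apply/funext => N; case/andP: rr => _ r1; rewrite mean_tgeo// mass_tgeo /rho; ring.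
pose f N := k.+1%:R * Ex (tgeo r (N + n)) (fun m => m%:R) * mass (tgeo r (N + n)) ^+ k +
  n%:R * u * mass (tgeo r N) ^+ k.+1.
pose g N := A + ((k %/ D).+1%:R *
       (((k.+1%:R * v0 + k.+1%:R ^+ 2 * (r ^+ (N + n).+1 * (N + n).+1%:R) ^+ 2) / t + t) / 2
        + (n%:R / t + t) / 2)
     + (n %/ D').+1%:R * ((n%:R / t + t) / 2 + (n%:R / t + t) / 2)).
have cf : f @ \oo --> k.+1%:R * rho + n%:R * u.
  apply: cvgD.
    rewrite -[X in _ --> X]mulr1; apply: cvgM.
      apply: cvgMr; by rewrite (cvg_shiftn n (fun N => Ex (tgeo r N) (fun m => m%:R))).
    by rewrite (cvg_shiftn n (fun N => mass (tgeo r N) ^+ k)).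
  by rewrite -[X in _ --> X]mulr1; apply: cvgMr.
have cg : g @ \oo --> A + ((k %/ D).+1%:R * ((k.+1%:R * v0 / t + t) / 2 + (n%:R / t + t) / 2)
     + (n %/ D').+1%:R * ((n%:R / t + t) / 2 + (n%:R / t + t) / 2)).
  apply: cvgD; first exact: cvg_cst.
  apply: cvgD; last exact: cvg_cst.
  apply: cvgMr; apply: cvgD; last exact: cvg_cst.
  apply: cvgMl; apply: cvgD; last exact: cvg_cst.
  apply: cvgMl; rewrite -[X in _ --> X]addr0; apply: cvgD; first exact: cvg_cst.
  rewrite -(mulr0 (k.+1%:R ^+ 2)); apply: cvgMr.
  have cb' : (fun N => r ^+ (N + n).+1 * (N + n).+1%:R) @ \oo --> (0 : R).
    by rewrite (cvg_shiftn n (fun N => r ^+ N.+1 * N.+1%:R)).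
  rewrite -[X in _ --> X](mulr0 0) (_ : (fun N => _) = fun N =>
    (r ^+ (N + n).+1 * (N + n).+1%:R) * (r ^+ (N + n).+1 * (N + n).+1%:R)).
    exact: cvgM.
  by apply/funext => N; rewrite expr2.
apply: (ler_cvg_to cf cg); apply: nearW => N.
exact: exit_bound_level.
Qed.

End StationaryExit.

(** * Asymptotics for fair bits *)

Section FairLimit.
Variable R : realType.

Lemma fair_slast_ge0 k n : 0 <= fair_slast R k n.
Proof.
apply: El_ge0; first exact/lpos_nseq/lpos_rowlaw.
move=> es; rewrite /bslast.
have := @bslast_drop_ge R es (size es) k; rewrite drop_size; apply: le_trans.
by rewrite /bslast /slast /=; apply: le_trans (rmax_ge _ (leqnn _)).
Qed.

Lemma fair_slast_cols k n c : (c <= k)%N -> fair_slast R (k - c) n <= fair_slast R k n.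
Proof.
move=> ck; rewrite /fair_slast.
rewrite -(@El_map _ _ _ n (rowlaw R k.+1) (rowlaw R (k - c).+1) (drop c)); last first.
  by move=> h; rewrite Ex_rowlaw_drop ?subSn// leqW.
apply: le_El => [|es]; first exact/lpos_nseq/lpos_rowlaw.
have := @bslast_col_drop R es k c 0 (leq0n _) ck.
by rewrite subn0 (@eq_map _ _ (drop 0) id) ?map_id// => x; rewrite drop0.
Qed.

Lemma fair_slast_rows k n c : (c <= n)%N -> fair_slast R k (n - c) <= fair_slast R k n.
Proof.
move=> cn; rewrite /fair_slast -(@El_drop _ _ n c _ (bslast R ^~ k)) ?mass_rowlaw//.
apply: le_El => [|es]; first exact/lpos_nseq/lpos_rowlaw.
exact: bslast_drop_ge.
Qed.

Lemma sqrt_sublinear (C e : R) : 0 <= C -> 0 < e ->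
  exists n0, forall n, (n0 <= n)%N -> C * Num.sqrt n%:R + C <= e * n%:R.
Proof.
move=> C0 e0.
have c0 : 0 <= 2 * C / e by rewrite divr_ge0 ?mulr_ge0// ltW.
exists (Num.truncn ((2 * C / e) ^+ 2)).+2 => n hn.
set x := Num.sqrt n%:R.
have x0 : 0 <= x by rewrite sqrtr_ge0.
have xx : n%:R = x * x by rewrite -expr2 sqr_sqrtr.
have nbig : (2 * C / e) ^+ 2 + 1 <= n%:R.
  have /andP[_ h] := truncn_itv (sqr_ge0 (2 * C / e)).
  have : (Num.truncn ((2 * C / e) ^+ 2)).+2%:R <= n%:R :> R by rewrite ler_nat.
  by rewrite -natr1; lra.
have x1 : 1 <= x by rewrite -(sqrtr1 R) ler_wsqrtr//; have := sqr_ge0 (2 * C / e); lra.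
have xc : 2 * C / e <= x.
  rewrite -(@ler_pXn2r R 2)// ?nnegrE// (_ : x ^+ 2 = n%:R); last by rewrite xx expr2.
  lra.
have cx : 2 * C <= e * x by move: xc; rewrite ler_pdivrMr// [x * e]mulrC.
rewrite xx.
have : 2 * C * x <= e * x * x by rewrite ler_wpM2r.
have : C * 1 <= C * x by rewrite ler_wpM2l.
lra.
Qed.

Lemma fair_slast_upper (a e : R) : 0 < a < 1 -> 0 < e -> exists n0, forall n k,
  (n0 <= n)%N -> k.+1%:R <= n%:R * a + 2 ->
  fair_slast R k n <= n%:R * (2^-1 + Num.sqrt a - a / 2 + e).
Proof.
move=> /andP[a0 a1] e0; set s := Num.sqrt a.
have s0 : 0 < s by rewrite sqrtr_gt0.
have s1 : s < 1 by rewrite -(sqrtr1 R) ltr_sqrt.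
have ss : a = s * s by rewrite -expr2 sqr_sqrtr// ltW.
exists (Num.truncn (s^-1 / e)).+1 => n k hn hk.
have se0 : 0 <= s^-1 / e by rewrite divr_ge0 ?invr_ge0// ltW.
have nbig : s^-1 <= e * n%:R.
  have /andP[_ h] := truncn_itv se0.
  have : (Num.truncn (s^-1 / e)).+1%:R <= n%:R :> R by rewrite ler_nat.
  move=> h'; have : s^-1 / e <= n%:R by lra.
  by rewrite ler_pdivrMr// mulrC.
have s01 : 0 < s < 1 by rewrite s0.
apply: le_trans (fair_slast_le k n s01) _.
have w0 : 0 < (1 - s) / (2 * s) by rewrite divr_gt0 ?mulr_gt0// subr_gt0.
apply: (@le_trans _ _ ((n%:R * a + 2) * ((1 - s) / (2 * s)) + n%:R * ((1 + s) / 2))).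
  by rewrite lerD2r ler_wpM2r// ltW.
have -> : (n%:R * a + 2) * ((1 - s) / (2 * s)) + n%:R * ((1 + s) / 2) =
   n%:R * (2^-1 + s - a / 2) + (s^-1 - 1).
  by rewrite ss; field; rewrite gt_eqF.
lra.
Qed.

Lemma bottom_exit_real (N K c D f s t : R) : 0 < s <= 2^-1 -> 0 < t <= 1 ->
  0 <= N -> 0 <= D -> K <= N * (s * s) + 2 -> N * (s * s) - 2 <= K ->
  D <= s * s * (t * t) / 64 * N + 1 -> t * (s * s) * N <= c ->
  f <= (K - c) * ((1 - s * (1 - t / 2)) / (2 * (s * (1 - t / 2)))) +
       N * ((1 + s * (1 - t / 2)) / 2) ->
  (c + D) * ((1 - s) / (2 * s)) + f <=
  N * (2^-1 + s - s * s / 2) - N * s * (t * t) / 16 + 4 / s.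
Proof.
move=> /andP[s0 s1] /andP[t0 t1] N0 D0 k1 k2 hD hc.
pose w := 1 - t / 2; have w0 : 0 < w by rewrite /w; lra.
have -> : (1 - s) / (2 * s) = s^-1 / 2 - 2^-1 by field; rewrite gt_eqF.
have -> : (1 - s * (1 - t / 2)) / (2 * (s * (1 - t / 2))) = s^-1 / w / 2 - 2^-1.
  rewrite -/w; by field; rewrite (gt_eqF w0) (gt_eqF s0).
have y0 : 0 < s^-1 by rewrite invr_gt0.
have y2 : 2 <= s^-1 by rewrite -[2]invrK lef_pV2 ?posrE ?invr_gt0.
have sy : s * s^-1 = 1 by rewrite divff// gt_eqF.
have zw : s^-1 / w * w = s^-1 by rewrite divfK// gt_eqF.
have z0 : 0 < s^-1 / w by rewrite divr_gt0.
move: y0 y2 sy zw z0; move: (s^-1 / w) => z; move: (s^-1) => y y0 y2 sy.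
rewrite /w => zw z0 h.
have zt : 0 <= z * t by rewrite mulr_ge0 ?ltW.
have zt1 : z * t <= z * 1 by rewrite ler_wpM2l// ltW.
have zy : y <= z by lra.
have z2 : z <= 2 * y by lra.
have ay : s * s * y = s by rewrite -mulrA sy mulr1.
have az : s * s * z * (1 - t / 2) = s by rewrite -mulrA zw.
have h1 : 0 <= (c - t * (s * s) * N) * (z - y) by rewrite mulr_ge0 ?subr_ge0.
have h2 : 0 <= (N * (s * s) + 2 - K) * z by rewrite mulr_ge0 ?subr_ge0// ltW.
have h3 : 0 <= (s * s * (t * t) / 64 * N + 1 - D) * y by rewrite mulr_ge0 ?subr_ge0// ltW.
have e1 : t * (s * s) * N * y = N * t * s.
  by transitivity (t * N * (s * s * y)); [ring|rewrite ay; ring].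
have e3 : s * s * (t * t) / 64 * N * y = N * s * (t * t) / 64.
  by transitivity (t * t / 64 * N * (s * s * y)); [field|rewrite ay; field].
have gain : s * s * z * (1 - t) <= s * (1 - t / 2 - t * t / 4).
  rewrite -(ler_pM2r w0) /w.
  have -> : s * s * z * (1 - t) * (1 - t / 2) = (s * s * z * (1 - t / 2)) * (1 - t) by ring.
  rewrite az; have : 0 <= s * t * t * t by rewrite !mulr_ge0 ?ltW.
  lra.
have gn : N * (s * s * z * (1 - t)) <= N * (s * (1 - t / 2 - t * t / 4)).
  by rewrite ler_wpM2l.
have st : 0 <= N * s * (t * t).
  by apply: mulr_ge0; apply: mulr_ge0; rewrite // ltW.
lra.
Qed.

(** Leaving the left side late removes rows and makes the remaining rectangle flatter, so the tilt
    goes the other way: [s * (1 + t / 2)]. *)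
Lemma left_exit_real (N K c D f s t : R) : 0 < s <= 2^-1 -> 0 < t <= 1 ->
  0 <= N -> 0 <= D -> K <= N * (s * s) + 2 -> N * (s * s) - 2 <= K ->
  D <= s * s * (t * t) / 64 * N + 1 -> t * N <= c ->
  f <= K * ((1 - s * (1 + t / 2)) / (2 * (s * (1 + t / 2)))) +
       (N - c) * ((1 + s * (1 + t / 2)) / 2) ->
  (c + D) * ((1 + s) / 2) + f <=
  N * (2^-1 + s - s * s / 2) - N * s * (t * t) / 16 + 4 / s.
Proof.
move=> /andP[s0 s1] /andP[t0 t1] N0 D0 k1 k2 hD hc.
pose w := 1 + t / 2; have w0 : 0 < w by rewrite /w; lra.
have -> : (1 - s * (1 + t / 2)) / (2 * (s * (1 + t / 2))) = s^-1 / w / 2 - 2^-1.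
  rewrite -/w; by field; rewrite (gt_eqF w0) (gt_eqF s0).
have y0 : 0 < s^-1 by rewrite invr_gt0.
have y2 : 2 <= s^-1 by rewrite -[2]invrK lef_pV2 ?posrE ?invr_gt0.
have sy : s * s^-1 = 1 by rewrite divff// gt_eqF.
have zw : s^-1 / w * w = s^-1 by rewrite divfK// gt_eqF.
have z0 : 0 < s^-1 / w by rewrite divr_gt0.
move: y0 y2 sy zw z0; move: (s^-1 / w) => z; move: (s^-1) => y y0 y2 sy.
rewrite /w => zw z0 h.
have zt : 0 <= z * t by rewrite mulr_ge0 ?ltW.
have z2 : z <= y by lra.
have az : s * s * z * (1 + t / 2) = s by rewrite -mulrA zw -mulrA sy mulr1.
have h1 : 0 <= (c - t * N) * (s * t) by rewrite mulr_ge0 ?subr_ge0// mulr_ge0 ?ltW.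
have h2 : 0 <= (N * (s * s) + 2 - K) * z by rewrite mulr_ge0 ?subr_ge0// ltW.
have gain : s * s * z <= s * (1 - t / 2 + t * t / 4).
  rewrite -(ler_pM2r w0) /w az.
  have : 0 <= s * t * t * t by rewrite !mulr_ge0 ?ltW.
  lra.
have gn : N * (s * s * z) <= N * (s * (1 - t / 2 + t * t / 4)) by rewrite ler_wpM2l.
have st : 0 <= N * s * (t * t).
  by apply: mulr_ge0; apply: mulr_ge0; rewrite // ltW.
have sts : N * s * (t * t) * s <= N * s * (t * t) * 1 by rewrite ler_wpM2l//; lra.
have Ds : D * s <= D * 1 by rewrite ler_wpM2l//; lra.
lra.
Qed.

(** Near the corner the boundary part itself is negligible, and the bulk is at most the value [f] of
    the whole rectangle. *)
Lemma bottom_exit_near (N c D f f' s t : R) : 0 < s <= 2^-1 -> 0 < t <= 1 ->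
  0 <= N -> 0 <= D -> 0 <= c -> D <= s * s * (t * t) / 64 * N + 1 -> c <= t * (s * s) * N ->
  f' <= f -> (c + D) * ((1 - s) / (2 * s)) + f' <= f + (2 * t * N + s^-1 + 1).
Proof.
move=> /andP[s0 s1] /andP[t0 t1] N0 D0 c0 hD hc ff.
have -> : (1 - s) / (2 * s) = s^-1 / 2 - 2^-1 by field; rewrite gt_eqF.
have y0 : 0 < s^-1 by rewrite invr_gt0.
have sy : s * s^-1 = 1 by rewrite divff// gt_eqF.
move: (s^-1) y0 sy => y y0 sy.
have h1 : c * y <= t * (s * s) * N * y by rewrite ler_wpM2r// ltW.
have h2 : D * y <= (s * s * (t * t) / 64 * N + 1) * y by rewrite ler_wpM2r// ltW.
have e1 : t * (s * s) * N * y = N * t * s.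
  by transitivity (t * N * s * (s * y)); [ring|rewrite sy; ring].
have e3 : s * s * (t * t) / 64 * N * y = N * t * s * t / 64.
  by transitivity (t * t / 64 * N * s * (s * y)); [field|rewrite sy; field].
have nt : 0 <= N * t by rewrite mulr_ge0// ltW.
have nts : N * t * s <= N * t * 2^-1 by rewrite ler_wpM2l.
have nts0 : 0 <= N * t * s by rewrite mulr_ge0// ltW.
have ntst : N * t * s * t <= N * t * s * 1 by rewrite ler_wpM2l.
lra.
Qed.

Lemma left_exit_near (N c D f f' s t : R) : 0 < s <= 2^-1 -> 0 < t <= 1 ->
  0 <= N -> 0 <= D -> 0 <= c -> D <= s * s * (t * t) / 64 * N + 1 -> c <= t * N ->
  f' <= f -> (c + D) * ((1 + s) / 2) + f' <= f + (2 * t * N + s^-1 + 1).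
Proof.
move=> /andP[s0 s1] /andP[t0 t1] N0 D0 c0 hD hc ff.
have y0 : 0 < s^-1 by rewrite invr_gt0.
move: (s^-1) y0 => y y0.
have nt : 0 <= N * t by rewrite mulr_ge0// ltW.
have nts : N * t * s <= N * t * 2^-1 by rewrite ler_wpM2l.
have nts0 : 0 <= N * t * s by rewrite mulr_ge0// ltW.
have ntst : N * t * s * t <= N * t * s * 1 by rewrite ler_wpM2l.
have ntst0 : 0 <= N * t * s * t by rewrite mulr_ge0// ltW.
have e3 : N * t * s * t * s <= N * t * s * t * 2^-1 by rewrite ler_wpM2l.
have cs : c * s <= c * 1 by rewrite ler_wpM2l//; lra.
have Ds : D * s <= D * 1 by rewrite ler_wpM2l//; lra.
lra.
Qed.

(** There are at most [dl^-1 + 1] blocks on each side, and every deviation is of order [x], the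
    square root of the number of rows. *)
Lemma exit_error (n k D : nat) (dl v x : R) : 0 < dl -> 0 <= v -> 0 < x -> n%:R = x * x ->
  k.+1%:R <= n%:R :> R -> dl * n%:R <= D%:R ->
  (k %/ D).+1%:R * ((k.+1%:R * v / x + x) / 2 + (n%:R / x + x) / 2) +
  (n %/ D).+1%:R * ((n%:R / x + x) / 2 + (n%:R / x + x) / 2) <= (dl^-1 + 1) * (v + 7) * x.
Proof.
move=> dl0 v0 x0 xx kn hD.
have nx : n%:R / x = x by rewrite xx mulfK// gt_eqF.
have n0 : 0 < n%:R :> R by rewrite xx mulr_gt0.
have divD m : (m%:R <= n%:R :> R) -> (m %/ D).+1%:R <= dl^-1 + 1.
  move=> mn; rewrite -natr1 lerD2r -(ler_pM2l dl0) divff ?gt_eqF//.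
  have q1 : (m %/ D)%:R * D%:R <= n%:R :> R.
    by apply: le_trans mn; rewrite -natrM ler_nat leq_trunc_div.
  have q2 : (m %/ D)%:R * (dl * n%:R) <= (m %/ D)%:R * D%:R :> R by rewrite ler_wpM2l.
  by rewrite -(ler_pM2r n0) mul1r; lra.
have vx : 0 <= v * x by rewrite mulr_ge0// ltW.
have b1 : (k.+1%:R * v / x + x) / 2 + (n%:R / x + x) / 2 <= (v + 7) / 2 * x.
  have : k.+1%:R * v / x <= v * x.
    by rewrite ler_pdivrMr// -mulrA -xx mulrC ler_wpM2l.
  by rewrite nx; lra.
have b2 : (n%:R / x + x) / 2 + (n%:R / x + x) / 2 <= (v + 7) / 2 * x by rewrite nx; lra.
have p1 : 0 <= (v + 7) / 2 * x by lra.
have kn' : k%:R <= n%:R :> R by apply: le_trans kn; rewrite ler_nat.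
have c1 : (k %/ D).+1%:R * ((k.+1%:R * v / x + x) / 2 + (n%:R / x + x) / 2) <=
    (dl^-1 + 1) * ((v + 7) / 2 * x).
  apply: (@le_trans _ _ ((k %/ D).+1%:R * ((v + 7) / 2 * x))); first by rewrite ler_wpM2l.
  by rewrite ler_wpM2r// divD.
have c2 : (n %/ D).+1%:R * ((n%:R / x + x) / 2 + (n%:R / x + x) / 2) <=
    (dl^-1 + 1) * ((v + 7) / 2 * x).
  apply: (@le_trans _ _ ((n %/ D).+1%:R * ((v + 7) / 2 * x))); first by rewrite ler_wpM2l.
  by rewrite ler_wpM2r// divD.
move: c1 c2; lra.
Qed.

(** Exits near the corner are covered by the first argument of the maximum, far ones by the second.
    The left side is the stationary mean, which exceeds the second argument by order [n], so for
    large [n] the first one must prevail. *)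
Lemma exit_alternative (s t : R) : 0 < s <= 2^-1 -> 0 < t <= 1 -> exists C : R,
  forall n k, (4 <= n)%N -> k.+1%:R <= n%:R * (s * s) + 2 -> n%:R * (s * s) - 2 <= k.+1%:R ->
  k.+1%:R * ((1 - s) / (2 * s)) + n%:R * ((1 + s) / 2) <=
  Num.max (fair_slast R k n + (2 * t * n%:R + s^-1 + 1))
     (n%:R * (2^-1 + s - s * s / 2) - n%:R * s * (t * t) / 16 + 4 / s)
  + C * Num.sqrt n%:R.
Proof.
move=> s01 t01; pose r := (1 - s) / (1 + s).
pose v := r * (1 + r) / (1 - r) ^+ 2 + (r / (1 - r)) ^+ 2.
(* Block length relative to [n]. Bottom increments have mean below [1 / (2 * s)], so a block is
   worth at most [s * (t * t) / 128] per row, well below the gain [s * (t * t) / 16] of a far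
   exit. *)
pose dl := s * s * (t * t) / 64.
exists ((dl^-1 + 1) * (v + 7)) => n k n4 k1 k2.
have [s0 s1] := andP s01; have [t0 t1] := andP t01.
have s1' : 0 < 1 + s by rewrite addr_gt0.
have s1'' : 0 < 1 - s by lra.
have r01 : 0 < r < 1.
  by rewrite /r divr_gt0//= ltr_pdivrMr// mul1r; lra.
have erho : r / (1 - r) = (1 - s) / (2 * s).
  rewrite /r; field; rewrite (gt_eqF s1') (gt_eqF s0) /= gt_eqF//.
  by clear -s0; lra.
have eu : (1 + r)^-1 = (1 + s) / 2.
  rewrite /r; field; rewrite (gt_eqF s1')/= gt_eqF//.
  by clear -s0; lra.
have v0 : 0 <= v.
  case/andP: r01 => r0 r1.
  by rewrite /v addr_ge0 ?sqr_ge0// divr_ge0 ?sqr_ge0// mulr_ge0 ?addr_ge0// ltW.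
have dl0 : 0 < dl by rewrite !mulr_gt0.
have n4' : 4 <= n%:R :> R by rewrite (ler_nat R 4).
set x := Num.sqrt n%:R.
have x0 : 0 < x by rewrite sqrtr_gt0; apply: lt_le_trans n4'.
have xx : n%:R = x * x by rewrite -expr2 sqr_sqrtr.
pose D := (Num.truncn (dl * n%:R)).+1.
have dln : 0 <= dl * n%:R by rewrite mulr_ge0// ltW.
have /andP[D1 D2] := truncn_itv dln.
have hD : D%:R <= dl * n%:R + 1 by rewrite /D -natr1 lerD2r.
have hD' : dl * n%:R <= D%:R by rewrite ltW.
have ss4 : s * s <= 4^-1.
  by apply: (@le_trans _ _ (2^-1 * 2^-1)); [rewrite ler_pM// ltW|lra].
have kn : k.+1%:R <= n%:R :> R.
  apply: le_trans k1 _.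
  have : n%:R * (s * s) <= n%:R * 4^-1 by rewrite ler_wpM2l.
  by clear -n4'; lra.
have N0 : 0 <= n%:R :> R by [].
have D0 : 0 <= D%:R :> R by [].
have st1 : s * t <= s * 1 by rewrite ler_wpM2l// ltW.
have st0 : 0 < s * t by rewrite mulr_gt0.
have w1 : 0 < s * (1 - t / 2) < 1 by clear -st1 st0 s1 s0; apply/andP; split; lra.
have w2 : 0 < s * (1 + t / 2) < 1 by clear -st1 st0 s1 s0; apply/andP; split; lra.
set A1 := (X in Num.max X _); set A2 := (X in Num.max _ X).
have hA m : (m * D <= k)%N ->
   (m.+1 * D)%:R * (r / (1 - r)) + fair_slast R (k - m * D) n <= Num.max A1 A2.
  move=> mk; rewrite erho mulSn addnC natrD le_max.
  case: (leP (t * (s * s) * n%:R) (m * D)%:R) => hc; apply/orP; [right|left].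
    apply: (bottom_exit_real s01 t01 N0 D0 k1 k2 hD hc).
    have := fair_slast_le (k - m * D) n w1.
    by rewrite -subSn// natrB ?leqW.
  apply: (bottom_exit_near s01 t01 N0 D0 _ hD (ltW hc)) => //.
  exact: fair_slast_cols.
have hA' m : (m * D <= n)%N ->
   (m.+1 * D)%:R * (1 + r)^-1 + fair_slast R k (n - m * D) <= Num.max A1 A2.
  move=> mn; rewrite eu mulSn addnC natrD le_max.
  case: (leP (t * n%:R) (m * D)%:R) => hc; apply/orP; [right|left].
    apply: (left_exit_real s01 t01 N0 D0 k1 k2 hD hc).
    have := fair_slast_le k (n - m * D) w2.
    by rewrite natrB.
  apply: (left_exit_near s01 t01 N0 D0 _ hD (ltW hc)) => //.
  exact: fair_slast_rows.
have A10 : 0 <= A1.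
  by rewrite /A1 !addr_ge0// ?fair_slast_ge0 ?invr_ge0 ?mulr_ge0// ltW.
have Am0 : 0 <= Num.max A1 A2 by rewrite le_max A10.
have D00 : (0 < D)%N by [].
have := exit_bound r01 D00 D00 x0 Am0 hA hA'; rewrite -/v erho eu => /le_trans; apply.
by rewrite lerD2l; apply: exit_error.
Qed.

Lemma fair_slast_lower (a e : R) : 0 < a <= 4^-1 -> 0 < e -> exists n0, forall n k,
  (n0 <= n)%N -> k.+1%:R <= n%:R * a + 2 -> n%:R * a - 2 <= k.+1%:R ->
  n%:R * (2^-1 + Num.sqrt a - a / 2 - e) <= fair_slast R k n.
Proof.
move=> /andP[a0 a1] e0.
have s0 : 0 < Num.sqrt a by rewrite sqrtr_gt0.
have ss : a = Num.sqrt a * Num.sqrt a by rewrite -expr2 sqr_sqrtr// ltW.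
have s1 : Num.sqrt a <= 2^-1.
  by rewrite -(@ler_pXn2r R 2)// ?nnegrE ?invr_ge0 ?(ltW s0)// expr2 -ss; lra.
move: (Num.sqrt a) s0 ss s1 => s s0 ss s1; subst a; clear a0 a1.
have [t [t0 t1 te]] : exists t : R, [/\ 0 < t, t <= 1 & 3 * t <= e].
  exists (Num.min 1 (e / 3)); rewrite lt_min ltr01 divr_gt0// ge_min lexx; split => //.
  by have : Num.min 1 (e / 3) <= e / 3; [rewrite ge_min lexx orbT|lra].
have t01 : 0 < t <= 1 by rewrite t0.
have s01 : 0 < s <= 2^-1 by rewrite s0.
have [C0 alt] := exit_alternative s01 t01.
pose C : R := `|C0| + 6 / s.
have Cpos : 0 <= C by rewrite addr_ge0// divr_ge0// ltW.
have [n1 hn1] := sqrt_sublinear Cpos t0.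
have g0 : 0 < s * (t * t) / 32 by rewrite divr_gt0 ?mulr_gt0.
have [n2 hn2] := sqrt_sublinear Cpos g0.
exists (maxn (maxn n1 n2) 4) => n k; rewrite !geq_max -andbA => /and3P[/hn1 H1 /hn2 H2 n4] k1 k2.
have {alt} := alt n k n4 k1 k2.
have n4' : 4 <= n%:R :> R by rewrite (ler_nat R 4).
have x1 : 1 <= Num.sqrt n%:R :> R.
  by rewrite -[leLHS](sqrtr1 R) ler_wsqrtr// ler1n; apply: leq_trans n4.
have C0x : C0 * Num.sqrt n%:R <= `|C0| * Num.sqrt n%:R.
  by rewrite ler_wpM2r ?ler_norm// (le_trans _ x1).
have sx : 6 / s * 1 <= 6 / s * Num.sqrt n%:R by rewrite ler_wpM2l// divr_ge0// ltW.
have c0 : 0 <= `|C0| by [].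
move: H1 H2 C0x sx; rewrite /C; move: (`|C0|) c0 (Num.sqrt n%:R) x1 => E E0 x x1.
have rhoE : (1 - s) / (2 * s) = s^-1 / 2 - 2^-1 by field; rewrite gt_eqF.
have base : n%:R * (2^-1 + s - s * s / 2) - s^-1 <=
    k.+1%:R * ((1 - s) / (2 * s)) + n%:R * ((1 + s) / 2).
  have w0 : 0 <= (1 - s) / (2 * s) by rewrite divr_ge0 ?mulr_ge0// ?(ltW s0)//; lra.
  have : (n%:R * (s * s) - 2) * ((1 - s) / (2 * s)) <= k.+1%:R * ((1 - s) / (2 * s)).
    by rewrite ler_wpM2r.
  have -> : (n%:R * (s * s) - 2) * ((1 - s) / (2 * s)) =
     n%:R * (s / 2 - s * s / 2) - (s^-1 - 1) by field; rewrite gt_eqF.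
  move: (k.+1%:R * _) => z; lra.
have y2 : 2 <= s^-1 by rewrite -[2]invrK lef_pV2 ?posrE ?invr_gt0.
have gpos : 0 < n%:R * (s * (t * t)) by rewrite !mulr_gt0//; lra.
have tn : n%:R * (3 * t) <= n%:R * e by rewrite ler_wpM2l.
move: base; move: (k.+1%:R * _ + _) (fair_slast R k n) => L f base H1 H2 h3 h4.
move: (s^-1) y2 base h4 H1 H2 => y y2 base h4 H1 H2.
(* If the second argument is the maximum, its deficit of order [n] contradicts [base]; otherwise the
   first argument is the required bound. *)
rewrite maxEle; case: ifP => _ hb; clear -E0 x1 y2 gpos tn base H1 H2 h3 h4 hb n4'.
  by exfalso; lra.
lra.
Qed.

End FairLimit.

(** * Universality by row replacement *)

Section Lindeberg.
Variable R : realType.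

Lemma fact_ge_exp2 n : (2 ^ n.+1 <= (n.+3)`!)%N.
Proof.
elim: n => [|n IH] //; rewrite expnS factS.
by apply: leq_mul => //; lia.
Qed.

(** Proved for the partial sums, where the room left by [1 - 2 ^- n] absorbs the next term thanks to
    [fact_ge_exp2]. *)
Lemma expR_taylor2 (y : R) : `|y| <= 1 ->
  `|expR y - (1 + y + y ^+ 2 / 2)| <= `|y| ^+ 3.
Proof.
move=> y1.
pose s n := series (exp_coeff y) n.+3.
have s_cvg : s @ \oo --> expR y.
  have h : series (exp_coeff y) @ \oo --> expR y by exact: is_cvg_series_exp_coeff.
  rewrite (_ : s = fun n => series (exp_coeff y) (n + 3)%N).
    by rewrite (cvg_shiftn 3 (series (exp_coeff y))).
  by apply/funext => n; rewrite /s addn3.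
have sb n : `|s n - (1 + y + y ^+ 2 / 2)| <= `|y| ^+ 3 * (1 - 2 ^- n).
  elim: n => [|n IH].
    rewrite /s seriesEnat /= !big_nat_recr//= big_geq// /exp_coeff /= !factS fact0 /=.
    rewrite (_ : _ - _ = 0) ?normr0 ?expr0 ?invr1 ?subrr ?mulr0//.
    by rewrite !muln1; ring.
  have -> : s n.+1 = s n + exp_coeff y n.+3.
    by rewrite /s seriesSr.
  rewrite addrAC; apply: le_trans (ler_normD _ _) _.
  have h : `|exp_coeff y n.+3| <= `|y| ^+ 3 * 2 ^- n.+1.
    rewrite /exp_coeff /= normrM normrX normfV [`|_%:R|]ger0_norm//.
    have -> : `|y| ^+ n.+3 = `|y| ^+ 3 * `|y| ^+ n by rewrite -exprD.
    rewrite -mulrA ler_wpM2l// ?exprn_ge0//.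
    rewrite -[leRHS]mul1r ler_pM ?exprn_ge0 ?invr_ge0// ?exprn_ile1//.
    by rewrite lef_pV2 ?posrE ?exprn_gt0 ?ltr0n ?fact_gt0// -natrX ler_nat fact_ge_exp2.
  move: IH h; rewrite (_ : 2 ^- n = 2 ^- n.+1 + 2 ^- n.+1).
    by move: (2 ^- n.+1) (`|y| ^+ 3) => u w; lra.
  by rewrite exprS invfM; lra.
have c : (fun n => `|s n - (1 + y + y ^+ 2 / 2)|) @ \oo --> `|expR y - (1 + y + y ^+ 2 / 2)|.
  by apply: cvg_norm; apply: cvgB => //; exact: cvg_cst.
rewrite -(cvg_lim _ c)//; apply: limr_le; first by apply/cvg_ex; eexists; exact: c.
apply: nearW => n; apply: le_trans (sb n) _.
by rewrite ler_piMr ?exprn_ge0// gerBl invr_ge0 exprn_ge0.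
Qed.

(** Cumulant expansion to second order. The logarithm is never expanded: with [t = ln E], the
    exponentials of [t] and of the [y i] are expanded and compared. Both remainders and half the
    difference of [t ^+ 2] and [m1 ^+ 2] cost [B ^+ 3] each. *)
Lemma log_mean_exp (k : nat) (p y : nat -> R) (B : R) : 0 <= B <= 4^-1 ->
  (forall i, (i < k.+1)%N -> 0 <= p i) -> \sum_(i < k.+1) p i = 1 ->
  (forall i, (i < k.+1)%N -> `|y i| <= B) ->
  `|ln (\sum_(i < k.+1) p i * expR (y i)) - (\sum_(i < k.+1) p i * y i +
     (\sum_(i < k.+1) p i * y i ^+ 2 - (\sum_(i < k.+1) p i * y i) ^+ 2) / 2)| <= 3 * B ^+ 3.
Proof.
move=> /andP[B0 B1] p0 p1 yB.
set E := \sum_(i < k.+1) p i * expR (y i).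
set m1 := \sum_(i < k.+1) p i * y i; set m2 := \sum_(i < k.+1) p i * y i ^+ 2.
have wsum (f : nat -> R) c : (forall i, (i < k.+1)%N -> f i <= c) ->
    \sum_(i < k.+1) p i * f i <= c.
  move=> fc; rewrite -[leRHS]mul1r -p1 mulr_suml; apply: ler_sum => i _.
  by rewrite ler_wpM2l ?p0 ?fc.
have wsumN (f : nat -> R) c : (forall i, (i < k.+1)%N -> c <= f i) ->
    c <= \sum_(i < k.+1) p i * f i.
  move=> fc; rewrite -[leLHS]mul1r -p1 mulr_suml; apply: ler_sum => i _.
  by rewrite ler_wpM2l ?p0 ?fc.
have yb i : (i < k.+1)%N -> - B <= y i <= B by move=> ik; rewrite -ler_norml yB.
have E1 : expR (- B) <= E by apply: (wsumN (expR \o y)) => i /yb/andP[h _]; rewrite ler_expR.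
have E2 : E <= expR B by apply: (wsum (expR \o y)) => i /yb/andP[_ h]; rewrite ler_expR.
have E0 : 0 < E by apply: lt_le_trans E1; exact: expR_gt0.
set t := ln E.
have Et : expR t = E by rewrite lnK.
have tB : `|t| <= B.
  by rewrite ler_norml -ler_expR -(ler_expR t) Et E1.
have B1' : B <= 1 by lra.
have yt := expR_taylor2 (le_trans tB B1').
have m1B : `|m1| <= B.
  rewrite ler_norml; apply/andP; split; first by apply: wsumN => i /yb/andP[].
  by apply: wsum => i /yb/andP[].
have m2B : 0 <= m2 <= B ^+ 2.
  apply/andP; split; first by apply: (wsumN (fun i => y i ^+ 2)) => i _; rewrite sqr_ge0.
  apply: (wsum (fun i => y i ^+ 2)) => i ik; rewrite -real_normK ?num_real// lerXn2r ?nnegrE// yB//.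
have EE : `|E - (1 + m1 + m2 / 2)| <= B ^+ 3.
  have -> : E - (1 + m1 + m2 / 2) =
      \sum_(i < k.+1) p i * (expR (y i) - (1 + y i + y i ^+ 2 / 2)).
    rewrite /E /m1 /m2 -[X in _ - (X + _ + _)]p1 mulr_suml -!big_split -sumrB /=.
    by apply: eq_bigr => i _; ring.
  apply: le_trans (ler_norm_sum _ _ _) _.
  rewrite (eq_bigr (fun i : 'I_k.+1 => p i * `|expR (y i) - (1 + y i + y i ^+ 2 / 2)|)); last first.
    by move=> i _; rewrite normrM ger0_norm ?p0.
  apply: (wsum (fun i => `|expR (y i) - (1 + y i + y i ^+ 2 / 2)|)) => i ik.
  apply: le_trans (expR_taylor2 (le_trans (yB i ik) B1')) _.
  by rewrite lerXn2r ?nnegrE ?yB.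
have tB3 : `|t| ^+ 3 <= B ^+ 3 by rewrite lerXn2r ?nnegrE.
move: EE yt; rewrite -Et => EE /le_trans/(_ tB3) yt.
have t2 : 0 <= t ^+ 2 <= B ^+ 2.
  by rewrite sqr_ge0 -real_normK ?num_real//= lerXn2r ?nnegrE.
have B3 : 0 <= B ^+ 3 <= B ^+ 2 / 4.
  rewrite exprn_ge0//= exprS mulrC ler_wpM2l ?sqr_ge0//.
move: (expR t) EE yt => et EE yt.
have d1 : `|t - m1| <= B ^+ 2.
  move: EE yt m2B t2 B3; rewrite !ler_norml => /andP[? ?] /andP[? ?] /andP[? ?] /andP[? ?] /andP[? ?].
  by apply/andP; split; lra.
have d2 : `|t ^+ 2 - m1 ^+ 2| <= 2 * B ^+ 3.
  have -> : t ^+ 2 - m1 ^+ 2 = (t - m1) * (t + m1) by ring.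
  rewrite normrM (_ : 2 * B ^+ 3 = B ^+ 2 * (2 * B)); last by ring.
  rewrite ler_pM//; apply: le_trans (ler_normD _ _) _; lra.
move: EE yt d2; rewrite !ler_norml => /andP[? ?] /andP[? ?] /andP[? ?].
by apply/andP; split; lra.
Qed.

(** Row step of the partition function at inverse temperature [b]: a sum over column choices in
    place of the maximum of [sstep]. *)
Definition zstep (b : R) (q v : nat -> R) : nat -> R :=
  fun i => (\sum_(c < i.+1) q c) * expR (b * v i).

Definition zpart (b : R) (q : nat -> R) (rows : seq (nat -> R)) (k : nat) : R :=
  \sum_(i < k.+1) foldl (zstep b) q rows i.

(** The rows that follow act linearly on [q], so their effect is a vector of positive weights that
    does not depend on the row about to be exchanged. *)
Lemma zpart_linear b rows k : exists w : nat -> R, (forall i, 0 < w i) /\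
  forall q, zpart b q rows k = \sum_(i < k.+1) q i * w i.
Proof.
elim: rows => [|v rows [w [w0 hw]]].
  exists (fun=> 1); split => // q; rewrite /zpart /=.
  by apply: eq_bigr => i _; rewrite mulr1.
pose w' c := (\sum_(i < k.+1 | (c <= i)%N) expR (b * v i) * w i) + (k < c)%:R.
exists w'; split.
  move=> c; rewrite /w'; case: (ltnP k c) => kc.
    by rewrite addrC ltr_pwDl// sumr_ge0// => i _; rewrite mulr_ge0 ?expR_ge0// ltW.
  have kk : (k < k.+1)%N by [].
  rewrite addr0 (bigD1 (Ordinal kk))//= ltr_pwDl ?mulr_gt0 ?expR_gt0//.
  by rewrite sumr_ge0// => i _; rewrite mulr_ge0 ?expR_ge0// ltW.
move=> q; rewrite -[LHS]/(zpart b (zstep b q v) rows k) hw /zstep.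
transitivity (\sum_(i < k.+1) \sum_(c < k.+1 | (c <= i)%N) q c * (expR (b * v i) * w i)).
  apply: eq_bigr => i _; rewrite -mulrA mulr_suml.
  rewrite -(big_mkord xpredT (fun c => q c * (expR (b * v i) * w i))).
  rewrite (@big_nat_widen _ _ _ 0 i.+1 k.+1)//= big_mkord.
  by apply: eq_bigl => c; rewrite ltnS.
rewrite (exchange_big_dep xpredT)//=; apply: eq_bigr => c _.
rewrite /w' ltnNge -ltnS ltn_ord /= addr0 mulr_sumr.
by [].
Qed.

Lemma rmax_sum_exp (b : R) (g z : nat -> R) k : 0 <= b ->
  (forall i, (i <= k)%N -> expR (b * g i) <= z i) -> expR (b * rmax g k) <= \sum_(i < k.+1) z i.
Proof.
move=> b0 h; have [c ck ->] := rmax_ex g k.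
apply: le_trans (h c ck) _; have ck' : (c < k.+1)%N by [].
rewrite (bigD1 (Ordinal ck'))//= lerDl sumr_ge0// => i _.
by apply: le_trans (h i _); rewrite ?expR_ge0// -ltnS.
Qed.

(** The prefactor bounds the number of nondecreasing column choices by the generating function of
    binomial coefficients at [x]. Taking [x] equal to the slope later gives the right order of the
    entropy. *)
Lemma zpart_slast (b x : R) rows k : 0 <= b -> 0 < x < 1 ->
  expR (b * slast rows k) <= zpart b (fun i => (i == 0%N)%:R) rows k <=
  x^-1 ^+ k * (1 - x)^-1 ^+ size rows * expR (b * slast rows k).
Proof.
move=> b0 /andP[x0 x1]; rewrite /zpart /slast.
have x1' : 0 < 1 - x by rewrite subr_gt0.
elim/last_ind: rows k => [|rows v IH] k.
  rewrite /= (_ : rmax _ k = 0); last by elim: k => //= k ->; rewrite maxxx.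
  rewrite mulr0 expR0 (bigD1 ord0)//= big1 ?addr0; last first.
    by move=> i; rewrite -val_eqE /= => /negbTE ->.
  by rewrite lexx /= mulr1 mulr1 exprn_ege1// invf_ge1// ltW.
rewrite !foldl_rcons size_rcons.
set s := foldl _ _ _ in IH *; set z := foldl (zstep b) _ _ in IH *.
have e i : expR (b * sstep s v i) = expR (b * rmax s i) * expR (b * v i).
  by rewrite /sstep mulrDr expRD.
apply/andP; split.
  apply: rmax_sum_exp => // i _; rewrite e /zstep ler_wpM2r ?expR_ge0//.
  by have /andP[] := IH i.
set X := x^-1; set Y := (1 - x)^-1 ^+ size rows.
have Y0 : 0 <= Y by rewrite exprn_ge0// invr_ge0 ltW.
have X0 : 0 < X by rewrite invr_gt0.
apply: (@le_trans _ _ (\sum_(i < k.+1) X ^+ i * (Y * expR (b * rmax (sstep s v) k)))).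
  apply: ler_sum => i _; rewrite /zstep.
  apply: (@le_trans _ _ (X ^+ i * Y * expR (b * rmax s i) * expR (b * v i))).
    by rewrite ler_wpM2r ?expR_ge0//; have /andP[] := IH i.
  rewrite -!mulrA -e ler_wpM2l ?exprn_ge0 ?(ltW X0)// ler_wpM2l// ler_expR ler_wpM2l//.
  by apply: rmax_ge; rewrite -ltnS.
have -> : X ^+ k * (1 - x)^-1 ^+ (size rows).+1 * expR (b * rmax (sstep s v) k) =
    (X ^+ k * (1 - x)^-1) * (Y * expR (b * rmax (sstep s v) k)).
  by rewrite exprS -/Y; ring.
rewrite -mulr_suml ler_wpM2r//; first by rewrite mulr_ge0 ?expR_ge0.
elim: k => [|k IHk].
  by rewrite big_ord1 !expr0 mul1r invf_ge1// gerBl ltW.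
rewrite big_ord_recr /=; apply: (@le_trans _ _ (X ^+ k * (1 - x)^-1 + X ^+ k.+1)).
  by rewrite lerD2r.
rewrite exprS le_eqVlt; apply/orP; left; apply/eqP; rewrite /X; field.
by rewrite (gt_eqF x0) (gt_eqF x1').
Qed.

Lemma Ex_le_cst (A : Type) (l : law R A) h (c : R) : lpos l -> mass l = 1 ->
  (forall a, h a <= c) -> Ex l h <= c.
Proof. by move=> l0 l1 hc; rewrite -[leRHS]mul1r -[X in X * _]l1 -Ex_cst; apply: le_Ex. Qed.

(** [s2] and [c] are uncentred: the second moment of an entry and the mean product of two distinct
    entries. Independence within a row is not part of the record, since averaging over the
    environment destroys it. *)
Record row_moments (A : Type) (l : law R A) (val : A -> nat -> R) (k : nat)
    (mu s2 c B : R) : Prop := RowMoments {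
  rm_pos : lpos l;
  rm_mass : mass l = 1;
  rm_mean : forall i, (i <= k)%N -> Ex l (val^~ i) = mu;
  rm_sqr : forall i, (i <= k)%N -> Ex l (fun a => val a i ^+ 2) = s2;
  rm_cov : forall i j, (i <= k)%N -> (j <= k)%N -> i != j ->
    Ex l (fun a => val a i * val a j) = c;
  rm_bound : forall a i, `|val a i| <= B }.

Section Replacement.
Variables (k : nat) (b mu sg2 B : R).
Hypotheses (b0 : 0 < b) (B0 : 0 <= B) (bB : b * B <= 4^-1).

(** The weights [p i = w i / W] sum to 1, so the variance of the row under [p] has mean
    [s2 - (c + (s2 - c) * sum p^2)]. Hence only [mu] and [s2 - c] survive: the common covariance
    cancels. *)
Lemma row_expansion (A : Type) (l : law R A) val s2 c (w : nat -> R) (W : R) :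
  row_moments l val k mu s2 c B -> s2 - c = sg2 -> (forall i, 0 < w i) ->
  W = \sum_(i < k.+1) w i ->
  `|Ex l (fun a => ln (\sum_(i < k.+1) w i * expR (b * val a i))) -
    (ln W + b * mu + b ^+ 2 / 2 * (sg2 * (1 - \sum_(i < k.+1) (w i / W) ^+ 2)))|
  <= 3 * (b * B) ^+ 3.
Proof.
move=> [l0 l1 hm hs hc hB] hsg w0 hW.
have W0 : 0 < W.
  by rewrite hW big_ord_recl ltr_pwDl ?w0// sumr_ge0// => i _; rewrite ltW.
pose p i := w i / W.
have p0 i : (i < k.+1)%N -> 0 <= p i by move=> _; rewrite divr_ge0 ?ltW.
have p1 : \sum_(i < k.+1) p i = 1 by rewrite -mulr_suml -hW divff// gt_eqF.
pose M1 a := \sum_(i < k.+1) p i * (b * val a i).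
pose M2 a := \sum_(i < k.+1) p i * (b * val a i) ^+ 2.
have EM1 : Ex l M1 = b * mu.
  rewrite /M1 Ex_sum (eq_bigr (fun i : 'I_k.+1 => p i * (b * mu))).
    by rewrite -mulr_suml p1 mul1r.
  by move=> i _; rewrite !ExZ hm// -ltnS.
have EM2 : Ex l M2 = b ^+ 2 * s2.
  rewrite /M2 Ex_sum (eq_bigr (fun i : 'I_k.+1 => p i * (b ^+ 2 * s2))).
    by rewrite -mulr_suml p1 mul1r.
  move=> i _; have ik : (i <= k)%N by rewrite -ltnS.
  rewrite ExZ; congr (_ * _); rewrite -(hs i ik) -ExZ.
  by apply: eq_Ex => a; rewrite exprMn.
have EM3 : Ex l (fun a => M1 a ^+ 2) = b ^+ 2 * (c + sg2 * \sum_(i < k.+1) p i ^+ 2).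
  rewrite (@eq_Ex _ _ _ _ (fun a => \sum_(i < k.+1) \sum_(j < k.+1)
      (b ^+ 2 * p i * p j) * (val a i * val a j))); last first.
    move=> a; rewrite /M1 expr2 mulr_suml; apply: eq_bigr => i _; rewrite mulr_sumr.
    by apply: eq_bigr => j _; ring.
  rewrite Ex_sum (eq_bigr (fun i : 'I_k.+1 => b ^+ 2 * (p i * c + sg2 * p i ^+ 2))).
    by rewrite -mulr_sumr big_split /= -mulr_suml p1 mul1r -mulr_sumr.
  move=> i _; have ik : (i <= k)%N by rewrite -ltnS.
  rewrite Ex_sum (bigD1 i)//= ExZ.
  rewrite (eq_bigr (fun j : 'I_k.+1 => b ^+ 2 * p i * c * p j)); last first.
    move=> j ji; have jk : (j <= k)%N by rewrite -ltnS.
    by rewrite ExZ hc//; [ring|rewrite eq_sym; exact: ji].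
  rewrite -mulr_sumr (_ : \sum_(j < k.+1 | j != i) p j = 1 - p i); last first.
    by rewrite -p1 [in RHS](bigD1 i)//= addrAC subrr add0r.
  rewrite (_ : Ex l (fun a => val a i * val a i) = s2); last by rewrite -(hs i ik).
  by rewrite -hsg; ring.
have EQ : Ex l (fun a => M1 a + (M2 a - M1 a ^+ 2) / 2) =
    b * mu + b ^+ 2 / 2 * (sg2 * (1 - \sum_(i < k.+1) p i ^+ 2)).
  rewrite ExD EM1 (@eq_Ex _ _ _ (fun a => _ / 2) (fun a => 2^-1 * (M2 a - M1 a ^+ 2))).
    by rewrite ExZ ExB EM2 EM3 -hsg; field.
  by move=> a; rewrite mulrC.
have -> : Ex l (fun a => ln (\sum_(i < k.+1) w i * expR (b * val a i))) -
    (ln W + b * mu + b ^+ 2 / 2 * (sg2 * (1 - \sum_(i < k.+1) (w i / W) ^+ 2))) =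
  Ex l (fun a => ln (\sum_(i < k.+1) p i * expR (b * val a i)) -
    (M1 a + (M2 a - M1 a ^+ 2) / 2)).
  rewrite ExB EQ -addrA opprD addrA; congr (_ - _).
  rewrite -[ln W]mul1r -[X in X * ln W]l1 -Ex_cst -ExB; apply: eq_Ex => a.
  have e0 : 0 < \sum_(i < k.+1) p i * expR (b * val a i).
    rewrite big_ord_recl; apply: ltr_pwDl; first by rewrite mulr_gt0 ?expR_gt0// divr_gt0.
    by apply: sumr_ge0 => i _; rewrite mulr_ge0 ?expR_ge0// divr_ge0 ?ltW.
  rewrite (_ : \sum_(i < k.+1) w i * expR (b * val a i) =
     W * \sum_(i < k.+1) p i * expR (b * val a i)).
    by rewrite lnM ?posrE// addrAC subrr add0r.
  rewrite mulr_sumr; apply: eq_bigr => i _.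
  by rewrite /p; field; rewrite gt_eqF.
apply: le_trans (Ex_norm _ l0) _.
apply: Ex_le_cst => // a.
apply: (@log_mean_exp k p (fun i => b * val a i)) => //.
  by rewrite bB mulr_ge0// ltW.
by move=> i _; rewrite normrM gtr0_norm// ler_wpM2l// ltW.
Qed.

Lemma row_swap (A A' : Type) (l : law R A) (l' : law R A') val val' s2 c s2' c' (w : nat -> R) :
  row_moments l val k mu s2 c B -> row_moments l' val' k mu s2' c' B ->
  s2 - c = sg2 -> s2' - c' = sg2 -> (forall i, 0 < w i) ->
  `|Ex l (fun a => ln (\sum_(i < k.+1) w i * expR (b * val a i))) -
    Ex l' (fun a => ln (\sum_(i < k.+1) w i * expR (b * val' a i)))| <= 6 * (b * B) ^+ 3.
Proof.
move=> h h' e e' w0; have := row_expansion h e w0 erefl; have := row_expansion h' e' w0 erefl.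
move: (Ex l _) (Ex l' _) => x y /=; set z := (_ + _ * (_ * _)).
rewrite !ler_norml => /andP[? ?] /andP[? ?]; apply/andP; split; lra.
Qed.

(** Telescoping through [mid], which keeps the first row of the original law and takes all others
    from the new one; the first row is exchanged last, against the linear weights of the rows that
    follow. *)
Lemma lindeberg_log (A A' : Type) (l : law R A) (l' : law R A') val val' s2 c s2' c' n q :
  row_moments l val k mu s2 c B -> row_moments l' val' k mu s2' c' B ->
  s2 - c = sg2 -> s2' - c' = sg2 -> (forall i, 0 <= q i) -> 0 < q 0%N ->
  `|El (nseq n l) (fun s => ln (zpart b q (map val s) k)) -
    El (nseq n l') (fun s => ln (zpart b q (map val' s) k))| <= n%:R * (6 * (b * B) ^+ 3).
Proof.
move=> h h' e e'; elim: n q => [|n IH] q q0 q00 /=; first by rewrite subrr normr0 mul0r.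
have l0 := rm_pos h; have l1 := rm_mass h; have l0' := rm_pos h'; have l1' := rm_mass h'.
set err := 6 * _ in IH *.
have zq v : (forall i, 0 <= zstep b q v i) /\ 0 < zstep b q v 0%N.
  split=> [i|]; first by rewrite mulr_ge0 ?expR_ge0// sumr_ge0.
  by rewrite mulr_gt0 ?expR_gt0// big_ord1.
pose mid := Ex l (fun a => El (nseq n l') (fun s =>
  ln (zpart b (zstep b q (val a)) (map val' s) k))).
have h1 : `|Ex l (fun a => El (nseq n l) (fun s =>
  ln (zpart b q (val a :: map val s) k))) - mid| <= n%:R * err.
  rewrite -ExB; apply: le_trans (Ex_norm _ l0) _.
  apply: Ex_le_cst => // a.
  by have [z0 z00] := zq (val a); exact: IH.
have h2 : `|mid - Ex l' (fun a => El (nseq n l') (fun s =>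
  ln (zpart b q (val' a :: map val' s) k)))| <= err.
  rewrite /mid !Ex_El -ElB; apply: le_trans (El_norm _ _) _; first exact: lpos_nseq.
  have -> : err = El (nseq n l') (fun=> err) by rewrite El_cst prod_mass_nseq l1' expr1n mul1r.
  apply: le_El => [|s]; first exact: lpos_nseq.
  have [w [w0 hw]] := zpart_linear b (map val' s) k.
  rewrite (@eq_Ex _ _ l _ (fun a => ln (\sum_(i < k.+1)
     ((\sum_(c < i.+1) q c) * w i) * expR (b * val a i)))); last first.
    by move=> a; rewrite hw; congr ln; apply: eq_bigr => i _; rewrite /zstep mulrAC.
  rewrite (@eq_Ex _ _ l' _ (fun a => ln (\sum_(i < k.+1)
     ((\sum_(c < i.+1) q c) * w i) * expR (b * val' a i)))); last first.
    move=> a; rewrite -[zpart _ _ (_ :: _) _]/(zpart b (zstep b q (val' a)) (map val' s) k) hw.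
    by congr ln; apply: eq_bigr => i _; rewrite /zstep mulrAC.
  apply: (row_swap (w := fun i => (\sum_(c < i.+1) q c) * w i) h h' e e') => i.
  by rewrite mulr_gt0// big_ord_recl ltr_pwDl// sumr_ge0.
rewrite -natr1 mulrDl mul1r.
apply: le_trans (ler_distD mid _ _) _.
by apply: lerD.
Qed.

(** [zpart_slast] turns the comparison of free energies into one of maxima, at the price of the
    entropy divided by [b]. *)
Lemma lindeberg (A A' : Type) (l : law R A) (l' : law R A') val val' s2 c s2' c' n (x : R) :
  row_moments l val k mu s2 c B -> row_moments l' val' k mu s2' c' B ->
  s2 - c = sg2 -> s2' - c' = sg2 -> 0 < x < 1 ->
  `|El (nseq n l) (fun s => slast (map val s) k) -
    El (nseq n l') (fun s => slast (map val' s) k)| <=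
  n%:R * (6 * b ^+ 2 * B ^+ 3) + (k%:R * ln x^-1 + n%:R * ln (1 - x)^-1) / b.
Proof.
move=> h h' e e' x01; have [x0 x1] := andP x01.
set L := k%:R * _ + _.
have sand (C : Type) (l1 : law R C) (f : C -> nat -> R) : lpos l1 -> mass l1 = 1 ->
  b * El (nseq n l1) (fun s => slast (map f s) k) <=
  El (nseq n l1) (fun s => ln (zpart b (fun i => (i == 0%N)%:R) (map f s) k)) <=
  b * El (nseq n l1) (fun s => slast (map f s) k) + L.
  move=> p1 m1.
  have m1' c1 : El (nseq n l1) (fun=> c1) = c1 by rewrite El_cst prod_mass_nseq m1 expr1n mul1r.
  rewrite -[X in _ <= _ + X](m1' L) -!ElZ -ElD; apply/andP; split; apply: le_El_size; rewrite ?lpos_nseq//.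
    move=> s _; have /andP[z1 _] := zpart_slast (map f s) k (ltW b0) x01.
    by rewrite -ler_expR lnK ?posrE// (lt_le_trans _ z1)// expR_gt0.
  move=> s; rewrite size_nseq => ss; have /andP[z1 z2] := zpart_slast (map f s) k (ltW b0) x01.
  have x1' : 0 < 1 - x by rewrite subr_gt0.
  rewrite -ler_expR lnK ?posrE ?(lt_le_trans _ z1) ?expR_gt0//.
  apply: le_trans z2 _; rewrite expRD mulrC ler_wpM2l ?expR_ge0// size_map ss.
  by rewrite /L expRD !expRM_natl !lnK ?posrE ?invr_gt0.
have q0 i : 0 <= ((i == 0%N)%:R : R) by [].
have := lindeberg_log n h h' e e' q0 ltr01.
have /andP[s1 s2'' ] := sand _ l val (rm_pos h) (rm_mass h).
have /andP[s3 s4] := sand _ l' val' (rm_pos h') (rm_mass h').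
have -> : n%:R * (6 * (b * B) ^+ 3) = b * (n%:R * (6 * b ^+ 2 * B ^+ 3)) by ring.
rewrite !ler_norml => /andP[d1 d2].
have bL : b * (L / b) = L by rewrite mulrCA divff ?mulr1// gt_eqF.
move: bL s1 s2'' s3 s4 d1 d2; move: (L / b) (L) => z y bL.
move: (El _ _) (El _ _) (El _ _) (El _ _) => e1 e2 e3 e4 s1 s2'' s3 s4 d1 d2.
clear -b0 bL s1 s2'' s3 s4 d1 d2.
by apply/andP; split; rewrite -(ler_pM2l b0); lra.
Qed.

End Replacement.
End Lindeberg.

Section FairComparison.
Variable R : realType.

Lemma El_nth (A : Type) (x0 : A) M (l : law R A) i h : mass l = 1 -> (i < M)%N ->
  El (nseq M l) (fun s => h (nth x0 s i)) = Ex l h.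
Proof.
move=> l1; elim: M i => [|M IH] [|i] //= iM.
  by apply: eq_Ex => a; rewrite El_cst prod_mass_nseq l1 expr1n mul1r.
by rewrite IH// Ex_cst l1 mul1r.
Qed.

Lemma El_nth2 (A : Type) (x0 : A) M (l : law R A) i j f g : mass l = 1 ->
  (i < M)%N -> (j < M)%N -> i != j ->
  El (nseq M l) (fun s => f (nth x0 s i) * g (nth x0 s j)) = Ex l f * Ex l g.
Proof.
move=> l1; elim: M i j => [|M IH] [|i] [|j] //= iM jM ij.
- rewrite mulrC -ExZ; apply: eq_Ex => a; rewrite ElZ (El_nth x0 g l1)//.
  by rewrite mulrC.
- rewrite -ExZ; apply: eq_Ex => a.
  rewrite (@eq_El _ _ _ _ (fun s => g a * f (nth x0 s i))) ?ElZ ?(El_nth x0 f l1) 1?mulrC//.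
  by move=> s; rewrite mulrC.
- by rewrite IH// Ex_cst l1 mul1r.
Qed.

Lemma rmax_affine (al be : R) g k : 0 <= al ->
  rmax (fun i => al * g i + be) k = al * rmax g k + be.
Proof. by move=> al0; elim: k => //= k ->; rewrite maxr_pMr// addr_maxl. Qed.

Lemma slast_affine (al be : R) rows k : 0 <= al ->
  slast (map (fun v : nat -> R => fun i => al * v i + be) rows) k =
  al * slast rows k + (size rows)%:R * be.
Proof.
move=> al0; rewrite /slast.
suff H (g : nat -> R) b0 : foldl (@sstep R) (fun i => al * g i + b0)
    (map (fun v : nat -> R => fun i => al * v i + be) rows) =
    fun i => al * foldl (@sstep R) g rows i + (b0 + (size rows)%:R * be).
  have := H (fun=> 0) 0; rewrite add0r => {H} H.
  rewrite -(rmax_affine _ (foldl (@sstep R) (fun=> 0) rows) k al0) -H.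
  by congr (rmax (foldl _ _ _) _); apply/funext => i; rewrite mulr0 add0r.
elim: rows g b0 => [|v rows IH] g b0 /=.
  by apply/funext => i; rewrite mul0r addr0.
rewrite -[(size rows).+1%:R]natr1 mulrDl mul1r [_ + be]addrC addrA -IH.
congr foldl; apply/funext => i; rewrite /sstep rmax_affine//; ring.
Qed.

Lemma Ex_rowlaw_nth k i h : (i <= k)%N ->
  Ex (rowlaw R k.+1) (fun e => h (nth false e i)) = Ex (ber (fairp R)) h.
Proof. by move=> ik; rewrite Ex_Lseq (El_nth false)// mass_ber. Qed.

Lemma sign_moments k (mu sg B : R) : 0 <= sg -> `|mu| + sg <= B ->
  row_moments (rowlaw R k.+1) (fun e i => 2 * sg * brow R e i + (mu - sg)) k mu
    (mu ^+ 2 + sg ^+ 2) (mu ^+ 2) B.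
Proof.
move=> sg0 hB; split.
- exact: lpos_rowlaw.
- exact: mass_rowlaw.
- move=> i ik; rewrite (Ex_rowlaw_nth (fun e : bool => 2 * sg * e%:R + (mu - sg)))//.
  by rewrite Ex_ber /fairp /=; field.
- move=> i ik; rewrite (Ex_rowlaw_nth (fun e : bool => (2 * sg * e%:R + (mu - sg)) ^+ 2))//.
  by rewrite Ex_ber /fairp /=; field.
- move=> i j ik jk ij; rewrite Ex_Lseq.
  rewrite (El_nth2 false (fun e : bool => 2 * sg * e%:R + (mu - sg))
    (fun e : bool => 2 * sg * e%:R + (mu - sg)) (mass_ber _))//.
  by rewrite !Ex_ber /fairp /=; field.
- move=> e i; apply: le_trans hB; rewrite /brow; case: nth => /=.
    have -> : 2 * sg * 1 + (mu - sg) = mu + sg by ring.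
    by apply: le_trans (ler_normD _ _) _; rewrite (ger0_norm sg0).
  rewrite mulr0 add0r; apply: le_trans (ler_normB _ _) _.
  by rewrite (ger0_norm sg0).
Qed.

Lemma lindeberg_fair (A : Type) (l : law R A) val k (mu s2 c sg B b x : R) n :
  0 < b -> b * B <= 4^-1 -> 0 < x < 1 -> 0 <= sg -> `|mu| + sg <= B ->
  s2 - c = sg ^+ 2 -> row_moments l val k mu s2 c B ->
  `|El (nseq n l) (fun s => slast (map val s) k) -
    (n%:R * mu + sg * (2 * fair_slast R k n - n%:R))| <=
  n%:R * (6 * b ^+ 2 * B ^+ 3) + (k%:R * ln x^-1 + n%:R * ln (1 - x)^-1) / b.
Proof.
move=> b0 bB x01 sg0 hB e h.
have B0 : 0 <= B by apply: le_trans hB; rewrite addr_ge0.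
have h' := sign_moments k sg0 hB.
have e' : mu ^+ 2 + sg ^+ 2 - mu ^+ 2 = sg ^+ 2 by ring.
have := lindeberg b0 B0 bB n h h' e e' x01.
set E' := El (nseq n (rowlaw R k.+1)) _.
suff -> : E' = n%:R * mu + sg * (2 * fair_slast R k n - n%:R) by [].
transitivity (El (nseq n (rowlaw R k.+1)) (fun s => 2 * sg * bslast R s k + n%:R * (mu - sg))).
  apply: eq_El_size => s; rewrite size_nseq => ss.
  have := @slast_affine (2 * sg) (mu - sg) (map (brow R) s) k.
  by rewrite size_map ss -map_comp => <-//; rewrite mulr_ge0.
rewrite ElD ElZ El_cst prod_mass_nseq mass_rowlaw expr1n mul1r -/(fair_slast R k n).
by ring.
Qed.

End FairComparison.

(** * Inhomogeneous Bernoulli rows: bounds affine in the row parameters *)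

Section BernoulliTails.
Variable R : realType.

(** The optimal [t = sqrt (y / x)] degenerates when [x] or [y] vanishes, so the quotient
    [(sqrt y + f) / (sqrt x + f)] is used with a small [f]. *)
Lemma optimise (A B C x y : R) : 0 <= C -> 0 <= x -> 0 <= y ->
  (forall t, 0 < t -> A <= B + C * (x * t + y / t)) -> A <= B + 2 * C * Num.sqrt (x * y).
Proof.
move=> C0 x0 y0 h.
suff H e : 0 < e -> A <= B + 2 * C * Num.sqrt (x * y) + 2 * C * e.
  case: (ltP 0 C) => [C1|]; last first.
    move=> C1; have C00 : C = 0 by lra.
    by have := H 1 ltr01; rewrite C00; lra.
  apply/ler_addgt0Pr => e e0; apply: le_trans (H (e / (2 * C)) _) _.
    by rewrite divr_gt0// mulr_gt0.
  by rewrite lerD2l [2 * C * _]mulrC divfK// gt_eqF// mulr_gt0.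
move=> e0.
pose sx := Num.sqrt x; pose sy := Num.sqrt y.
have sx0 : 0 <= sx by rewrite sqrtr_ge0.
have sy0 : 0 <= sy by rewrite sqrtr_ge0.
have xs : x = sx ^+ 2 by rewrite sqr_sqrtr.
have ys : y = sy ^+ 2 by rewrite sqr_sqrtr.
have -> : Num.sqrt (x * y) = sx * sy by rewrite sqrtrM.
have [f [f0 fe]] : exists f : R, 0 < f /\ (sx + sy + f) * f <= e.
  exists (Num.min 1 (e / (sx + sy + 1))).
  have d0 : 0 < sx + sy + 1 by rewrite ltr_wpDl// addr_ge0.
  split; first by rewrite lt_min ltr01 divr_gt0.
  set m := Num.min _ _.
  have m1 : m <= 1 by rewrite ge_min lexx.
  have m2 : m <= e / (sx + sy + 1) by rewrite ge_min lexx orbT.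
  have m0 : 0 <= m by rewrite le_min ler01 divr_ge0// ltW.
  apply: (@le_trans _ _ ((sx + sy + 1) * m)); first by rewrite ler_wpM2r// lerD2l.
  by rewrite mulrC -ler_pdivlMr.
have t0 : 0 < (sy + f) / (sx + f) by rewrite divr_gt0// ltr_wpDl.
have fx : 0 < sx + f by rewrite ltr_wpDl.
have fy : 0 < sy + f by rewrite ltr_wpDl.
apply: le_trans (h _ t0) _; rewrite -addrA lerD2l -mulrDr.
rewrite [2 * C]mulrC -mulrA ler_wpM2l//.
have a1 : x * ((sy + f) / (sx + f)) <= sx * (sy + f).
  rewrite mulrA ler_pdivrMr// xs; have : 0 <= sx * (sy + f) * f by rewrite !mulr_ge0// ltW.
  lra.
have a2 : y / ((sy + f) / (sx + f)) <= sy * (sx + f).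
  rewrite invf_div mulrA ler_pdivrMr// ys.
  have : 0 <= sy * (sx + f) * f by rewrite !mulr_ge0// ltW.
  lra.
have ff : 0 <= f * f by rewrite mulr_ge0// ltW.
move: a1 a2 fe; lra.
Qed.

Lemma sum_le_linear (ps : seq R) (f : R -> R) (a c : R) :
  {in ps, forall p, f p <= a + c * p} ->
  \sum_(p <- ps) f p <= (size ps)%:R * a + c * \sum_(p <- ps) p.
Proof.
elim: ps => [|p ps IH] h /=; first by rewrite !big_nil mul0r mulr0 addr0.
rewrite !big_cons -natr1.
have := h p (mem_head _ _).
have : \sum_(p <- ps) f p <= (size ps)%:R * a + c * \sum_(p <- ps) p.
  by apply: IH => q qs; apply: h; rewrite inE qs orbT.
lra.
Qed.

Lemma EB_mono M ps h h' : {in ps, forall p : R, 0 <= p <= 1} ->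
  (forall s, size s = size ps -> h s <= h' s) -> EB M ps h <= EB M ps h'.
Proof.
elim: ps h h' => [|p ps IH] h h' hp hh /=; first exact: hh.
apply: le_El => [|e].
  by apply/lpos_nseq/lpos_ber/hp; rewrite mem_head.
by apply: IH => [q qs|s ss]; [apply: hp; rewrite inE qs orbT|apply: hh; rewrite /= ss].
Qed.

Lemma EB_cst M ps (c : R) : EB M ps (fun=> c) = c.
Proof.
elim: ps => [|p ps IH] //=.
by rewrite IH El_cst prod_mass_nseq mass_ber expr1n mul1r.
Qed.

Lemma tlast_brow_le (s : seq (seq bool)) k : tlast (map (brow R) s) k <= k.+1%:R.
Proof.
rewrite /tlast; suff H t : (forall i, t i <= i.+1%:R) ->
   forall i, foldl (@tstep R) t (map (brow R) s) i <= i.+1%:R by apply: H.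
elim: s t => [|e s IH] t ht //=; apply: IH.
elim=> [|i IHi] /=; first by rewrite ge_max ht brow_le1.
by rewrite ge_max ht andbT -natr1 lerD// brow_le1.
Qed.

Lemma bslast_le_size (s : seq (seq bool)) k : bslast R s k <= (size s)%:R.
Proof.
elim/last_ind: s k => [|s e IH] k.
  by rewrite /bslast /slast /=; apply: rmax_le.
rewrite /bslast map_rcons slast_rcons size_rcons; apply: rmax_le => c _.
by rewrite -natr1 lerD// ?brow_le1//; exact: IH.
Qed.

(** [EB_slast_le] with the column cost [r / (1 - r)] at most [t]: [r = 1 - t^-1] for large [t] and
    [r = t / 4] for small [t]. The bound is affine in the sum of the row parameters, so its mean
    over the environment is explicit. *)
Lemma EB_slast_tail k ps (t : R) : {in ps, forall p, 0 <= p <= 1} -> 0 < t ->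
  EB k.+1 ps (fun s => slast (map (brow R) s) k) <=
  \sum_(p <- ps) p + 4 * (k.+1%:R * t + (\sum_(p <- ps) p) / t).
Proof.
move=> hp t0.
have S0 : 0 <= \sum_(p <- ps) p.
  by rewrite big_seq sumr_ge0// => p /hp/andP[].
have kt : 0 <= k.+1%:R * t by rewrite mulr_ge0// ltW.
have St : 0 <= (\sum_(p <- ps) p) / t by rewrite divr_ge0// ltW.
case: (leP 2 t) => t2.
- have ti : t^-1 <= 2^-1 by rewrite lef_pV2 ?posrE.
  have ti0 : 0 < t^-1 by rewrite invr_gt0.
  have r01 : 0 < 1 - t^-1 < 1 by apply/andP; split; lra.
  apply: le_trans (EB_slast_le k r01 hp) _.
  have e1 : (1 - t^-1) / (1 - (1 - t^-1)) = t - 1.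
    have -> : 1 - (1 - t^-1) = t^-1 by ring.
    by rewrite invrK mulrBl mul1r mulVf ?gt_eqF.
  have h : {in ps, forall p, p / (p + (1 - t^-1) * (1 - p)) <= 0 + (1 + 2 * t^-1) * p}.
    move=> p /hp/andP[p0 p1].
    have d0 : 0 < p + (1 - t^-1) * (1 - p).
      have : 0 <= t^-1 * p by rewrite mulr_ge0// ltW.
      lra.
    rewrite add0r ler_pdivrMr// mulrAC ler_peMl//.
    have a1 : 0 <= t^-1 * p by rewrite mulr_ge0// ltW.
    have a2 : t^-1 * t^-1 <= 2^-1 * t^-1 by rewrite ler_wpM2r// ltW.
    have a3 : 0 <= t^-1 * t^-1 * p by rewrite !mulr_ge0// ltW.
    lra.
  have := sum_le_linear h; rewrite mulr0 add0r e1 => h'.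
  have : (1 + 2 * t^-1) * \sum_(p <- ps) p = \sum_(p <- ps) p + 2 * ((\sum_(p <- ps) p) / t).
    by ring.
  have k0 : 0 <= k.+1%:R :> R by [].
  move: h'; lra.
- pose r := t / 4.
  have r0 : 0 < r by rewrite divr_gt0.
  have r1 : r < 2^-1 by rewrite /r; lra.
  have r01 : 0 < r < 1 by rewrite r0; lra.
  apply: le_trans (EB_slast_le k r01 hp) _.
  have h : {in ps, forall p, p / (p + r * (1 - p)) <= 0 + r^-1 * p}.
    move=> p /hp/andP[p0 p1].
    have rp : 0 <= (1 - r) * p by rewrite mulr_ge0//; lra.
    have d0 : 0 < p + r * (1 - p) by lra.
    rewrite add0r ler_pdivrMr// mulrAC ler_peMl// mulrC ler_pdivlMr// mul1r; lra.
  have := sum_le_linear h; rewrite mulr0 add0r => h'.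
  have e1 : r^-1 * \sum_(p <- ps) p = 4 * ((\sum_(p <- ps) p) / t).
    by rewrite /r; field; rewrite gt_eqF.
  have : r / (1 - r) <= t.
    have r1' : 0 < 1 - r by lra.
    have tt : t * t <= t * 2 by rewrite ler_wpM2l// ltW.
    by rewrite ler_pdivrMr// /r; lra.
  move=> h2; have : k.+1%:R * (r / (1 - r)) <= k.+1%:R * t by rewrite ler_wpM2l.
  move: h'; rewrite e1; lra.
Qed.

(** [EB_tlast_le] at [u = b + t], where the distance of [u] to every row parameter is at least [t].
    If [b + t] exceeds 1, the number of columns is already a sufficient bound. *)
Lemma EB_tlast_tail k ps (b t : R) : 0 <= b -> {in ps, forall p, 0 <= p <= b} ->
  {in ps, forall p, p <= 1} -> 0 < t ->
  EB k.+1 ps (fun s => tlast (map (brow R) s) k) <=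
  k.+1%:R * b + (k.+1%:R * t + (\sum_(p <- ps) p) / t).
Proof.
move=> b0 hp hp1 t0.
have hp' : {in ps, forall p, 0 <= p <= 1}.
  by move=> p pps; have /andP[-> _] := hp p pps; exact: hp1.
have S0 : 0 <= \sum_(p <- ps) p.
  by rewrite big_seq sumr_ge0// => p /hp/andP[].
have St : 0 <= (\sum_(p <- ps) p) / t by rewrite divr_ge0// ltW.
case: (leP (b + t) 1) => bt; last first.
  apply: (@le_trans _ _ k.+1%:R).
    by rewrite -[leRHS](EB_cst k.+1 ps); apply: EB_mono => // s _; exact: tlast_brow_le.
  have : k.+1%:R * 1 <= k.+1%:R * (b + t) by rewrite ler_wpM2l// ltW.
  lra.
have u01 : 0 < b + t <= 1 by rewrite bt ltr_wpDl.
have hpu : {in ps, forall p, 0 <= p < b + t}.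
  by move=> p /hp/andP[-> pb]; rewrite (le_lt_trans pb)// ltrDl.
apply: le_trans (EB_tlast_le k u01 hpu) _; rewrite mulrDr -addrA lerD2l lerD2l.
have h : {in ps, forall p, p * (1 - (b + t)) / (b + t - p) <= 0 + t^-1 * p}.
  move=> p /hp/andP[p0 pb].
  have d0 : 0 < b + t - p by lra.
  rewrite add0r ler_pdivrMr// [t^-1 * p]mulrC -mulrA ler_wpM2l//.
  apply: (@le_trans _ _ 1); first by lra.
  by rewrite mulrC ler_pdivlMr// mul1r; lra.
by have := sum_le_linear h; rewrite mulr0 add0r mulrC.
Qed.

(** Serves to bound minima: the least number of hits is the number of rows minus the largest number
    of misses. For [t] at most 1 the number of rows is a sufficient bound. *)
Lemma EB_slast_compl k ps (t : R) : {in ps, forall p, 0 <= p <= 1} -> 0 < t ->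
  EB k.+1 [seq 1 - p | p <- ps] (fun s => slast (map (brow R) s) k) <=
  (size ps)%:R - \sum_(p <- ps) p + (k.+1%:R * t + (\sum_(p <- ps) p) / t).
Proof.
move=> hp t0.
have hp' : {in [seq 1 - p | p <- ps], forall p, 0 <= p <= 1}.
  by move=> _ /mapP[p /hp/andP[p0 p1] ->]; apply/andP; split; lra.
have S0 : 0 <= \sum_(p <- ps) p.
  by rewrite big_seq sumr_ge0// => p /hp/andP[].
have kt : 0 <= k.+1%:R * t by rewrite mulr_ge0// ltW.
case: (leP t 1) => t1.
  apply: (@le_trans _ _ (size ps)%:R).
    rewrite -[leRHS](EB_cst k.+1 [seq 1 - p | p <- ps]); apply: EB_mono => // s.
    by rewrite size_map => <-; exact: bslast_le_size.
  have : \sum_(p <- ps) p <= (\sum_(p <- ps) p) / t by rewrite ler_peMr// invf_ge1.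
  lra.
have ti : t^-1 < 1 by rewrite invf_lt1.
have ti0 : 0 < t^-1 by rewrite invr_gt0.
have r01 : 0 < 1 - t^-1 < 1 by apply/andP; split; lra.
apply: le_trans (EB_slast_le k r01 hp') _.
have e1 : (1 - t^-1) / (1 - (1 - t^-1)) = t - 1.
  have -> : 1 - (1 - t^-1) = t^-1 by ring.
  by rewrite invrK mulrBl mul1r mulVf ?gt_eqF.
rewrite big_map e1.
have h : {in ps, forall p, (1 - p) / (1 - p + (1 - t^-1) * (1 - (1 - p))) <= 1 + (t^-1 - 1) * p}.
  move=> p /hp/andP[p0 p1].
  have tp : t^-1 * p <= t^-1 * 1 by rewrite ler_wpM2l// ltW.
  have d0 : 0 < 1 - p + (1 - t^-1) * (1 - (1 - p)) by lra.
  rewrite ler_pdivrMr//.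
  have a1 : 0 <= t^-1 * p * p by rewrite !mulr_ge0// ltW.
  have a2 : t^-1 * p * (t^-1 * p) <= t^-1 * p * 1 * p.
    rewrite -[leRHS]mulrA ler_wpM2l// ?mulr_ge0 ?(ltW ti0)// mul1r ler_piMl//; exact: ltW.
  lra.
have := sum_le_linear h; rewrite mulr1 => h'.
have k0 : 0 <= k.+1%:R :> R by [].
move: h'; lra.
Qed.

End BernoulliTails.

(** * Joint law of the weights *)

Section BoundedExpectation.
Context (R : realType) (d : measure_display) (T : measurableType d) (P : probability T R).
Implicit Types f g : T -> R.

(** Quantized weights and cell probabilities only produce bounded functions, so this class settles
    integrability until unbounded moments of the environment appear. *)
Definition bmf f := measurable_fun setT f /\ exists K : R, forall w, `|f w| <= K.

Definition EP f : R := \int[P]_w f w.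

Lemma bmf_integrable f : bmf f -> P.-integrable setT (EFin \o f).
Proof.
move=> [mf [K fK]].
have PT : (P setT < +oo)%E by rewrite probability_setT ltry.
apply: measurable_bounded_integrable => //.
exists K; split; first exact: num_real.
by move=> x Kx w _ /=; apply: le_trans (fK w) (ltW Kx).
Qed.

Lemma bmf_cst (c : R) : bmf (fun=> c).
Proof. by split; [exact: measurable_cst|exists `|c|]. Qed.

Lemma bmfD f g : bmf f -> bmf g -> bmf (fun w => f w + g w).
Proof.
move=> [mf [K fK]] [mg [L gL]]; split; first exact: measurable_funD.
by exists (K + L) => w; apply: le_trans (ler_normD _ _) (lerD _ _).
Qed.

Lemma bmfM f g : bmf f -> bmf g -> bmf (fun w => f w * g w).
Proof.
move=> [mf [K fK]] [mg [L gL]]; split; first exact: measurable_funM.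
by exists (K * L) => w; rewrite normrM ler_pM.
Qed.

Lemma bmfZ (c : R) f : bmf f -> bmf (fun w => c * f w).
Proof. exact: bmfM (bmf_cst c). Qed.

Lemma bmfB f g : bmf f -> bmf g -> bmf (fun w => f w - g w).
Proof.
move=> bf bg; have := bmfD bf (bmfZ (-1) bg).
by under eq_fun do rewrite mulN1r.
Qed.

Lemma bmf_max f g : bmf f -> bmf g -> bmf (fun w => Num.max (f w) (g w)).
Proof.
move=> [mf [K fK]] [mg [L gL]]; split; first exact: measurable_maxr.
exists (K + L) => w; have := fK w; have := gL w.
have := normr_ge0 (f w); have := normr_ge0 (g w).
by case: (leP (f w) (g w)) => _; lra.
Qed.

Lemma bmf_sum (I : Type) (s : seq I) (f : I -> T -> R) : (forall i, bmf (f i)) ->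
  bmf (fun w => \sum_(i <- s) f i w).
Proof.
move=> bf; elim: s => [|i s IH].
  by under eq_fun do rewrite big_nil; exact: bmf_cst.
by under eq_fun do rewrite big_cons; exact: bmfD.
Qed.

Lemma bmf_prod (I : Type) (s : seq I) (f : I -> T -> R) : (forall i, bmf (f i)) ->
  bmf (fun w => \prod_(i <- s) f i w).
Proof.
move=> bf; elim: s => [|i s IH].
  by under eq_fun do rewrite big_nil; exact: bmf_cst.
by under eq_fun do rewrite big_cons; exact: bmfM.
Qed.

Lemma bmf_bool (b : T -> bool) : measurable [set w | b w] -> bmf (fun w => (b w)%:R).
Proof.
move=> mb; split; last by exists 1 => w; case: (b w); rewrite /= ?normr1 ?normr0.
have -> : (fun w => (b w)%:R) = \1_[set w | b w] :> (T -> R).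
  by apply/funext => w; rewrite indicE; congr (nat_of_bool _)%:R; exact/esym/asboolb.
exact: measurable_indic.
Qed.

Lemma EP_cst (c : R) : EP (fun=> c) = c.
Proof. by have PT := probability_setT P; rewrite /EP Rintegral_cst// [X in fine X]PT mulr1. Qed.

Lemma EPD f g : bmf f -> bmf g -> EP (fun w => f w + g w) = EP f + EP g.
Proof. by move=> bf bg; rewrite /EP RintegralD//; exact: bmf_integrable. Qed.

Lemma EPZ (c : R) f : bmf f -> EP (fun w => c * f w) = c * EP f.
Proof. by move=> bf; rewrite /EP RintegralZl//; exact: bmf_integrable. Qed.

Lemma EPB f g : bmf f -> bmf g -> EP (fun w => f w - g w) = EP f - EP g.
Proof. by move=> bf bg; rewrite /EP RintegralB//; exact: bmf_integrable. Qed.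

Lemma eq_EP f g : f =1 g -> EP f = EP g.
Proof. by move=> fg; congr EP; apply/funext. Qed.

Lemma EP_sum (I : Type) (s : seq I) (f : I -> T -> R) : (forall i, bmf (f i)) ->
  EP (fun w => \sum_(i <- s) f i w) = \sum_(i <- s) EP (f i).
Proof.
move=> bf; elim: s => [|i s IH].
  by under eq_EP do rewrite big_nil; rewrite big_nil EP_cst.
under eq_EP do rewrite big_cons.
by rewrite big_cons -IH EPD//; exact: bmf_sum.
Qed.

Lemma le_EP f g : bmf f -> bmf g -> (forall w, f w <= g w) -> EP f <= EP g.
Proof. by move=> bf bg fg; apply: le_Rintegral => //; exact: bmf_integrable. Qed.

Lemma EP_ge0 f : (forall w, 0 <= f w) -> 0 <= EP f.
Proof. by move=> f0; exact: Rintegral_ge0. Qed.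

Lemma EP_dist f g (e : R) : bmf f -> bmf g -> (forall w, `|f w - g w| <= e) ->
  `|EP f - EP g| <= e.
Proof.
move=> bf bg fg; rewrite ler_norml -EPB//.
have b := bmfB bf bg.
have [b1 b2] := (bmf_cst (- e), bmf_cst e).
rewrite -(EP_cst (- e)) -[X in _ && (_ <= X)](EP_cst e).
by apply/andP; split; apply: le_EP => // w; have := fg w; rewrite ler_norml => /andP[].
Qed.

Lemma EP_bool (b : T -> bool) : measurable [set w | b w] ->
  EP (fun w => (b w)%:R) = fine (P [set w | b w]).
Proof.
move=> mb; rewrite /EP /Rintegral.
rewrite (_ : (fun w => (b w)%:R%:E) = EFin \o \1_[set w | b w]).
  by rewrite integral_indic// setIT.
by apply/funext => w /=; rewrite indicE; congr (nat_of_bool _)%:R%:E; exact/esym/asboolb.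
Qed.

Lemma le_EP_ae f g : bmf f -> bmf g -> {ae P, forall w, f w <= g w} -> EP f <= EP g.
Proof.
move=> bf bg fg.
have [[mf [K fK]] [mg [L gL]]] := (bf, bg).
have f0 w : 0 <= f w + (K + L).
  have := fK w; rewrite ler_norml => /andP[+ _].
  by have : 0 <= L := le_trans (normr_ge0 _) (gL w); lra.
have g0 w : 0 <= g w + (K + L).
  have := gL w; rewrite ler_norml => /andP[+ _].
  by have : 0 <= K := le_trans (normr_ge0 _) (fK w); lra.
suff : EP (fun w => f w + (K + L)) <= EP (fun w => g w + (K + L)).
  by rewrite !EPD ?EP_cst ?lerD2r//; exact: bmf_cst.
have bf' := bmfD bf (bmf_cst (K + L)); have bg' := bmfD bg (bmf_cst (K + L)).
apply: fine_le.
- exact/integrable_fin_num/bmf_integrable.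
- exact/integrable_fin_num/bmf_integrable.
apply: ae_ge0_le_integral => //.
- by move=> w _; rewrite lee_fin.
- by apply/measurable_EFinP; case: bf'.
- by move=> w _; rewrite lee_fin.
- by apply/measurable_EFinP; case: bg'.
- by apply: filterS fg => w fgw _; rewrite lee_fin lerD2r.
Qed.

Section FiniteValued.
Variables (A : eqType) (es : seq A) (I : Type) (V : I -> T -> A) (rho : I -> T -> A -> R).
Hypothesis es_uniq : uniq es.
Hypothesis V_es : forall i w, V i w \in es.
Hypothesis V_bmf : forall i a, bmf (fun w => (V i w == a)%:R).
Hypothesis rho_bmf : forall i a, bmf (fun w => rho i w a).

Lemma expand_finite (i : I) (w : T) (h : A -> R) :
  h (V i w) = \sum_(a <- es) (V i w == a)%:R * h a.
Proof.
rewrite (bigD1_seq (V i w))//= eqxx mul1r big1 ?addr0// => a /negbTE.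
by rewrite eq_sym => ->; rewrite mul0r.
Qed.

Lemma bmf_finite (s : seq I) (h : seq A -> R) : bmf (fun w => h (map (V^~ w) s)).
Proof.
elim: s h => [|i s IH] h /=; first exact: bmf_cst.
under eq_fun => w do rewrite (expand_finite i w (fun a => h (a :: map (V^~ w) s))).
by apply: bmf_sum => a; apply: bmfM => //; exact: (IH (fun s => h (a :: s))).
Qed.

Lemma bmf_El (s : seq I) (h : seq A -> R) :
  bmf (fun w => El [seq [seq (a, rho i w a) | a <- es] | i <- s] h).
Proof.
elim: s h => [|i s IH] h /=; first exact: bmf_cst.
rewrite /Ex; under eq_fun do rewrite big_map /=.
by apply: bmf_sum => a; apply: bmfM => //; exact: IH.
Qed.

(** [G] and [G'] collect the coordinates already fixed in the induction over [s]. The weights [rho]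
    may depend on the sample point, as in the quenched law, or be constant, as in the annealed
    one. *)
Lemma EP_finite (s : seq I) (G G' : T -> R) (h : seq A -> R) : bmf G -> bmf G' ->
  (forall al : seq A, size al = size s -> all (mem es) al ->
    EP (fun w => G w * \prod_(x <- zip s al) (V x.1 w == x.2)%:R) =
    EP (fun w => G' w * \prod_(x <- zip s al) rho x.1 w x.2)) ->
  EP (fun w => G w * h (map (V^~ w) s)) =
  EP (fun w => G' w * El [seq [seq (a, rho i w a) | a <- es] | i <- s] h).
Proof.
elim: s G G' h => [|i s IH] G G' h bG bG' hyp /=.
  have := hyp [::] erefl isT.
  under eq_EP do rewrite big_nil mulr1.
  under [in X in _ = X -> _]eq_EP do rewrite big_nil mulr1.
  move=> e; under eq_EP do rewrite mulrC.
  by rewrite EPZ// e -EPZ//; apply: eq_EP => w; rewrite mulrC.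
transitivity (\sum_(a <- es) EP (fun w => G w * (V i w == a)%:R * h (a :: map (V^~ w) s))).
  rewrite -EP_sum; last first.
    by move=> a; apply: bmfM; [exact: bmfM|exact: (bmf_finite s (fun s => h (a :: s)))].
  apply: eq_EP => w; rewrite (expand_finite i w (fun a => h (a :: map (V^~ w) s))).
  by rewrite mulr_sumr; apply: eq_bigr => a _; rewrite mulrA.
transitivity (\sum_(a <- es) EP (fun w => G' w * rho i w a *
   El [seq [seq (a, rho i w a) | a <- es] | i <- s] (fun s => h (a :: s)))); last first.
  rewrite -EP_sum; last by move=> a; apply: bmfM; [exact: bmfM|exact: bmf_El].
  apply: eq_EP => w; rewrite /Ex big_map /= mulr_sumr.
  by apply: eq_bigr => a _; rewrite mulrA.
rewrite big_seq [RHS]big_seq; apply: eq_bigr => a aes.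
apply: (IH (fun w => G w * (V i w == a)%:R) (fun w => G' w * rho i w a) (fun s => h (a :: s))).
- exact: bmfM.
- exact: bmfM.
- move=> al sal alle; have := hyp (a :: al); rewrite /= sal aes alle => /(_ erefl isT).
  under eq_EP do rewrite big_cons /= mulrA.
  by under [in X in _ = X -> _]eq_EP do rewrite big_cons /= mulrA.
Qed.

Lemma EP_finite1 (s : seq I) (h : seq A -> R) :
  (forall al : seq A, size al = size s -> all (mem es) al ->
    EP (fun w => \prod_(x <- zip s al) (V x.1 w == x.2)%:R) =
    EP (fun w => \prod_(x <- zip s al) rho x.1 w x.2)) ->
  EP (fun w => h (map (V^~ w) s)) =
  EP (fun w => El [seq [seq (a, rho i w a) | a <- es] | i <- s] h).
Proof.
move=> hyp; have := @EP_finite s (fun=> 1) (fun=> 1) h (bmf_cst 1) (bmf_cst 1).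
under eq_EP do rewrite mul1r.
under [X in (_ -> _ = X) -> _]eq_EP do rewrite mul1r.
move=> -> // al sal hal; under eq_EP do rewrite mul1r.
by rewrite hyp//; apply: eq_EP => w; rewrite mul1r.
Qed.

End FiniteValued.

End BoundedExpectation.

Section Cells.
Variable R : realType.

(* The half-lines, together with the two trivial sets; a cell is a difference of two of them. *)
Definition hline (D : set R) := [\/ D = setT, D = set0 | exists t, D = [set x | x <= t]].

Definition hcell (C : set R) := exists D D', [/\ hline D, hline D', D' `<=` D & C = D `\` D'].

Lemma measurable_hline D : hline D -> measurable D.
Proof.
case=> [->//|->//|[t ->]]; rewrite (_ : [set x | x <= t] = `]-oo, t]%classic)//.
Qed.

Lemma measurable_hcell C : hcell C -> measurable C.
Proof. by move=> [D [D' [hD hD' _ ->]]]; apply: measurableD; exact: measurable_hline. Qed.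

Lemma hline_leP D D' : hline D -> hline D' -> D `<=` D' \/ D' `<=` D.
Proof.
case=> [->|->|[t ->]]; [by right|by left|].
case=> [->|->|[t' ->]]; [by left|by right|].
by case: (leP t t') => tt'; [left|right] => x /= xt; apply: le_trans xt _; rewrite // ltW.
Qed.

Lemma hlineI D D' : hline D -> hline D' -> hline (D `&` D').
Proof.
move=> hD hD'; have [DD'|DD'] := hline_leP hD hD'.
  by rewrite setIidl.
by rewrite setIidr.
Qed.

Lemma hlineU D D' : hline D -> hline D' -> hline (D `|` D').
Proof.
move=> hD hD'; have [DD'|DD'] := hline_leP hD hD'.
  by rewrite setUidr.
by rewrite setUidl.
Qed.

Lemma hcell_hline D : hline D -> hcell D.
Proof. by move=> hD; exists D, set0; split => //; [exact: Or32|rewrite setD0]. Qed.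

Lemma hcell_gt (t : R) : hcell [set x | t < x].
Proof.
exists setT, [set x | x <= t]; split => //; [exact: Or31|by apply: Or33; exists t|].
by apply/seteqP; split => x /=; rewrite ltNge; [move/negP|case=> _ /negP].
Qed.

Lemma hcell_le (t : R) : hcell [set x | x <= t].
Proof. by apply/hcell_hline/Or33; exists t. Qed.

Definition ncross (ts : seq R) (x : R) : nat := count (fun t => t < x) ts.

(** Crossing is strict and the count is nondecreasing in [x], so its sublevel sets are closed
    half-lines, whatever the order of [ts]. *)
Lemma hline_ncross_le (ts : seq R) a : hline [set x | (ncross ts x <= a)%N].
Proof.
elim: ts a => [|t ts IH] a; first by apply: Or31; apply/seteqP; split.
case: a => [|a].
  rewrite (_ : mkset _ = [set x | x <= t] `&` [set x | (ncross ts x <= 0)%N]).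
    by apply: hlineI => //; apply: Or33; exists t.
  apply/seteqP; split => x; rewrite /ncross /= leNgt -/(ncross ts x); first by case: (t < x).
  by case: (t < x) => // -[].
rewrite (_ : mkset _ = ([set x | x <= t] `&` [set x | (ncross ts x <= a.+1)%N])
   `|` [set x | (ncross ts x <= a)%N]).
  by apply: hlineU => //; apply: hlineI => //; apply: Or33; exists t.
apply/seteqP; split => x; rewrite /ncross /= leNgt -/(ncross ts x); case: (t < x) => //=.
- by rewrite add1n ltnS; right.
- by rewrite add0n; left.
- by case=> [[]|].
- by rewrite add0n => -[[]//|/leqW].
Qed.

Lemma hcell_ncross (ts : seq R) a : hcell [set x | ncross ts x = a].
Proof.
case: a => [|a].
  rewrite (_ : mkset _ = [set x | (ncross ts x <= 0)%N]).
    exact/hcell_hline/hline_ncross_le.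
  by apply/seteqP; split => x /=; [move=> ->|rewrite leqn0 => /eqP].
exists [set x | (ncross ts x <= a.+1)%N], [set x | (ncross ts x <= a)%N].
split; [exact: hline_ncross_le|exact: hline_ncross_le|by move=> x /=; exact: leqW|].
apply/seteqP; split => x /=; first by move=> ->; rewrite ltnn.
by move=> [h1 /negP]; rewrite -ltnNge => h2; apply/eqP; rewrite eqn_leq h1.
Qed.

End Cells.

(** * Independence of weights and of row laws, from half-lines and events to functions *)

Section Environment.
Context (R : realType) (d : measure_display) (T : measurableType d).
Variables (P : probability T R) (F : T -> nat -> distr R) (X : T -> nat -> nat -> R).
Hypothesis Fmeas : env_measurable F.
Hypothesis Fiid : env_iid P F.
Hypothesis Xmeas : weights_measurable X.
Hypothesis Xlaw : quenched_law P F X.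

Local Notation EP := (EP P).

Lemma distr_fin (m : distr R) (C : set R) : measurable C -> m C \is a fin_num.
Proof. by move=> mC; exact: fin_num_measure. Qed.

Lemma distr_01 (m : distr R) (C : set R) : measurable C -> 0 <= fine (m C) <= 1.
Proof.
move=> mC; rewrite fine_ge0//= -lee_fin fineK ?distr_fin//.
exact: probability_le1.
Qed.

Lemma distrD (m : distr R) (D D' : set R) : measurable D -> measurable D' -> D' `<=` D ->
  fine (m (D `\` D')) = fine (m D) - fine (m D').
Proof.
move=> mD mD' DD'; rewrite measureD//; last by rewrite ltey_eq distr_fin.
rewrite setIidr// fineB ?distr_fin//.
Qed.

Lemma distr_setT (m : distr R) : fine (m setT) = 1.
Proof. by rewrite probability_setT. Qed.

Lemma bmf_env j C : measurable C -> bmf (fun w => fine (F w j C)).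
Proof.
move=> mC; split.
  exact: measurableT_comp (Fmeas j mC).
by exists 1 => w; have /andP[h0 h1] := distr_01 (F w j) mC; rewrite ger0_norm.
Qed.

Lemma bmf_weight (z : nat * nat) C : measurable C -> bmf (fun w => (X w z.1 z.2 \in C)%:R : R).
Proof.
move=> mC; apply: bmf_bool.
have := Xmeas z.1 z.2 measurableT mC; rewrite setTI.
by congr measurable; apply/seteqP; split => w /=; rewrite inE.
Qed.

(* The sites of s1 carry cells and those of s2 half-lines; the cells are expanded one by one. *)
Lemma joint_cells_mixed (s1 s2 : seq (nat * nat)) (C : nat * nat -> set R)
    (t : nat * nat -> R) :
  uniq (s1 ++ s2) -> (forall z, hcell (C z)) ->
  EP (fun w => \prod_(z <- s1) (X w z.1 z.2 \in C z)%:R * \prod_(z <- s2) (X w z.1 z.2 <= t z)%R%:R) =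
  EP (fun w => \prod_(z <- s1) fine (F w z.2 (C z)) * \prod_(z <- s2) distr_cdf (F w z.2) (t z)).
Proof.
move=> + hC; elim: s1 s2 t => [|z s1 IH] s2 t /= us.
  under eq_EP do rewrite big_nil mul1r; under [RHS]eq_EP do rewrite big_nil mul1r.
  have envT : env_event F setT by exact: (@measurableT _ (g_sigma_algebraType _)).
  rewrite {2}/EP /Rintegral -(Xlaw t us envT) setTI.
  have := @EP_bool _ _ _ P (fun w => all (fun z => X w z.1 z.2 <= t z) s2).
  rewrite (_ : [set w | all _ s2] = [set w | forall z, z \in s2 -> X w z.1 z.2 <= t z]); last first.
    by apply/seteqP; split => w /= => [/allP//|h]; apply/allP.
  move=> <-.
    apply: eq_EP => w; elim: {us envT} s2 => [|z s IHs]; first by rewrite big_nil.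
    by rewrite big_cons IHs /=; case: (_ <= _); rewrite /= ?mul1r ?mul0r.
  elim: {us envT} s2 => [|z s IHs].
    by rewrite (_ : mkset _ = setT)//; apply/seteqP; split.
  rewrite (_ : mkset _ = [set w | X w z.1 z.2 <= t z] `&` [set w | forall z, z \in s -> X w z.1 z.2 <= t z]).
    apply: measurableI => //; rewrite -[X in measurable X]setTI.
    apply: measurable_fun_le => //; exact: Xmeas.
  apply/seteqP; split => w /=.
    by move=> h; split => [|z' z's]; apply: h; rewrite inE ?eqxx// z's orbT.
  by move=> [h1 h2] z'; rewrite inE => /orP[/eqP->|/h2].
have {}us : z \notin s1 ++ s2 /\ uniq (s1 ++ s2) by apply/andP.
have {us} [zs us] := us.
pose G w := \prod_(z <- s1) (X w z.1 z.2 \in C z)%:R * \prod_(z <- s2) (X w z.1 z.2 <= t z)%R%:R : R.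
pose G' w := \prod_(z <- s1) fine (F w z.2 (C z)) * \prod_(z <- s2) distr_cdf (F w z.2) (t z) : R.
have mC z' := measurable_hcell (hC z').
have mle t' : measurable [set x : R | x <= t'] by exact: measurable_hcell (hcell_le t').
have cdfE m t' : distr_cdf m t' = fine (m [set x : R | x <= t']) by rewrite /distr_cdf set_itvNyc.
have leE w z' : (X w z'.1 z'.2 <= t z') = (X w z'.1 z'.2 \in [set x | x <= t z']).
  by apply/idP/idP; rewrite inE.
have bG : bmf G.
  apply: bmfM; apply: bmf_prod => z'; first exact: (bmf_weight z').
  by under eq_fun do rewrite leE; exact: (bmf_weight z').
have bG' : bmf G'.
  apply: bmfM; apply: bmf_prod => z'; first exact: bmf_env.
  by under eq_fun do rewrite cdfE; exact: bmf_env.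
(* A cell is a difference of nested half-lines, and both sides are additive in it. *)
suff H D : hline D -> EP (fun w => (X w z.1 z.2 \in D)%:R * G w) = EP (fun w => fine (F w z.2 D) * G' w).
  have [D [D' [hD hD' DD' CE]]] := hC z.
  have [mD mD'] := (measurable_hline hD, measurable_hline hD').
  transitivity (EP (fun w => (X w z.1 z.2 \in D)%:R * G w - (X w z.1 z.2 \in D')%:R * G w)).
    apply: eq_EP => w; rewrite big_cons -mulrA -/(G w) -mulrBl; congr (_ * _).
    rewrite CE in_setD; case: (boolP (X w z.1 z.2 \in D')) => /= [|_]; last by rewrite andbT subr0.
    by rewrite inE => /DD'/mem_set ->; rewrite /= subrr.
  rewrite EPB; [|by apply: bmfM => //; exact: (bmf_weight z)..].
  rewrite !H// -EPB; [|by apply: bmfM => //; exact: bmf_env..].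
  apply: eq_EP => w; rewrite big_cons -mulrA -/(G' w) -mulrBl; congr (_ * _).
  by rewrite CE distrD.
have IH0 := IH s2 t us.
case=> [->|->|[t0 ->]].
- transitivity (EP G); first by apply: eq_EP => w; rewrite in_setT mul1r.
  by rewrite IH0; apply: eq_EP => w; rewrite distr_setT mul1r.
- by apply: eq_EP => w; rewrite in_set0 measure0 /= !mul0r.
(* A proper half-line sends the site to the second list, with its own threshold [t0], where the
   induction hypothesis takes over. *)
- have us' : uniq (s1 ++ z :: s2).
    by rewrite (uniq_catCA s1 [:: z] s2) /= zs.
  have := IH (z :: s2) (fun z' => if z' == z then t0 else t z') us'.
  have zs2 : z \notin s2 by move: zs; rewrite mem_cat negb_or => /andP[].
  have e z' : z' \in s2 -> (z' == z) = false by move=> h; apply: contraNF zs2 => /eqP <-.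
  under eq_EP => w do (rewrite big_cons eqxx mulrCA; under [X in _ * (_ * X)]eq_big_seq => z' z's do rewrite e//).
  under [in X in _ = X -> _]eq_EP => w do (rewrite big_cons eqxx mulrCA; under [X in _ * (_ * X)]eq_big_seq => z' z's do rewrite e//).
  move=> IH1; transitivity (EP (fun w => (X w z.1 z.2 <= t0)%R%:R * G w)).
    by apply: eq_EP => w; congr ((nat_of_bool _)%:R * _); apply/idP/idP; rewrite inE.
  by rewrite IH1; apply: eq_EP => w; rewrite cdfE.
Qed.

Lemma joint_cells (s : seq (nat * nat)) (C : nat * nat -> set R) :
  uniq s -> (forall z, hcell (C z)) ->
  EP (fun w => \prod_(z <- s) (X w z.1 z.2 \in C z)%:R) =
  EP (fun w => \prod_(z <- s) fine (F w z.2 (C z))).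
Proof.
move=> us hC; have := @joint_cells_mixed s [::] C (fun=> 0); rewrite cats0 => /(_ us hC).
by under eq_EP do rewrite big_nil mulr1; under [in X in _ = X -> _]eq_EP do rewrite big_nil mulr1.
Qed.

(** Measurability for the sigma-algebra generated by evaluations, in which [env_iid] is phrased. *)
Definition dmeas (phi : distr R -> R) :=
  measurable_fun setT (phi : g_sigma_algebraType (@eval_gen R) -> R).

Lemma dmeas_eval C : measurable C -> dmeas (fun m => fine (m C)).
Proof.
move=> mC; apply: (measurability _ (RGenOInfty.measurableE R)).
move=> _ [_ [c ->] <-]; rewrite setTI.
rewrite (_ : _ @^-1` _ = ~` [set m : distr R | fine (m C) <= c]).
  by apply: sigma_algebraC; apply: sub_gen_smallest; exists C, c.
by apply/seteqP; split => m /=; rewrite in_itv /= andbT ltNge => /negP.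
Qed.

Lemma distr_measurable_ge phi c : dmeas phi -> distr_measurable [set m | c <= phi m].
Proof.
move=> mphi; have := mphi measurableT `[c, +oo[%classic (measurable_itv _).
rewrite setTI /distr_measurable; congr (smallest _ _ _).
by apply/seteqP; split => m /=; rewrite in_itv /= andbT.
Qed.

Lemma measurable_env j S : distr_measurable S -> measurable [set w | S (F w j)].
Proof.
move: S; apply: smallest_sub.
  split; first by rewrite (_ : mkset _ = set0)//; apply/seteqP; split.
    move=> S mS; rewrite setTD (_ : mkset _ = ~` [set w | S (F w j)]).
      exact: measurableC.
    by apply/seteqP; split.
  move=> S mS; rewrite (_ : mkset _ = \bigcup_i [set w | S i (F w j)]).
    exact: bigcup_measurable.
  by apply/seteqP; split.
move=> S [C [c [mC ->]]] /=; rewrite -[X in measurable X]setTI.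
by apply: measurable_fun_le => //; case: (bmf_env j mC).
Qed.

Lemma bmf_env_ge j phi c : dmeas phi -> bmf (fun w => (c <= phi (F w j))%R%:R : R).
Proof. by move=> mphi; apply: bmf_bool; exact: measurable_env (distr_measurable_ge c mphi). Qed.

Lemma bmf_dmeas j phi : dmeas phi -> (forall m, 0 <= phi m <= 1) -> bmf (fun w => phi (F w j)).
Proof.
move=> mphi p01; split.
  apply: (measurability _ (RGenCInfty.measurableE R)).
  move=> _ [_ [c ->] <-]; rewrite setTI.
  have := measurable_env j (distr_measurable_ge c mphi); congr measurable.
  by apply/seteqP; split => m /=; rewrite in_itv /= andbT.
by exists 1 => w; have /andP[h0 h1] := p01 (F w j); rewrite ger0_norm.
Qed.

(** Layer-cake approximation: a number of [0, 1] lies within [1 / N] of an average of indicators of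
    levels. It carries independence from events to functions. *)
Definition ladder (N : nat) (x : R) : R := N%:R^-1 * \sum_(k < N) ((k.+1%:R / N%:R <= x)%R%:R).

Lemma ladder_dist N (x : R) : (0 < N)%N -> 0 <= x <= 1 -> `|x - ladder N x| <= N%:R^-1.
Proof.
move=> N0 /andP[x0 x1].
have N0' : 0 < N%:R :> R by rewrite ltr0n.
have Nx : 0 <= N%:R * x by rewrite mulr_ge0// ltW.
have := truncn_itv Nx; set t := Num.truncn _ => /andP[t1 t2].
have tN : (t <= N)%N.
  by rewrite -(ler_nat R); apply: le_trans t1 _; rewrite ler_piMr// ltW.
have -> : ladder N x = N%:R^-1 * t%:R.
  congr (_ * _); rewrite -(big_mkord xpredT (fun k => ((k.+1%:R / N%:R <= x)%R)%:R)).
  rewrite (@big_cat_nat _ _ _ t)//=.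
  rewrite [X in X + _](eq_big_nat _ _ (F2 := fun=> 1)); last first.
    move=> k /andP[_ kt]; rewrite ler_pdivrMr// mulrC (le_trans _ t1)// ler_nat//.
  rewrite [X in _ + X](eq_big_nat _ _ (F2 := fun=> 0)); last first.
    move=> k /andP[tk kN]; rewrite ler_pdivrMr// mulrC leNgt (lt_le_trans t2)// ler_nat//.
  by rewrite big1_eq addr0 sumr_const_nat subn0.
rewrite -[x in x - _](mulKf (lt0r_neq0 N0')) -mulrBr normrM gtr0_norm ?invr_gt0//.
rewrite ler_piMr ?invr_ge0//.
by rewrite ger0_norm ?subr_ge0// lerBlDr addrC natr1 ltW.
Qed.

Lemma EP_ladder G j phi N : dmeas phi -> (forall m, 0 <= phi m <= 1) -> bmf G ->
  EP (fun w => ladder N (phi (F w j)) * G w) =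
  N%:R^-1 * \sum_(k < N) EP (fun w => (k.+1%:R / N%:R <= phi (F w j))%R%:R * G w).
Proof.
move=> mphi p01 bG; rewrite -EP_sum; last by move=> k; apply: bmfM => //; exact: bmf_env_ge.
rewrite -EPZ; last by apply: bmf_sum => k; apply: bmfM => //; exact: bmf_env_ge.
by apply: eq_EP => w; rewrite /ladder -mulrA mulr_suml.
Qed.

Lemma bmf_ladder j phi N : dmeas phi -> bmf (fun w => ladder N (phi (F w j))).
Proof. by move=> mphi; apply: bmfZ; apply: bmf_sum => k; exact: bmf_env_ge. Qed.

Lemma prod_01 (I : Type) (s : seq I) (f : I -> R) : (forall i, 0 <= f i <= 1) ->
  0 <= \prod_(i <- s) f i <= 1.
Proof.
move=> f01; elim/big_ind: _ => [|x y /andP[x0 x1] /andP[y0 y1]|//]; first by rewrite ler01 lexx.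
by rewrite mulr_ge0//= mulr_ile1.
Qed.

Lemma EP_01 f : bmf f -> (forall w, 0 <= f w <= 1) -> 0 <= EP f <= 1.
Proof.
move=> bf f01; rewrite EP_ge0; last by move=> w; have /andP[] := f01 w.
rewrite -[X in _ <= X](EP_cst P 1) le_EP//; first exact: bmf_cst.
by move=> w; have /andP[] := f01 w.
Qed.

Lemma norm01_le1 (x : R) : 0 <= x <= 1 -> `|x| <= 1.
Proof. by case/andP => x0 x1; rewrite ger0_norm. Qed.

(* The rows of js1 carry [0, 1]-valued functions of the environment and those of js2 events. *)
Lemma env_prod_mixed (js1 js2 : seq nat) (phi : nat -> distr R -> R) (S : nat -> set (distr R)) :
  uniq (js1 ++ js2) -> (forall j, dmeas (phi j)) -> (forall j m, 0 <= phi j m <= 1) ->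
  (forall j, distr_measurable (S j)) ->
  EP (fun w => \prod_(j <- js1) phi j (F w j) * \prod_(j <- js2) (`[< S j (F w j) >])%:R) =
  \prod_(j <- js1) EP (fun w => phi j (F w 0%N)) *
  \prod_(j <- js2) EP (fun w => (`[< S j (F w 0%N) >])%:R).
Proof.
move=> + mphi p01; elim: js1 js2 S => [|j js1 IH] js2 S /= us mS.
  rewrite big_nil mul1r; under eq_EP do rewrite big_nil mul1r.
  have mS' i j : measurable [set w | `[< S j (F w i) >]].
    have := measurable_env i (mS j); congr measurable.
    by apply/seteqP; split => w /= /asboolP.
  have Ei i j : EP (fun w => (`[< S j (F w i) >])%:R) = fine (P [set w | S j (F w i)]).
    rewrite EP_bool//; congr (fine (P _)).
    by apply/seteqP; split => w /= /asboolP.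
  transitivity (fine (P [set w | forall j, j \in js2 -> S j (F w j)])).
    have := @EP_bool _ _ _ P (fun w => all (fun j => `[< S j (F w j) >]) js2).
    rewrite (_ : [set w | all _ js2] = [set w | forall z, z \in js2 -> S z (F w z)]); last first.
      apply/seteqP; split => w /= => [/allP h z /h/asboolP//|h].
      by apply/allP => z /h/asboolP.
    move=> <-.
      apply: eq_EP => w; elim: {us} js2 => [|z s IHs]; first by rewrite big_nil.
      by rewrite big_cons IHs /=; case: `[< _ >]; rewrite /= ?mul1r ?mul0r.
    elim: {us} js2 => [|z s IHs].
      by rewrite (_ : mkset _ = setT)//; apply/seteqP; split.
    rewrite (_ : mkset _ = [set w | S z (F w z)] `&` [set w | forall z, z \in s -> S z (F w z)]).
      by apply: measurableI => //; exact: measurable_env.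
    apply/seteqP; split => w /=.
      by move=> h; split => [|z' z's]; apply: h; rewrite inE ?eqxx// z's orbT.
    by move=> [h1 h2] z'; rewrite inE => /orP[/eqP->|/h2].
  have [F1 F2] := Fiid; rewrite F2//.
  elim: {us} js2 => [|z s IHs]; first by rewrite !big_nil.
  rewrite !big_cons fineM ?IHs.
  - by rewrite Ei F1.
  - by apply: fin_num_measure; exact: measurable_env.
  - by rewrite prode_fin_num// => z' _; apply: fin_num_measure; exact: measurable_env.
have /andP[js us'] := us.
pose G w := \prod_(j <- js1) phi j (F w j) * \prod_(j <- js2) (`[< S j (F w j) >])%:R : R.
pose c := \prod_(j <- js1) EP (fun w => phi j (F w 0%N)) *
  \prod_(j <- js2) EP (fun w => (`[< S j (F w 0%N) >])%:R).
have bS i z : bmf (fun w => (`[< S z (F w i) >])%:R : R).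
  apply: bmf_bool; have := measurable_env i (mS z); congr measurable.
  by apply/seteqP; split => w /= /asboolP.
have bphi i z : bmf (fun w => phi z (F w i)) by apply: bmf_dmeas.
have S01 i z w : (0 : R) <= (`[< S z (F w i) >])%:R <= (1 : R) by case: `[< _ >]; rewrite /= ?lexx ?ler01.
have bG : bmf G by apply: bmfM; apply: bmf_prod.
have G01 w : 0 <= G w <= 1.
  have /andP[a1 a2] := prod_01 js1 (fun z => p01 z (F w z)).
  have /andP[b1 b2] := prod_01 js2 (fun z => S01 z z w).
  by rewrite /G mulr_ge0//= mulr_ile1.
have c01 : 0 <= c <= 1.
  have /andP[a1 a2] := prod_01 js1 (fun z => EP_01 (bphi 0%N z) (fun w => p01 z (F w 0%N))).
  have /andP[b1 b2] := prod_01 js2 (fun z => EP_01 (bS 0%N z) (S01 0%N z)).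
  by rewrite /c mulr_ge0//= mulr_ile1.
have step N : EP (fun w => ladder N (phi j (F w j)) * G w) =
    EP (fun w => ladder N (phi j (F w 0%N))) * c.
  rewrite EP_ladder//.
  transitivity (N%:R^-1 * (\sum_(k < N) EP (fun w => (k.+1%:R / N%:R <= phi j (F w 0%N))%R%:R)) * c); last first.
    congr (_ * _); have := @EP_ladder (fun=> 1) 0 (phi j) N (mphi j) (p01 j) (bmf_cst _ 1).
    under eq_EP do rewrite mulr1.
    by move=> ->; congr (_ * _); apply: eq_bigr => k _; apply: eq_EP => w; rewrite mulr1.
  rewrite -mulrA mulr_suml; congr (_ * _); apply: eq_bigr => k _.
  (* A level set of [phi j] becomes the event of row [j], so the induction hypothesis applies with
     [j] moved to the second list. *)
  pose S' z := if z == j then [set m | k.+1%:R / N%:R <= phi j m] else S z.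
  have mS' z : distr_measurable (S' z).
    by rewrite /S'; case: ifP => _ //; exact: distr_measurable_ge.
  have us2 : uniq (js1 ++ j :: js2).
    by rewrite (uniq_catCA js1 [:: j] js2) /= js.
  have js2j : j \notin js2 by move: js; rewrite mem_cat negb_or => /andP[].
  have e z : z \in js2 -> (z == j) = false by move=> h; apply: contraNF js2j => /eqP <-.
  have := IH (j :: js2) S' us2 mS'.
  have S'j w i : `[< S' j (F w i) >] = (k.+1%:R / N%:R <= phi j (F w i)).
    by rewrite /S' eqxx; exact: asboolb.
  under eq_EP => w do (rewrite big_cons mulrCA S'j; under [X in _ * (_ * X)]eq_big_seq => z z2 do rewrite /S' e//).
  rewrite big_cons mulrCA; under [X in _ = X * _ -> _]eq_EP do rewrite S'j.
  rewrite [X in _ = _ * (_ * X) -> _](eq_big_seq (fun z => EP (fun w => (`[< S z (F w 0%N) >])%:R))); last first.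
    by move=> z z2; rewrite /S' e.
  by move=> ->.
rewrite big_cons -mulrA -/c; under eq_EP do rewrite big_cons -mulrA -/(G _).
apply/eqP; rewrite -subr_eq0 -normr_eq0 eq_le normr_ge0 andbT.
apply/ler_addgt0Pr => e e0; rewrite add0r.
pose N := (Num.truncn (2 / e)).+1.
have N0 : 0 < N%:R :> R by [].
have Ne : 2 * N%:R^-1 <= e.
  rewrite ler_pdivrMr// -ler_pdivrMl// mulrC ltW//.
  by have /andP[] := truncn_itv (divr_ge0 (ler0n R 2) (ltW e0)).
apply: le_trans Ne.
have h1 : `|EP (fun w => phi j (F w j) * G w) - EP (fun w => ladder N (phi j (F w j)) * G w)| <= N%:R^-1.
  apply: EP_dist; [exact: bmfM|by apply: bmfM => //; exact: bmf_ladder|move=> w].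
  rewrite -mulrBl normrM -[leRHS]mulr1 ler_pM// ?norm01_le1//.
  exact: ladder_dist.
have h2 : `|EP (fun w => phi j (F w 0%N)) - EP (fun w => ladder N (phi j (F w 0%N)))| <= N%:R^-1.
  by apply: EP_dist; [exact: bphi|exact: bmf_ladder|move=> w; exact: ladder_dist].
have h3 : `|EP (fun w => phi j (F w 0%N)) * c - EP (fun w => ladder N (phi j (F w 0%N))) * c| <= N%:R^-1.
  by rewrite -mulrBl normrM -[leRHS]mulr1 ler_pM// norm01_le1.
move: h1 h3; rewrite step !ler_norml => /andP[? ?] /andP[? ?]; apply/andP; split; lra.
Qed.

Lemma env_prod (js : seq nat) (phi : nat -> distr R -> R) : uniq js ->
  (forall j, dmeas (phi j)) -> (forall j m, 0 <= phi j m <= 1) ->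
  EP (fun w => \prod_(j <- js) phi j (F w j)) = \prod_(j <- js) EP (fun w => phi j (F w 0%N)).
Proof.
move=> us mphi p01; have := @env_prod_mixed js [::] phi (fun=> setT).
rewrite cats0 big_nil mulr1 => <-//; first by apply: eq_EP => w; rewrite big_nil mulr1.
by move=> j; exact: (@measurableT _ (g_sigma_algebraType (@eval_gen R))).
Qed.

Lemma env_id (j : nat) (phi : distr R -> R) : dmeas phi -> (forall m, 0 <= phi m <= 1) ->
  EP (fun w => phi (F w j)) = EP (fun w => phi (F w 0%N)).
Proof.
move=> mphi p01; have := @env_prod [:: j] (fun=> phi) isT (fun=> mphi) (fun=> p01).
by rewrite big_seq1; under eq_EP do rewrite big_seq1.
Qed.

End Environment.

Section RowExtensionality.
Variable R : realType.
Implicit Types (X Y : nat -> nat -> R).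

Lemma eq_slast (rows rows' : seq (nat -> R)) k : size rows = size rows' ->
  (forall j i, (j < size rows)%N -> (i <= k)%N ->
    nth (fun=> 0) rows j i = nth (fun=> 0) rows' j i) ->
  slast rows k = slast rows' k.
Proof.
elim/last_ind: rows rows' k => [|rows v IH] rows' k.
  by move/esym/size0nil => ->.
case/lastP: rows' => [|rows' v']; first by rewrite size_rcons.
rewrite !size_rcons => -[ss] h; rewrite !slast_rcons.
have e i : (i <= k)%N -> slast rows i + v i = slast rows' i + v' i.
  move=> ik; rewrite (IH rows' i ss).
    by have := h (size rows) i (ltnSn _) ik; rewrite !nth_rcons ss ltnn eqxx => ->.
  move=> j i' jr i'i; have := h j i' (ltnW jr) (leq_trans i'i ik).
  by rewrite !nth_rcons -ss jr.
by apply/eqP; rewrite eq_le !le_rmax// => i /e ->.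
Qed.

Lemma eq_tlast (rows rows' : seq (nat -> R)) k : size rows = size rows' ->
  (forall j i, (j < size rows)%N -> (i <= k)%N ->
    nth (fun=> 0) rows j i = nth (fun=> 0) rows' j i) ->
  tlast rows k = tlast rows' k.
Proof.
rewrite /tlast => + +; suff H : forall i, (i <= k)%N -> size rows = size rows' ->
  (forall j i, (j < size rows)%N -> (i <= k)%N ->
    nth (fun=> 0) rows j i = nth (fun=> 0) rows' j i) ->
  foldl (@tstep R) (fun=> 0) rows i = foldl (@tstep R) (fun=> 0) rows' i by exact: H.
elim/last_ind: rows rows' => [|rows v IH] rows' i ik.
  by move/esym/size0nil => ->.
case/lastP: rows' => [|rows' v']; first by rewrite size_rcons.
rewrite !size_rcons => -[ss] h; rewrite !foldl_rcons.
have hv i' : (i' <= k)%N -> v i' = v' i'.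
  by move=> i'k; have := h (size rows) i' (ltnSn _) i'k; rewrite !nth_rcons ss ltnn eqxx.
have ht i' : (i' <= k)%N -> foldl (@tstep R) (fun=> 0) rows i' = foldl (@tstep R) (fun=> 0) rows' i'.
  move=> i'k; apply: IH => // j i2 jr i2k; have := h j i2 (ltnW jr) i2k.
  by rewrite !nth_rcons -ss jr.
by elim: i ik => [|i IHi] ik /=; [rewrite hv// ht|rewrite hv// ht// IHi// ltnW].
Qed.

(** Sites entered by a step to the right can only lower the sum. *)
Lemma lastp_le_slast_npos X l k : (forall i j, X i j <= 0) ->
  lastp X l k <= slast (rows_of X l.+1) k.
Proof.
move=> X0; elim: l k => [|l IHl] k.
  rewrite /slast /=; elim: k => [|k IHk].
    by rewrite big_ord1 /sstep /= add0r.
  rewrite big_ord_recr /=.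
  have := rmax_mono (sstep (fun=> 0) (X^~ 0%N)) (leqnSn k).
  by move: IHk (X0 k.+1 0%N) => /=; lra.
rewrite rows_ofS slast_rcons.
elim: k => [|k IHk]; first by rewrite lastpS0 /= lerD2r; exact: IHl.
have h1 := rmax_ge (fun i => slast (rows_of X l.+1) i + X i l.+1) (leqnn k.+1).
have h2 := rmax_mono (fun i => slast (rows_of X l.+1) i + X i l.+1) (leqnSn k).
rewrite lastpSS -lerBrDr ge_max.
have := IHl k.+1; move: h1 h2 IHk (X0 k.+1 l.+1); cbv beta => h1 h2 h3 h4 h5.
by apply/andP; split; lra.
Qed.

End RowExtensionality.

Lemma bmf_lastp (R : realType) (d : measure_display) (T : measurableType d)
    (Y : T -> nat -> nat -> R) l k :
  (forall i j, bmf (fun w => Y w i j)) -> bmf (fun w => lastp (Y w) l k).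
Proof.
move=> bY; elim: l k => [|l IHl] k; first exact: bmf_sum.
elim: k => [|k IHk].
  by under eq_fun do rewrite lastpS0; exact: bmfD.
by under eq_fun do rewrite lastpSS; apply: bmfD => //; exact: bmf_max.
Qed.

(** * Quantized weights *)

Section QuantizedLaw.
Variables (R : realType) (A : eqType) (es : seq A) (q : R -> A).
Hypothesis es_uniq : uniq es.
Hypothesis q_es : forall x, q x \in es.
Hypothesis q_cell : forall a, hcell [set x | q x = a].

Let mcell a : measurable [set x | q x = a]. Proof. exact: measurable_hcell (q_cell a). Qed.

Definition cellmass (m : distr R) a : R := fine (m [set x | q x = a]).
Definition qlaw (m : distr R) : law R A := [seq (a, cellmass m a) | a <- es].
Definition cellw (m : distr R) (s : seq A) : R := \prod_(a <- s) cellmass m a.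

Fixpoint qwords M : seq (seq A) :=
  if M is M'.+1 then [seq a :: s | a <- es, s <- qwords M'] else [:: [::]].

Lemma mem_qwords M s : (s \in qwords M) = (size s == M) && all (mem es) s.
Proof.
elim: M s => [|M IH] s /=; first by rewrite inE; case: s.
case: s => [|a s] /=.
  by apply/negbTE/negP => /allpairsP[[a s] [_ _ //]].
rewrite eqSS; apply/allpairsP/idP => [[[a' s'] [/= ha hs [-> ->]]]|].
  by move: hs; rewrite IH => /andP[-> ->]; rewrite ha.
by case/and3P => ss ha hs; exists (a, s); split => //=; rewrite IH ss.
Qed.

Lemma uniq_qwords M : uniq (qwords M).
Proof. by elim: M => [|M IH] //=; apply: allpairs_uniq => // -[a s] [a' s'] _ _ [-> ->]. Qed.

Lemma Lseq_qlaw M m : Lseq (nseq M (qlaw m)) = [seq (s, cellw m s) | s <- qwords M].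
Proof.
elim: M => [|M IH] /=; first by rewrite /cellw big_nil.
rewrite IH map_allpairs allpairs_mapl allpairs_mapr.
by apply: eq_allpairs => a s; rewrite /cellw big_cons.
Qed.

Lemma prod_bool (B : eqType) (s s' : seq B) (b0 : B) : size s = size s' ->
  ((s == s')%:R : R) = \prod_(i <- iota 0 (size s)) (nth b0 s i == nth b0 s' i)%:R.
Proof.
elim: s s' => [|a s IH] [|a' s'] //=; first by rewrite big_nil.
move=> [ss]; rewrite big_cons /= -[1%N]addn0 iotaDl big_map /= -IH// eqseq_cons.
by case: (a == a'); case: (s == s'); rewrite /= ?mul1r ?mul0r.
Qed.

Lemma cellw_nth (m : distr R) (s : seq A) a0 :
  cellw m s = \prod_(i <- iota 0 (size s)) cellmass m (nth a0 s i).
Proof. by rewrite /cellw (big_nth a0) /index_iota subn0. Qed.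

Lemma prod_zip_iota (B : Type) (b0 : B) (al : seq B) (g : nat -> B -> R) :
  \prod_(x <- zip (iota 0 (size al)) al) g x.1 x.2 =
  \prod_(j <- iota 0 (size al)) g j (nth b0 al j).
Proof.
suff H m : \prod_(x <- zip (iota m (size al)) al) g x.1 x.2 =
  \prod_(j <- iota m (size al)) g j (nth b0 al (j - m)).
  by rewrite H; apply: eq_bigr => j _; rewrite subn0.
elim: al m => [|b al IH] m /=; first by rewrite !big_nil.
rewrite !big_cons subnn /= IH; congr (_ * _).
apply: eq_big_seq => j; rewrite mem_iota => /andP[mj _].
by rewrite -(subnSK mj).
Qed.

Lemma cellw01 m s : 0 <= cellw m s <= 1.
Proof. by apply: prod_01 => a; exact: distr_01. Qed.

Lemma dmeas_cellw s : dmeas (cellw^~ s).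
Proof. by apply: measurable_prod => a _; exact: dmeas_eval. Qed.

Lemma bmf_q_cell a : bmf (fun x => (q x == a)%:R : R).
Proof.
apply: bmf_bool; have := mcell a; congr measurable.
by apply/seteqP; split => x /= /eqP.
Qed.

Lemma Ex_qlaw (m : distr R) (v : A -> R) : Ex (qlaw m) v = \int[m]_x v (q x).
Proof.
transitivity (EP m (fun x => \sum_(a <- es) (q x == a)%:R * v a)); last first.
  by apply: eq_EP => x; rewrite -(@expand_finite _ _ _ _ es _ (fun (_ : unit) x => q x) es_uniq _ tt x v).
rewrite EP_sum; last first.
  by move=> a; apply: bmfM; [exact: bmf_q_cell|exact: bmf_cst].
rewrite /Ex /qlaw big_map; apply: eq_bigr => a _ /=; rewrite mulrC.
under eq_EP do rewrite mulrC.
rewrite EPZ; last exact: bmf_q_cell.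
congr (_ * _); rewrite EP_bool; last first.
  by have := mcell a; congr measurable; apply/seteqP; split => x /= /eqP.
by congr (fine (m _)); apply/seteqP; split => x /= /eqP.
Qed.

Lemma mass_qlaw m : mass (qlaw m) = 1.
Proof. by rewrite /mass Ex_qlaw; exact: EP_cst. Qed.

End QuantizedLaw.

Section QuantizedRows.
Context (R : realType) (d : measure_display) (T : measurableType d).
Variables (P : probability T R) (F : T -> nat -> distr R) (X : T -> nat -> nat -> R).
Hypothesis Fmeas : env_measurable F.
Hypothesis Fiid : env_iid P F.
Hypothesis Xmeas : weights_measurable X.
Hypothesis Xlaw : quenched_law P F X.
Variables (A : eqType) (es : seq A) (q : R -> A).
Hypothesis es_uniq : uniq es.
Hypothesis q_es : forall x, q x \in es.
Hypothesis q_cell : forall a, hcell [set x | q x = a].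

Local Notation EP := (EP P).
Local Notation cellw := (cellw q).
Local Notation cellmass := (cellmass q).
Local Notation qlaw := (qlaw es q).
Local Notation qwords := (qwords es).

Let mcell a : measurable [set x | q x = a]. Proof. exact: measurable_hcell (q_cell a). Qed.

Definition qrow M w j : seq A := mkseq (fun i => q (X w i j)) M.

Lemma qrow_qwords M w j : qrow M w j \in qwords M.
Proof.
by rewrite mem_qwords size_mkseq eqxx; apply/allP => a /mapP[i _ ->]; exact: q_es.
Qed.

Lemma rows_joint M N (al : seq (seq A)) : size al = N -> all (mem (qwords M)) al ->
  EP (fun w => \prod_(x <- zip (iota 0 N) al) (qrow M w x.1 == x.2)%:R) =
  EP (fun w => \prod_(x <- zip (iota 0 N) al) cellw (F w x.1) x.2).
Proof.
move=> <- /allP hal; set N' := size al.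
pose a0 := q 0; pose al' j := nth [::] al j.
have sal j : j \in iota 0 N' -> size (al' j) = M.
  rewrite mem_iota add0n => /andP[_ jN].
  by have := hal (al' j) (mem_nth _ jN); rewrite /= mem_qwords => /andP[/eqP].
pose C (z : nat * nat) := [set x : R | q x = nth a0 (al' z.2) z.1].
pose s := [seq (i, j) | j <- iota 0 N', i <- iota 0 M].
have us : uniq s.
  by apply: allpairs_uniq; rewrite ?iota_uniq// => -[i j] [i' j'] _ _ /= [-> ->].
have := joint_cells Fmeas Xmeas Xlaw us (fun z => q_cell (nth a0 (al' z.2) z.1)).
move=> H; transitivity (EP (fun w => \prod_(z <- s) (X w z.1 z.2 \in C z)%:R)).
  apply: eq_EP => w; rewrite (prod_zip_iota [::] al (fun j s => (qrow M w j == s)%:R)).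
  rewrite big_allpairs_dep; apply: eq_big_seq => j jN.
  rewrite (prod_bool R a0) size_mkseq ?sal//; apply: eq_big_seq => i.
  rewrite mem_iota add0n => /andP[_ iM]; rewrite nth_mkseq//=.
  by congr (nat_of_bool _)%:R; apply/eqP/idP; rewrite inE.
rewrite H; apply: eq_EP => w.
rewrite (prod_zip_iota [::] al (fun j s => cellw (F w j) s)) big_allpairs_dep.
by apply: eq_big_seq => j jN; rewrite (cellw_nth _ _ _ a0) -/(al' j) sal.
Qed.

Lemma bmf_qX i j a : bmf (fun w => (q (X w i j) == a)%:R : R).
Proof.
have := bmf_weight Xmeas (i, j) (mcell a).
by congr bmf; apply/funext => w /=; congr (nat_of_bool _)%:R; apply/idP/eqP; rewrite inE.
Qed.

Lemma bmf_qrow M j a : bmf (fun w => (qrow M w j == a)%:R : R).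
Proof.
case: (eqVneq (size a) M) => [<-|sa]; last first.
  have e w : (qrow M w j == a) = false.
    by apply: contra_neqF sa => /eqP <-; rewrite size_mkseq.
  by under eq_fun do rewrite e; exact: bmf_cst.
have e w : ((qrow (size a) w j == a)%:R : R) =
    \prod_(i <- iota 0 (size a)) (q (X w i j) == nth (q 0) a i)%:R.
  rewrite (prod_bool R (q 0)) size_mkseq//; apply: eq_big_seq => i.
  by rewrite mem_iota add0n => /andP[_ ia]; rewrite nth_mkseq.
by under eq_fun do rewrite e; apply: bmf_prod => i; exact: bmf_qX.
Qed.

Lemma bmf_cellw j s : bmf (fun w => cellw (F w j) s).
Proof. by apply: bmf_prod => a; exact: bmf_env. Qed.

Lemma EP_quenched M N (h : seq (seq A) -> R) :
  EP (fun w => h (mkseq (qrow M w) N)) =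
  EP (fun w => El [seq Lseq (nseq M (qlaw (F w j))) | j <- iota 0 N] h).
Proof.
rewrite (@EP_finite1 _ _ _ P _ (qwords M) nat (fun j w => qrow M w j)
  (fun j w s => cellw (F w j) s) (uniq_qwords es_uniq M) (fun j w => qrow_qwords M w j)
  (fun j a => bmf_qrow M j a) (fun j a => bmf_cellw j a) (iota 0 N) h).
  by apply: eq_EP => w; congr El; apply: eq_map => j; rewrite Lseq_qlaw.
by move=> al; rewrite size_iota => sal hal; exact: rows_joint.
Qed.

(** Law of a quantized row with the environment averaged out. Distinct rows are independent under
    it, whereas the entries of one row remain coupled through their common random distribution. *)
Definition annealed M : law R (seq A) :=
  [seq (s, EP (fun w => cellw (F w 0%N) s)) | s <- qwords M].

Lemma EP_annealed M N (h : seq (seq A) -> R) :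
  EP (fun w => h (mkseq (qrow M w) N)) = El (nseq N (annealed M)) h.
Proof.
rewrite (@EP_finite1 _ _ _ P _ (qwords M) nat (fun j w => qrow M w j)
  (fun j w s => EP (fun w => cellw (F w 0%N) s)) (uniq_qwords es_uniq M) (fun j w => qrow_qwords M w j)
  (fun j a => bmf_qrow M j a) (fun j a => bmf_cst _ _) (iota 0 N) h).
  rewrite EP_cst; congr El; rewrite -/(annealed M).
  by elim: N 0%N => [|N IH] m //=; rewrite IH.
move=> al; rewrite size_iota => sal hal; rewrite EP_cst.
rewrite rows_joint// -sal; under eq_EP do rewrite (prod_zip_iota [::] al (fun j s => cellw (F _ j) s)).
rewrite (prod_zip_iota [::] al (fun j s => EP (fun w => cellw (F w 0%N) s))).
apply: (@env_prod _ _ _ P F Fmeas Fiid _ (fun j m => cellw m (nth [::] al j))).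
- exact: iota_uniq.
- by move=> j; exact: dmeas_cellw q_cell _.
- by move=> j m; exact: cellw01 q_cell _ _.
Qed.

Lemma Ex_annealed M g : Ex (annealed M) g = EP (fun w => El (nseq M (qlaw (F w 0%N))) g).
Proof.
rewrite /Ex /annealed big_map /=.
under eq_bigr => s _ do rewrite mulrC -(EPZ _ _ (bmf_cellw 0 s)).
rewrite -EP_sum; last by move=> s; apply/bmfZ/bmf_cellw.
apply: eq_EP => w; rewrite -Ex_Lseq Lseq_qlaw /Ex big_map.
by apply: eq_bigr => s _; rewrite mulrC.
Qed.

(** Given the environment, the entries of a row are independent with one law, so a mixed product
    averages to the square of the conditional mean. The difference [s2 - c] is therefore the mean
    conditional variance. *)
Lemma row_moments_annealed (v : A -> R) k (B : R) : (forall a, `|v a| <= B) ->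
  row_moments (annealed k.+1) (fun s i => v (nth (q 0) s i)) k
    (EP (fun w => \int[F w 0%N]_x v (q x)))
    (EP (fun w => \int[F w 0%N]_x (v (q x)) ^+ 2))
    (EP (fun w => (\int[F w 0%N]_x v (q x)) ^+ 2)) B.
Proof.
move=> vB; split => //.
- rewrite /lpos all_map; apply/allP => s _ /=; apply: EP_ge0 => w.
  by have /andP[] := cellw01 q_cell (F w 0%N) s.
- rewrite /mass Ex_annealed; under eq_EP => w do
    rewrite El_cst prod_mass_nseq (mass_qlaw es_uniq q_es q_cell) expr1n mul1r.
  exact: EP_cst.
- move=> i ik; rewrite Ex_annealed; apply: eq_EP => w.
  by rewrite (El_nth (q 0) v (mass_qlaw es_uniq q_es q_cell _))// (Ex_qlaw es_uniq q_es q_cell).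
- move=> i ik; rewrite Ex_annealed; apply: eq_EP => w.
  by rewrite (El_nth (q 0) (fun a => v a ^+ 2) (mass_qlaw es_uniq q_es q_cell _))// (Ex_qlaw es_uniq q_es q_cell).
- move=> i j ik jk ij; rewrite Ex_annealed; apply: eq_EP => w.
  by rewrite (El_nth2 (q 0) v v (mass_qlaw es_uniq q_es q_cell _))// (Ex_qlaw es_uniq q_es q_cell) expr2.
Qed.

Lemma bmf_rows M N (h : seq (seq A) -> R) : bmf (fun w => h (mkseq (qrow M w) N)).
Proof.
rewrite /mkseq; exact: (@bmf_finite R _ T _ (qwords M) nat (fun j w => qrow M w j)
  (uniq_qwords es_uniq M) (fun j w => qrow_qwords M w j) (fun j a => bmf_qrow M j a) (iota 0 N) h).
Qed.

Lemma slast_rows (v : A -> R) w n k :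
  slast (rows_of (fun i j => v (q (X w i j))) n) k =
  slast (map (fun s i => v (nth (q 0) s i)) (mkseq (qrow k.+1 w) n)) k.
Proof.
apply: eq_slast; first by rewrite size_map !size_mkseq.
move=> j i; rewrite size_mkseq => jn ik.
by rewrite (nth_map [::]) ?size_mkseq// !nth_mkseq.
Qed.

End QuantizedRows.

(** * Contribution of the tails *)

Section ThresholdTails.
Context (R : realType) (d : measure_display) (T : measurableType d).
Variables (P : probability T R) (F : T -> nat -> distr R) (X : T -> nat -> nat -> R).
Hypothesis Fmeas : env_measurable F.
Hypothesis Fiid : env_iid P F.
Hypothesis Xmeas : weights_measurable X.
Hypothesis Xlaw : quenched_law P F X.
Variables (q : R -> bool).
Hypothesis q_cell : forall a, hcell [set x | q x = a].

Local Notation EP := (EP P).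

Definition hitp w j : R := fine (F w j [set x | q x = true]).
Definition hitbar : R := EP (hitp^~ 0%N).

Let es_uniq : uniq [:: true; false]. Proof. by []. Qed.
Let q_es x : q x \in [:: true; false]. Proof. by case: (q x). Qed.
Let mcell a : measurable [set x | q x = a]. Proof. exact: measurable_hcell (q_cell a). Qed.

Lemma qlaw_ber m : qlaw [:: true; false] q m = ber (fine (m [set x | q x = true])).
Proof.
have := mass_qlaw es_uniq q_es q_cell m.
rewrite /mass /Ex /qlaw /= big_cons big_seq1 /= !mulr1 => e.
by rewrite /ber /cellmass -e addrAC subrr add0r.
Qed.

Lemma hitp01 w j : 0 <= hitp w j <= 1. Proof. exact: distr_01. Qed.

Lemma bmf_hitp j : bmf (hitp^~ j). Proof. exact: bmf_env. Qed.

Lemma EP_hitp j : EP (hitp^~ j) = hitbar.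
Proof.
apply: (@env_id _ _ _ P F Fmeas Fiid j (fun m => fine (m [set x | q x = true]))).
- exact: dmeas_eval.
- by move=> m; exact: distr_01.
Qed.

Lemma hitbar_ge0 : 0 <= hitbar.
Proof. by apply: EP_ge0 => w; have /andP[] := hitp01 w 0. Qed.

(** The bound is an evaluation event, so identical distribution passes it from row 0 to each row,
    and countably many null sets are discarded. *)
Lemma hitp_le_ae (b : R) : {ae P, forall w, hitp w 0%N <= b} ->
  {ae P, forall w, forall j, hitp w j <= b}.
Proof.
move=> hb; apply/ae_foralln => j.
have mS i : measurable [set w | hitp w i <= b].
  by rewrite -[X in measurable X]setTI; apply: measurable_fun_le => //; case: (bmf_hitp i).
have e : P [set w | hitp w j <= b] = P [set w | hitp w 0%N <= b].
  have [F1 _] := Fiid.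
  apply: (F1 j [set m : distr R | fine (m [set x | q x = true]) <= b]).
  by apply: sub_gen_smallest; exists [set x | q x = true], b.
have P0 : P (~` [set w | hitp w 0%N <= b]) = 0%E.
  apply/eqP; rewrite -measure_le0.
  have [N [mN N0 sub]] := hb.
  by rewrite -N0 le_measure ?inE//; apply: measurableC.
have Pj : P (~` [set w | hitp w j <= b]) = 0%E.
  by rewrite -P0 !probability_setC// e.
by exists (~` [set w | hitp w j <= b]); split => //; exact: measurableC.
Qed.

Definition hit (w : T) (i j : nat) : R := (q (X w i j))%:R.

Lemma bmf_hit i j : bmf (fun w => hit w i j).
Proof.
have := bmf_qX Xmeas q_cell i j true; congr bmf; apply/funext => w.
by rewrite eqb_id.
Qed.

Lemma slast_hit w n k : slast (rows_of (hit w) n) k =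
  slast (map (brow R) (mkseq (qrow X q k.+1 w) n)) k.
Proof.
apply: eq_slast; first by rewrite size_map !size_mkseq.
move=> j i; rewrite size_mkseq => jn ik.
by rewrite (nth_map [::]) ?size_mkseq// !nth_mkseq// /brow nth_mkseq.
Qed.

Lemma tlast_hit w n k : tlast (rows_of (hit w) n) k =
  tlast (map (brow R) (mkseq (qrow X q k.+1 w) n)) k.
Proof.
apply: eq_tlast; first by rewrite size_map !size_mkseq.
move=> j i; rewrite size_mkseq => jn ik.
by rewrite (nth_map [::]) ?size_mkseq// !nth_mkseq// /brow nth_mkseq.
Qed.

Lemma EP_hit M n (h : seq (seq bool) -> R) :
  EP (fun w => h (mkseq (qrow X q M w) n)) =
  EP (fun w => EB M [seq hitp w j | j <- iota 0 n] h).
Proof.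
rewrite (EP_quenched Fmeas Xmeas Xlaw es_uniq q_es q_cell); apply: eq_EP => w.
rewrite EB_El -map_comp; congr El; apply: eq_map => j.
by rewrite qlaw_ber.
Qed.

Lemma bmf_EB M n (h : seq (seq bool) -> R) : bmf (fun w => EB M [seq hitp w j | j <- iota 0 n] h).
Proof.
have := @bmf_El R _ T _ (qwords [:: true; false] M) nat (fun j w s => cellw q (F w j) s)
  (fun j s => bmf_cellw Fmeas q_cell j s) (iota 0 n) h.
congr bmf; apply/funext => w; rewrite EB_El -map_comp; congr El; apply: eq_map => j /=.
by rewrite -Lseq_qlaw qlaw_ber.
Qed.

Lemma bmf_sum_hitp n : bmf (fun w => \sum_(p <- [seq hitp w j | j <- iota 0 n]) p).
Proof. by under eq_fun do rewrite big_map; apply: bmf_sum => j; exact: bmf_hitp. Qed.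

Lemma EP_sum_hitp n : EP (fun w => \sum_(p <- [seq hitp w j | j <- iota 0 n]) p) = n%:R * hitbar.
Proof.
under eq_EP do rewrite big_map; rewrite EP_sum; last by move=> j; exact: bmf_hitp.
under eq_bigr do rewrite EP_hitp.
by rewrite big_const_seq iter_addr addr0 count_predT size_iota mulr_natl.
Qed.

Lemma EP_affine_hitp n (a c : R) :
  EP (fun w => a + c * \sum_(p <- [seq hitp w j | j <- iota 0 n]) p) = a + c * (n%:R * hitbar).
Proof.
rewrite EPD ?EP_cst; [|exact: bmf_cst|by apply/bmfZ/bmf_sum_hitp].
by rewrite EPZ ?EP_sum_hitp//; exact: bmf_sum_hitp.
Qed.

Lemma bmf_affine_hitp n (a c : R) :
  bmf (fun w => a + c * \sum_(p <- [seq hitp w j | j <- iota 0 n]) p).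
Proof. by apply: bmfD; [exact: bmf_cst|apply/bmfZ/bmf_sum_hitp]. Qed.

Let p01 w n : {in [seq hitp w j | j <- iota 0 n], forall p : R, 0 <= p <= 1}.
Proof. by move=> p /mapP[j _ ->]; exact: hitp01. Qed.

(** The quenched bound is affine in the row parameters and turns into one in [hitbar]; only then is
    [t] optimised, which makes the square root appear outside the expectation. *)
Lemma EP_slast_hit n k :
  EP (fun w => slast (rows_of (hit w) n) k) <=
  n%:R * hitbar + 8 * Num.sqrt (k.+1%:R * (n%:R * hitbar)).
Proof.
have -> : 8 = 2 * 4 :> R by ring.
apply: optimise => //; first by rewrite mulr_ge0// hitbar_ge0.
move=> t t0; under eq_EP do rewrite slast_hit.
rewrite (EP_hit k.+1 n (fun s => slast (map (brow R) s) k)).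
have -> : n%:R * hitbar + 4 * (k.+1%:R * t + n%:R * hitbar / t) =
    4 * (k.+1%:R * t) + (1 + 4 * t^-1) * (n%:R * hitbar) by ring.
rewrite -EP_affine_hitp; apply: le_EP; [exact: bmf_EB|exact: bmf_affine_hitp|move=> w].
have h := EB_slast_tail k (@p01 w n) t0; apply: le_trans h _.
by rewrite le_eqVlt; apply/orP; left; apply/eqP; ring.
Qed.

Lemma EP_tlast_hit n k (b : R) : 0 <= b -> {ae P, forall w, hitp w 0%N <= b} ->
  EP (fun w => tlast (rows_of (hit w) n) k) <=
  k.+1%:R * b + 2 * Num.sqrt (k.+1%:R * (n%:R * hitbar)).
Proof.
move=> b0 hb; rewrite -[2]mulr1.
apply: optimise => //; first by rewrite mulr_ge0// hitbar_ge0.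
move=> t t0; under eq_EP do rewrite tlast_hit.
rewrite (EP_hit k.+1 n (fun s => tlast (map (brow R) s) k)).
have -> : k.+1%:R * b + 1 * (k.+1%:R * t + n%:R * hitbar / t) =
    k.+1%:R * b + k.+1%:R * t + t^-1 * (n%:R * hitbar) by ring.
rewrite -EP_affine_hitp; apply: le_EP_ae; [exact: bmf_EB|exact: bmf_affine_hitp|].
apply: filterS (hitp_le_ae hb) => w hw.
apply: le_trans (@EB_tlast_tail _ k [seq hitp w j | j <- iota 0 n] b t b0 _ _ t0) _.
- by move=> p /mapP[j _ ->]; rewrite hw andbT; have /andP[] := hitp01 w j.
- by move=> p /mapP[j _ ->]; have /andP[] := hitp01 w j.
by rewrite le_eqVlt; apply/orP; left; apply/eqP; ring.
Qed.

Lemma bmf_slast_hit n k : bmf (fun w => slast (rows_of (hit w) n) k).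
Proof.
under eq_fun do rewrite slast_hit.
exact: (bmf_rows Xmeas es_uniq q_es q_cell k.+1 n (fun s => slast (map (brow R) s) k)).
Qed.

Lemma bmf_tlast_hit n k : bmf (fun w => tlast (rows_of (hit w) n) k).
Proof.
under eq_fun do rewrite tlast_hit.
exact: (bmf_rows Xmeas es_uniq q_es q_cell k.+1 n (fun s => tlast (map (brow R) s) k)).
Qed.

(** Splitting into the two one-site problems; the constant 10 adds the 8 of [EP_slast_hit] to the 2
    of [EP_tlast_hit]. *)
Lemma EP_lastp_hit n k (b : R) : 0 <= b -> {ae P, forall w, hitp w 0%N <= b} ->
  EP (fun w => lastp (hit w) n k) <=
  n.+1%:R * hitbar + 10 * Num.sqrt (k.+1%:R * (n.+1%:R * hitbar)) + k.+1%:R * b.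
Proof.
move=> b0 hb.
apply: (@le_trans _ _ (EP (fun w => slast (rows_of (hit w) n.+1) k + tlast (rows_of (hit w) n.+1) k))).
  apply: le_EP => [||w].
  - by apply: bmf_lastp => i j; exact: bmf_hit.
  - by apply: bmfD; [exact: bmf_slast_hit|exact: bmf_tlast_hit].
  - by apply: lastp_le_slast_tlast => i j; rewrite /hit ler0n.
rewrite EPD; [|exact: bmf_slast_hit|exact: bmf_tlast_hit].
have := EP_slast_hit n.+1 k; have := EP_tlast_hit n.+1 k b0 hb.
by lra.
Qed.

End ThresholdTails.

Section ThresholdMinimum.
Context (R : realType) (d : measure_display) (T : measurableType d).
Variables (P : probability T R) (F : T -> nat -> distr R) (X : T -> nat -> nat -> R).
Hypothesis Fmeas : env_measurable F.
Hypothesis Fiid : env_iid P F.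
Hypothesis Xmeas : weights_measurable X.
Hypothesis Xlaw : quenched_law P F X.
Variables (q : R -> bool).
Hypothesis q_cell : forall a, hcell [set x | q x = a].

Local Notation EP := (EP P).
Local Notation nq := (fun x => ~~ q x).

Let nq_cell a : hcell [set x | nq x = a].
Proof.
have := q_cell (~~ a); congr hcell; apply/seteqP; split => x /=; first by move=> ->; rewrite negbK.
by move=> <-; rewrite negbK.
Qed.

Let hitpN w j : hitp F nq w j = 1 - hitp F q w j.
Proof.
rewrite /hitp -(distr_setT (F w j)) -distrD//; last exact: measurable_hcell (q_cell true).
congr (fine (F w j _)); apply/seteqP; split => x /=; first by case: (q x) => // _; split.
by move=> [_]; case: (q x).
Qed.

Let p01 w n : {in [seq hitp F q w j | j <- iota 0 n], forall p : R, 0 <= p <= 1}.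
Proof. by move=> p /mapP[j _ ->]; exact: hitp01. Qed.

Lemma EP_slast_miss n k :
  EP (fun w => slast (rows_of (hit X nq w) n) k) <=
  n%:R - n%:R * hitbar P F q + 2 * Num.sqrt (k.+1%:R * (n%:R * hitbar P F q)).
Proof.
rewrite -[2]mulr1.
apply: optimise => //; first by rewrite mulr_ge0// hitbar_ge0.
move=> t t0; under eq_EP do rewrite slast_hit.
rewrite (EP_hit Fmeas Xmeas Xlaw nq_cell k.+1 n (fun s => slast (map (brow R) s) k)).
have -> : n%:R - n%:R * hitbar P F q + 1 * (k.+1%:R * t + n%:R * hitbar P F q / t) =
    n%:R + k.+1%:R * t + (t^-1 - 1) * (n%:R * hitbar P F q) by ring.
rewrite -(EP_affine_hitp Fmeas Fiid q_cell); apply: le_EP.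
- exact: bmf_EB.
- exact: bmf_affine_hitp.
move=> w; have -> : [seq hitp F nq w j | j <- iota 0 n] = [seq 1 - p | p <- [seq hitp F q w j | j <- iota 0 n]].
  by rewrite -map_comp; apply: eq_map => j /=; exact: hitpN.
have h := EB_slast_compl k (@p01 w n) t0; apply: le_trans h _.
by rewrite size_map size_iota le_eqVlt; apply/orP; left; apply/eqP; ring.
Qed.

(** Adding 1 in each row turns negated hits into hits of the complement. By subadditivity, an upper
    bound for the negated layer is what a lower bound for the full passage time requires. *)
Lemma EP_lastp_hitN n k :
  EP (fun w => lastp (fun i j => - hit X q w i j) n k) <=
  - (n.+1%:R * hitbar P F q) + 2 * Num.sqrt (k.+1%:R * (n.+1%:R * hitbar P F q)).
Proof.
apply: (@le_trans _ _ (EP (fun w => slast (rows_of (hit X nq w) n.+1) k - n.+1%:R))).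
  apply: le_EP => [||w].
  - by apply: bmf_lastp => i j; have := bmfZ (-1) (bmf_hit Xmeas q_cell i j);
      under eq_fun do rewrite mulN1r.
  - by apply: bmfB; [exact: bmf_slast_hit|exact: bmf_cst].
  - apply: le_trans (@lastp_le_slast_npos _ _ n k _) _; first by move=> i j; rewrite oppr_le0 /hit ler0n.
    have := @slast_affine _ 1 (-1) (rows_of (hit X nq w) n.+1) k ler01.
    rewrite mul1r mulrN1 size_mkseq => <-; rewrite le_eqVlt; apply/orP; left; apply/eqP.
    rewrite /rows_of; apply: eq_slast; first by rewrite /mkseq !size_map.
    move=> j i; rewrite size_mkseq => jn _; rewrite (nth_map (fun=> 0)) ?size_mkseq// !nth_mkseq//.
    by rewrite mul1r /hit; case: (q _); rewrite /= ?add0r ?subrr ?oppr0.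
rewrite EPB ?EP_cst; [|exact: bmf_slast_hit|exact: bmf_cst].
by have := EP_slast_miss n.+1 k; lra.
Qed.

End ThresholdMinimum.

Section LastPassageSums.
Variable R : realType.
Implicit Types (Y : nat -> nat -> R).

Lemma eq_lastp Y Y' l k : (forall i j, Y i j = Y' i j) -> lastp Y l k = lastp Y' l k.
Proof. by move=> e; congr lastp; apply/funext => i; apply/funext => j. Qed.

Lemma lastp_scale (c : R) Y l k : 0 <= c -> lastp (fun i j => c * Y i j) l k = c * lastp Y l k.
Proof.
move=> c0; elim: l k => [|l IHl] k; first by rewrite /= mulr_sumr.
elim: k => [|k IHk]; first by rewrite !lastpS0 IHl mulrDr.
by rewrite !lastpSS IHk IHl mulrDr maxr_pMr.
Qed.

Lemma lastp_sum_le (c : R) Y (r : seq nat) (Z : nat -> nat -> nat -> R) l k : 0 <= c ->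
  lastp (fun i j => Y i j + \sum_(m <- r) c * Z m i j) l k <=
  lastp Y l k + \sum_(m <- r) c * lastp (Z m) l k.
Proof.
move=> c0; elim: r => [|m r IH].
  by rewrite big_nil addr0 (@eq_lastp _ Y)// => i j; rewrite big_nil addr0.
rewrite big_cons addrCA -lastp_scale//.
apply: le_trans (lerD (lexx _) IH); apply: le_trans (lastpD _ _ _ _).
by rewrite le_eqVlt; apply/orP; left; apply/eqP/eq_lastp => i j; rewrite big_cons addrCA.
Qed.

End LastPassageSums.

Section Staircase.
Variables (R : realType) (h : nat).

(* Thresholds m / h and - m / h; [stair A B] rounds x to a multiple of 1 / h, truncated to
   [- A / h, B / h]. *)
Definition up m (x : R) : bool := m%:R / h%:R < x.
Definition dn m (x : R) : bool := x <= - (m%:R / h%:R).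
Definition stair A B (x : R) : R :=
  h%:R^-1 * (\sum_(m < B) (up m x)%:R - \sum_(m < A) (dn m x)%:R).

Lemma up_cell m a : hcell [set x | up m x = a].
Proof.
case: a; first exact: hcell_gt.
rewrite (_ : mkset _ = [set x | x <= m%:R / h%:R]); first exact: hcell_le.
by apply/seteqP; split => x /=; rewrite /up; case: ltP.
Qed.

Lemma dn_cell m a : hcell [set x | dn m x = a].
Proof.
case: a; first exact: hcell_le.
rewrite (_ : mkset _ = [set x | - (m%:R / h%:R) < x]); first exact: hcell_gt.
by apply/seteqP; split => x /=; rewrite /dn; case: leP.
Qed.

Lemma stair_split m0 A B x : (m0 <= A)%N -> (m0 <= B)%N ->
  stair A B x = stair m0 m0 x + \sum_(m <- index_iota m0 B) h%:R^-1 * (up m x)%:R +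
    \sum_(m <- index_iota m0 A) h%:R^-1 * - (dn m x)%:R.
Proof.
move=> mA mB; rewrite /stair.
rewrite -(big_mkord xpredT (fun m => (up m x)%:R)) -(big_mkord xpredT (fun m => (dn m x)%:R)).
rewrite (@big_cat_nat _ _ _ m0)//= (@big_cat_nat _ _ _ m0 0 A)//= !big_mkord -!mulr_sumr sumrN.
by ring.
Qed.

Variable m0 : nat.

(** All thresholds of the symmetric staircase in one list: the number of them below [x] determines
    [stair m0 m0 x], so the clipped weight is a function of a quantization whose cells are
    differences of half-lines. *)
Definition levels : seq R :=
  [seq m%:R / h%:R | m <- iota 0 m0] ++ [seq - (m%:R / h%:R) | m <- iota 0 m0].
Definition level : R -> nat := ncross levels.
(** [level] never exceeds [m0 + m0]; the default 0 beyond makes the value bounded for every natural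
    number, as [row_moments] demands. *)
Definition levelval (a : nat) : R :=
  if (a <= m0 + m0)%N then h%:R^-1 * (a%:R - m0%:R) else 0.

Lemma level_cell a : hcell [set x | level x = a]. Proof. exact: hcell_ncross. Qed.

Lemma level_le x : (level x <= m0 + m0)%N.
Proof.
by rewrite /level /ncross (leq_trans (count_size _ _))// size_cat !size_map size_iota.
Qed.

Lemma level_mem x : level x \in iota 0 (m0 + m0).+1.
Proof. by rewrite mem_iota leq0n add0n ltnS level_le. Qed.

Lemma stair_level x : stair m0 m0 x = levelval (level x).
Proof.
rewrite /levelval level_le /stair /level /ncross count_cat natrD; congr (_ * _).
have H (f : nat -> R) : \sum_(m < m0) (f m < x)%R%:R = (count (fun t => t < x) [seq f m | m <- iota 0 m0])%:R :> R.
  rewrite count_map -sum1_count -(big_mkord xpredT (fun m => (f m < x)%R%:R)) /index_iota subn0.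
  by rewrite natr_sum [RHS]big_mkcond /=; apply: eq_bigr => m _ /=; case: (_ < x).
rewrite -(H (fun m => m%:R / h%:R)) -(H (fun m => - (m%:R / h%:R))) -addrA; congr (_ + _).
rewrite -[X in _ = _ - X%:R]card_ord -sum1_card natr_sum -sumrB -sumrN; apply: eq_bigr => m _.
by rewrite /dn; case: leP => /= _; rewrite ?sub0r ?subrr ?oppr0.
Qed.

Lemma levelval_le a : `|levelval a| <= m0%:R / h%:R.
Proof.
rewrite /levelval; case: leqP => am; last by rewrite normr0 divr_ge0.
rewrite normrM ger0_norm ?invr_ge0// mulrC ler_wpM2r ?invr_ge0//.
have : a%:R <= m0%:R + m0%:R :> R by rewrite -natrD ler_nat.
have : 0 <= a%:R :> R by [].
by rewrite ler_norml => ? ?; apply/andP; split; lra.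
Qed.

End Staircase.

Section FiniteEstimate.
Context (R : realType) (d : measure_display) (T : measurableType d).
Variables (P : probability T R) (F : T -> nat -> distr R) (X : T -> nat -> nat -> R).
Hypothesis Fmeas : env_measurable F.
Hypothesis Fiid : env_iid P F.
Hypothesis Xmeas : weights_measurable X.
Hypothesis Xlaw : quenched_law P F X.

Lemma norm_chain (a c a0 c0 s t u : R) :
  `|a - c - (a0 - c0)| <= t -> `|a0 - (c0 + s)| <= u -> `|a - (c + s)| <= t + u.
Proof. by rewrite !ler_norml => /andP[? ?] /andP[? ?]; apply/andP; split; lra. Qed.

Definition mean (f : R -> R) : R := EP P (fun w => EP (F w 0%N) f).
(** The mean over the environment of the variance of [f] under the random law of a row. *)
Definition qvar (f : R -> R) : R :=
  EP P (fun w => EP (F w 0%N) (fun x => f x ^+ 2)) - EP P (fun w => (EP (F w 0%N) f) ^+ 2).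

Variable h : nat.
Local Notation pu m := (hitbar P F (up h m)).
Local Notation pd m := (hitbar P F (dn h m)).

Lemma EP_var_ge0 (d' : measure_display) (T' : measurableType d') (m : probability T' R) (f : T' -> R) :
  bmf f -> (EP m f) ^+ 2 <= EP m (fun x => f x ^+ 2).
Proof.
move=> bf; have : 0 <= EP m (fun x => (f x - EP m f) ^+ 2) by apply: EP_ge0 => x; exact: sqr_ge0.
have b2 : bmf (fun x => f x ^+ 2) by under eq_fun do rewrite expr2; exact: bmfM.
have -> : EP m (fun x => (f x - EP m f) ^+ 2) =
    EP m (fun x => f x ^+ 2 + (- 2 * EP m f * f x + (EP m f) ^+ 2)) by apply: eq_EP => x; ring.
have b3 := bmfZ (- 2 * EP m f) bf; have b4 := bmf_cst T' ((EP m f) ^+ 2).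
rewrite EPD//; last exact: bmfD.
by rewrite EPD// EPZ// EP_cst; lra.
Qed.

Lemma EP_norm_le (d' : measure_display) (T' : measurableType d') (m : probability T' R) (f : T' -> R)
    (K : R) : bmf f -> (forall x, `|f x| <= K) -> `|EP m f| <= K.
Proof.
move=> bf fK; rewrite -[EP m f]subr0 -(EP_cst m 0); apply: EP_dist => // [|x].
  exact: bmf_cst.
by rewrite subr0.
Qed.

Lemma bmf_cellfun (q : R -> bool) : (forall a, hcell [set x | q x = a]) ->
  bmf (fun x => (q x)%:R : R).
Proof.
by move=> qc; apply: bmf_bool; have := measurable_hcell (qc true); congr measurable.
Qed.

Lemma EP_cellfun (q : R -> bool) (m : distr R) : (forall a, hcell [set x | q x = a]) ->
  EP m (fun x => (q x)%:R) = fine (m [set x | q x = true]).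
Proof.
by move=> qc; rewrite EP_bool//; have := measurable_hcell (qc true).
Qed.

Lemma bmf_stair A B : bmf (stair h A B : R -> R).
Proof.
apply: bmfZ; apply: bmfB; apply: bmf_sum => m; apply: bmf_cellfun.
  exact: up_cell.
exact: dn_cell.
Qed.

Lemma mean_stair A B :
  mean (stair h A B) = h%:R^-1 * (\sum_(m < B) pu m - \sum_(m < A) pd m).
Proof.
have bu m := bmf_cellfun (up_cell R h m); have bd m := bmf_cellfun (dn_cell R h m).
transitivity (EP P (fun w => h%:R^-1 * (\sum_(m < B) hitp F (up h m) w 0%N - \sum_(m < A) hitp F (dn h m) w 0%N))).
  apply: eq_EP => w; rewrite /stair EPZ; last by apply: bmfB; apply: bmf_sum => m.
  rewrite EPB; [|by apply: bmf_sum => m..].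
  rewrite !EP_sum//; congr (_ * (_ - _)); apply: eq_bigr => m _; apply: EP_cellfun.
    exact: up_cell.
  exact: dn_cell.
have bu' m : bmf (fun w => hitp F (up h m) w 0%N) by apply: bmf_hitp => // a; exact: up_cell.
have bd' m : bmf (fun w => hitp F (dn h m) w 0%N) by apply: bmf_hitp => // a; exact: dn_cell.
rewrite EPZ; last by apply: bmfB; apply: bmf_sum => m.
by rewrite EPB ?EP_sum//; apply: bmf_sum => m.
Qed.

Let upc m := @up_cell R h m.
Let dnc m := @dn_cell R h m.

Lemma bmf_stairX A B i j : bmf (fun w => stair h A B (X w i j)).
Proof.
apply: bmfZ; apply: bmfB; apply: bmf_sum => m.
  exact: (bmf_hit Xmeas (upc m)).
exact: (bmf_hit Xmeas (dnc m)).
Qed.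

Lemma bmf_lastp_stair A B n k : bmf (fun w => lastp (fun i j => stair h A B (X w i j)) n k).
Proof. by apply: bmf_lastp => i j; exact: bmf_stairX. Qed.

Lemma bmf_lastp_hit (q : R -> bool) n k : (forall a, hcell [set x | q x = a]) ->
  bmf (fun w => lastp (hit X q w) n k).
Proof. by move=> qc; apply: bmf_lastp => i j; exact: bmf_hit. Qed.

Lemma bmf_lastp_hitN (q : R -> bool) n k : (forall a, hcell [set x | q x = a]) ->
  bmf (fun w => lastp (fun i j => - hit X q w i j) n k).
Proof.
move=> qc; apply: bmf_lastp => i j; have := bmfZ (-1) (bmf_hit Xmeas qc i j).
by under eq_fun do rewrite mulN1r.
Qed.

Variables (m0 A B : nat) (mA : (m0 <= A)%N) (mB : (m0 <= B)%N).
Variables (bu bd : nat -> R).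
Hypothesis bu0 : forall m, 0 <= bu m.
Hypothesis bd0 : forall m, 0 <= bd m.
Hypothesis hbu : forall m, {ae P, forall w, hitp F (up h m) w 0%N <= bu m}.
Hypothesis hbd : forall m, {ae P, forall w, hitp F (dn h m) w 0%N <= bd m}.

Local Notation eta := (h%:R^-1 : R).

Let eta0 : 0 <= eta. Proof. by rewrite invr_ge0. Qed.

Lemma stair_lastp_le n k :
  EP P (fun w => lastp (fun i j => stair h A B (X w i j)) n k) <=
  EP P (fun w => lastp (fun i j => stair h m0 m0 (X w i j)) n k) +
  \sum_(m <- index_iota m0 B) eta * EP P (fun w => lastp (hit X (up h m) w) n k) +
  \sum_(m <- index_iota m0 A) eta * EP P (fun w => lastp (fun i j => - hit X (dn h m) w i j) n k).
Proof.
have b1 := bmf_lastp_stair A B n k; have b2 := bmf_lastp_stair m0 m0 n k.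
have b3 m := bmf_lastp_hit n k (upc m); have b4 m := bmf_lastp_hitN n k (dnc m).
under eq_bigr do rewrite -EPZ//.
under [X in _ <= _ + X]eq_bigr do rewrite -EPZ//.
have b5 m := bmfZ eta (b3 m); have b6 m := bmfZ eta (b4 m).
rewrite -!EP_sum//.
have b7 := bmf_sum (index_iota m0 B) b5; have b8 := bmf_sum (index_iota m0 A) b6.
rewrite -EPD// -EPD//; last exact: bmfD.
apply: le_EP => // [|w]; first by apply: bmfD => //; exact: bmfD.
apply: le_trans (lerD (lastp_sum_le _ _ _ n k eta0) (lexx _)).
apply: le_trans (lastp_sum_le _ _ _ n k eta0).
rewrite le_eqVlt; apply/orP; left; apply/eqP/eq_lastp => i j.
exact: stair_split.
Qed.

(** Subadditivity once more, with the clipped weights written as the full ones plus the negated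
    outer layers. *)
Lemma stair_lastp_ge n k :
  EP P (fun w => lastp (fun i j => stair h m0 m0 (X w i j)) n k) <=
  EP P (fun w => lastp (fun i j => stair h A B (X w i j)) n k) +
  \sum_(m <- index_iota m0 B) eta * EP P (fun w => lastp (fun i j => - hit X (up h m) w i j) n k) +
  \sum_(m <- index_iota m0 A) eta * EP P (fun w => lastp (hit X (dn h m) w) n k).
Proof.
have b1 := bmf_lastp_stair A B n k; have b2 := bmf_lastp_stair m0 m0 n k.
have b3 m := bmf_lastp_hitN n k (upc m); have b4 m := bmf_lastp_hit n k (dnc m).
under eq_bigr do rewrite -EPZ//.
under [X in _ <= _ + X]eq_bigr do rewrite -EPZ//.
have b5 m := bmfZ eta (b3 m); have b6 m := bmfZ eta (b4 m).
rewrite -!EP_sum//.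
have b7 := bmf_sum (index_iota m0 B) b5; have b8 := bmf_sum (index_iota m0 A) b6.
rewrite -EPD// -EPD//; last exact: bmfD.
apply: le_EP => // [|w]; first by apply: bmfD => //; exact: bmfD.
apply: le_trans (lerD (lastp_sum_le _ _ _ n k eta0) (lexx _)).
apply: le_trans (lastp_sum_le _ _ _ n k eta0).
rewrite le_eqVlt; apply/orP; left; apply/eqP/eq_lastp => i j.
rewrite (stair_split h _ mA mB) -!mulr_sumr !sumrN; rewrite /hit; ring.
Qed.

Lemma bmf_EP_quant (C : eqType) (es : seq C) (q : R -> C) (v : C -> R) : uniq es ->
  (forall x, q x \in es) -> (forall a, hcell [set x | q x = a]) ->
  bmf (fun w => EP (F w 0%N) (fun x => v (q x))).
Proof.
move=> ues qes qc.
have e w : EP (F w 0%N) (fun x => v (q x)) = \sum_(a <- es) cellmass q (F w 0%N) a * v a.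
  by have := Ex_qlaw ues qes qc (F w 0%N) v; rewrite /Ex /qlaw big_map => e; exact: esym e.
under eq_fun do rewrite e.
apply: bmf_sum => a; apply: bmfM; last exact: bmf_cst.
by apply: bmf_env => //; exact: measurable_hcell (qc a).
Qed.

Let stairE : (stair h m0 m0 : R -> R) = (fun x => levelval R h m0 (level h m0 x)).
Proof. by apply/funext => x; exact: stair_level. Qed.

Let lvu : uniq (iota 0 (m0 + m0).+1). Proof. exact: iota_uniq. Qed.
Let lvm := @level_mem R h m0.
Let lvc := @level_cell R h m0.
Let clipK (x : R) : `|stair h m0 m0 x| <= m0%:R / h%:R.
Proof. by rewrite stair_level; exact: levelval_le. Qed.

(** Weights clipped at level [m0 / h]: the term with [k.+1] pays for the passage to one site per
    row, the rest is the exchange of rows. *)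
Lemma clip_lindeberg n k (b x : R) : 0 < b -> b * (2 * (m0%:R / h%:R)) <= 4^-1 -> 0 < x < 1 ->
  `|EP P (fun w => lastp (fun i j => stair h m0 m0 (X w i j)) n k) -
   (n.+1%:R * mean (stair h m0 m0) +
     Num.sqrt (qvar (stair h m0 m0)) * (2 * fair_slast R k n.+1 - n.+1%:R))| <=
  m0%:R / h%:R * k.+1%:R + (n.+1%:R * (6 * b ^+ 2 * (2 * (m0%:R / h%:R)) ^+ 3) +
    (k%:R * ln x^-1 + n.+1%:R * ln (1 - x)^-1) / b).
Proof.
move=> b0 bK x01; set K := m0%:R / h%:R in bK *.
have K0 : 0 <= K by rewrite divr_ge0.
pose f : R -> R := stair h m0 m0.
have bf : bmf f := bmf_stair m0 m0.
have fK y : `|f y| <= K := clipK y.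
have bE : bmf (fun w => EP (F w 0%N) f).
  by rewrite /f stairE; exact: (bmf_EP_quant (levelval R h m0) lvu lvm lvc).
have bE2 : bmf (fun w => EP (F w 0%N) (fun y => f y ^+ 2)).
  by rewrite /f stairE; exact: (bmf_EP_quant (fun a => levelval R h m0 a ^+ 2) lvu lvm lvc).
have EK w : `|EP (F w 0%N) f| <= K by apply: EP_norm_le.
have bEs : bmf (fun w => (EP (F w 0%N) f) ^+ 2) by under eq_fun do rewrite expr2; exact: bmfM.
have bf2 : bmf (fun y => f y ^+ 2) by under eq_fun do rewrite expr2; exact: bmfM.
have muK : `|mean f| <= K by apply: EP_norm_le.
have v0 : 0 <= qvar f.
  by rewrite subr_ge0; apply: le_EP => // w; exact: EP_var_ge0.
have vK : qvar f <= K ^+ 2.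
  rewrite lerBlDr -[leLHS]addr0 lerD//; last by apply: EP_ge0 => w; exact: sqr_ge0.
  have : `|EP P (fun w => EP (F w 0%N) (fun y => f y ^+ 2))| <= K ^+ 2.
    apply: EP_norm_le => // w; apply: EP_norm_le => // y.
    by rewrite normrX lerXn2r// nnegrE.
  by apply: le_trans; exact: ler_norm.
have sK : Num.sqrt (qvar f) <= K by rewrite -[K]ger0_norm// -sqrtr_sqr ler_wsqrtr.
(* The comparison entries are the mean plus or minus the standard deviation, each at most [K]; hence
   the sup norm [2 * K]. *)
have B2 : `|mean f| + Num.sqrt (qvar f) <= 2 * K by rewrite mulr2n mulrDl mul1r lerD.
have rm : row_moments (annealed P F (iota 0 (m0 + m0).+1) (level h m0) k.+1)
    (fun s i => levelval R h m0 (nth (level h m0 (0 : R)) s i)) k (mean f)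
    (EP P (fun w => EP (F w 0%N) (fun y => f y ^+ 2))) (EP P (fun w => (EP (F w 0%N) f) ^+ 2)) (2 * K).
  rewrite /mean /f stairE.
  have hv a : `|levelval R h m0 a| <= 2 * K.
    by apply: le_trans (levelval_le _ _ _ a) _; rewrite -/K; lra.
  exact: (@row_moments_annealed _ _ _ P _ Fmeas _ _ _ lvu lvm lvc (levelval R h m0) k (2 * K) hv).
have := lindeberg_fair n.+1 b0 bK x01 (sqrtr_ge0 _) B2 (esym (sqr_sqrtr v0)) rm.
rewrite -(EP_annealed Fmeas Fiid Xmeas Xlaw lvu lvm lvc k.+1 n.+1
  (fun s => slast (map (fun s i => levelval R h m0 (nth (level h m0 (0 : R)) s i)) s) k)).
set E1 := EP P _; set E2 := EP P _; set c := _ + _ * (_ - _) => H.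
suff E12 : `|E1 - E2| <= K * k.+1%:R.
  by move: H E12; rewrite !ler_norml => /andP[? ?] /andP[? ?]; apply/andP; split; lra.
rewrite distrC; apply: EP_dist => [||w].
- exact: bmf_lastp_stair.
- exact: (bmf_rows Xmeas lvu lvm lvc k.+1 n.+1
    (fun s => slast (map (fun s i => levelval R h m0 (nth (level h m0 (0 : R)) s i)) s) k)).
- rewrite -(slast_rows X (level h m0) (levelval R h m0) w n.+1 k).
  have e : (fun i j => levelval R h m0 (level h m0 (X w i j))) = (fun i j => stair h m0 m0 (X w i j)).
    by apply/funext => i; apply/funext => j; rewrite stair_level.
  rewrite e.
  have h1 := @lastp_le_slast _ (fun i j => stair h m0 m0 (X w i j)) K n k (fun i j => clipK _).
  have h2 := @slast_le_lastp _ (fun i j => stair h m0 m0 (X w i j)) K n k (fun i j => clipK _).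
  have : K * k%:R <= K * k.+1%:R by rewrite ler_wpM2l// ler_nat.
  by rewrite ler_norml => ?; apply/andP; split; lra.
Qed.

(** [M] counts columns and [N] rows. Each layer beyond [m0] enters with its fluctuation bound and
    with the essential supremum [bu] or [bd] of its row parameter. *)
Definition tails (M N : R) : R :=
  \sum_(m <- index_iota m0 B) eta * (10 * Num.sqrt (M * (N * pu m)) + M * bu m) +
  \sum_(m <- index_iota m0 A) eta * (10 * Num.sqrt (M * (N * pd m)) + M * bd m).

Lemma mean_stair_split : mean (stair h A B) = mean (stair h m0 m0) +
  \sum_(m <- index_iota m0 B) eta * pu m - \sum_(m <- index_iota m0 A) eta * pd m.
Proof.
rewrite !mean_stair.
rewrite -(big_mkord xpredT (fun m => pu m)) -(big_mkord xpredT (fun m => pd m)).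
rewrite (@big_cat_nat _ _ _ m0)//= (@big_cat_nat _ _ _ m0 0 A)//= !big_mkord -!mulr_sumr.
by ring.
Qed.

(** The leading terms of the layers are exactly the difference of the two means, so they cancel and
    only fluctuations remain. *)
Lemma stair_lastp_clip n k :
  `|EP P (fun w => lastp (fun i j => stair h A B (X w i j)) n k) - n.+1%:R * mean (stair h A B) -
   (EP P (fun w => lastp (fun i j => stair h m0 m0 (X w i j)) n k) - n.+1%:R * mean (stair h m0 m0))|
  <= tails k.+1%:R n.+1%:R.
Proof.
have U := stair_lastp_le n k; have L := stair_lastp_ge n k.
have u1 m := EP_lastp_hit Fmeas Fiid Xmeas Xlaw (upc m) n k (bu0 m) (hbu m).
have u2 m := EP_lastp_hitN Fmeas Fiid Xmeas Xlaw (dnc m) n k.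
have l1 m := EP_lastp_hitN Fmeas Fiid Xmeas Xlaw (upc m) n k.
have l2 m := EP_lastp_hit Fmeas Fiid Xmeas Xlaw (dnc m) n k (bd0 m) (hbd m).
have s0 (x : R) : 0 <= Num.sqrt x by exact: sqrtr_ge0.
have M0 : 0 <= k.+1%:R :> R by [].
set M := k.+1%:R in u1 u2 l1 l2 M0 *; set N := n.+1%:R in u1 u2 l1 l2 *.
have U1 : \sum_(m <- index_iota m0 B) eta * EP P (fun w => lastp (hit X (up h m) w) n k) <=
    \sum_(m <- index_iota m0 B) (N * (eta * pu m) + eta * (10 * Num.sqrt (M * (N * pu m)) + M * bu m)).
  apply: ler_sum => m _; apply: le_trans (ler_wpM2l eta0 (u1 m)) _.
  by rewrite le_eqVlt; apply/orP; left; apply/eqP; ring.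
have U2 : \sum_(m <- index_iota m0 A) eta * EP P (fun w => lastp (fun i j => - hit X (dn h m) w i j) n k) <=
    \sum_(m <- index_iota m0 A) (- N * (eta * pd m) + eta * (10 * Num.sqrt (M * (N * pd m)) + M * bd m)).
  apply: ler_sum => m _; apply: le_trans (ler_wpM2l eta0 (u2 m)) _.
  have := mulr_ge0 eta0 (mulr_ge0 M0 (bd0 m)); have := mulr_ge0 eta0 (s0 (M * (N * pd m))); lra.
have L1 : \sum_(m <- index_iota m0 B) eta * EP P (fun w => lastp (fun i j => - hit X (up h m) w i j) n k) <=
    \sum_(m <- index_iota m0 B) (- N * (eta * pu m) + eta * (10 * Num.sqrt (M * (N * pu m)) + M * bu m)).
  apply: ler_sum => m _; apply: le_trans (ler_wpM2l eta0 (l1 m)) _.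
  have := mulr_ge0 eta0 (mulr_ge0 M0 (bu0 m)); have := mulr_ge0 eta0 (s0 (M * (N * pu m))); lra.
have L2 : \sum_(m <- index_iota m0 A) eta * EP P (fun w => lastp (hit X (dn h m) w) n k) <=
    \sum_(m <- index_iota m0 A) (N * (eta * pd m) + eta * (10 * Num.sqrt (M * (N * pd m)) + M * bd m)).
  apply: ler_sum => m _; apply: le_trans (ler_wpM2l eta0 (l2 m)) _.
  by rewrite le_eqVlt; apply/orP; left; apply/eqP; ring.
move: U L U1 U2 L1 L2; rewrite mean_stair_split /tails !big_split /= -!mulr_sumr.
move: (EP P _) (EP P _) (mean _) (eta * _) (eta * _) (eta * _) (eta * _) => a1 a2 a3 a4 a5 a6 a7.
move: (\sum_(m <- _) _) (\sum_(m <- _) _) (\sum_(m <- _) _) (\sum_(m <- _) _) => c1 c2 c3 c4.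
move=> U L U1 U2 L1 L2; rewrite ler_norml; apply/andP; split; lra.
Qed.

Theorem finite_estimate n k (b x : R) : 0 < b -> b * (2 * (m0%:R / h%:R)) <= 4^-1 -> 0 < x < 1 ->
  `|EP P (fun w => lastp (fun i j => stair h A B (X w i j)) n k) -
   (n.+1%:R * mean (stair h A B) +
     Num.sqrt (qvar (stair h m0 m0)) * (2 * fair_slast R k n.+1 - n.+1%:R))| <=
  tails k.+1%:R n.+1%:R +
  (m0%:R / h%:R * k.+1%:R + (n.+1%:R * (6 * b ^+ 2 * (2 * (m0%:R / h%:R)) ^+ 3) +
    (k%:R * ln x^-1 + n.+1%:R * ln (1 - x)^-1) / b)).
Proof.
move=> b0 bK x01; have h1 := stair_lastp_clip n k; have h2 := clip_lindeberg n k b0 bK x01.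
exact: norm_chain h1 h2.
Qed.

End FiniteEstimate.

(** * From tail integrals to tail sums *)

Section SumsAndIntegrals.
Variable R : realType.

Lemma step_sum_le (D : set R) (f : R -> \bar R) (I : nat -> set R) (c : nat -> R) L :
  measurable D -> measurable_fun D f -> (forall x, D x -> (0 <= f x)%E) ->
  (forall i, measurable (I i)) -> trivIset setT I -> (forall i, I i `<=` D) ->
  (forall i, lebesgue_measure (I i) = 1%E) -> (forall i, 0 <= c i) ->
  (forall i x, I i x -> ((c i)%:E <= f x)%E) ->
  ((\sum_(i < L) c i)%:E <= \int[lebesgue_measure]_(x in D) f x)%E.
Proof.
move=> mD mf f0 mI tI ID I1 c0 cf.
pose U := \big[setU/set0]_(i <- iota 0 L) I i.
have UD : U `<=` D.
  rewrite /U; elim: (iota 0 L) => [|i s IH]; first by rewrite big_nil.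
  by rewrite big_cons => x [/ID|/IH].
have mU : measurable U by apply: bigsetU_measurable => i _.
have h1 : (\int[lebesgue_measure]_(x in U) f x <= \int[lebesgue_measure]_(x in D) f x)%E.
  exact: ge0_subset_integral.
apply: le_trans h1.
have h2 : (\int[lebesgue_measure]_(x in U) f x =
    \sum_(i <- iota 0 L) \int[lebesgue_measure]_(x in I i) f x)%E.
  apply: ge0_integral_bigsetU => //.
  - exact: iota_uniq.
  - by apply: sub_trivIset tI.
  - exact: measurable_funS mf.
  - by move=> x /UD; exact: f0.
rewrite h2 -sumEFin -(big_mkord xpredT (fun i => (c i)%:E)) /index_iota subn0.
apply: lee_sum => i _.
have := @integral_cst _ _ _ (@lebesgue_measure R) (I i) (mI i) (c i)%:E.
rewrite [X in _ = (_ * X)%E -> _]I1 mule1 => h3.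
rewrite -h3; apply: ge0_le_integral => //.
- exact: mI.
- by move=> x _; rewrite lee_fin.
- exact: measurable_funS mf.
- exact: cf.
Qed.

Lemma small_tails (c : nat -> R) (G e : R) : (forall i, 0 <= c i) ->
  (forall L, \sum_(i < L) c i <= G) -> 0 < e ->
  exists K, forall K' L, (K <= K')%N -> \sum_(i <- index_iota K' L) c i <= e.
Proof.
move=> c0 cG e0; pose S := [set \sum_(i < L) c i | L in [set: nat]].
have supS : has_sup S.
  by split; [exists (\sum_(i < 0) c i); exists 0%N|exists G => _ [L _ <-]].
have [_ [K _ <-] hK] := sup_adherent e0 supS.
have mono a b : (a <= b)%N -> \sum_(i < a) c i <= \sum_(i < b) c i.
  move=> ab; rewrite -(big_mkord xpredT c) -(big_mkord xpredT c) (@big_cat_nat _ _ _ a 0 b)//=.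
  by rewrite lerDl sumr_ge0.
exists K => K' L KK'; case: (leqP K' L) => KL; last by rewrite big_geq ?ltW// ltnW.
have : \sum_(i < L) c i <= sup S by apply: ub_le_sup; [case: supS|exists L].
rewrite -(big_mkord xpredT c) (@big_cat_nat _ _ _ K' 0 L)//= big_mkord.
have := mono _ _ KK'; move: hK; lra.
Qed.

(** The thresholds [m / h] with the same integer part form a block of [h] terms, so tail sums are
    bounded uniformly in the mesh. *)
Lemma block_sum (g : R -> R) (h K B : nat) : (0 < h)%N ->
  {homo g : x y /~ x <= y} ->
  \sum_(m <- index_iota (K * h) (B * h)) h%:R^-1 * g (m%:R / h%:R) <=
  \sum_(i <- index_iota K B) g i%:R.
Proof.
move=> h0 gmono; elim: B => [|B IH]; first by rewrite mul0n !big_geq.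
case: (leqP K B) => KB; last by rewrite !big_geq// leq_mul2r KB orbT.
have KBh : (K * h <= B * h)%N by rewrite leq_mul2r KB orbT.
rewrite mulSn addnC big_nat_recr// (@big_cat_nat _ _ _ (B * h) (K * h) (B * h + h)) ?leq_addr//=.
apply: lerD => //; have h0' : 0 < h%:R :> R by rewrite ltr0n.
apply: (@le_trans _ _ (\sum_(B * h <= m < B * h + h) h%:R^-1 * g B%:R)).
  rewrite !big_nat; apply: ler_sum => m /andP[Bm _]; rewrite ler_wpM2l ?invr_ge0//.
  by apply: gmono; rewrite ler_pdivlMr// -natrM ler_nat.
by rewrite sumr_const_nat addKn -(mulr_natl (_ * _)) mulrA divff ?mul1r// gt_eqF.
Qed.

End SumsAndIntegrals.

Section Tails.
Context (R : realType) (d : measure_display) (T : measurableType d).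
Variables (P : probability T R) (F : T -> nat -> distr R).
Hypothesis Fmeas : env_measurable F.

Local Notation cdf w x := (distr_cdf (F w 0%N) x).

Definition pgt (t : R) : R := hitbar P F (fun x => t < x).
(** The left tail is reflected, so that all four tail functions are nonincreasing in [t]. *)
Definition ple (t : R) : R := hitbar P F (fun x => x <= - t).
Definition bgt (t : R) : R := fine (ess_sup P (fun w => (1 - cdf w t)%:E)).
Definition ble (t : R) : R := fine (ess_sup P (fun w => (cdf w (- t))%:E)).

Lemma measurable_le_set (t : R) : measurable [set x : R | x <= t].
Proof. exact: measurable_hcell (hcell_le t). Qed.

Lemma distr_cdfE (m : distr R) t : distr_cdf m t = fine (m [set x | x <= t]).
Proof. by rewrite /distr_cdf set_itvNyc. Qed.

Lemma hitp_le w t : hitp F (fun x => x <= t) w 0%N = cdf w t.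
Proof. by rewrite distr_cdfE. Qed.

Lemma hitp_gt w t : hitp F (fun x => t < x) w 0%N = 1 - cdf w t.
Proof.
rewrite distr_cdfE -(distr_setT (F w 0%N)) -distrD//; last exact: measurable_le_set.
congr (fine (F w 0%N _)); apply/seteqP; split => x /=; rewrite ltNge; first by move/negP.
by case=> _ /negP.
Qed.

Lemma cdf01 w t : 0 <= cdf w t <= 1.
Proof. by rewrite distr_cdfE; apply: distr_01; exact: measurable_le_set. Qed.

Lemma cdf_mono w : {homo (fun t => cdf w t) : x y / x <= y}.
Proof.
move=> x y xy; rewrite !distr_cdfE fine_le ?distr_fin//; try exact: measurable_le_set.
apply: le_measure; rewrite ?inE; try exact: measurable_le_set.
by move=> z /= zx; exact: le_trans xy.
Qed.

Lemma bmf_cdf t : bmf (fun w => cdf w t).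
Proof. by under eq_fun do rewrite distr_cdfE; exact: bmf_env (measurable_le_set t). Qed.

Lemma bmf_cdfC t : bmf (fun w => 1 - cdf w t).
Proof. by apply: bmfB; [exact: bmf_cst|exact: bmf_cdf]. Qed.

Lemma pgtE t : pgt t = 1 - fine (\int[P]_w (cdf w t)%:E).
Proof.
rewrite /pgt /hitbar; under eq_EP do rewrite hitp_gt.
by rewrite EPB ?EP_cst//; [exact: bmf_cst|exact: bmf_cdf].
Qed.

Lemma pgt_mono : {homo pgt : x y /~ x <= y}.
Proof.
move=> x y xy; rewrite /pgt /hitbar; under eq_EP do rewrite hitp_gt.
under [leRHS]eq_EP do rewrite hitp_gt.
apply: le_EP => [||w]; [exact: bmf_cdfC..|].
by rewrite lerD2l lerN2 cdf_mono.
Qed.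

Lemma ple_mono : {homo ple : x y /~ x <= y}.
Proof.
move=> x y xy; rewrite /ple /hitbar; under eq_EP do rewrite hitp_le.
under [leRHS]eq_EP do rewrite hitp_le.
apply: le_EP => [||w]; [exact: bmf_cdf..|].
by rewrite cdf_mono// lerN2.
Qed.

Lemma ess_sup01 (f : T -> R) : (forall w, 0 <= f w <= 1) ->
  (0 <= ess_sup P (fun w => (f w)%:E) <= 1)%E.
Proof.
move=> f01; apply/andP; split.
  apply: ess_sup_gee; first by rewrite [X in (_ < X)%E](probability_setT P).
  by apply: nearW => w; rewrite lee_fin; have /andP[] := f01 w.
apply/ess_supP; apply: nearW => w; rewrite lee_fin; by have /andP[] := f01 w.
Qed.

Lemma cdfC01 w t : 0 <= 1 - cdf w t <= 1.
Proof. by have /andP[? ?] := cdf01 w t; apply/andP; split; lra. Qed.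

Lemma ess_sup01_fin (f : T -> R) : (forall w, 0 <= f w <= 1) ->
  ess_sup P (fun w => (f w)%:E) \is a fin_num.
Proof.
move=> /ess_sup01/andP[e0 e1]; rewrite ge0_fin_numE//.
by apply: le_lt_trans e1 _; rewrite ltry.
Qed.

Lemma bgtE t : (bgt t)%:E = ess_sup P (fun w => (1 - cdf w t)%:E).
Proof. by rewrite fineK// ess_sup01_fin// => w; exact: cdfC01. Qed.

Lemma bleE t : (ble t)%:E = ess_sup P (fun w => (cdf w (- t))%:E).
Proof. by rewrite fineK// ess_sup01_fin// => w; exact: cdf01. Qed.

Lemma bgt_ge0 t : 0 <= bgt t.
Proof. by rewrite -lee_fin bgtE; have /andP[] := ess_sup01 (fun w => cdfC01 w t). Qed.

Lemma ble_ge0 t : 0 <= ble t.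
Proof. by rewrite -lee_fin bleE; have /andP[] := ess_sup01 (fun w => cdf01 w (- t)). Qed.

Lemma bgt_mono : {homo bgt : x y /~ x <= y}.
Proof.
move=> x y xy; rewrite -lee_fin !bgtE; apply: le_ess_sup; apply: nearW => w.
by rewrite lee_fin lerD2l lerN2 cdf_mono.
Qed.

Lemma ble_mono : {homo ble : x y /~ x <= y}.
Proof.
move=> x y xy; rewrite -lee_fin !bleE; apply: le_ess_sup; apply: nearW => w.
by rewrite lee_fin cdf_mono// lerN2.
Qed.

Lemma hitp_gt_ae t : {ae P, forall w, hitp F (fun x => t < x) w 0%N <= bgt t}.
Proof.
apply: filterS (ess_sup_ge P (fun w => (1 - cdf w t)%:E)) => w.
by rewrite -bgtE lee_fin hitp_gt.
Qed.

Lemma hitp_le_ae' t : {ae P, forall w, hitp F (fun x => x <= - t) w 0%N <= ble t}.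
Proof.
apply: filterS (ess_sup_ge P (fun w => (cdf w (- t))%:E)) => w.
by rewrite -bleE lee_fin hitp_le.
Qed.

(** Integral test: [g i.+1] is a lower bound on the interval from [i] to [i.+1], which is why the
    sum starts at 1. *)
Lemma sums_right (g : R -> R) (f : R -> \bar R) : {homo g : x y /~ x <= y} -> (forall x, 0 <= g x) ->
  (forall x : R, 0 <= x -> f x = (g x)%:E) ->
  (\int[@lebesgue_measure R]_(x in `[0%R, +oo[) f x < +oo)%E ->
  exists G : R, forall L, \sum_(i < L) g i.+1%:R <= G.
Proof.
move=> gm g0 fg.
have -> : (\int[@lebesgue_measure R]_(x in `[0%R, +oo[) f x =
    \int[@lebesgue_measure R]_(x in `[0%R, +oo[) (g x)%:E)%E.
  by apply: eq_integral => x; rewrite inE /= in_itv /= andbT => /fg.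
move=> fin; exists (fine (\int[@lebesgue_measure R]_(x in `[0%R, +oo[) (g x)%:E)) => L.
rewrite -lee_fin fineK; last first.
  by rewrite ge0_fin_numE//; apply: integral_ge0 => x _; rewrite lee_fin.
apply: (@step_sum_le _ _ _ (fun i => `]i%:R, i.+1%:R]%classic) (fun i => g i.+1%:R)) => //.
- by apply/measurable_EFinP; apply: nonincreasing_measurable => // x y xy; exact: gm.
- by move=> x _; rewrite lee_fin.
- apply/trivIsetP => i j _ _ ij; rewrite -subset0 => x [] /=; rewrite !in_itv /=.
  move=> /andP[ix xi] /andP[jx xj]; move: ij; rewrite neq_ltn => /orP[lt|lt].
    have : (i.+1%:R <= j%:R :> R) by rewrite ler_nat.
    by clear fin; lra.
  have : (j.+1%:R <= i%:R :> R) by rewrite ler_nat.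
  by clear fin; lra.
- move=> i x /=; rewrite !in_itv /= andbT => /andP[ix _].
  by rewrite (le_trans _ (ltW ix)).
- move=> i; rewrite lebesgue_measure_itv /= lte_fin ltr_nat ltnSn -EFinB.
  by rewrite -natr1 addrAC subrr add0r.
- by move=> i x /=; rewrite in_itv /= => /andP[_ xi]; rewrite lee_fin gm.
Qed.

Lemma sums_left (g : R -> R) (f : R -> \bar R) : {homo g : x y /~ x <= y} -> (forall x, 0 <= g x) ->
  (forall x : R, 0 <= x -> f (- x) = (g x)%:E) ->
  (\int[@lebesgue_measure R]_(x in `]-oo, 0%R]) f x < +oo)%E ->
  exists G : R, forall L, \sum_(i < L) g i.+1%:R <= G.
Proof.
move=> gm g0 fg.
have -> : (\int[@lebesgue_measure R]_(x in `]-oo, 0%R]) f x =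
    \int[@lebesgue_measure R]_(x in `]-oo, 0%R]) (g (- x))%:E)%E.
  by apply: eq_integral => x; rewrite inE /= in_itv /= => x0; rewrite -fg ?opprK// oppr_ge0.
move=> fin; exists (fine (\int[@lebesgue_measure R]_(x in `]-oo, 0%R]) (g (- x))%:E)) => L.
rewrite -lee_fin fineK; last first.
  by rewrite ge0_fin_numE//; apply: integral_ge0 => x _; rewrite lee_fin.
apply: (@step_sum_le _ _ _ (fun i => `]- (i.+1%:R), - (i%:R)]%classic) (fun i => g i.+1%:R)) => //.
- apply/measurable_EFinP; apply: nondecreasing_measurable => // x y xy.
  by apply: gm; rewrite lerN2.
- by move=> x _; rewrite lee_fin.
- apply/trivIsetP => i j _ _ ij; rewrite -subset0 => x [] /=; rewrite !in_itv /=.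
  move=> /andP[ix xi] /andP[jx xj]; move: ij; rewrite neq_ltn => /orP[lt|lt].
    have : (i.+1%:R <= j%:R :> R) by rewrite ler_nat.
    by clear fin; lra.
  have : (j.+1%:R <= i%:R :> R) by rewrite ler_nat.
  by clear fin; lra.
- move=> i x /=; rewrite !in_itv /= => /andP[_ xi].
  by rewrite (le_trans xi)// oppr_le0.
- move=> i; rewrite lebesgue_measure_itv /= lte_fin ltrN2 ltr_nat ltnSn -EFinB.
  by rewrite -natr1 opprK addrA addNr add0r.
- by move=> i x /=; rewrite in_itv /= => /andP[xi _]; rewrite lee_fin gm// lerNl ltW.
Qed.

End Tails.

(** * Fatou's lemma for almost sure lower limits *)

Section FatouBound.
Context (R : realType) (d : measure_display) (T : measurableType d).
Variable mu : {measure set T -> \bar R}.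

Lemma limn_einf_sup_einfs (u : (\bar R)^nat) : limn_einf u = ereal_sup (range (einfs u)).
Proof. by rewrite limn_einf_lim; apply/cvg_lim => //; exact: cvg_einfs_sup. Qed.

Lemma limn_einf_ge (u : (\bar R)^nat) (c : \bar R) n0 :
  (forall n, (n0 <= n)%N -> (c <= u n)%E) -> (c <= limn_einf u)%E.
Proof.
move=> cu; rewrite limn_einf_sup_einfs; apply: (@le_trans _ _ (einfs u n0)).
  by apply: le_ereal_inf_tmp => _ [n /= n0n <-]; exact: cu.
by apply: ereal_sup_ubound; exists n0.
Qed.

Lemma limn_einf_le (u : (\bar R)^nat) (c : \bar R) n0 :
  (forall n, (n0 <= n)%N -> (u n <= c)%E) -> (limn_einf u <= c)%E.
Proof.
move=> uc; rewrite limn_einf_sup_einfs; apply: ub_ereal_sup => _ [n _ <-].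
apply: (@le_trans _ _ (u (maxn n n0))); last by apply: uc; exact: leq_maxr.
by apply: ereal_inf_lbound; exists (maxn n n0) => //=; exact: leq_maxl.
Qed.

Lemma measurable_limn_einf (f : nat -> T -> \bar R) : (forall n, measurable_fun setT (f n)) ->
  measurable_fun setT (fun x => limn_einf (f^~ x)).
Proof.
move=> mf; have := @measurable_fun_limn_esup _ _ _ setT (fun n x => - f n x)%E.
move=> h; apply: measurableT_comp => //; apply: h => n.
exact: measurableT_comp.
Qed.

Lemma fatou_liminf (f : nat -> T -> \bar R) (g : T -> \bar R) (C : \bar R) n1 :
  (forall n, measurable_fun setT (f n)) -> (forall n x, (0 <= f n x)%E) ->
  measurable_fun setT g -> (forall x, (0 <= g x)%E) ->
  {ae mu, forall x, (g x <= limn_einf (f^~ x))%E} ->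
  (forall n, (n1 <= n)%N -> (\int[mu]_x f n x <= C)%E) ->
  (\int[mu]_x g x <= C)%E.
Proof.
move=> mf f0 mg g0 gf fC.
have fat := @fatou _ _ _ mu _ measurableT f mf (fun n x _ => f0 n x).
apply: le_trans (limn_einf_le fC); apply: le_trans fat.
apply: ae_ge0_le_integral => //.
- by move=> x _; apply: (@limn_einf_ge _ _ 0).
- exact: measurable_limn_einf.
- by apply: filterS gf => x h _.
Qed.

Lemma fatou_le (f : nat -> T -> \bar R) (g : T -> \bar R) (C : \bar R) n1 :
  (forall n, measurable_fun setT (f n)) -> (forall n x, (0 <= f n x)%E) ->
  measurable_fun setT g -> (forall x, (0 <= g x)%E) ->
  {ae mu, forall x, exists n0, forall n, (n0 <= n)%N -> (g x <= f n x)%E} ->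
  (forall n, (n1 <= n)%N -> (\int[mu]_x f n x <= C)%E) ->
  (\int[mu]_x g x <= C)%E.
Proof.
move=> mf f0 mg g0 gf; apply: fatou_liminf => //.
by apply: filterS gf => x [n0 h]; exact: limn_einf_ge h.
Qed.

End FatouBound.

Section CountThresholds.
Variable R : realType.

(** An indicator of index [L] is added to a sum of at most [L], which raises the square by at most
    [2 * L + 1]. *)
Lemma sum_bool_sqr (u : nat -> bool) L :
  (\sum_(m < L) (u m)%:R) ^+ 2 <= \sum_(m < L) (2 * m%:R + 1) * (u m)%:R :> R.
Proof.
elim: L => [|L IH]; first by rewrite !big_ord0 expr0n.
rewrite !big_ord_recr /=.
have S0 : 0 <= \sum_(m < L) (u m)%:R :> R by apply: sumr_ge0.
have SL : \sum_(m < L) (u m)%:R <= L%:R :> R.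
  rewrite -[X in _ <= X%:R]card_ord -sum1_card natr_sum ler_sum// => m _.
  by case: (u m).
by case: (u L) => /=; rewrite ?mulr0 ?addr0 ?mulr1//; move: IH; lra.
Qed.

Lemma count_lt (y : R) n : y <= 0 -> \sum_(m < n) (m%:R < y)%R%:R = 0 :> R.
Proof.
move=> y0; apply: big1 => m _; rewrite ltNge (le_trans y0)//.
Qed.

Lemma count_lt_bounds (y : R) n : 0 < y ->
  [/\ \sum_(m < n) (m%:R < y)%R%:R <= n%:R :> R,
      \sum_(m < n) (m%:R < y)%R%:R <= y + 1 :> R &
      Num.min y n%:R <= \sum_(m < n) (m%:R < y)%R%:R :> R].
Proof.
move=> y0; elim: n => [|n [h1 h2 h3]].
  by rewrite !big_ord0; split => //; [lra|rewrite ge_min lexx orbT].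
rewrite big_ord_recr /= -natr1; move: h3; rewrite !ge_min => h3.
case: (ltP n%:R y) h3 => yn /=.
  move=> h3; split; [by lra| by lra|]; apply/orP; right.
  by move: h3 => /orP[]; lra.
rewrite addr0 => h3; split => //; [by lra|].
by apply/orP; left; move: h3 => /orP[//|]; lra.
Qed.

Lemma count_le (z : R) n : z < 0 -> \sum_(m < n) (m%:R <= z)%R%:R = 0 :> R.
Proof.
move=> z0; apply: big1 => m _; rewrite leNgt (lt_le_trans z0)//.
Qed.

Lemma count_le_bounds (z : R) n : 0 <= z ->
  [/\ \sum_(m < n) (m%:R <= z)%R%:R <= n%:R :> R,
      \sum_(m < n) (m%:R <= z)%R%:R <= z + 1 :> R &
      Num.min z n%:R <= \sum_(m < n) (m%:R <= z)%R%:R :> R].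
Proof.
move=> z0; elim: n => [|n [h1 h2 h3]].
  by rewrite !big_ord0; split => //; [lra|rewrite ge_min lexx orbT].
rewrite big_ord_recr /= -natr1; move: h3; rewrite !ge_min => h3.
case: (leP n%:R z) h3 => zn /= h3.
  split; [by lra| by lra|]; apply/orP; right.
  by move: h3 => /orP[]; lra.
rewrite addr0; split => //; [by lra|].
by apply/orP; left; move: h3 => /orP[//|]; lra.
Qed.

Variable h : nat.
Hypothesis h0 : (0 < h)%N.

Let h0' : 0 < h%:R :> R. Proof. by rewrite ltr0n. Qed.
Let hi : 0 < h%:R^-1 :> R. Proof. by rewrite invr_gt0. Qed.

Lemma sum_up (x : R) n : \sum_(m < n) (up h m x)%:R = \sum_(m < n) (m%:R < x * h%:R)%R%:R :> R.
Proof. by apply: eq_bigr => m _; rewrite /up ltr_pdivrMr. Qed.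

Lemma sum_dn (x : R) n : \sum_(m < n) (dn h m x)%:R = \sum_(m < n) (m%:R <= - x * h%:R)%R%:R :> R.
Proof. by apply: eq_bigr => m _; rewrite /dn lerNr ler_pdivrMr. Qed.

Lemma stair_pos A B (x : R) : 0 < x ->
  [/\ stair h A B x <= B%:R / h%:R, stair h A B x <= x + h%:R^-1 &
      Num.min x (B%:R / h%:R) <= stair h A B x].
Proof.
move=> x0; rewrite /stair sum_up sum_dn count_le ?subr0; last by rewrite mulNr oppr_lt0 mulr_gt0.
have [h1 h2 h3] := count_lt_bounds B (mulr_gt0 x0 h0').
split.
- by rewrite mulrC ler_pM2r.
- have -> : x + h%:R^-1 = h%:R^-1 * (x * h%:R + 1) by field; rewrite gt_eqF.
  by rewrite ler_pM2l.
- have -> : Num.min x (B%:R / h%:R) = h%:R^-1 * Num.min (x * h%:R) B%:R.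
    by rewrite minr_pMr ?ltW// mulrCA mulVf ?gt_eqF// mulr1 [_ * B%:R]mulrC.
  by rewrite ler_pM2l.
Qed.

Lemma stair_npos A B (x : R) : x <= 0 ->
  [/\ - (A%:R / h%:R) <= stair h A B x, x - h%:R^-1 <= stair h A B x &
      stair h A B x <= - Num.min (- x) (A%:R / h%:R)].
Proof.
move=> x0; rewrite /stair sum_up sum_dn count_lt ?sub0r; last by rewrite mulr_le0_ge0// ltW.
have [|h1 h2 h3] := @count_le_bounds (- x * h%:R) A.
  by rewrite mulr_ge0 ?oppr_ge0// ltW.
split.
- by rewrite mulrN lerN2 mulrC ler_pM2r.
- have -> : x - h%:R^-1 = - (h%:R^-1 * (- x * h%:R + 1)) by field; rewrite gt_eqF.
  by rewrite mulrN lerN2 ler_pM2l.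
- have -> : Num.min (- x) (A%:R / h%:R) = h%:R^-1 * Num.min (- x * h%:R) A%:R.
    by rewrite minr_pMr ?ltW// mulrCA mulVf ?gt_eqF// mulr1 [_ * A%:R]mulrC.
  by rewrite mulrN lerN2 ler_pM2l.
Qed.

Let scale A : (A * h)%:R / h%:R = A%:R :> R.
Proof. by rewrite natrM mulfK// gt_eqF. Qed.

Lemma stair_bounds A B (x : R) : - A%:R <= stair h (A * h) (B * h) x <= B%:R.
Proof.
have A0 : 0 <= A%:R :> R by []. have B0 : 0 <= B%:R :> R by [].
case: (ltP 0 x) => x0.
  have [] := stair_pos (A * h) (B * h) x0; rewrite scale => h1 h2 h3.
  have : 0 <= Num.min x B%:R by rewrite le_min (ltW x0).
  by rewrite h1 andbT; lra.
have [] := stair_npos (A * h) (B * h) x0; rewrite scale => h1 h2 h3.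
have : 0 <= Num.min (- x) A%:R by rewrite le_min oppr_ge0 x0.
by rewrite h1; lra.
Qed.

Lemma stair_ge A B (x : R) : x <= B%:R -> x <= stair h (A * h) (B * h) x + h%:R^-1.
Proof.
move=> xB; case: (ltP 0 x) => x0.
  have [] := stair_pos (A * h) (B * h) x0; rewrite scale => h1 h2 h3.
  by move: h3; rewrite min_l//; have := ltW hi; lra.
have [] := stair_npos (A * h) (B * h) x0; rewrite scale => h1 h2 h3.
by lra.
Qed.

Lemma stair_le A B (x : R) : - A%:R <= x -> stair h (A * h) (B * h) x <= x + h%:R^-1.
Proof.
move=> xA; case: (ltP 0 x) => x0.
  by have [] := stair_pos (A * h) (B * h) x0.
have [] := stair_npos (A * h) (B * h) x0; rewrite scale => h1 h2.
by rewrite min_l; [have := ltW hi; lra|lra].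
Qed.

(** Inside the window only rounding acts; outside, clipping moves [x] towards zero, by at most its
    absolute value. *)
Lemma stair_dist L A B (x : R) : (L <= A)%N -> (L <= B)%N ->
  `|stair h (A * h) (B * h) x - x| <= h%:R^-1 \/
  (`|stair h (A * h) (B * h) x - x| <= `|x| /\ L%:R < `|x|).
Proof.
move=> LA LB.
have LA' : L%:R <= A%:R :> R by rewrite ler_nat.
have LB' : L%:R <= B%:R :> R by rewrite ler_nat.
have A0 : 0 <= A%:R :> R by []. have B0 : 0 <= B%:R :> R by [].
case: (leP `|x| L%:R) => xL.
  move: xL; rewrite ler_norml => /andP[xL1 xL2]; left.
  have u : x <= stair h (A * h) (B * h) x + h%:R^-1 by apply: stair_ge; lra.
  have l : stair h (A * h) (B * h) x <= x + h%:R^-1 by apply: stair_le; lra.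
  by rewrite ler_norml; apply/andP; split; lra.
case: (ltP 0 x) => x0.
  have [] := stair_pos (A * h) (B * h) x0; rewrite scale => h1 h2 h3.
  case: (leP x B%:R) => xB; [left|right; split => //].
    by move: h3; rewrite min_l// => h3; rewrite ler_norml; apply/andP; split; have := ltW hi; lra.
  by move: h3; rewrite (min_r (ltW xB)) => h3; rewrite (gtr0_norm x0) ler_norml; apply/andP; split; lra.
have [] := stair_npos (A * h) (B * h) x0; rewrite scale => h1 h2 h3.
case: (leP (- x) A%:R) => xA; [left|right; split => //].
  by move: h3; rewrite min_l// => h3; rewrite ler_norml; apply/andP; split; have := ltW hi; lra.
by move: h3; rewrite (min_r (ltW xA)) => h3; rewrite (ler0_norm x0) ler_norml; apply/andP; split; lra.
Qed.

End CountThresholds.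

(** * Moments of the environment *)

Section SecondMoment.
Variable R : realType.

(** The embedding of the Lorentz space L(2,1) into L2, in discrete form: by monotonicity
    [i * sqrt (p i)] is at most the sum of the square roots, so one factor [sqrt (p i)] of each term
    trades its weight for [G]. *)
Lemma weighted_sum_le (p : nat -> R) (G : R) L : (forall m, 0 <= p m <= 1) ->
  (forall m, p m.+1 <= p m) -> (forall L, \sum_(i < L) Num.sqrt (p i.+1) <= G) ->
  \sum_(m < L) (2 * m%:R + 1) * p m <= 1 + 3 * G ^+ 2.
Proof.
move=> p01 pd pG.
have G0 : 0 <= G by have := pG 0%N; rewrite big_ord0.
have s0 i : 0 <= Num.sqrt (p i) by exact: sqrtr_ge0.
case: L => [|L].
  by rewrite big_ord0 addr_ge0// mulr_ge0// sqr_ge0.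
rewrite big_ord_recl /= mulr0 add0r mul1r lerD//; first by case/andP: (p01 0%N).
apply: (@le_trans _ _ (\sum_(i < L) 3 * G * Num.sqrt (p i.+1))); last first.
  by rewrite -mulr_sumr expr2 mulrA ler_wpM2l ?mulr_ge0.
apply: ler_sum => i _; rewrite /bump leq0n add1n.
have ps : p i.+1 = Num.sqrt (p i.+1) * Num.sqrt (p i.+1).
  by rewrite -expr2 sqr_sqrtr//; case/andP: (p01 i.+1).
have mono a b : (a <= b)%N -> p b <= p a.
  move=> ab; rewrite -(subnK ab); elim: (b - a)%N => [|c IH]; first by rewrite add0n.
  by rewrite addSn (le_trans (pd _)).
have iG : i.+1%:R * Num.sqrt (p i.+1) <= G.
  apply: le_trans (pG i.+1).
  rewrite -[X in X%:R * _]card_ord mulr_natl -sumr_const; apply: ler_sum => j _.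
  by apply: ler_wsqrtr; exact: mono.
rewrite [X in _ * X <= _]ps mulrA ler_wpM2r//.
have e1 : (1 : R) <= i.+1%:R by rewrite ler1n.
apply: (@le_trans _ _ (3 * (i.+1%:R * Num.sqrt (p i.+1)))); last by rewrite ler_wpM2l.
by rewrite mulrA ler_wpM2r//; lra.
Qed.

End SecondMoment.

Section RealIntegrable.
Context (R : realType) (d : measure_display) (T : measurableType d) (P : probability T R).

Lemma integrable_scale (c : R) (u : T -> R) : P.-integrable setT (EFin \o u) ->
  P.-integrable setT (EFin \o (fun x => c * u x)).
Proof. by move=> Iu; have := integrableZl measurableT c Iu. Qed.

Lemma integrable_add (u v : T -> R) : P.-integrable setT (EFin \o u) ->
  P.-integrable setT (EFin \o v) -> P.-integrable setT (EFin \o (fun x => u x + v x)).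
Proof. by move=> Iu Iv; have := integrableD measurableT Iu Iv. Qed.

Lemma integrable_cst (c : R) : P.-integrable setT (EFin \o (fun=> c)).
Proof. exact/bmf_integrable/bmf_cst. Qed.

Lemma EPDi (u v : T -> R) : P.-integrable setT (EFin \o u) -> P.-integrable setT (EFin \o v) ->
  EP P (fun x => u x + v x) = EP P u + EP P v.
Proof. by move=> Iu Iv; rewrite /EP RintegralD. Qed.

Lemma EPBi (u v : T -> R) : P.-integrable setT (EFin \o u) -> P.-integrable setT (EFin \o v) ->
  EP P (fun x => u x - v x) = EP P u - EP P v.
Proof. by move=> Iu Iv; rewrite /EP RintegralB. Qed.

Lemma EPZi (c : R) (u : T -> R) : P.-integrable setT (EFin \o u) ->
  EP P (fun x => c * u x) = c * EP P u.
Proof. by move=> Iu; rewrite /EP RintegralZl. Qed.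

End RealIntegrable.

Section GoodDistribution.
Variables (R : realType) (m : distr R).
Hypothesis sqr_fin : (\int[m]_x (x ^+ 2)%:E < +oo)%E.

Let mid : measurable_fun setT (fun x : R => x). Proof. exact: measurable_id. Qed.

Lemma integrable_sqr : m.-integrable setT (EFin \o (fun x => x ^+ 2)).
Proof.
apply/integrableP; split; first exact/measurable_EFinP.
under eq_integral do rewrite gee0_abs ?lee_fin ?sqr_ge0//.
exact: sqr_fin.
Qed.

Lemma integrable_quad (f : R -> R) (e c : R) : measurable_fun setT f -> 0 <= e -> 0 <= c ->
  (forall x, `|f x| <= e + c * x ^+ 2) -> m.-integrable setT (EFin \o f).
Proof.
move=> mf e0 c0 fq.
have Iq := integrable_add (integrable_cst m e) (integrable_scale c integrable_sqr).
apply: (le_integrable measurableT _ _ Iq); first exact/measurable_EFinP.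
move=> x _; rewrite lee_fin.
by rewrite [X in _ <= X]ger0_norm ?fq// addr_ge0// mulr_ge0// sqr_ge0.
Qed.

Lemma integrable_idR : m.-integrable setT (EFin \o (fun x => x)).
Proof.
apply: (@integrable_quad _ 1 1) => // x; rewrite mul1r.
have := sqr_ge0 (`|x| - 1); have := real_normK (num_real x).
move: (`|x|) (normr_ge0 x) => y y0 <-; lra.
Qed.

Let I1 := integrable_idR.
Let I2 := integrable_sqr.

Lemma distr_mean_close (f : R -> R) (e c : R) : bmf f -> 0 <= e -> 0 <= c ->
  (forall x, `|f x - x| <= e + c * x ^+ 2) ->
  `|EP m f - EP m (fun x => x)| <= e + c * EP m (fun x => x ^+ 2).
Proof.
move=> bf e0 c0 fx; have If := bmf_integrable m bf.
have [mf _] := bf.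
have mfx : measurable_fun setT (fun x => f x - x) by exact: measurable_funB.
have Ifx := integrable_quad mfx e0 c0 fx.
rewrite /EP -RintegralB//.
apply: le_trans (le_normr_Rintegral _ _) _ => //.
have Iq : m.-integrable setT (EFin \o (fun x => c * x ^+ 2)).
  apply: (@integrable_quad _ 0 c) => // [|x]; first exact: measurable_funM.
  by rewrite add0r ger0_norm// mulr_ge0// sqr_ge0.
have -> : e + c * \int[m]_x (x ^+ 2) = \int[m]_x (e + c * x ^+ 2).
  by rewrite RintegralD ?RintegralZl//; [rewrite -/(EP m (fun=> e)) EP_cst|exact: integrable_cst].
apply: le_Rintegral => //.
- apply: (@integrable_quad _ e c) => // [|x]; first exact: measurableT_comp.
  by rewrite normr_id.
- apply: (@integrable_quad _ e c) => // [|x].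
    by apply: measurable_funD => //; exact: measurable_funM.
  by rewrite ger0_norm// addr_ge0// mulr_ge0// sqr_ge0.
Qed.

(** The variance of [f + g] is nonnegative; with a rescaled [f] this is Young's inequality for
    covariances. *)
Lemma EP_centered (f g : R -> R) :
  m.-integrable setT (EFin \o f) -> m.-integrable setT (EFin \o g) ->
  m.-integrable setT (EFin \o (fun x => f x ^+ 2)) ->
  m.-integrable setT (EFin \o (fun x => g x ^+ 2)) ->
  m.-integrable setT (EFin \o (fun x => f x * g x)) ->
  0 <= (EP m (fun x => f x ^+ 2) - EP m f ^+ 2) + 2 * (EP m (fun x => f x * g x) - EP m f * EP m g)
     + (EP m (fun x => g x ^+ 2) - EP m g ^+ 2).
Proof.
move=> If Ig If2 Ig2 Ifg; pose a := EP m f; pose b := EP m g.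
have : 0 <= EP m (fun x => (f x - a + (g x - b)) ^+ 2) by apply: EP_ge0 => x; exact: sqr_ge0.
have Z := integrable_scale (P := m).
have D := integrable_add (P := m).
pose c := - 2 * (a + b).
have -> : EP m (fun x => (f x - a + (g x - b)) ^+ 2) =
    EP m (fun x => f x ^+ 2 + (2 * (f x * g x) + (g x ^+ 2 + (c * f x + (c * g x + (a + b) ^+ 2))))).
  by apply: eq_EP => x; rewrite /c; ring.
have Ic := integrable_cst m ((a + b) ^+ 2).
have J1 := D _ _ (Z c _ Ig) Ic.
have J2 := D _ _ (Z c _ If) J1.
have J3 := D _ _ Ig2 J2.
have J4 := D _ _ (Z 2 _ Ifg) J3.
rewrite EPDi// EPDi//; last exact: Z.
rewrite EPDi// EPDi//; last exact: Z.
rewrite EPDi//; last exact: Z.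
by rewrite EP_cst !EPZi// -/a -/b /c; lra.
Qed.

(** With [dl = f - x] the two variances differ by twice a covariance plus the variance of [dl].
    Young's inequality with weight [th] moves the covariance onto the variance of [x] and that of
    [dl]. *)
Lemma distr_var_close (f t : R -> R) (e th : R) : bmf f -> 0 <= e -> 0 < th ->
  measurable_fun setT t -> (forall x, 0 <= t x <= x ^+ 2) ->
  (forall x, (f x - x) ^+ 2 <= e + t x) ->
  `|(EP m (fun x => f x ^+ 2) - EP m f ^+ 2) -
    (EP m (fun x => x ^+ 2) - EP m (fun x => x) ^+ 2)| <=
  th * EP m (fun x => x ^+ 2) + (1 + th^-1) * (e + EP m t).
Proof.
move=> bf e0 th0 mt t01 fxt; have If := bmf_integrable m bf.
have [mf [K fK]] := bf.
pose dl x := f x - x.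
have mdl : measurable_fun setT dl by exact: measurable_funB.
have dl2 x : dl x ^+ 2 <= e + 1 * x ^+ 2.
  by rewrite mul1r; apply: le_trans (fxt x) _; rewrite lerD2l; have /andP[] := t01 x.
have Idl : m.-integrable setT (EFin \o dl).
  apply: (@integrable_quad _ (1 + e) 1) => //; first by rewrite addr_ge0.
  move=> x; have := dl2 x; have := sqr_ge0 (`|dl x| - 1); have := real_normK (num_real (dl x)).
  move: (`|dl x|) (normr_ge0 (dl x)) => y y0 <-; lra.
have Idl2 : m.-integrable setT (EFin \o (fun x => dl x ^+ 2)).
  apply: (@integrable_quad _ e 1) => // [|x]; first exact: measurable_funX.
  by rewrite ger0_norm ?sqr_ge0.
have Ixdl : m.-integrable setT (EFin \o (fun x => x * dl x)).
  apply: (@integrable_quad _ e 2) => // [|x]; first exact: measurable_funM.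
  have := sqr_ge0 (`|x| - `|dl x|); have := dl2 x; rewrite normrM.
  have := real_normK (num_real (dl x)); have := real_normK (num_real x).
  have := normr_ge0 x; have := normr_ge0 (dl x); have := sqr_ge0 x.
  move: (`|x|) (`|dl x|) => y z; move=> ? ? ? <- <- ; nra.
pose a := EP m (fun x => x ^+ 2); pose b := EP m (fun x => x).
pose g := EP m dl; pose ee := EP m (fun x => dl x ^+ 2); pose c := EP m (fun x => x * dl x).
have Ef : EP m f = b + g.
  rewrite /b /g /EP -RintegralD//; apply: eq_Rintegral => x _; rewrite /dl; ring.
have Z := integrable_scale (P := m).
have D := integrable_add (P := m).
have Ef2 : EP m (fun x => f x ^+ 2) = a + (2 * c + ee).
  rewrite /a /c /ee /EP -RintegralZl// -RintegralD//; last exact: Z.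
  rewrite -RintegralD//; first by apply: eq_Rintegral => x _; rewrite /dl; ring.
  exact: D (Z 2 _ Ixdl) Idl2.
have et : ee <= e + EP m t.
  have It : m.-integrable setT (EFin \o t).
    apply: (@integrable_quad _ 0 1) => // x; rewrite add0r mul1r.
    by have /andP[t0 t1] := t01 x; rewrite ger0_norm.
  have -> : e + EP m t = \int[m]_x (e + t x).
    by rewrite RintegralD//; [rewrite -/(EP m (fun=> e)) EP_cst|exact: integrable_cst].
  apply: le_Rintegral => //.
    exact: D (integrable_cst m e) It.
  by move=> x _; exact: fxt.
have Ev (u : R -> R) : m.-integrable setT (EFin \o u) -> m.-integrable setT (EFin \o (fun x => u x ^+ 2)) ->
    0 <= EP m (fun x => u x ^+ 2) - EP m u ^+ 2.
  move=> Iu Iu2; have := EP_centered Iu (integrable_cst m 0) Iu2.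
  have e00 : EP m (fun=> 0 : R) = 0 by rewrite EP_cst.
  have -> : (fun x => u x * 0) = (fun=> 0) by apply/funext => x; rewrite mulr0.
  have -> : (fun x : R => (0 : R) ^+ 2) = (fun=> 0) by apply/funext => x; rewrite expr0n.
  rewrite !e00 => /(_ (integrable_cst m 0) (integrable_cst m 0)); lra.
have vx : 0 <= a - b ^+ 2 by apply: Ev.
have vd : 0 <= ee - g ^+ 2 by apply: Ev.
(* The variance of [s * x + dl]; the values [- th] and [th] give the two signs of the covariance. *)
have cov (s : R) : 0 <= s ^+ 2 * (a - b ^+ 2) + 2 * s * (c - b * g) + (ee - g ^+ 2).
  have := EP_centered (Z s _ I1) Idl.
  have E1 : EP m (fun x => s * x) = s * b by rewrite /EP RintegralZl.
  have E2 : EP m (fun x => (s * x) ^+ 2) = s ^+ 2 * a.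
    rewrite -[RHS]RintegralZl//; apply: eq_Rintegral => x _; ring.
  have E3 : EP m (fun x => s * x * dl x) = s * c.
    rewrite -[RHS]RintegralZl//; apply: eq_Rintegral => x _; ring.
  rewrite E1 E2 E3 => H.
  have {}H := H _ Idl2 _; move: (H) => {H} H.
  suff : 0 <= s ^+ 2 * a - (s * b) ^+ 2 + 2 * (s * c - s * b * g) + (ee - g ^+ 2) by lra.
  apply: H.
    have := Z (s ^+ 2) _ I2; congr (_.-integrable _ _); apply/funext => x /=; congr EFin; ring.
  have := Z s _ Ixdl; congr (_.-integrable _ _); apply/funext => x /=; congr EFin; ring.
rewrite Ef Ef2 -/a -/b.
have k1 : 2 * (c - b * g) <= th * (a - b ^+ 2) + th^-1 * (ee - g ^+ 2).
  have := mulr_ge0 (ltW th0 : 0 <= th) vx.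
  have := cov (- th); have thi : 0 < th^-1 by rewrite invr_gt0.
  move=> H _; have := mulr_ge0 (ltW thi) H.
  have -> : th^-1 * ((- th) ^+ 2 * (a - b ^+ 2) + 2 * - th * (c - b * g) + (ee - g ^+ 2)) =
    th * (a - b ^+ 2) - 2 * (c - b * g) + th^-1 * (ee - g ^+ 2) by field; rewrite gt_eqF.
  lra.
have k2 : - (2 * (c - b * g)) <= th * (a - b ^+ 2) + th^-1 * (ee - g ^+ 2).
  have := cov th; have thi : 0 < th^-1 by rewrite invr_gt0.
  move=> H; have := mulr_ge0 (ltW thi) H.
  have -> : th^-1 * (th ^+ 2 * (a - b ^+ 2) + 2 * th * (c - b * g) + (ee - g ^+ 2)) =
    th * (a - b ^+ 2) + 2 * (c - b * g) + th^-1 * (ee - g ^+ 2) by field; rewrite gt_eqF.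
  lra.
have thi : 0 < th^-1 by rewrite invr_gt0.
have b2 := mulr_ge0 (ltW th0) (sqr_ge0 b).
have k3 : th^-1 * (ee - g ^+ 2) <= th^-1 * (e + EP m t).
  by rewrite ler_pM2l//; have := sqr_ge0 g; lra.
have g2 := sqr_ge0 g.
have -> : a + (2 * c + ee) - (b + g) ^+ 2 - (a - b ^+ 2) = 2 * (c - b * g) + (ee - g ^+ 2) by ring.
have -> : (1 + th^-1) * (e + EP m t) = e + EP m t + th^-1 * (e + EP m t) by ring.
move: et k1 k2 k3; set z := th^-1 * (ee - g ^+ 2).
move: (th^-1 * (e + EP m t)) (e + EP m t) => z' z2 k0 k1 k2 k3.
clear -k0 k1 k2 k3 b2 g2 vd vx.
by rewrite ler_norml; apply/andP; split; lra.
Qed.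

Lemma distr_var_integral :
  (\int[m]_x ((x - EP m (fun x => x)) ^+ 2)%:E)%E =
  (EP m (fun x => x ^+ 2) - EP m (fun x => x) ^+ 2)%:E.
Proof.
set b := EP m (fun x => x).
have Z := integrable_scale (P := m).
have I3 : m.-integrable setT (EFin \o (fun x => - 2 * b * x + b ^+ 2)).
  exact: integrable_add (Z (- 2 * b) _ I1) (integrable_cst m _).
have I4 : m.-integrable setT (EFin \o (fun x => x ^+ 2 + (- 2 * b * x + b ^+ 2))).
  exact: integrable_add I2 I3.
have -> : (\int[m]_x ((x - b) ^+ 2)%:E = \int[m]_x (x ^+ 2 + (- 2 * b * x + b ^+ 2))%:E)%E.
  by apply: eq_integral => x _; congr EFin; ring.
rewrite -[LHS]fineK; last exact: integrable_fin_num I4.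
congr EFin; rewrite -/(Rintegral m setT (fun x => x ^+ 2 + (- 2 * b * x + b ^+ 2))).
rewrite RintegralD// RintegralD//; [|exact: Z|exact: integrable_cst].
rewrite RintegralZl// -/(EP m (fun x => x)) -/(EP m (fun=> b ^+ 2)) EP_cst -/b /EP; ring.
Qed.

End GoodDistribution.

Section Moments.
Context (R : realType) (d : measure_display) (T : measurableType d).
Variables (P : probability T R) (F : T -> nat -> distr R).
Hypothesis Fmeas : env_measurable F.

Definition sqr_int (w : T) : \bar R := (\int[F w 0%N]_x (x ^+ 2)%:E)%E.

Lemma measurable_int_nonneg (f : R -> \bar R) : (forall x, (0 <= f x)%E) ->
  measurable_fun setT f -> measurable_fun setT (fun w => (\int[F w 0%N]_x f x)%E).
Proof.
move=> f0 mf.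
exact: (@measurable_fun_integral_kernel _ _ _ _ _ (fun w => F w 0%N) (fun U mU => Fmeas 0 mU) f f0 mf).
Qed.

Lemma measurable_sqr_int : measurable_fun setT sqr_int.
Proof.
apply: measurable_int_nonneg => [x|]; first by rewrite lee_fin sqr_ge0.
by apply/measurable_EFinP; exact: measurable_funX.
Qed.

Lemma sqr_int_ge0 w : (0 <= sqr_int w)%E.
Proof. by apply: integral_ge0 => x _; rewrite lee_fin sqr_ge0. Qed.

Lemma stair1_sqr L (x : R) : stair 1 L L x ^+ 2 <=
  2 * \sum_(m < L) (2 * m%:R + 1) * (up 1 m x)%:R + 2 * \sum_(m < L) (2 * m%:R + 1) * (dn 1 m x)%:R.
Proof.
rewrite /stair invr1 mul1r.
have := @sum_bool_sqr R (fun m => up 1 m x) L; have := @sum_bool_sqr R (fun m => dn 1 m x) L.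
set a := \sum_(m < L) _; set b := \sum_(m < L) (2 * _ + 1) * _.
set c := \sum_(m < L) (up 1 m x)%:R; set e := \sum_(m < L) (2 * _ + 1) * (up 1 m x)%:R.
have := sqr_ge0 (a + c); lra.
Qed.

Lemma stair1_ge L (x : R) : `|x| <= L%:R -> x ^+ 2 <= stair 1 L L x ^+ 2.
Proof.
rewrite ler_norml => /andP[x1 x2].
have D1 : L%:R / 1%:R = L%:R :> R by rewrite divr1.
case: (ltP 0 x) => x0.
  have [_ _] := @stair_pos R 1 isT L L x x0; rewrite D1 min_l// => h.
  by rewrite lerXn2r// nnegrE ?(ltW x0)// (le_trans (ltW x0)).
have [_ _] := @stair_npos R 1 isT L L x x0; rewrite D1 min_l; last by rewrite lerNl.
rewrite opprK => h.
rewrite -[x ^+ 2]sqrrN -[stair _ _ _ _ ^+ 2]sqrrN lerXn2r ?nnegrE ?oppr_ge0// ?lerN2//.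
exact: le_trans h x0.
Qed.

Lemma EP_stair1_sqr L (Gu Gd : R) :
  (forall L, \sum_(i < L) Num.sqrt (pgt P F i.+1%:R) <= Gu) ->
  (forall L, \sum_(i < L) Num.sqrt (ple P F i.+1%:R) <= Gd) ->
  EP P (fun w => EP (F w 0%N) (fun x => stair 1 L L x ^+ 2)) <=
  2 * (1 + 3 * Gu ^+ 2) + 2 * (1 + 3 * Gd ^+ 2).
Proof.
move=> hu hd.
have upc m := @up_cell R 1 m; have dnc m := @dn_cell R 1 m.
have bu m := bmf_cellfun (upc m); have bd m := bmf_cellfun (dnc m).
have bu' m : bmf (fun w => hitp F (up 1 m) w 0%N) by apply: bmf_hitp.
have bd' m : bmf (fun w => hitp F (dn 1 m) w 0%N) by apply: bmf_hitp.
have puE m : hitbar P F (up 1 m) = pgt P F m%:R.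
  by rewrite /pgt; congr hitbar; apply/funext => x; rewrite /up divr1.
have pdE m : hitbar P F (dn 1 m) = ple P F m%:R.
  by rewrite /ple; congr hitbar; apply/funext => x; rewrite /dn divr1.
have p01 (q : R -> bool) : (forall a, hcell [set x | q x = a]) -> 0 <= hitbar P F q <= 1.
  by move=> qc; apply: EP_01 => [|w]; [exact: bmf_hitp|exact: hitp01].
have c0 m : 0 <= 2 * m%:R + 1 :> R by rewrite addr_ge0// mulr_ge0.
have bS : bmf (fun x : R => 2 * \sum_(m < L) (2 * m%:R + 1) * (up 1 m x)%:R +
    2 * \sum_(m < L) (2 * m%:R + 1) * (dn 1 m x)%:R : R).
  by apply: bmfD; apply: bmfZ; apply: bmf_sum => m; apply: bmfZ.
have b2 : bmf (fun x : R => stair 1 L L x ^+ 2).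
  by under eq_fun do rewrite expr2; apply: bmfM; exact: bmf_stair.
have e1 w : EP (F w 0%N) (fun x => stair 1 L L x ^+ 2) <=
   2 * \sum_(m < L) (2 * m%:R + 1) * hitp F (up 1 m) w 0%N +
   2 * \sum_(m < L) (2 * m%:R + 1) * hitp F (dn 1 m) w 0%N.
  apply: le_trans (le_EP _ b2 bS (fun x => stair1_sqr L x)) _.
  rewrite EPD; [|by apply: bmfZ; apply: bmf_sum => m; apply: bmfZ..].
  rewrite !EPZ; [|by apply: bmf_sum => m; apply: bmfZ..].
  rewrite !EP_sum; [|by move=> m; apply: bmfZ..].
  under eq_bigr => m _ do rewrite EPZ// EP_cellfun//.
  by under [X in _ + 2 * X <= _]eq_bigr => m _ do rewrite EPZ// EP_cellfun//.
have lvE : (stair 1 L L : R -> R) = (fun x => levelval R 1 L (level 1 L x)).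
  by apply/funext => x; exact: stair_level.
have bE : bmf (fun w => EP (F w 0%N) (fun x => stair 1 L L x ^+ 2)).
  rewrite lvE; exact: (bmf_EP_quant Fmeas (fun a => levelval R 1 L a ^+ 2) (iota_uniq 0 (L + L).+1)
    (@level_mem R 1 L) (@level_cell R 1 L)).
apply: (@le_trans _ _ (2 * \sum_(m < L) (2 * m%:R + 1) * pgt P F m%:R +
    2 * \sum_(m < L) (2 * m%:R + 1) * ple P F m%:R)).
  apply: le_trans (le_EP _ bE _ e1) _.
    by apply: bmfD; apply: bmfZ; apply: bmf_sum => m; apply: bmfZ.
  rewrite EPD; [|by apply: bmfZ; apply: bmf_sum => m; apply: bmfZ..].
  rewrite !EPZ; [|by apply: bmf_sum => m; apply: bmfZ..].
  rewrite !EP_sum; [|by move=> m; apply: bmfZ..].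
  under eq_bigr => m _ do rewrite EPZ// -/(hitbar P F (up 1 m)) puE.
  by under [X in _ + 2 * X <= _]eq_bigr => m _ do rewrite EPZ// -/(hitbar P F (dn 1 m)) pdE.
apply: lerD; rewrite ler_pM2l//.
  apply: (@weighted_sum_le _ (fun m => pgt P F m%:R)) => // m.
    by rewrite -puE; exact: p01.
  by apply: pgt_mono => //; rewrite ler_nat.
apply: (@weighted_sum_le _ (fun m => ple P F m%:R)) => // m.
  by rewrite -pdE; exact: p01.
by apply: ple_mono => //; rewrite ler_nat.
Qed.

(** The staircases of mesh 1 dominate [x ^+ 2] once [L] exceeds the absolute value of [x], and their
    second moments are bounded uniformly in [L]. Fatou's lemma is used under the random law of row 0
    and then under [P]. *)
Lemma sqr_int_bound (Gu Gd : R) :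
  (forall L, \sum_(i < L) Num.sqrt (pgt P F i.+1%:R) <= Gu) ->
  (forall L, \sum_(i < L) Num.sqrt (ple P F i.+1%:R) <= Gd) ->
  (\int[P]_w sqr_int w < +oo)%E.
Proof.
move=> hu hd; apply: (@le_lt_trans _ _ (2 * (1 + 3 * Gu ^+ 2) + 2 * (1 + 3 * Gd ^+ 2))%:E); last exact: ltry.
have lvE L : (stair 1 L L : R -> R) = (fun x => levelval R 1 L (level 1 L x)).
  by apply/funext => x; exact: stair_level.
have bE L : bmf (fun w => EP (F w 0%N) (fun x => stair 1 L L x ^+ 2)).
  rewrite lvE; exact: (bmf_EP_quant Fmeas (fun a => levelval R 1 L a ^+ 2) (iota_uniq 0 (L + L).+1)
    (@level_mem R 1 L) (@level_cell R 1 L)).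
have b2 L : bmf (fun x : R => stair 1 L L x ^+ 2).
  by under eq_fun do rewrite expr2; apply: bmfM; exact: bmf_stair.
have IE w L : (\int[F w 0%N]_x (stair 1 L L x ^+ 2)%:E = (EP (F w 0%N) (fun x => stair 1 L L x ^+ 2))%:E)%E.
  by rewrite fineK//; exact: integrable_fin_num (bmf_integrable _ (b2 L)).
apply: (@fatou_liminf _ _ _ P (fun L w => (EP (F w 0%N) (fun x => stair 1 L L x ^+ 2))%:E) _ _ 0).
- by move=> L; apply/measurable_EFinP; case: (bE L).
- by move=> L w; rewrite lee_fin; apply: EP_ge0 => x; exact: sqr_ge0.
- exact: measurable_sqr_int.
- exact: sqr_int_ge0.
- apply: nearW => w; rewrite /sqr_int.
  have m2 L : measurable_fun setT (fun x : R => (stair 1 L L x ^+ 2)%:E).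
    by apply/measurable_EFinP; case: (b2 L).
  have fat := @fatou _ _ _ (F w 0%N) _ measurableT (fun L (x : R) => (stair 1 L L x ^+ 2)%:E) m2.
  have f0 L (x : R) : (0 <= (stair 1 L L x ^+ 2)%:E)%E by rewrite lee_fin sqr_ge0.
  have {}fat := fat (fun L x _ => f0 L x).
  have e : (fun n => \int[F w 0%N]_x (stair 1 n n x ^+ 2)%:E)%E =
      (fun n => (EP (F w 0%N) (fun x => stair 1 n n x ^+ 2))%:E) by apply/funext => n; exact: IE.
  rewrite e in fat; apply: le_trans fat; apply: ge0_le_integral => //.
  + by move=> x _; rewrite lee_fin sqr_ge0.
  + by apply/measurable_EFinP; exact: measurable_funX.
  + exact: measurable_limn_einf.
  + move=> x _; apply: (@limn_einf_ge _ _ _ (Num.truncn `|x|).+1) => n xn.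
    rewrite lee_fin stair1_ge//.
    have /andP[_ /ltW h] := truncn_itv (normr_ge0 x).
    by apply: le_trans h _; rewrite ler_nat.
- move=> L _; rewrite -[leLHS]fineK.
    by rewrite lee_fin; exact: EP_stair1_sqr.
  exact: integrable_fin_num (bmf_integrable _ (bE L)).
Qed.

End Moments.

Section AlmostEverywhere.
Context (R : realType) (d : measure_display) (T : measurableType d) (P : probability T R).

Lemma integrable_measurable (u : T -> R) : P.-integrable setT (EFin \o u) -> measurable_fun setT u.
Proof. by case/integrableP => /measurable_EFinP. Qed.

Lemma integrable_ae_le (u g : T -> R) : measurable_fun setT u -> (forall w, 0 <= g w) ->
  P.-integrable setT (EFin \o g) -> {ae P, forall w, `|u w| <= g w} ->
  P.-integrable setT (EFin \o u).
Proof.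
move=> mu g0 Ig ug; have mg := integrable_measurable Ig.
apply/integrableP; split; first exact/measurable_EFinP.
case/integrableP: Ig => _; apply: le_lt_trans; apply: ae_ge0_le_integral => //.
- by apply: measurableT_comp => //; exact/measurable_EFinP.
- by apply: measurableT_comp => //; exact/measurable_EFinP.
- by apply: filterS ug => w ugw _ /=; rewrite lee_fin [X in _ <= X]ger0_norm.
Qed.

Lemma le_EPi_ae (u v : T -> R) : P.-integrable setT (EFin \o u) -> P.-integrable setT (EFin \o v) ->
  {ae P, forall w, u w <= v w} -> EP P u <= EP P v.
Proof.
move=> Iu Iv uv; have [mu mv] := (integrable_measurable Iu, integrable_measurable Iv).
rewrite -subr_ge0 -EPBi//.
have mB : measurable_fun setT (fun w => v w - u w) by exact: measurable_funB.
have mM : measurable_fun setT (fun w => Num.max (v w - u w) 0) by exact: measurable_maxr.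
suff -> : EP P (fun w => v w - u w) = EP P (fun w => Num.max (v w - u w) 0).
  by apply: EP_ge0 => w; rewrite le_max lexx orbT.
congr fine; apply: ae_eq_integral => //.
- exact/measurable_EFinP.
- exact/measurable_EFinP.
- by apply: filterS uv => w uvw _ /=; rewrite max_l// subr_ge0.
Qed.

Lemma EP_dist_ae (u v r : T -> R) : P.-integrable setT (EFin \o u) ->
  P.-integrable setT (EFin \o v) -> P.-integrable setT (EFin \o r) ->
  {ae P, forall w, `|u w - v w| <= r w} -> `|EP P u - EP P v| <= EP P r.
Proof.
move=> Iu Iv Ir uv; rewrite ler_norml; apply/andP; split.
  rewrite lerBrDr addrC -lerBrDr opprK -EPDi//; apply: le_EPi_ae => //.
    exact: integrable_add.
  by apply: filterS uv => w; rewrite ler_norml => /andP[+ _]; lra.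
rewrite lerBlDr -EPDi//; apply: le_EPi_ae => //; first exact: integrable_add.
by apply: filterS uv => w; rewrite ler_norml => /andP[_ +]; lra.
Qed.

End AlmostEverywhere.

Section OuterMoments.
Context (R : realType) (d : measure_display) (T : measurableType d).
Variables (P : probability T R) (F : T -> nat -> distr R).
Hypothesis Fmeas : env_measurable F.
Hypothesis S2fin : (\int[P]_w sqr_int F w < +oo)%E.

Definition q2 (w : T) : R := EP (F w 0%N) (fun x => x ^+ 2).
Definition m1 (w : T) : R := EP (F w 0%N) (fun x => x).

Let msq := measurable_sqr_int Fmeas.
Let sq0 := @sqr_int_ge0 R d T F.

Lemma integrable_sqr_int : P.-integrable setT (sqr_int F).
Proof.
apply/integrableP; split => //.
by under eq_integral do rewrite gee0_abs//.
Qed.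

Lemma good_ae : {ae P, forall w, (sqr_int F w < +oo)%E}.
Proof.
apply: filterS (integrable_ae measurableT integrable_sqr_int) => w /(_ I).
by rewrite ge0_fin_numE.
Qed.

Lemma q2_ge0 w : 0 <= q2 w. Proof. by apply: EP_ge0 => x; exact: sqr_ge0. Qed.

Lemma measurable_q2 : measurable_fun setT q2.
Proof. exact: measurableT_comp (fine_measurable measurableT) msq. Qed.

Lemma fine_le_ge0 (x : \bar R) : (0 <= x)%E -> ((fine x)%:E <= x)%E.
Proof. by case: x => //= _; rewrite leey. Qed.

Lemma integrable_q2 : P.-integrable setT (EFin \o q2).
Proof.
apply: (le_integrable measurableT _ _ integrable_sqr_int).
  by apply/measurable_EFinP; exact: measurable_q2.
move=> w _; rewrite gee0_abs ?lee_fin ?q2_ge0// gee0_abs//.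
exact: fine_le_ge0 (sq0 w).
Qed.

(** Kernel integrals are measurable for nonnegative integrands, so the mean is split into positive
    and negative parts. *)
Lemma measurable_m1 : measurable_fun setT m1.
Proof.
have e : m1 = fine \o (fun w => \int[F w 0%N]_x ((EFin \o (fun x : R => x))^\+ x) -
    \int[F w 0%N]_x ((EFin \o (fun x : R => x))^\- x))%E.
  by apply/funext => w; rewrite /m1 /EP /Rintegral integralE.
rewrite e; apply: measurableT_comp; first exact: fine_measurable.
have mE : measurable_fun setT (EFin \o (fun x : R => x)) by exact/measurable_EFinP.
apply: emeasurable_funB; apply: measurable_int_nonneg => //.
- exact: measurable_funepos.
- exact: measurable_funeneg.
Qed.

Lemma m1_sqr_le w : (sqr_int F w < +oo)%E -> m1 w ^+ 2 <= q2 w.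
Proof.
move=> gw; have I1 := integrable_idR gw; have I2 := integrable_sqr gw.
have := EP_centered I1 (integrable_cst _ 0) I2.
have e0 : EP (F w 0%N) (fun=> 0 : R) = 0 by rewrite EP_cst.
have -> : (fun x : R => x * 0) = (fun=> 0) by apply/funext => x; rewrite mulr0.
have -> : (fun x : R => (0 : R) ^+ 2) = (fun=> 0) by apply/funext => x; rewrite expr0n.
by rewrite !e0 => /(_ (integrable_cst _ 0) (integrable_cst _ 0)); rewrite -/(m1 w) -/(q2 w); lra.
Qed.

Lemma integrable_m1 : P.-integrable setT (EFin \o m1).
Proof.
apply: (@integrable_ae_le _ _ _ P _ (fun w => 1 + q2 w)).
- exact: measurable_m1.
- by move=> w; rewrite addr_ge0// q2_ge0.
- by apply: integrable_add; [exact: integrable_cst|exact: integrable_q2].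
- apply: filterS good_ae => w /m1_sqr_le.
  have := sqr_ge0 (`|m1 w| - 1); have := real_normK (num_real (m1 w)).
  by move: (`|m1 w|) (normr_ge0 (m1 w)) => y y0 <-; lra.
Qed.

Lemma integrable_m1_sqr : P.-integrable setT (EFin \o (fun w => m1 w ^+ 2)).
Proof.
apply: (@integrable_ae_le _ _ _ P _ q2).
- by apply: measurable_funX; exact: measurable_m1.
- exact: q2_ge0.
- exact: integrable_q2.
- by apply: filterS good_ae => w /m1_sqr_le; rewrite ger0_norm// sqr_ge0.
Qed.

(** Valid for every environment: where the second moment is infinite, [m1 w] is still a real number
    and both sides are infinite. *)
Lemma sigma0sqE w : (\int[F w 0%N]_x ((x - m1 w) ^+ 2)%:E = sqr_int F w - (m1 w ^+ 2)%:E)%E.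
Proof.
have [gw|] := ltP (sqr_int F w) +oo%E.
  rewrite (distr_var_integral gw) EFinB; congr (_ - _)%E.
  by rewrite fineK//; exact: integrable_fin_num (integrable_sqr gw).
rewrite leye_eq => /eqP Qw; rewrite Qw /=.
apply/eqP; rewrite -leye_eq leNgt; apply/negP => V.
have mV : measurable_fun setT (fun x : R => (x - m1 w) ^+ 2).
  by apply: measurable_funX; apply: measurable_funB.
have IV : (F w 0%N).-integrable setT (EFin \o (fun x => (x - m1 w) ^+ 2)).
  apply/integrableP; split; first exact/measurable_EFinP.
  by under eq_integral do rewrite gee0_abs ?lee_fin ?sqr_ge0//.
have IB := integrable_add (integrable_scale 2 IV) (integrable_cst _ (2 * m1 w ^+ 2)).
have IS : (F w 0%N).-integrable setT (EFin \o (fun x => x ^+ 2)).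
  apply: (le_integrable measurableT _ _ IB).
    by apply/measurable_EFinP; exact: measurable_funX.
  move=> x _; rewrite lee_fin ger0_norm ?sqr_ge0// ger0_norm.
    by have := sqr_ge0 (x - 2 * m1 w); lra.
  by rewrite addr_ge0// mulr_ge0// sqr_ge0.
have := integrable_fin_num measurableT IS; rewrite -/(sqr_int F w) Qw.
by [].
Qed.

Lemma sigma_sqrE :
  fine (\int[P]_w (\int[F w 0%N]_x ((x - m1 w) ^+ 2)%:E))%E = EP P (fun w => q2 w - m1 w ^+ 2).
Proof.
have -> : (\int[P]_w (\int[F w 0%N]_x ((x - m1 w) ^+ 2)%:E) =
    \int[P]_w (sqr_int F w - (m1 w ^+ 2)%:E))%E by apply: eq_integral => w _; exact: sigma0sqE.
congr fine.
apply: ae_eq_integral => //.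
- apply: emeasurable_funB => //; apply/measurable_EFinP; apply: measurable_funX.
  exact: measurable_m1.
- apply/measurable_EFinP; apply: measurable_funB; first exact: measurable_q2.
  by apply: measurable_funX; exact: measurable_m1.
- apply: filterS good_ae => w gw _.
  have -> : sqr_int F w = (q2 w)%:E by rewrite [RHS]fineK//; rewrite ge0_fin_numE//; exact: sq0.
  by rewrite -EFinB.
Qed.

Definition S2 : R := EP P q2.

Lemma S2_ge0 : 0 <= S2. Proof. by apply: EP_ge0 => w; exact: q2_ge0. Qed.

Lemma bmf_EP_stair h A B : bmf (fun w => EP (F w 0%N) (stair h A B)).
Proof.
have upc m := @up_cell R h m; have dnc m := @dn_cell R h m.
have bu m := bmf_cellfun (upc m); have bd m := bmf_cellfun (dnc m).
have e w : EP (F w 0%N) (stair h A B) =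
    h%:R^-1 * (\sum_(m < B) hitp F (up h m) w 0%N - \sum_(m < A) hitp F (dn h m) w 0%N).
  rewrite /stair EPZ; last by apply: bmfB; apply: bmf_sum => m.
  rewrite EPB; [|by apply: bmf_sum => m..].
  by rewrite !EP_sum//; congr (_ * (_ - _)); apply: eq_bigr => m _; apply: EP_cellfun.
under eq_fun do rewrite e.
by apply: bmfZ; apply: bmfB; apply: bmf_sum => m; apply: bmf_hitp.
Qed.

(** Rounding costs [1 / h], and beyond [L] the clipped part is at most [x ^+ 2 / L]. *)
Lemma mean_close h L A B : (0 < h)%N -> (0 < L)%N -> (L <= A)%N -> (L <= B)%N ->
  `|mean P F (stair h (A * h) (B * h)) - EP P m1| <= h%:R^-1 + L%:R^-1 * S2.
Proof.
move=> h0 L0 LA LB; have L0' : 0 < L%:R :> R by rewrite ltr0n.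
have Iq := integrable_scale L%:R^-1 integrable_q2.
have -> : h%:R^-1 + L%:R^-1 * S2 = EP P (fun w => h%:R^-1 + L%:R^-1 * q2 w).
  by rewrite EPDi ?EP_cst ?EPZi//; [exact: integrable_q2|exact: integrable_cst].
apply: EP_dist_ae.
- exact/bmf_integrable/bmf_EP_stair.
- exact: integrable_m1.
- exact: integrable_add (integrable_cst _ _) Iq.
apply: filterS good_ae => w gw.
apply: (distr_mean_close gw); rewrite ?invr_ge0//; first exact: bmf_stair.
move=> x; case: (stair_dist h0 x LA LB) => [h1|[h1 h2]]; apply: le_trans h1 _.
  by rewrite lerDl mulr_ge0 ?invr_ge0// sqr_ge0.
rewrite -[leLHS]add0r lerD ?invr_ge0// mulrC ler_pdivlMr// -real_normK ?num_real// expr2.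
by rewrite ler_wpM2l// ltW.
Qed.

Definition tailsq (K : nat) (x : R) : R := if K%:R < `|x| then x ^+ 2 else 0.

Lemma tailsq_bounds K x : 0 <= tailsq K x <= x ^+ 2.
Proof. by rewrite /tailsq; case: ifP; rewrite ?lexx ?sqr_ge0. Qed.

Lemma measurable_tailsq K : measurable_fun setT (tailsq K).
Proof.
rewrite /tailsq; apply: measurable_fun_ifT => //.
  by apply: measurable_fun_ltr => //; exact: measurableT_comp.
Qed.

Definition tau (K : nat) : R := EP P (fun w => EP (F w 0%N) (tailsq K)).

Lemma tailsq_int_le K w : (\int[F w 0%N]_x (tailsq K x)%:E <= sqr_int F w)%E.
Proof.
apply: ge0_le_integral => //.
- by move=> x _; rewrite lee_fin; have /andP[] := tailsq_bounds K x.
- by apply/measurable_EFinP; exact: measurable_tailsq.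
- by apply/measurable_EFinP; exact: measurable_funX.
- by move=> x _; rewrite lee_fin; have /andP[] := tailsq_bounds K x.
Qed.

Lemma tailsq_int_ge0 K w : (0 <= \int[F w 0%N]_x (tailsq K x)%:E)%E.
Proof. by apply: integral_ge0 => x _; rewrite lee_fin; have /andP[] := tailsq_bounds K x. Qed.

Lemma measurable_tailsq_int K : measurable_fun setT (fun w => \int[F w 0%N]_x (tailsq K x)%:E)%E.
Proof.
apply: measurable_int_nonneg => // [x|].
  by rewrite lee_fin; have /andP[] := tailsq_bounds K x.
by apply/measurable_EFinP; exact: measurable_tailsq.
Qed.

Lemma integrable_tailsq K : P.-integrable setT (EFin \o (fun w => EP (F w 0%N) (tailsq K))).
Proof.
apply: (le_integrable measurableT _ _ integrable_sqr_int).
  apply/measurable_EFinP; apply: measurableT_comp; first exact: fine_measurable.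
  exact: measurable_tailsq_int.
move=> w _; rewrite !gee0_abs//.
  by apply: le_trans (tailsq_int_le K w); exact: fine_le_ge0 (tailsq_int_ge0 K w).
by rewrite lee_fin; apply: EP_ge0 => x; have /andP[] := tailsq_bounds K x.
Qed.

Lemma tailsq_cvg w : (sqr_int F w < +oo)%E ->
  (\int[F w 0%N]_x (tailsq K x)%:E)%E @[K --> \oo] --> 0%E.
Proof.
move=> gw; rewrite -(integral0 (F w 0%N) setT).
apply: (@dominated_cvg _ _ _ (F w 0%N) setT measurableT (fun K x => (tailsq K x)%:E) (cst 0%E)
  (fun x => (x ^+ 2)%:E)) => //.
- by move=> K; apply/measurable_EFinP; exact: measurable_tailsq.
- move=> x _; apply: cvg_near_cst.
  near=> K; congr EFin; rewrite /tailsq ltNge ifF//; apply/negbTE; rewrite negbK.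
  have /andP[_ /ltW h] := truncn_itv (normr_ge0 x); apply: le_trans h _; rewrite ler_nat.
  by near: K; exact: nbhs_infty_ge.
- exact: integrable_sqr gw.
- move=> K x _; have /andP[t0 t1] := tailsq_bounds K x.
  by rewrite gee0_abs lee_fin.
Unshelve. all: by end_near. Qed.

(** Dominated convergence twice: in [x] for almost every environment, then in the environment with
    majorant [sqr_int]. *)
Lemma tau_small (e : R) : 0 < e -> exists K0, forall K, (K0 <= K)%N -> tau K <= e.
Proof.
move=> e0.
have [_ _ cv] := @dominated_convergence _ _ _ P setT measurableT
  (fun K w => \int[F w 0%N]_x (tailsq K x)%:E)%E (cst 0%E) (sqr_int F)
  measurable_tailsq_int (measurable_cst _)
  (filterS (fun w gw _ => tailsq_cvg gw) good_ae) integrable_sqr_int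
  (nearW _ (fun w K _ => eq_ind_r (fun z => (z <= sqr_int F w)%E) (tailsq_int_le K w)
     (gee0_abs (tailsq_int_ge0 K w)))).
rewrite integral0 in cv.
have /fine_cvgP[fin /cvgrPdist_lt/(_ e e0) cv'] := cv.
have [K0 _ hK0] : \forall K \near \oo, (\int[P]_w (\int[F w 0%N]_x (tailsq K x)%:E) <= e%:E)%E.
  near=> K; rewrite -[leLHS]fineK; last by near: K.
  rewrite lee_fin; have : `|0 - fine (\int[P]_w (\int[F w 0%N]_x (tailsq K x)%:E))%E| < e by near: K.
  by rewrite sub0r normrN => h; apply: le_trans (ler_norm _) (ltW h).
exists K0 => K KK0; have := hK0 K KK0; rewrite /tau.
rewrite -lee_fin => h; apply: le_trans h.
rewrite fineK; last exact: integrable_fin_num (integrable_tailsq K).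
apply: ge0_le_integral => //.
- by move=> w _; rewrite lee_fin; apply: EP_ge0 => x; have /andP[] := tailsq_bounds K x.
- by have /integrableP[] := integrable_tailsq K.
- exact: measurable_tailsq_int.
- by move=> w _; exact: fine_le_ge0 (tailsq_int_ge0 K w).
Unshelve. all: by end_near. Qed.

(** The squared distance between a weight and its staircase value is at most the squared mesh plus
    the truncated square beyond [K], which [tau K] averages. *)
Lemma qvar_close h K (th : R) : (0 < h)%N -> 0 < th ->
  `|qvar P F (stair h (K * h) (K * h)) - EP P (fun w => q2 w - m1 w ^+ 2)| <=
  th * S2 + (1 + th^-1) * (h%:R^-1 ^+ 2 + tau K).
Proof.
move=> h0 th0; set f : R -> R := stair h (K * h) (K * h).
have bf : bmf f := bmf_stair _ _ _ _.
have lvE : f = (fun x => levelval R h (K * h) (level h (K * h) x)).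
  by apply/funext => x; exact: stair_level.
have bE2 : bmf (fun w => EP (F w 0%N) (fun y => f y ^+ 2)).
  rewrite lvE; exact: (bmf_EP_quant Fmeas (fun a => levelval R h (K * h) a ^+ 2)
    (iota_uniq 0 (K * h + K * h).+1) (@level_mem R h (K * h)) (@level_cell R h (K * h))).
have bE : bmf (fun w => EP (F w 0%N) f) by exact: bmf_EP_stair.
have bEs : bmf (fun w => (EP (F w 0%N) f) ^+ 2) by under eq_fun do rewrite expr2; exact: bmfM.
rewrite /qvar -EPB//.
have It := integrable_tailsq K.
have I3 := integrable_add (integrable_cst P (h%:R^-1 ^+ 2)) It.
have I4 := integrable_scale (1 + th^-1) I3.
have I5 := integrable_scale th integrable_q2.
have -> : th * S2 + (1 + th^-1) * (h%:R^-1 ^+ 2 + tau K) =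
    EP P (fun w => th * q2 w + (1 + th^-1) * (h%:R^-1 ^+ 2 + EP (F w 0%N) (tailsq K))).
  rewrite EPDi// EPZi; last exact: integrable_q2.
  by rewrite EPZi// EPDi ?EP_cst//; exact: integrable_cst.
apply: EP_dist_ae.
- exact/bmf_integrable/bmfB.
- have := integrable_add integrable_q2 (integrable_scale (-1) integrable_m1_sqr).
  by congr (_.-integrable _ _); apply/funext => w /=; rewrite mulN1r.
- exact: integrable_add.
apply: filterS good_ae => w gw.
apply: (distr_var_close gw) => //.
- exact: measurable_tailsq.
- exact: tailsq_bounds.
move=> x; have hi : 0 <= h%:R^-1 :> R by rewrite invr_ge0.
rewrite -real_normK ?num_real//.
case: (stair_dist h0 x (leqnn K) (leqnn K)) => [h1|[h1 h2]].
  rewrite -[leLHS]addr0 lerD//; first by rewrite lerXn2r// nnegrE.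
  by have /andP[] := tailsq_bounds K x.
rewrite -[leLHS]add0r lerD ?sqr_ge0// /tailsq h2 -[leRHS]real_normK ?num_real//.
by rewrite lerXn2r// nnegrE.
Qed.

End OuterMoments.

(** * Small-slope asymptotics *)

Section LimitBound.
Context (R : realType) (d : measure_display) (T : measurableType d) (P : probability T R).

(** Convergence is almost sure only, so Fatou's lemma replaces convergence of means: in the
    truncation [B] at fixed [n], then in [n]. The shift by [C] and the positive part provide
    nonnegative integrands. *)
Lemma limit_le (Z : nat -> T -> R) (g : nat -> nat -> T -> R) (z c C : R) n1 B1 :
  (forall n, measurable_fun setT (Z n)) -> {ae P, forall w, Z n w @[n --> \oo] --> z} ->
  (forall n B, bmf (g n B)) ->
  (forall n B w, (n1 <= n)%N -> - C <= g n B w) ->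
  (forall n w, exists B0, forall B, (B0 <= B)%N -> Z n w <= g n B w) ->
  (forall n B, (n1 <= n)%N -> (B1 <= B)%N -> EP P (g n B) <= c) -> z <= c.
Proof.
move=> mZ Zz bg gC Zg Eg.
pose Y n w := Num.max (Z n w + C) 0.
have mY n : measurable_fun setT (Y n).
  by apply: measurable_maxr => //; exact: measurable_funD.
have EY n : (n1 <= n)%N -> (\int[P]_w (Y n w)%:E <= (c + C)%:E)%E.
  move=> n1n.
  apply: (@fatou_le _ _ _ P (fun B w => (g n B w + C)%:E) _ _ B1).
  - by move=> B; apply/measurable_EFinP; apply: measurable_funD => //; case: (bg n B).
  - by move=> B w; rewrite lee_fin; have := gC n B w n1n; lra.
  - exact/measurable_EFinP.
  - by move=> w; rewrite lee_fin /Y le_max lexx orbT.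
  - apply: nearW => w; have [B0 h] := Zg n w; exists B0 => B BB; rewrite lee_fin /Y ge_max.
    by have := h B BB; have := gC n B w n1n; move=> ? ?; apply/andP; split; lra.
  - move=> B BB; have b := bmfD (bg n B) (bmf_cst T C).
    rewrite -[leLHS]fineK; last exact: integrable_fin_num (bmf_integrable _ b).
    have e := EPD P (bg n B) (bmf_cst T C); rewrite EP_cst in e.
    rewrite lee_fin; apply: (@le_trans _ _ (EP P (g n B) + C)); first by rewrite -e.
    by rewrite lerD2r; exact: Eg.
apply/ler_addgt0Pr => e e0.
have : (\int[P]_w (Num.max (z - e + C) 0)%:E <= (c + C)%:E)%E.
  apply: (@fatou_le _ _ _ P (fun n w => (Y n w)%:E) _ _ n1).
  - by move=> n; apply/measurable_EFinP; exact: mY.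
  - by move=> n w; rewrite lee_fin /Y le_max lexx orbT.
  - exact: measurable_cst.
  - by move=> w; rewrite lee_fin le_max lexx orbT.
  - apply: filterS Zz => w /cvgrPdist_lt/(_ e e0) [n0 _ h]; exists n0 => n n0n.
    have := h n n0n; rewrite ltr_norml => /andP[h1 h2].
    by rewrite lee_fin /Y ge_max !le_max lexx orbT andbT; apply/orP; left; move: h2 => /=; lra.
  - exact: EY.
have -> : (\int[P]_w (Num.max (z - e + C) 0)%:E = (Num.max (z - e + C) 0)%:E)%E.
  rewrite -[LHS]fineK; last by apply: integrable_fin_num => //; exact: integrable_cst.
  by congr EFin; exact: (EP_cst P).
rewrite lee_fin; have : z - e + C <= Num.max (z - e + C) 0 by rewrite le_max lexx.
lra.
Qed.

End LimitBound.

Section ErrorTerms.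
Variable R : realType.

Lemma fair_asymptotics (a : R) : 0 < a <= 4^-1 ->
  exists n0, forall n k, (n0 <= n)%N -> n%:R * a - 2 <= k.+1%:R -> k.+1%:R <= n%:R * a + 2 ->
  `|2 * fair_slast R k n - n%:R - n%:R * (2 * Num.sqrt a)| <= n%:R * (3 * a).
Proof.
move=> /andP[a0 a4].
have a01 : 0 < a < 1 by rewrite a0 /=; lra.
have a04 : 0 < a <= 4^-1 by rewrite a0.
have [n1 U] := fair_slast_upper a01 a0; have [n2 L] := fair_slast_lower a04 a0.
exists (maxn n1 n2) => n k; rewrite geq_max => /andP[nn1 nn2] k1 k2.
have u := U n k nn1 k2; have l := L n k nn2 k2 k1.
have na : 0 <= n%:R * a by rewrite mulr_ge0// ltW.
by rewrite ler_norml; apply/andP; split; lra.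
Qed.

(** A crude bound of the logarithm by [1 / s]: with [a = s ^+ 16] and temperature [s ^+ 5], the
    entropy term is still of order [s ^+ 10], below [s ^+ 8]. *)
Lemma ln_inv_le (s : R) : 0 < s -> ln (s ^+ 16)^-1 <= 16 / s.
Proof.
move=> s0; have si : 0 < s^-1 by rewrite invr_gt0.
rewrite -exprVn lnXn// -[ln _ *+ 16]mulr_natl ler_wpM2l//.
have := @le_ln1Dx R (s^-1 - 1).
have -> : 1 + (s^-1 - 1) = s^-1 by ring.
by move=> h; apply: le_trans (h _) _; lra.
Qed.

Lemma ln_inv1_le (x : R) : 0 < x <= 2^-1 -> ln (1 - x)^-1 <= 2 * x.
Proof.
move=> /andP[x0 x2].
have d0 : 0 < 1 - x by lra.
have e : (1 - x)^-1 = 1 + x / (1 - x) by field; rewrite gt_eqF.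
have h : x / (1 - x) <= 2 * x.
  rewrite ler_pdivrMr//; have : 0 <= x * (2^-1 - x) by rewrite mulr_ge0// ?subr_ge0// ltW.
  lra.
apply: le_trans h; rewrite [X in ln X]e; apply: le_ln1Dx.
by rewrite (lt_le_trans (_ : -1 < 0))// ?divr_ge0 ?ltW// oppr_lt0.
Qed.

(* Every error term is measured against s ^+ 8 = sqrt a, where a = s ^+ 16, and the inverse
   temperature is s ^+ 5. *)
Lemma error_terms (s e K M N k sg sig W : R) : 0 < s -> s ^+ 2 <= 4^-1 -> 0 <= e -> 0 < N ->
  0 <= K -> 0 <= k -> M <= 2 * s ^+ 16 * N -> 0 <= M -> k <= s ^+ 16 * N -> 0 <= sg ->
  sg <= sig + 1 -> W = 2 * K + 48 * K ^+ 3 + 18 + 3 * (sig + 1) -> s ^+ 2 * W <= e ->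
  20 * e * Num.sqrt (M * N) + 2 * e * M +
  (K * M + (N * (6 * (s ^+ 5) ^+ 2 * (2 * K) ^+ 3) +
    (k * ln (s ^+ 16)^-1 + N * ln (1 - s ^+ 16)^-1) / s ^+ 5)) + sg * (N * (3 * s ^+ 16)) <=
  N * (36 * e * s ^+ 8).
Proof.
move=> s0 s4 e0 N0 K0 k0 MN M0 kN sg0 sgs WE We.
have s1 : s <= 1.
  rewrite leNgt; apply/negP => s1; have : 1 * 1 <= s * s by rewrite ler_pM// ltW.
  by move: s4; rewrite expr2; lra.
have p0 i : 0 <= s ^+ i by rewrite exprn_ge0// ltW.
have p1 i : s ^+ i <= 1 by rewrite exprn_ile1// ltW.
have p8 : s ^+ 8 = s ^+ 2 * s ^+ 6 by rewrite -exprD.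
have p8q : s ^+ 8 <= s ^+ 2 by rewrite p8 ler_piMr.
have p16 : s ^+ 16 = s ^+ 8 * s ^+ 8 by rewrite -exprD.
have p10 : (s ^+ 5) ^+ 2 = s ^+ 8 * s ^+ 2 by rewrite -exprM -exprD.
pose u := N * s ^+ 8; have u0 : 0 <= u by rewrite mulr_ge0// ltW.
have uq (c : R) : 0 <= c -> N * s ^+ 16 * c <= u * (s ^+ 2 * c).
  by move=> c0; rewrite p16 mulrA -/u -mulrA ler_wpM2l// ler_wpM2r.
have t1 : 20 * e * Num.sqrt (M * N) <= 30 * (e * u).
  have : Num.sqrt (M * N) <= 3 / 2 * u.
    have q0 : 0 <= 3 / 2 * u by rewrite mulr_ge0.
    rewrite -[leRHS]ger0_norm// -sqrtr_sqr ler_wsqrtr//.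
    apply: (@le_trans _ _ (2 * s ^+ 16 * N * N)); first by rewrite ler_wpM2r// ltW.
    have := sqr_ge0 u; rewrite /u p16; lra.
  by move=> h; have := ler_wpM2l e0 h; lra.
have t2 : 2 * e * M <= e * u.
  have h : M <= 2^-1 * u.
    apply: le_trans MN _; rewrite p16.
    have : N * s ^+ 8 * s ^+ 8 <= N * s ^+ 8 * 4^-1 by rewrite ler_wpM2l// (le_trans p8q).
    by rewrite /u; lra.
  by have := ler_wpM2l e0 h; lra.
have t3 : K * M <= u * (s ^+ 2 * (2 * K)).
  by apply: le_trans (uq (2 * K) _); rewrite ?mulr_ge0//; have := ler_wpM2l K0 MN; lra.
have t4 : N * (6 * (s ^+ 5) ^+ 2 * (2 * K) ^+ 3) = u * (s ^+ 2 * (48 * K ^+ 3)).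
  by rewrite p10 /u; ring.
have s5 : 0 < s ^+ 5 by rewrite exprn_gt0.
have l1 : k * ln (s ^+ 16)^-1 <= s ^+ 16 * N * (16 / s).
  apply: le_trans (ler_wpM2l k0 (ln_inv_le s0)) _; rewrite ler_wpM2r// divr_ge0// ltW//.
have s16 : 0 < s ^+ 16 <= 2^-1.
  rewrite exprn_gt0//= p16; have : s ^+ 8 * s ^+ 8 <= 4^-1 * 1 by rewrite ler_pM// (le_trans p8q).
  lra.
have l2 : N * ln (1 - s ^+ 16)^-1 <= N * (2 * s ^+ 16) by rewrite ler_pM2l// ln_inv1_le.
have t5 : (k * ln (s ^+ 16)^-1 + N * ln (1 - s ^+ 16)^-1) / s ^+ 5 <= u * (s ^+ 2 * 18).
  rewrite ler_pdivrMr//; apply: le_trans (lerD l1 l2) _.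
  have -> : s ^+ 16 * N * (16 / s) = 16 * (u * s ^+ 7).
    by rewrite /u; field; rewrite gt_eqF.
  have -> : N * (2 * s ^+ 16) = 2 * (u * s ^+ 8) by rewrite p16 /u; ring.
  have -> : u * (s ^+ 2 * 18) * s ^+ 5 = 18 * (u * s ^+ 7) by ring.
  have : u * s ^+ 8 <= u * s ^+ 7 by rewrite ler_wpM2l// exprS ler_piMl.
  lra.
have t6 : sg * (N * (3 * s ^+ 16)) <= u * (s ^+ 2 * (3 * (sig + 1))).
  apply: le_trans (uq (3 * (sig + 1)) _); last by rewrite mulr_ge0//; lra.
  have := ler_wpM2r (mulr_ge0 (ltW N0) (p0 16%N)) sgs; lra.
have := ler_wpM2l u0 We; rewrite WE => t7.
have -> : N * (36 * e * s ^+ 8) = 36 * (e * u) by rewrite /u; ring.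
have eu : 0 <= e * u by rewrite mulr_ge0.
rewrite t4; move: t1 t2 t3 t5 t6 t7.
have -> : u * (s ^+ 2 * (2 * K + 48 * K ^+ 3 + 18 + 3 * (sig + 1))) =
  u * (s ^+ 2 * (2 * K)) + u * (s ^+ 2 * (48 * K ^+ 3)) + u * (s ^+ 2 * 18) +
  u * (s ^+ 2 * (3 * (sig + 1))) by ring.
have -> : u * e = e * u by rewrite mulrC.
move: (u * (s ^+ 2 * (2 * K))) (u * (s ^+ 2 * (48 * K ^+ 3))) (u * (s ^+ 2 * 18))
  (u * (s ^+ 2 * (3 * (sig + 1)))) (20 * e * Num.sqrt (M * N)) (2 * e * M) (K * M)
  (_ / s ^+ 5) (sg * _) eu => a1 a2 a3 a4 a5 a6 a7 a8 a9.
by clear; move: (e * u) => z; lra.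
Qed.

(** Passes from variances to standard deviations without a lower bound on the limit variance, which
    may vanish. *)
Lemma sqrt_dist (x y : R) : `|Num.sqrt x - Num.sqrt y| <= Num.sqrt `|x - y|.
Proof.
wlog yx : x y / y <= x.
  by move=> H; case: (leP y x) => [/H//|/ltW/H]; rewrite distrC [`|y - x|]distrC.
rewrite ger0_norm ?subr_ge0 ?ler_wsqrtr// ger0_norm ?subr_ge0// lerBlDr.
case: (leP 0 y) => y0; last first.
  by rewrite (ler0_sqrtr (ltW y0)) addr0 ler_wsqrtr//; lra.
have x0 : 0 <= x by exact: le_trans yx.
have d0 : 0 <= x - y by rewrite subr_ge0.
have [a0 b0] := (sqrtr_ge0 (x - y), sqrtr_ge0 y).
rewrite -[leRHS]ger0_norm ?addr_ge0// -sqrtr_sqr ler_wsqrtr//.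
rewrite sqrrD !sqr_sqrtr//; have := mulr_ge0 a0 b0; lra.
Qed.

Lemma shifted_tails (g : R -> R) (G e : R) : (forall x, 0 <= g x) ->
  (forall L, \sum_(i < L) g i.+1%:R <= G) -> 0 < e ->
  exists K0, forall K L, (K0 <= K)%N -> \sum_(i <- index_iota K L) g i%:R <= e.
Proof.
move=> g0 gG e0; have [K0 h] := small_tails (fun i => g0 i.+1%:R) gG e0.
exists K0.+1 => -[//|K] L KK; have := h K L.-1 KK; case: L => [|L] /=.
  by rewrite !big_geq.
by rewrite big_add1.
Qed.

Lemma nat_above (x : R) : exists n : nat, x <= n%:R.
Proof.
exists (Num.truncn `|x|).+1; have /andP[_ /ltW] := truncn_itv (normr_ge0 x).
by apply: le_trans; exact: ler_norm.
Qed.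

Lemma inv_below (c : R) : 0 < c -> exists2 n : nat, (0 < n)%N & forall m, (n <= m)%N -> m%:R^-1 <= c.
Proof.
move=> c0; have [n hn] := nat_above c^-1; exists n.+1 => // m nm.
rewrite -[c]invrK lef_pV2 ?posrE ?invr_gt0// ?ltr0n; last exact: leq_trans nm.
by apply: le_trans hn _; rewrite ler_nat ltnW.
Qed.

End ErrorTerms.

Section UniformEstimate.
Context (R : realType) (d : measure_display) (T : measurableType d).
Variables (P : probability T R) (F : T -> nat -> distr R) (X : T -> nat -> nat -> R).
Hypothesis Fmeas : env_measurable F.
Hypothesis Fiid : env_iid P F.
Hypothesis Xmeas : weights_measurable X.
Hypothesis Xlaw : quenched_law P F X.
Hypothesis S2fin : (\int[P]_w sqr_int F w < +oo)%E.
Hypothesis tails_small : forall e : R, 0 < e -> exists K0, forall K L, (K0 <= K)%N ->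
  [/\ \sum_(i <- index_iota K L) Num.sqrt (pgt P F i%:R) <= e,
      \sum_(i <- index_iota K L) Num.sqrt (ple P F i%:R) <= e,
      \sum_(i <- index_iota K L) bgt P F i%:R <= e &
      \sum_(i <- index_iota K L) ble P F i%:R <= e].

Definition limit_mean : R := EP P (m1 F).
Definition limit_sd : R := Num.sqrt (EP P (fun w => q2 F w - m1 F w ^+ 2)).

Lemma sd_close (e : R) : 0 < e -> exists K0, forall K, (K0 <= K)%N -> exists2 h0, (0 < h0)%N &
  forall h, (h0 <= h)%N -> `|Num.sqrt (qvar P F (stair h (K * h) (K * h))) - limit_sd| <= e.
Proof.
move=> e0; have S0 := S2_ge0 P F.
(* Three contributions of [e ^+ 2 / 3] are allowed under the square root: the Young term [th * S2],
   the rounding and the clipping. The added 1 covers a vanishing [S2]. *)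
pose th := e ^+ 2 / (3 * (S2 P F + 1)).
have e2 : 0 < e ^+ 2 by rewrite exprn_gt0.
have th0 : 0 < th by rewrite divr_gt0// mulr_gt0//; lra.
have thS : th * S2 P F <= e ^+ 2 / 3.
  rewrite /th mulrAC ler_pdivrMr; last by rewrite mulr_gt0//; lra.
  have -> : e ^+ 2 / 3 * (3 * (S2 P F + 1)) = e ^+ 2 * (S2 P F + 1) by field.
  by rewrite ler_pM2l//; lra.
pose c := 1 + th^-1; have c0 : 0 < c by rewrite addr_gt0// invr_gt0.
pose e' := e ^+ 2 / 3 / c; have e'0 : 0 < e' by rewrite !divr_gt0.
have [K0 hK0] := tau_small Fmeas S2fin e'0.
exists K0 => K /hK0 tK; have [h0 h00 hh0] := inv_below e'0.
exists h0 => // h hh; have hpos : (0 < h)%N by exact: leq_trans hh.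
apply: le_trans (sqrt_dist _ _) _.
rewrite -[leRHS](ger0_norm (ltW e0)) -(sqrtr_sqr e) ler_wsqrtr//.
apply: le_trans (qvar_close Fmeas S2fin K hpos th0) _; rewrite -/c.
have h1 : h%:R^-1 ^+ 2 <= e'.
  apply: le_trans (hh0 h hh); rewrite expr2 ler_piMl ?invr_ge0//.
  by rewrite invf_le1 ?ltr0n// ler1n.
have : c * (h%:R^-1 ^+ 2 + tau P F K) <= c * (e' + e') by rewrite ler_pM2l// lerD.
have -> : c * (e' + e') = e ^+ 2 / 3 + e ^+ 2 / 3 by rewrite /e'; field; rewrite gt_eqF.
move: thS; lra.
Qed.

(** Sums over all layers reduce by [block_sum] to sums over the integers beyond [K], so the bound
    depends neither on the mesh nor on the outer levels [A] and [B]. *)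
Lemma tails_le (e M N : R) h K A B : (0 < h)%N -> 0 <= M -> 0 <= N ->
  \sum_(i <- index_iota K B) Num.sqrt (pgt P F i%:R) <= e ->
  \sum_(i <- index_iota K A) Num.sqrt (ple P F i%:R) <= e ->
  \sum_(i <- index_iota K B) bgt P F i%:R <= e ->
  \sum_(i <- index_iota K A) ble P F i%:R <= e ->
  tails P F h (K * h) (A * h) (B * h) (fun m => bgt P F (m%:R / h%:R)) (fun m => ble P F (m%:R / h%:R)) M N
  <= 20 * e * Num.sqrt (M * N) + 2 * e * M.
Proof.
move=> h0 M0 N0 h1 h2 h3 h4; have MN0 : 0 <= M * N by rewrite mulr_ge0.
have sq (p : R) : Num.sqrt (M * (N * p)) = Num.sqrt (M * N) * Num.sqrt p by rewrite mulrA sqrtrM.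
have H (p b : R -> R) D : {homo p : x y /~ x <= y} -> {homo b : x y /~ x <= y} ->
    \sum_(i <- index_iota K D) Num.sqrt (p i%:R) <= e ->
    \sum_(i <- index_iota K D) b i%:R <= e ->
    \sum_(m <- index_iota (K * h) (D * h)) h%:R^-1 *
      (10 * Num.sqrt (M * (N * p (m%:R / h%:R))) + M * b (m%:R / h%:R)) <=
    10 * e * Num.sqrt (M * N) + e * M.
  move=> pm bm hp hb.
  have pm' : {homo (fun x => Num.sqrt (p x)) : x y /~ x <= y}.
    by move=> x y xy; apply: ler_wsqrtr; exact: pm.
  have b1 := @block_sum R (fun x => Num.sqrt (p x)) h K D h0 pm'.
  have b2 := @block_sum R b h K D h0 bm.
  under eq_bigr do rewrite sq.
  have -> : \sum_(m <- index_iota (K * h) (D * h)) h%:R^-1 *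
      (10 * (Num.sqrt (M * N) * Num.sqrt (p (m%:R / h%:R))) + M * b (m%:R / h%:R)) =
    10 * Num.sqrt (M * N) * (\sum_(m <- index_iota (K * h) (D * h)) h%:R^-1 * Num.sqrt (p (m%:R / h%:R))) +
    M * (\sum_(m <- index_iota (K * h) (D * h)) h%:R^-1 * b (m%:R / h%:R)).
    by rewrite !mulr_sumr -big_split /=; apply: eq_bigr => m _; ring.
  apply: lerD.
    rewrite [10 * e * _]mulrAC ler_wpM2l ?mulr_ge0 ?sqrtr_ge0//.
    exact: le_trans b1 hp.
  by rewrite [e * M]mulrC ler_wpM2l//; exact: le_trans b2 hb.
have -> : 20 * e * Num.sqrt (M * N) + 2 * e * M =
  (10 * e * Num.sqrt (M * N) + e * M) + (10 * e * Num.sqrt (M * N) + e * M) by ring.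
apply: lerD; first exact: (H (pgt P F) (bgt P F) B (pgt_mono P Fmeas) (bgt_mono P F)).
exact: (H (ple P F) (ble P F) A (ple_mono P Fmeas) (ble_mono P F)).
Qed.

Lemma root16 (a : R) : 0 < a -> exists2 s : R, 0 < s & s ^+ 16 = a /\ s ^+ 8 = Num.sqrt a.
Proof.
move=> a0; pose s := Num.sqrt (Num.sqrt (Num.sqrt (Num.sqrt a))).
have s0 : 0 < s by rewrite !sqrtr_gt0.
have s8 : s ^+ 8 = Num.sqrt a.
  have -> : s ^+ 8 = ((s ^+ 2) ^+ 2) ^+ 2 by rewrite -!exprM.
  by rewrite /s !sqr_sqrtr ?sqrtr_ge0.
exists s => //; split => //.
have -> : s ^+ 16 = (s ^+ 8) ^+ 2 by rewrite -exprM.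
by rewrite s8 sqr_sqrtr// ltW.
Qed.

Lemma combine_errors (ET N mean mu sg sig f a2 E1 E2 E3 E4 : R) : 0 <= N -> 0 <= sg -> 0 <= a2 ->
  `|ET - (N * mean + sg * (f - N))| <= E1 -> `|f - N - N * (2 * a2)| <= E2 ->
  `|mean - mu| <= E3 -> `|sg - sig| <= E4 ->
  `|ET - N * (mu + 2 * sig * a2)| <= E1 + sg * E2 + N * E3 + N * (2 * a2) * E4.
Proof.
move=> N0 sg0 a0 h1 h2 h3 h4.
have -> : ET - N * (mu + 2 * sig * a2) = (ET - (N * mean + sg * (f - N))) +
  sg * (f - N - N * (2 * a2)) + N * (mean - mu) + N * (2 * a2) * (sg - sig) by ring.
have Na : 0 <= N * (2 * a2) by rewrite !mulr_ge0.
apply: le_trans (ler_normD _ _) _; apply: lerD; last by rewrite normrM (ger0_norm Na) ler_wpM2l.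
apply: le_trans (ler_normD _ _) _; apply: lerD; last by rewrite normrM (ger0_norm N0) ler_wpM2l.
by apply: le_trans (ler_normD _ _) _; apply: lerD => //; rewrite normrM (ger0_norm sg0) ler_wpM2l.
Qed.

(** Rows are numbered from 0 to [n], which gives the factor [n.+1], while the limit is normalised by
    [n]. *)
Lemma renormalise (ET D r c : R) n : (0 < n)%N -> 0 <= r -> (`|D| + r) <= c * n%:R ->
  `|ET - n.+1%:R * D| <= n.+1%:R * r -> `|ET / n%:R - D| <= r + c.
Proof.
move=> n0 r0 hc h; have n0' : 0 < n%:R :> R by rewrite ltr0n.
have -> : ET / n%:R - D = (ET - n.+1%:R * D + D) / n%:R.
  by rewrite -natr1; field; rewrite gt_eqF.
rewrite normrM [X in _ * X]gtr0_norm ?invr_gt0// ler_pdivrMr//.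
apply: le_trans (ler_normD _ _) _; move: h hc; rewrite -natr1; lra.
Qed.

(** The order of choices matters: [K] depends on [ep] alone, then [a] is small depending on [K],
    then the mesh [h], the level [L] and [n1] depend on [a]. The outer truncations [A] and [B] stay
    arbitrary beyond [L]. *)
Theorem uniform_estimate (ep : R) : 0 < ep -> exists2 a0 : R, 0 < a0 & forall a, 0 < a < a0 ->
  a <= 1 /\ exists h L n1 : nat, [/\ (0 < h)%N, h%:R^-1 <= ep * Num.sqrt a, (0 < n1)%N &
  forall n A B, (n1 <= n)%N -> (L <= A)%N -> (L <= B)%N ->
  `|EP P (fun w => lastp (fun i j => stair h (A * h) (B * h) (X w i j)) n (Num.truncn (n%:R * a))) / n%:R
    - (limit_mean + 2 * limit_sd * Num.sqrt a)| <= ep * Num.sqrt a].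
Proof.
(* In units of [e * sqrt a]: 36 from [error_terms], 2 from the mean, 2 from the standard deviation,
   1 from the renormalisation, and 1 to spare. *)
move=> ep0; pose e := ep / 42; have e0 : 0 < e by rewrite divr_gt0.
have [K1 hK1] := tails_small e0.
pose e1 := Num.min e 1; have e10 : 0 < e1 by rewrite lt_min e0 ltr01.
have [K2 hK2] := sd_close e10.
pose K := maxn K1 K2.
have [h0 h00 hh0] := hK2 K (leq_maxr _ _).
have sd0 : 0 <= limit_sd by exact: sqrtr_ge0.
pose W := 2 * K%:R + 48 * K%:R ^+ 3 + 18 + 3 * (limit_sd + 1) : R.
have W0 : 0 < W.
  have : 0 <= K%:R ^+ 3 :> R by rewrite exprn_ge0.
  have : 0 <= K%:R :> R by [].
  by rewrite /W; lra.
have K8 : 0 < 8 * K%:R + 1 :> R by rewrite ltr_wpDl// mulr_ge0.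
(* Upper bounds for [s ^+ 2]: the first is the smallness required by [error_terms], the second makes
   [b] times the sup norm [2 * K] at most [1 / 4], the third absorbs the constants collected in [W].
   Since [a = (s ^+ 2) ^+ 8], the threshold for [a] is [dl ^+ 8]. *)
pose dl := Num.min 4^-1 (Num.min (8 * K%:R + 1)^-1 (e / W)).
have dl0 : 0 < dl by rewrite !lt_min !invr_gt0 K8 divr_gt0// ltr0n.
exists (dl ^+ 8); first by rewrite exprn_gt0.
move=> a /andP[a0 adl]; have [s s0 [s16 s8]] := root16 a0.
have sdl : s ^+ 2 <= dl.
  rewrite leNgt; apply/negP => H.
  have : dl ^+ 8 <= (s ^+ 2) ^+ 8 by rewrite lerXn2r ?nnegrE ?ltW// exprn_gt0.
  by rewrite -exprM s16 leNgt adl.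
have s4 : s ^+ 2 <= 4^-1 by rewrite (le_trans sdl)// ge_min lexx.
have sK : s ^+ 2 * (8 * K%:R + 1) <= 1.
  rewrite -ler_pdivlMr// div1r (le_trans sdl)// /dl ge_min; apply/orP; right.
  by rewrite ge_min lexx.
have sW : s ^+ 2 * W <= e.
  rewrite -ler_pdivlMr// (le_trans sdl)// /dl ge_min; apply/orP; right.
  by rewrite ge_min lexx orbT.
have s1 : s <= 1.
  rewrite leNgt; apply/negP => H; have : 1 * 1 <= s * s by rewrite ler_pM// ltW.
  by move: s4; rewrite expr2; lra.
have p1 i : s ^+ i <= 1 by rewrite exprn_ile1// ltW.
have p0 i : 0 < s ^+ i by rewrite exprn_gt0.
have a4 : a <= 4^-1.
  have e16 : s ^+ 16 = s ^+ 2 * s ^+ 14 by rewrite -exprD.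
  by rewrite -s16 (le_trans _ s4)// e16 ler_piMr// ltW.
split; first by lra.
have sa0 : 0 < e * Num.sqrt a by rewrite mulr_gt0// sqrtr_gt0.
have [h1 h10 hh1] := inv_below sa0; pose h := maxn h0 h1.
have hpos : (0 < h)%N by rewrite (leq_trans h00)// leq_maxl.
have hinv : h%:R^-1 <= e * Num.sqrt a by apply: hh1; exact: leq_maxr.
have sgc : `|Num.sqrt (qvar P F (stair h (K * h) (K * h))) - limit_sd| <= e1 by apply: hh0; exact: leq_maxl.
set sg := Num.sqrt (qvar P F _) in sgc.
have sg0 : 0 <= sg by exact: sqrtr_ge0.
have sgs : sg <= limit_sd + 1.
  have : e1 <= 1 by rewrite ge_min lexx orbT.
  by move: sgc; rewrite ler_norml => /andP[_]; lra.
have S0 := S2_ge0 P F; have S1 : 0 < S2 P F + 1 by lra.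
have [L0 L00 hL0] := inv_below (divr_gt0 sa0 S1); pose L := maxn K L0.
have Lpos : (0 < L)%N by rewrite (leq_trans L00)// leq_maxr.
have LS : L%:R^-1 * S2 P F <= e * Num.sqrt a.
  apply: (@le_trans _ _ (e * Num.sqrt a / (S2 P F + 1) * (S2 P F + 1))).
    rewrite ler_pM ?invr_ge0//; first by apply: hL0; exact: leq_maxr.
    by rewrite lerDl.
  by rewrite divfK// gt_eqF.
have a04 : 0 < a <= 4^-1 by rewrite a0.
have [n0 hn0] := fair_asymptotics a04.
set D := limit_mean + 2 * limit_sd * Num.sqrt a.
(* Ensures that [n * a] is at least 2, so that [k.+1] is at most [2 * a * n.+1]. *)
have [n2 hn2] := nat_above (2 / a).
have [n3 hn3] := nat_above ((`|D| + 40 * e) / (e * Num.sqrt a)).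
exists h, L, (maxn (maxn n0 n2) n3).+1; split => //.
  by apply: le_trans hinv _; rewrite ler_wpM2r ?sqrtr_ge0// ler_pdivrMr// ler_peMr ?ler1n// ltW.
move=> n A B nn LA LB.
have npos : (0 < n)%N by exact: leq_trans nn.
move: nn; rewrite ltnNge -ltnNge => /ltnW; rewrite !geq_max => /andP[/andP[nn0 nn2] nn3].
set k := Num.truncn (n%:R * a).
have na0 : 0 <= n%:R * a by rewrite mulr_ge0// ltW.
have /andP[k1 k2] : k%:R <= n%:R * a < k.+1%:R by exact: truncn_itv.
have N1 : n.+1%:R = n%:R + 1 :> R by rewrite natr1.
have k3 : k.+1%:R = k%:R + 1 :> R by rewrite natr1.
have kU : k.+1%:R <= n.+1%:R * a + 2 by rewrite N1 k3; move: k1 (ltW a0); clear -Fmeas Fiid Xmeas Xlaw S2fin tails_small; lra.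
have kL : n.+1%:R * a - 2 <= k.+1%:R by rewrite N1; move: k2 a4; clear -Fmeas Fiid Xmeas Xlaw S2fin tails_small; lra.
have fa := hn0 n.+1 k (leqW nn0) kL kU.
have n2a : 2 <= n.+1%:R * a.
  rewrite -ler_pdivrMr//; apply: le_trans hn2 _.
  by rewrite ler_nat (leq_trans nn2).
have KA : (K * h <= A * h)%N by rewrite leq_mul2r (leq_trans _ LA) ?orbT// leq_maxl.
have KB : (K * h <= B * h)%N by rewrite leq_mul2r (leq_trans _ LB) ?orbT// leq_maxl.
have Kh : (K * h)%:R / h%:R = K%:R :> R by rewrite natrM mulfK// pnatr_eq0 -lt0n.
have b0 : 0 < s ^+ 5 by [].
have bK : s ^+ 5 * (2 * ((K * h)%:R / h%:R)) <= 4^-1.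
  rewrite Kh; have : s ^+ 5 * (2 * K%:R) <= s ^+ 2 * (2 * K%:R).
    have e5 : s ^+ 5 = s ^+ 2 * s ^+ 3 by rewrite -exprD.
    by rewrite ler_wpM2r ?mulr_ge0// e5 ler_piMr// ltW.
  by have := ltW (p0 2%N); move: sK; clear -Fmeas Fiid Xmeas Xlaw S2fin tails_small; lra.
have x01 : 0 < s ^+ 16 < 1 by rewrite s16 a0 /=; move: a4; clear -Fmeas Fiid Xmeas Xlaw S2fin tails_small; lra.
have FE := finite_estimate Fmeas Fiid Xmeas Xlaw KA KB
  (fun m => bgt_ge0 P F (m%:R / h%:R)) (fun m => ble_ge0 P F (m%:R / h%:R))
  (fun m => hitp_gt_ae P F (m%:R / h%:R)) (fun m => hitp_le_ae' P F (m%:R / h%:R)) n k b0 bK x01.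
rewrite -/sg in FE.
have MC := mean_close Fmeas S2fin hpos Lpos LA LB.
have CE := combine_errors (ler0n R n.+1) sg0 (sqrtr_ge0 a) FE fa MC sgc.
have [t1 _ t3 _] := hK1 K B (leq_maxl _ _); have [_ t2 _ t4] := hK1 K A (leq_maxl _ _).
have TL := tails_le hpos (ler0n R k.+1) (ler0n R n.+1) t1 t2 t3 t4.
have M2 : k.+1%:R <= 2 * s ^+ 16 * n.+1%:R by rewrite s16; move: kU n2a; clear -Fmeas Fiid Xmeas Xlaw S2fin tails_small; lra.
have kN : k%:R <= s ^+ 16 * n.+1%:R by rewrite s16 N1; move: k1 (ltW a0); clear -Fmeas Fiid Xmeas Xlaw S2fin tails_small; lra.
have ER := error_terms s0 s4 (ltW e0) (ltr0Sn R n) (ler0n R K) (ler0n R k) M2 (ler0n R k.+1) kN sg0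
  sgs erefl sW.
rewrite -/D in CE *.
have e42 : ep = 42 * e by rewrite /e; field.
have e1e : e1 <= e by rewrite ge_min lexx.
have H : `|EP P (fun w => lastp (fun i j => stair h (A * h) (B * h) (X w i j)) n k) - n.+1%:R * D|
    <= n.+1%:R * (40 * e * Num.sqrt a).
  apply: le_trans CE _; rewrite Kh s16; move: ER TL; rewrite s16 s8.
  have g1 : n.+1%:R * (h%:R^-1 + L%:R^-1 * S2 P F) <= n.+1%:R * (2 * (e * Num.sqrt a)).
    by rewrite ler_pM2l ?ltr0Sn//; move: hinv LS; clear -Fmeas Fiid Xmeas Xlaw S2fin tails_small; lra.
  have g2 : n.+1%:R * (2 * Num.sqrt a) * e1 <= n.+1%:R * (2 * Num.sqrt a) * e.
    by rewrite ler_wpM2l// !mulr_ge0// sqrtr_ge0.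
  move: g1 g2.
  have -> : n.+1%:R * (40 * e * Num.sqrt a) = n.+1%:R * (36 * e * Num.sqrt a) +
    n.+1%:R * (2 * (e * Num.sqrt a)) + n.+1%:R * (2 * Num.sqrt a) * e by ring.
  move: (n.+1%:R * (h%:R^-1 + _)) (_ * e1) (tails _ _ _ _ _ _ _ _ _ _) => a1 a2 a3.
  move: (20 * e * Num.sqrt _ + _) (K%:R * _ + _) (sg * _) => a8 a9 a10.
  move: (n.+1%:R * (36 * _ * _)) (n.+1%:R * (2 * (e * _))) (n.+1%:R * (2 * Num.sqrt a) * e) => a5 a6 a7.
  by clear -Fmeas Fiid Xmeas Xlaw S2fin tails_small; lra.
have D3 : `|D| + 40 * e * Num.sqrt a <= e * Num.sqrt a * n%:R.
  apply: (@le_trans _ _ (`|D| + 40 * e)).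
    by rewrite lerD2l ler_piMr -?s8// mulr_ge0// ltW.
  rewrite [leRHS]mulrC -ler_pdivrMr//; apply: le_trans hn3 _.
  by rewrite ler_nat.
have r1 : 0 <= 40 * e * Num.sqrt a by rewrite !mulr_ge0 ?sqrtr_ge0// ltW.
apply: le_trans (renormalise npos r1 D3 H) _; rewrite e42.
by move: (mulr_ge0 (ltW e0) (sqrtr_ge0 a)); clear -Fmeas Fiid Xmeas Xlaw S2fin tails_small; lra.
Qed.

End UniformEstimate.

(** * Transfer of the finite estimates to the almost sure limit *)

Section LimitShape.
Context (R : realType) (d : measure_display) (T : measurableType d).
Variables (P : probability T R) (F : T -> nat -> distr R) (X : T -> nat -> nat -> R).
Hypothesis Xmeas : weights_measurable X.

Lemma measurable_lastp l k : measurable_fun setT (fun w => lastp (X w) l k).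
Proof.
elim: l k => [|l IHl] k; first by apply: measurable_sum => i; exact: Xmeas.
elim: k => [|k IHk].
  by under eq_fun do rewrite lastpS0; apply: measurable_funD => //; exact: Xmeas.
under eq_fun do rewrite lastpSS; apply: measurable_funD; last exact: Xmeas.
exact: measurable_maxr.
Qed.

Lemma box_bound w n k : exists B0 : nat, forall i j, (i <= k)%N -> (j <= n)%N -> `|X w i j| <= B0%:R.
Proof.
pose S := \sum_(i < k.+1) \sum_(j < n.+1) `|X w i j|.
have [B0 hB0] := nat_above S; exists B0 => i j; rewrite -(ltnS i) -(ltnS j) => ik jn; apply: le_trans hB0.
rewrite /S (bigD1 (Ordinal ik))//= (bigD1 (Ordinal jn))//= -addrA lerDl.
rewrite addr_ge0 ?sumr_ge0// => i' _; exact: sumr_ge0.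
Qed.

Lemma lastp_le_near (Y Y' : nat -> nat -> R) (e : R) l k :
  (forall i j, (i <= k)%N -> (j <= l)%N -> Y i j <= Y' i j + e) ->
  lastp Y l k <= lastp Y' l k + e * (k + l).+1%:R.
Proof.
move=> h; rewrite -lastp_cst; apply: le_trans (lastpD _ _ _ _).
exact: le_lastp.
Qed.

Lemma path_length_le (a : R) n : (0 < n)%N -> 0 <= a ->
  (Num.truncn (n%:R * a) + n).+1%:R <= (a + 2) * n%:R :> R.
Proof.
move=> n0 a0; have na : 0 <= n%:R * a by rewrite mulr_ge0.
have /andP[k1 _] := truncn_itv na; have : (1 : R) <= n%:R by rewrite ler1n.
by rewrite -natr1 natrD; lra.
Qed.

(** The lower truncation stays at [L]: up to rounding it only raises weights, and it supplies the
    uniform lower bound for Fatou's lemma. The upper truncation [B] tends to infinity; at fixed [n]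
    finitely many weights matter, so it eventually exceeds them all. *)
Lemma limit_upper (a z c : R) h L n1 : 0 < a -> (0 < h)%N -> (0 < n1)%N ->
  {ae P, forall w, lastp (X w) n (Num.truncn (n%:R * a)) / n%:R @[n --> \oo] --> z} ->
  (forall n B, (n1 <= n)%N -> (L <= B)%N ->
    EP P (fun w => lastp (fun i j => stair h (L * h) (B * h) (X w i j)) n (Num.truncn (n%:R * a))) / n%:R
      <= c) -> z <= c + h%:R^-1 * (a + 2).
Proof.
move=> a0 h0 n10 Tz Ec.
have hi : 0 <= h%:R^-1 :> R by rewrite invr_ge0.
pose S n B w := lastp (fun i j => stair h (L * h) (B * h) (X w i j)) n (Num.truncn (n%:R * a)).
pose r : R := h%:R^-1 * (a + 2).
have a2 : 0 <= a + 2 by rewrite addr_ge0// ltW.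
have r0 : 0 <= r by rewrite mulr_ge0.
have bS n B : bmf (S n B) by exact: bmf_lastp_stair.
have bSn n B : bmf (fun w => n%:R^-1 * S n B w) by exact: bmfZ.
apply: (@limit_le _ _ _ P (fun n w => lastp (X w) n (Num.truncn (n%:R * a)) / n%:R)
  (fun n B w => n%:R^-1 * S n B w + r) z _ (L%:R * (a + 2)) n1 L) => //.
- by move=> n; apply: measurable_funM => //; exact: measurable_lastp.
- by move=> n B; apply: bmfD => //; exact: bmf_cst.
- move=> n B w n1n; have npos : (0 < n)%N by exact: leq_trans n1n.
  have n0' : 0 < n%:R :> R by rewrite ltr0n.
  have lo : - L%:R * (Num.truncn (n%:R * a) + n).+1%:R <= S n B w.
    rewrite -lastp_cst; apply: le_lastp => i j _ _.
    by have /andP[] := stair_bounds h0 L B (X w i j).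
  have pl := path_length_le npos (ltW a0).
  have : - (L%:R * (a + 2)) <= n%:R^-1 * S n B w.
    by rewrite [leRHS]mulrC ler_pdivlMr// (le_trans _ lo)// !mulNr lerN2 -mulrA ler_wpM2l.
  by move=> h1; apply: le_trans h1 _; rewrite lerDl.
- move=> n w; have [B0 hB0] := box_bound w n (Num.truncn (n%:R * a)).
  exists B0 => B BB; case: n hB0 => [|n] hB0; first by rewrite invr0 mulr0 mul0r add0r.
  have n0' : 0 < n.+1%:R :> R by rewrite ltr0n.
  have hX i j : (i <= Num.truncn (n.+1%:R * a))%N -> (j <= n.+1)%N ->
      X w i j <= stair h (L * h) (B * h) (X w i j) + h%:R^-1.
    move=> ik jn; apply: stair_ge => //; apply: le_trans (ler_norm _) _.
    by apply: le_trans (hB0 i j ik jn) _; rewrite ler_nat.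
  rewrite ler_pdivrMr// mulrDl [n.+1%:R^-1 * _]mulrC divfK ?gt_eqF//.
  apply: le_trans (lastp_le_near hX) _.
  by rewrite lerD2l /r -mulrA ler_wpM2l//; exact: path_length_le (ltW a0).
- move=> n B n1n LB; rewrite EPD//; last exact: bmf_cst.
  by rewrite EP_cst lerD2r EPZ// mulrC; exact: Ec.
Qed.

(** The mirror image, for negated passage times: the upper truncation is fixed and the lower one
    removed. *)
Lemma limit_lower (a z c : R) h L n1 : 0 < a -> (0 < h)%N -> (0 < n1)%N ->
  {ae P, forall w, lastp (X w) n (Num.truncn (n%:R * a)) / n%:R @[n --> \oo] --> z} ->
  (forall n A, (n1 <= n)%N -> (L <= A)%N ->
    c <= EP P (fun w => lastp (fun i j => stair h (A * h) (L * h) (X w i j)) n (Num.truncn (n%:R * a))) / n%:R)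
  -> c - h%:R^-1 * (a + 2) <= z.
Proof.
move=> a0 h0 n10 Tz Ec.
have hi : 0 <= h%:R^-1 :> R by rewrite invr_ge0.
pose S n A w := lastp (fun i j => stair h (A * h) (L * h) (X w i j)) n (Num.truncn (n%:R * a)).
pose r : R := h%:R^-1 * (a + 2).
have a2 : 0 <= a + 2 by rewrite addr_ge0// ltW.
have r0 : 0 <= r by rewrite mulr_ge0.
have bS n A : bmf (S n A) by exact: bmf_lastp_stair.
have bSn n A : bmf (fun w => - n%:R^-1 * S n A w) by exact: bmfZ.
suff : - z <= - c + r by rewrite /r; lra.
apply: (@limit_le _ _ _ P (fun n w => - (lastp (X w) n (Num.truncn (n%:R * a)) / n%:R))
  (fun n A w => - n%:R^-1 * S n A w + r) (- z) _ (L%:R * (a + 2)) n1 L) => //.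
- move=> n; under eq_fun do rewrite -mulN1r.
  apply: measurable_funM => //; apply: measurable_funM => //; exact: measurable_lastp.
- by apply: filterS Tz => w; exact: cvgN.
- by move=> n A; apply: bmfD => //; exact: bmf_cst.
- move=> n A w n1n; have npos : (0 < n)%N by exact: leq_trans n1n.
  have n0' : 0 < n%:R :> R by rewrite ltr0n.
  have hi' : S n A w <= L%:R * (Num.truncn (n%:R * a) + n).+1%:R.
    rewrite -lastp_cst; apply: le_lastp => i j _ _.
    by have /andP[] := stair_bounds h0 A L (X w i j).
  have pl := path_length_le npos (ltW a0).
  have : n%:R^-1 * S n A w <= L%:R * (a + 2).
    by rewrite mulrC ler_pdivrMr// (le_trans hi')// -mulrA ler_wpM2l.
  by rewrite mulNr; move: r0; lra.
- move=> n w; have [B0 hB0] := box_bound w n (Num.truncn (n%:R * a)).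
  exists B0 => A BA; case: n hB0 => [|n] hB0; first by rewrite invr0 mulr0 oppr0 mul0r add0r.
  have n0' : 0 < n.+1%:R :> R by rewrite ltr0n.
  have hX i j : (i <= Num.truncn (n.+1%:R * a))%N -> (j <= n.+1)%N ->
      stair h (A * h) (L * h) (X w i j) <= X w i j + h%:R^-1.
    move=> ik jn; apply: stair_le => //; have := hB0 i j ik jn; rewrite ler_norml => /andP[+ _].
    by apply: le_trans; rewrite lerN2 ler_nat.
  have := lastp_le_near hX; rewrite -/(S n.+1 A w) => near.
  have pl := path_length_le (ltn0Sn n) (ltW a0).
  have near2 : n.+1%:R^-1 * S n.+1 A w <= lastp (X w) n.+1 (Num.truncn (n.+1%:R * a)) / n.+1%:R + r.
    rewrite mulrC ler_pdivrMr// mulrDl divfK ?gt_eqF//; apply: le_trans near _.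
    by rewrite lerD2l /r -mulrA ler_wpM2l.
  by rewrite mulNr -lerBlDr -opprD lerN2.
- move=> n A n1n LA; rewrite EPD//; last exact: bmf_cst.
  rewrite EP_cst lerD2r EPZ// mulNr lerN2 mulrC; exact: Ec.
Qed.

End LimitShape.

(** All that the rest of the argument takes from the four integrals: a finite annealed second
    moment, from the two integrals of square roots, and one level [K0] beyond which the four tail
    sums are small. *)
Lemma tails_from_integrals (R : realType) (d : measure_display) (T : measurableType d)
    (P : probability T R) (F : T -> nat -> distr R) : env_measurable F ->
  (\int[@lebesgue_measure R]_(x in `[0%R, +oo[)
      (Num.sqrt (1 - fine (\int[P]_w (distr_cdf (F w 0%N) x)%:E)))%:E < +oo)%E ->
  (\int[@lebesgue_measure R]_(x in `[0%R, +oo[)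
      ess_sup P (fun w => (1 - distr_cdf (F w 0%N) x)%:E) < +oo)%E ->
  (\int[@lebesgue_measure R]_(x in `]-oo, 0%R])
      (Num.sqrt (fine (\int[P]_w (distr_cdf (F w 0%N) x)%:E)))%:E < +oo)%E ->
  (\int[@lebesgue_measure R]_(x in `]-oo, 0%R])
      ess_sup P (fun w => (distr_cdf (F w 0%N) x)%:E) < +oo)%E ->
  (\int[P]_w sqr_int F w < +oo)%E /\
  forall e : R, 0 < e -> exists K0, forall K L, (K0 <= K)%N ->
  [/\ \sum_(i <- index_iota K L) Num.sqrt (pgt P F i%:R) <= e,
      \sum_(i <- index_iota K L) Num.sqrt (ple P F i%:R) <= e,
      \sum_(i <- index_iota K L) bgt P F i%:R <= e &
      \sum_(i <- index_iota K L) ble P F i%:R <= e].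
Proof.
move=> Fmeas h1 h2 h3 h4.
have [G1 g1] : exists G : R, forall L, \sum_(i < L) Num.sqrt (pgt P F i.+1%:R) <= G.
  apply: (@sums_right _ (fun x => Num.sqrt (pgt P F x)) _ _ _ _ h1) => //.
  - by move=> x y xy; apply: ler_wsqrtr; exact: pgt_mono.
  - by move=> x _; rewrite pgtE.
have [G2 g2] : exists G : R, forall L, \sum_(i < L) bgt P F i.+1%:R <= G.
  apply: (@sums_right _ (bgt P F) _ _ _ _ h2).
  - exact: bgt_mono.
  - exact: bgt_ge0.
  - by move=> x _; rewrite bgtE.
have [G3 g3] : exists G : R, forall L, \sum_(i < L) Num.sqrt (ple P F i.+1%:R) <= G.
  apply: (@sums_left _ (fun x => Num.sqrt (ple P F x)) _ _ _ _ h3) => //.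
  by move=> x y xy; apply: ler_wsqrtr; exact: ple_mono.
have [G4 g4] : exists G : R, forall L, \sum_(i < L) ble P F i.+1%:R <= G.
  apply: (@sums_left _ (ble P F) _ _ _ _ h4).
  - exact: ble_mono.
  - exact: ble_ge0.
  - by move=> x _; rewrite bleE.
split; first exact: sqr_int_bound g1 g3.
move=> e e0.
have [K1 k1] := shifted_tails (fun x => sqrtr_ge0 (pgt P F x)) g1 e0.
have [K2 k2] := shifted_tails (bgt_ge0 P F) g2 e0.
have [K3 k3] := shifted_tails (fun x => sqrtr_ge0 (ple P F x)) g3 e0.
have [K4 k4] := shifted_tails (ble_ge0 P F) g4 e0.
exists (maxn (maxn K1 K2) (maxn K3 K4)) => K L; rewrite !geq_max => /andP[/andP[? ?] /andP[? ?]].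
by split; [exact: k1|exact: k3|exact: k2|exact: k4].
Qed.

Theorem theorem2p2 (R : realType) (d : measure_display) (T : measurableType d)
  (P : probability T R) (F : T -> nat -> distr R) (X : T -> nat -> nat -> R)
  (Psi : R -> R) :
  env_measurable F ->
  env_iid P F ->
  weights_measurable X ->
  quenched_law P F X ->
  (* Psi(a) = Psi(a,1) is the a.s. limit of n^-1 T(floor(n a), floor(n)) *)
  (forall a : R, 0 < a ->
     {ae P, forall w, (fun n : nat => lpp (X w) (Num.truncn (n%:R * a)) n / n%:R)
                        @ \oo --> Psi a}) ->
  (\int[@lebesgue_measure R]_(x in `[0%R, +oo[)
      (Num.sqrt (1 - fine (\int[P]_w (distr_cdf (F w 0%N) x)%:E)))%:E < +oo)%E ->
  (\int[@lebesgue_measure R]_(x in `[0%R, +oo[)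
      ess_sup P (fun w => (1 - distr_cdf (F w 0%N) x)%:E) < +oo)%E ->
  (\int[@lebesgue_measure R]_(x in `]-oo, 0%R])
      (Num.sqrt (fine (\int[P]_w (distr_cdf (F w 0%N) x)%:E)))%:E < +oo)%E ->
  (\int[@lebesgue_measure R]_(x in `]-oo, 0%R])
      ess_sup P (fun w => (distr_cdf (F w 0%N) x)%:E) < +oo)%E ->
  let mu0 := fun w => fine (\int[F w 0%N]_x x%:E) in
  let sigma0sq := fun w => (\int[F w 0%N]_x ((x - mu0 w) ^+ 2)%:E)%E in
  let mu := fine (\int[P]_w (mu0 w)%:E) in
  let sigma := Num.sqrt (fine (\int[P]_w sigma0sq w)) in
  (`|Psi a - mu - 2 * sigma * Num.sqrt a| / Num.sqrt a)
    @[a --> (0:R)^'+] --> (0:R).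
Proof.
move=> Fmeas Fiid Xmeas Xlaw PsiP h1 h2 h3 h4 mu0 sigma0sq mu sigma.
have [S2fin tails_small] := tails_from_integrals Fmeas h1 h2 h3 h4.
have muE : mu = limit_mean P F by [].
have sigmaE : sigma = limit_sd P F.
  by congr Num.sqrt; exact: (sigma_sqrE Fmeas S2fin).
(* One fifth goes to [uniform_estimate] and three to the rounding of the weights along the path,
   whose factor [a + 2] is at most 3. *)
apply/cvgrPdist_le => e e0; have e5 : 0 < e / 5 by rewrite divr_gt0.
have [a0 a00 UE] := uniform_estimate Fmeas Fiid Xmeas Xlaw S2fin tails_small e5.
near=> a.
have apos : 0 < a by near: a; exact: nbhs_right_gt.
have alt : a < a0 by near: a; exact: nbhs_right_lt.
have [a1 [h [L [n1 [hpos hinv n10 est]]]]] := UE a (introT andP (conj apos alt)).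
have sa : 0 < Num.sqrt a by rewrite sqrtr_gt0.
have Tz : {ae P, forall w, lastp (X w) n (Num.truncn (n%:R * a)) / n%:R @[n --> \oo] --> Psi a}.
  have e' w : (fun n => lpp (X w) (Num.truncn (n%:R * a)) n / n%:R) =
      (fun n => lastp (X w) n (Num.truncn (n%:R * a)) / n%:R) by apply/funext => n; rewrite lppE.
  by apply: filterS (PsiP a apos) => w; rewrite e'.
rewrite muE sigmaE; set D := limit_mean P F + 2 * limit_sd P F * Num.sqrt a.
have U : Psi a <= D + e / 5 * Num.sqrt a + h%:R^-1 * (a + 2).
  apply: (limit_upper Xmeas apos hpos n10 Tz) => n B n1n LB.
  by have := est n L B n1n (leqnn L) LB; rewrite -/D ler_norml => /andP[_]; rewrite lerBlDl.
have Lo : D - e / 5 * Num.sqrt a - h%:R^-1 * (a + 2) <= Psi a.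
  apply: (@limit_lower _ _ _ P X Xmeas a (Psi a) (D - e / 5 * Num.sqrt a) h L n1 apos hpos n10 Tz) => n A n1n LA.
  by have := est n A L n1n LA (leqnn L); rewrite -/D ler_norml => /andP[+ _]; rewrite lerBrDl.
have hb : h%:R^-1 * (a + 2) <= e / 5 * Num.sqrt a * 3.
  by rewrite ler_pM ?invr_ge0//; move: a1 apos; clear -R; lra.
rewrite sub0r normrN ger0_norm; last by rewrite divr_ge0// sqrtr_ge0.
rewrite ler_pdivrMr//.
have -> : Psi a - limit_mean P F - 2 * limit_sd P F * Num.sqrt a = Psi a - D by rewrite /D; ring.
move: U Lo hb; clearbody D.
move: (h%:R^-1 * (a + 2)) (Psi a) D => x y z.
have -> : e * Num.sqrt a = e / 5 * Num.sqrt a * 5 by field.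
move: (e / 5 * _) (mulr_gt0 e5 sa) => u u0 U Lo hb.
by rewrite ler_norml; apply/andP; split; clear -u0 U Lo hb; lra.
Unshelve. all: by end_near. Qed.
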